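(* Let $\mathcal P$ be a finite injective labeled oriented tree. Then $\mathcal P$ is aspherical, i.e. $\pi_2(K(\mathcal P))=0$. Furthermore, if $\mathcal H$ is a sub-LOT of $\mathcal P$, then the homomorphism $\pi_1(K(\mathcal H))\to\pi_1(K(\mathcal P))$ induced by the inclusion $K(\mathcal H)\subseteq K(\mathcal P)$ is injective.
   Context: A labeled oriented graph (LOG) $\mathcal G$ is a finite oriented graph with vertex set $\mathbf x$ and edge set $\mathbf e$ in which every edge is labeled by a vertex; an edge from $x$ to $y$ with label $z$ is written $e=[x,z,y]$. Its LOG-presentation is $P(\mathcal G)=\langle \mathbf x\mid \{r_e\}_{e\in\mathbf e}\rangle$ with $r_e=xz(zy)^{-1}=xzy^{-1}z^{-1}$ for $e=[x,z,y]$, and $K(\mathcal G)$ is the standard 2-complex of this presentation (one 0-cell, one oriented 1-cell per generator, one 2-cell per relator attached along the relator word). $\mathcal G$ is called aspherical if $K(\mathcal G)$ is aspherical. A labeled oriented tree (LOT) is a LOG whose underlying graph is a tree. A LOG is injective if each vertex occurs at most once as an edge label. A sub-LOT of $\mathcal G$ is a connected subgraph $\mathcal H$ containing at least one edge such that every edge label of an edge of $\mathcal H$ is a vertex of $\mathcal H$ (with the inherited orientations and labels); $K(\mathcal H)$ is then a subcomplex of $K(\mathcal G)$. *)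

(* Defs.v *)
From HB Require Import structures.
From mathcomp Require Import all_boot all_order all_algebra generic_quotient.
From mathcomp Require Import boolp classical_sets functions reals topology subtype_topology normedtype.

Set Implicit Arguments.
Unset Strict Implicit.
Unset Printing Implicit Defensive.

Import numFieldTopology.Exports.
Local Open Scope classical_set_scope.
Local Open Scope ring_scope.
Local Open Scope quotient_scope.

(* Labeled oriented graphs.  A finite LOG is given by a finite vertex type V, *)
(* a finite edge type E and, for every edge e = [x, z, y], its source         *)
(* [lsrc e = x], its label [llab e = z] and its target [ltgt e = y].          *)

Definition log_adj (V E : finType) (lsrc ltgt : E -> V) (HE : {set E}) : rel V :=
  fun u v => [exists e in HE, ((lsrc e == u) && (ltgt e == v))
                           || ((lsrc e == v) && (ltgt e == u))].

Definition is_LOT (V E : finType) (lsrc llab ltgt : E -> V) : Prop :=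
  (forall u v : V, connect (log_adj lsrc ltgt [set: E]) u v) /\ #|E|.+1 = #|V|.

Definition log_injective (V E : finType) (llab : E -> V) : Prop := injective llab.

Definition is_subLOT (V E : finType) (lsrc llab ltgt : E -> V)
    (HV : {set V}) (HE : {set E}) : Prop :=
  [/\ (0 < #|HE|)%N,
      (forall e, e \in HE -> [/\ lsrc e \in HV, llab e \in HV & ltgt e \in HV]) &
      (forall u v, u \in HV -> v \in HV ->
         connect [rel a b | [&& a \in HV, b \in HV & log_adj lsrc ltgt HE a b]] u v)].

(* The standard 2-complex K(G) as a topological space.                        *)
(* One 1-cell [0,1] per vertex (generator), whose endpoints are glued to the  *)
(* single 0-cell; one 2-cell [0,1]^2 per edge e = [x,z,y], whose boundary is  *)
(* attached along the relator word x z y^-1 z^-1:                             *)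
(*     (s,0) |-> x(s),  (1,t) |-> z(t),  (s,1) |-> y(s),  (0,t) |-> z(t).     *)

Section Complex.
Context (R : realType) (V E : finType) (lsrc llab ltgt : E -> V).

Definition unit_interval : topologicalType := set_type (`[0, 1] : set R).
Definition unit_square : topologicalType :=
  set_type ((`[0, 1] `*` `[0, 1]) : set (R * R)).

Definition cell (i : (V + E)%type) : topologicalType :=
  match i with inl _ => unit_interval | inr _ => unit_square end.

Definition precomplex := {i : (V + E)%type & cell i}.

(* canonical representative of a point: None is the 0-cell, Some (inl (v,t)) *)
(* an interior point of the 1-cell v, Some (inr (e,p)) an interior point of   *)
(* the 2-cell e                                                               *)
Definition canon_point := option ((V * R) + (E * (R * R)))%type.

Definition canon_edge (v : V) (t : R) : canon_point :=
  if (t == 0) || (t == 1) then None else Some (inl (v, t)).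

Definition canon_square (e : E) (p : R * R) : canon_point :=
  let: (s, t) := p in
  if t == 0 then canon_edge (lsrc e) s
  else if t == 1 then canon_edge (ltgt e) s
  else if (s == 0) || (s == 1) then canon_edge (llab e) t
  else Some (inr (e, (s, t))).

Definition canon (x : precomplex) : canon_point :=
  match x with
  | existT (inl v) p => canon_edge v (set_val p)
  | existT (inr e) p => canon_square e (set_val p)
  end.

Definition glue_rel' (a b : precomplex) : bool := `[< canon a = canon b >].

Lemma glue_rel_refl : reflexive glue_rel'.
Proof. by move=> a; apply/asboolP. Qed.

Lemma glue_rel_sym : symmetric glue_rel'.
Proof.
move=> a b; apply/idP/idP => /asboolP H; apply/asboolP; by rewrite H.
Qed.

Lemma glue_rel_trans : transitive glue_rel'.
Proof.
move=> b a c /asboolP H1 /asboolP H2; apply/asboolP; by rewrite H1.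
Qed.

Definition glue_rel := EquivRel _ glue_rel_refl glue_rel_sym glue_rel_trans.

Definition LOGcomplex := {eq_quot glue_rel}.
HB.instance Definition _ := Topological.copy LOGcomplex (quotient_topology LOGcomplex).
HB.instance Definition _ := Quotient.on LOGcomplex.

Definition cell_in (HV : {set V}) (HE : {set E}) (i : (V + E)%type) : bool :=
  match i with inl v => v \in HV | inr e => e \in HE end.

Definition subcomplex (HV : {set V}) (HE : {set E}) : set LOGcomplex :=
  [set q | exists x : precomplex, cell_in HV HE (projT1 x) /\ \pi_LOGcomplex x = q].

Definition is_basepoint (k : LOGcomplex) : Prop :=
  exists x : precomplex, canon x = None /\ \pi_LOGcomplex x = k.

End Complex.

Definition sphere2 (R : realType) : topologicalType :=
  set_type ([set p : R * (R * R) | p.1 ^+ 2 + p.2.1 ^+ 2 + p.2.2 ^+ 2 = 1]).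

Definition pi2_trivial (R : realType) (X : topologicalType) (x0 : X) : Prop :=
  forall f : sphere2 R -> X, continuous f ->
    (forall p : sphere2 R, set_val p = (1, (0, 0)) -> f p = x0) ->
    exists H : (unit_interval R * sphere2 R)%type -> X,
      [/\ continuous H,
          (forall q, set_val q.1 = 0 -> H q = f q.2),
          (forall q, set_val q.1 = 1 -> H q = x0) &
          (forall q, set_val q.2 = (1, (0, 0)) -> H q = x0)].

Definition loop_homotopic_in (R : realType) (X : topologicalType) (A : set X)
    (x0 : X) (g1 g2 : unit_interval R -> X) : Prop :=
  exists H : (unit_interval R * unit_interval R)%type -> X,
    [/\ continuous H, (forall q, A (H q)),
        (forall q, set_val q.1 = 0 -> H q = g1 q.2),
        (forall q, set_val q.1 = 1 -> H q = g2 q.2) &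
        (forall q, set_val q.2 = 0 \/ set_val q.2 = 1 -> H q = x0)].

Definition is_loop_in (R : realType) (X : topologicalType) (A : set X) (x0 : X)
    (g : unit_interval R -> X) : Prop :=
  [/\ continuous g, (forall t, A (g t)) &
      (forall t, set_val t = 0 \/ set_val t = 1 -> g t = x0)].

Definition pi1_inclusion_injective (R : realType) (X : topologicalType)
    (A : set X) (x0 : X) : Prop :=
  forall g1 g2 : unit_interval R -> X,
    is_loop_in A x0 g1 -> is_loop_in A x0 g2 ->
    loop_homotopic_in setT x0 g1 g2 -> loop_homotopic_in A x0 g1 g2.

(* Main.v *)
(* Let K be the standard complex of an injective LOT. A square complex L over the
   LOT is a finite complex of squares with an immersion (the labelling map)
   L -> K; it is graded if its vertices carry a height that grows by one along
   every edge.

   Nonpositive Euler characteristic. Partition the tree into a coarsest family of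
   at least two closed tight blocks. The edges labelled in a block lead to other
   blocks in such a way that Edmonds' theorem provides two disjoint
   arborescences, and these give a rule that marks two corners of each face that
   joins different blocks. Counting marked corners and using heights inside the
   blocks shows chi(L) <= 0 for every connected graded L that has a face and in
   which no link of a vertex has a bridge, that is, a corner whose removal
   disconnects a component of the link.

   Contraction. If chi(L) >= 1, then there is a bridge, and one can split the
   vertex there and remove the face of the bridge. This changes neither chi(L)
   nor the homotopy type relative to K, because the split vertex can be pulled
   around the rest of the boundary of the removed face. Iterating ends at a tree,
   so the labelling map of L is homotopic to a constant. Restricting to bridges
   that are compatible with a sub-LOT J gives chi >= 1 for every component of the
   J-labelled part of L.

   Lifting. A map of the square into K maps, after stretching the cells of K, each
   square of a fine grid into one closed cell. Gluing these cells along the grid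
   and folding yields an immersed L through which the map factors. A closed
   1-cochain on L pulls back to functions on the squares of the grid that differ by
   constants, so it is exact; thus H^1(L; R) = 0, which gives both chi(L) >= 1
   and a grading.

   For pi_2, collapse the boundary of the square to get the sphere. For pi_1, the
   boundary of a null homotopy of a loop in the subcomplex of J lies in a single
   J-component of L, which is contractible in the subcomplex of J. *)

Require Import Defs.
From HB Require Import structures.
From mathcomp Require Import all_boot all_order all_algebra generic_quotient zify.
From mathcomp Require Import boolp.

Set Implicit Arguments.
Unset Strict Implicit.
Unset Printing Implicit Defensive.
Import GRing.Theory.

(** * Disjoint arborescences *)

(** Two kinds of splitting occur. A vertex with disconnected link is split without touching faces;
    the count of corners starts only when all links are connected, because then a vertex without
    corners between blocks has all its ends labelled in one block. Splitting at a bridge costs a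
    face. The count rests on two colours. The arborescences give each block a bit [c], and the type
    of an end of an edge is its orientation added to the bit of its block. At a vertex, the corners
    with two ends of one type form a forest on the blocks present, since they follow one
    arborescence. Inside a block, ends of one type have the same orientation, so a vertex of extreme
    height misses that type. A face between blocks has exactly two such corners, which balances the
    sum. L is never realised as a space. A map out of L is a compatible family of maps of its cells,
    and since the labelling is an immersion, a point of L is given by its image in K and a reference
    vertex of the open cell around it. Discrete data of L become continuous real functions with
    finitely many values along segments of the square. *)

Section Arborescences.
Variables (T : finType) (N : {set T}) (h : T -> bool -> T).

Definition leaving (P : T -> bool -> bool) (S : {set T}) : nat :=
  \sum_(p : T * bool) [&& p.1 \in S, P p.1 p.2 & h p.1 p.2 \notin S].

(** Submodularity of a cut function: each arc counts on the left at most as often as on the right,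
    and arcs between the two differences account for the deficit. *)
Lemma leaving_submod P (S1 S2 : {set T}) :
  leaving P (S1 :&: S2) + leaving P (S1 :|: S2) <= leaving P S1 + leaving P S2.
Proof.
rewrite -!big_split; apply: leq_sum => -[x o] _ /=; rewrite !inE.
by case: (x \in S1); case: (x \in S2); case: (h x o \in S1); case: (h x o \in S2); case: (P x o).
Qed.

(** By finiteness this amounts to the absence of an [f]-cycle inside [N]: iterating [f] from a
    vertex of [N] ends outside. The counting arguments use it in the form for subsets. *)
Definition acyc (f : T -> T) :=
  forall S : {set T}, S \subset N -> S != set0 -> exists2 x, x \in S & f x \notin S.

Lemma leaving_rem (P : T -> bool -> bool) (x0 : T) (o0 : bool) (S : {set T}) : P x0 o0 ->
  leaving P S = leaving (fun x o => P x o && ((x, o) != (x0, o0))) S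
                + ((x0 \in S) && (h x0 o0 \notin S)).
Proof.
move=> P0; rewrite /leaving (bigD1 (x0, o0)) //= [in RHS](bigD1 (x0, o0)) //= P0 eqxx /=.
rewrite andbF /= add0n addnC; congr addn; apply: eq_bigr => -[x o] /= /negbTE ne.
by rewrite ne andbT.
Qed.

(* Lovasz's proof of Edmonds' disjoint arborescence theorem, for two
   arborescences in a digraph where every vertex of N has two outgoing arcs:
   the first one is grown from the complement of N while every non-empty
   S \subset N keeps an unused leaving arc. *)
Lemma two_arborescences :
  (forall S : {set T}, S \subset N -> S != set0 -> 1 < leaving (fun _ _ => true) S) ->
  exists c : T -> bool, forall t : bool, acyc (fun x => h x (t (+) c x)).
Proof.
move=> h2.
(* Despite the name, this selects the arcs that are still free: an arc is taken once its source in
   [N] has joined [U] and [c] points to it. *)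
pose used (U : {set T}) (c : T -> bool) x o := ~~ ((x \in U) && (x \in N) && (o == c x)).
suff: exists U : {set T}, exists c : T -> bool,
    [/\ ~: N \subset U, N \subset U,
        forall S : {set T}, S \subset N -> S != set0 -> 0 < leaving (used U c) S &
        forall S : {set T}, S \subset N -> S != set0 -> S \subset U ->
          exists2 x, x \in S & h x (c x) \notin S].
  move=> [U [c [_ NU res acycU]]]; exists c; case => S SN S0.
    have := res S SN S0; rewrite lt0n => /eqP ne.
    case: (pickP (fun x => (x \in S) && (h x (~~ c x) \notin S))) => [x /andP[xS hx]|no].
      by exists x; rewrite //= addTb.
    case: ne; apply: big1 => -[x o] _; rewrite /used /=; case: (boolP (x \in S)) => //= xS.
    have xN := subsetP SN x xS; rewrite (subsetP NU x xN) xN /=.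
    move: (no x); rewrite xS /= => /negbFE; case: o (c x) => -[] //= ->; by rewrite ?andbF.
  by have [x xS hx] := acycU S SN S0 (subset_trans SN NU); exists x.
suff grow n : forall U c, #|~: U| <= n -> ~: N \subset U ->
    (forall S : {set T}, S \subset N -> S != set0 -> 0 < leaving (used U c) S) ->
    (forall S : {set T}, S \subset N -> S != set0 -> S \subset U ->
          exists2 x, x \in S & h x (c x) \notin S) ->
    (forall x, x \in U -> x \in N -> h x (c x) \in U) ->
    exists U : {set T}, exists c : T -> bool,
    [/\ ~: N \subset U, N \subset U,
        forall S : {set T}, S \subset N -> S != set0 -> 0 < leaving (used U c) S &
        forall S : {set T}, S \subset N -> S != set0 -> S \subset U ->
          exists2 x, x \in S & h x (c x) \notin S].
  apply: (grow #|~: ~: N| (~: N) (fun=> false)) => //.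
    move=> S SN S0; apply: leq_trans (ltnW (h2 S SN S0)) _.
    apply: leq_sum => -[x o] _; rewrite /used /=; case: (boolP (x \in S)) => //= xS.
    by rewrite inE (subsetP SN x xS).
    move=> S SN /set0Pn[x xS] SU; have := subsetP SU x xS.
    by rewrite inE (subsetP SN x xS).
  by move=> x; rewrite inE => /negbTE ->.
elim: n => [|n IH] U c cU NU res ac cl.
  exists U, c; split=> //; apply/subsetP => x _.
  by move: cU; rewrite leqn0 cards_eq0 => /eqP/setP/(_ x); rewrite !inE => /negbFE.
case: (boolP (N \subset U)) => [|nNU]; first by exists U, c.
have [x [o [xU hxU safe]]] : exists x o, [/\ x \notin U, h x o \in U &
   forall S : {set T}, S \subset N -> x \in S -> h x o \notin S -> 1 < leaving (used U c) S].
  (* A dangerous set has exactly one free leaving arc and is not yet swallowed by [U]. The new arc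
     is chosen inside a minimal one; another set that it leaves and that has a single free leaving
     arc would, by submodularity, meet [S] in a smaller dangerous set. *)
  pose bad (S : {set T}) := [&& S \subset N, ~~ (S \subset U) & leaving (used U c) S == 1].
  have full (S : {set T}) : [disjoint S & U] -> leaving (used U c) S = leaving (fun _ _ => true) S.
    move=> dis; apply: eq_bigr => -[y o] _ /=; case: (boolP (y \in S)) => //= yS.
    by rewrite /used (disjointFr dis yS).
  case: (pickP bad) => [S1 bS1|nobad].
    have [S /minsetP[bS Smin] _] := minset_exists bS1.
    have := bS; rewrite /bad => /and3P[SN SU /eqP S1'].
    have D0 : S :\: U != set0 by rewrite setD_eq0.
    have DN : S :\: U \subset N := subset_trans (subsetDl _ _) SN.
    have disD : [disjoint S :\: U & U] by rewrite -setI_eq0 setIDAC setDIl setDv setI0.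
    (* Otherwise all arcs leaving [S :\: U] would be free arcs leaving [S]. There is only one of
       these, against the two that [h2] provides. *)
    have [x [o [xD hx]]] : exists x o, x \in S :\: U /\ h x o \in S :&: U.
      case: (pickP (fun p : T * bool => (p.1 \in S :\: U) && (h p.1 p.2 \in S :&: U))) => [[x o] /andP[]|no].
        by exists x, o.
      have := h2 _ DN D0; rewrite -full // ltnNge -S1' => /negP[].
      apply: leq_sum => -[y o] _ /=; move: (no (y, o)); rewrite /= !inE.
      by case: (y \in S); case: (y \in U); case: (h y o \in S); case: (h y o \in U); case: (used _ _ _ _).
    move: xD hx; rewrite !inE => /andP[xU xS] /andP[hS hU].
    exists x, o; split=> // S' S'N xS' hS'.
    have S'0 : S' != set0 by apply/set0Pn; exists x.
    rewrite ltn_neqAle eq_sym res // andbT; apply/negP => /eqP l1.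
    have := leaving_submod (used U c) S S'; rewrite S1' l1.
    have I0 : S :&: S' != set0 by apply/set0Pn; exists x; rewrite inE xS.
    have U0 : S :|: S' != set0 by apply/set0Pn; exists x; rewrite inE xS.
    have IN : S :&: S' \subset N := subset_trans (subsetIl _ _) SN.
    have UN : S :|: S' \subset N by rewrite subUset SN.
    move=> le2.
    have bI : bad (S :&: S').
      apply/and3P; split=> //; first by apply/subsetPn; exists x; rewrite // inE xS.
      rewrite eqn_leq res // andbT -(leq_add2r 1); apply: leq_trans le2.
      by rewrite leq_add2l res.
    have := Smin _ bI (subsetIl _ _) => /setP/(_ (h x o)).
    by rewrite inE hS (negbTE hS').
  have D0 : ~: U != set0.
    by apply/set0Pn; move/subsetPn: nNU => [y _ yU]; exists y; rewrite inE.
  have DN : ~: U \subset N by rewrite -(setCK N) setCS.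
  have := h2 _ DN D0.
  case: (pickP (fun p : T * bool => (p.1 \notin U) && (h p.1 p.2 \in U))) => [[x o] /andP[xU hU] _|no].
    exists x, o; split=> // S SN xS hS.
    have S0 : S != set0 by apply/set0Pn; exists x.
    rewrite ltn_neqAle eq_sym res // andbT.
    have := nobad S; rewrite /bad SN /= => /negbT; rewrite negb_and negbK => /orP[SU|//].
    by rewrite (subsetP SU x xS) in xU.
  rewrite ltnNge => /negP[]; rewrite /leaving big1 // => -[y o] _ /=; have := no (y, o); rewrite /= !inE negbK.
  by case: (y \in U) => //= ->.
have xN : x \in N.
  by apply/negP => /negP xN; have := subsetP NU x; rewrite inE xN (negbTE xU) => /(_ isT).
pose c' y := if y == x then o else c y.
have usedE y p : used (x |: U) c' y p = used U c y p && ((y, p) != (x, o)).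
  rewrite /used /c' xpair_eqE !inE; case: (eqVneq y x) => [->|] //=.
    by rewrite (negbTE xU) xN.
  by rewrite andbT.
apply: (IH (x |: U) c').
- by rewrite -ltnS; apply: leq_trans cU; rewrite setCU; apply: proper_card; rewrite properE subsetIr /=; apply/subsetPn; exists x; rewrite !inE ?eqxx.
- by apply: subset_trans NU _; rewrite subsetUr.
- move=> S SN S0; have P0 : used U c x o by rewrite /used (negbTE xU).
  have := leaving_rem S P0 => eq1.
  have -> : leaving (used (x |: U) c') S = leaving (fun y p => used U c y p && ((y, p) != (x, o))) S.
    by apply: eq_bigr => -[y p] _ /=; rewrite usedE.
  case: (boolP ((x \in S) && (h x o \notin S))) => [/andP[xS hS]|nb].
    by have := safe S SN xS hS; rewrite eq1 xS hS /= addn1.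
  by have := res S SN S0; rewrite eq1 (negbTE nb) addn0.
- move=> S SN S0 SU; case: (boolP (x \in S)) => xS; last first.
    have [|y yS hy] := ac S SN S0.
      apply/subsetP => y yS; have := subsetP SU y yS; rewrite !inE => /orP[/eqP yx|//].
      by rewrite -yx yS in xS.
    exists y => //; rewrite /c'; case: eqP => // yx; by rewrite -yx yS in xS.
  case: (eqVneq (S :\ x) set0) => [Sx|Sx0].
    exists x => //; rewrite /c' eqxx; apply/negP => hS.
    have : h x o \in S :\ x by rewrite !inE hS andbT; apply: contraNneq xU => <-.
    by rewrite Sx inE.
  have [| |y] := ac (S :\ x) _ Sx0.
  + exact: subset_trans (subsetDl _ _) SN.
  + apply/subsetP => y; rewrite !inE => /andP[yx yS]; have := subsetP SU y yS.
    by rewrite !inE (negbTE yx).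
  rewrite !inE => /andP[yx yS]; rewrite negb_and negbK => /orP[/eqP hyx|hy].
    have yU : y \in U by have := subsetP SU y yS; rewrite !inE (negbTE yx).
    by have := cl y yU (subsetP SN y yS); rewrite hyx (negbTE xU).
  by exists y; rewrite /c' ?(negbTE yx).
- move=> y; rewrite !inE /c'; case: (eqVneq y x) => [-> _ _|yx /= yU yN].
    by rewrite hxU orbT.
  by rewrite cl ?orbT.
Qed.
End Arborescences.

(** * Edge counts by growing a connected set *)

Section Growth.
Variables (X A : finType) (vt : A -> bool -> X).

(** Connectedness as the absence of empty cuts, a form that trees and connected square complexes
    share. *)
Definition crossing (W : {set X}) (F : {set A}) :=
  forall U : {set X}, U \subset W -> U != set0 -> U != W ->
  exists a o, [/\ a \in F, vt a o \in U & vt a (~~ o) \in W :\: U].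

(** Each vertex added to [U] is reached by an edge of [F] that was not inside [U] and is inside
    afterwards, so every new vertex uses up a fresh edge. *)
Lemma growth (W : {set X}) (F : {set A}) (U : {set X}) :
  crossing W F -> U \subset W -> U != set0 ->
  #|W :\: U| <= #|[set a in F | ~~ [forall o, vt a o \in U]]|.
Proof.
move=> cr; have [n] := ubnP #|W :\: U|; elim: n U => // n IH U leq_n UW U0.
case: (eqVneq U W) => [->|UneW]; first by rewrite setDv cards0.
have [a [o [aF aU aW]]] := cr U UW U0 UneW.
set y := vt a (~~ o) in aW; have := aW; rewrite inE => /andP[yU yW].
have Dy : W :\: U = y |: (W :\: (y |: U)).
  by apply/setP => z; rewrite !inE; case: (eqVneq z y) => [->|//]; rewrite yU yW.
have cDy : #|W :\: U| = #|W :\: (y |: U)|.+1 by rewrite Dy cardsU1 !inE eqxx.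
rewrite cDy in leq_n *.
have le1 : #|W :\: (y |: U)| <= #|[set a in F | ~~ [forall o, vt a o \in y |: U]]|.
  by apply: IH; rewrite ?subUset ?sub1set ?yW ?UW //; apply/set0Pn; exists y; rewrite !inE eqxx.
apply: leq_ltn_trans le1 _; apply: proper_card; rewrite properE; apply/andP; split.
  apply/subsetP => b; rewrite !inE => /andP[-> /=]; apply: contra => /forallP b1.
  by apply/forallP => p; rewrite !inE b1 orbT.
apply/subsetPn; exists a; rewrite !inE aF /=.
  by apply/forallPn; exists (~~ o); rewrite -/y.
rewrite negbK; apply/forallP => p; rewrite !inE; case: (eqVneq p o) => [->|po].
  by rewrite aU orbT.
have -> : p = ~~ o by move: po; case: (p); case: (o).
by rewrite -/y eqxx.
Qed.

End Growth.

(** * Closed tight blocks *)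

Section Blocks.
Variables (V E : finType) (lsrc llab ltgt : E -> V).

Definition hl (e : E) (j : bool) := if j then ltgt e else lsrc e.

Definition Ein (U : {set V}) : {set E} := [set e | (lsrc e \in U) && (ltgt e \in U)].

(** In a forest, a full subgraph with one edge less than vertices is a tree. So these are the vertex
    sets of sub-LOTs, together with single vertices; a count replaces connectedness. *)
Definition ctight (W : {set V}) :=
  [&& W != set0, #|Ein W|.+1 == #|W| & [forall e in Ein W, llab e \in W]].

Lemma in_Ein (U : {set V}) e : (e \in Ein U) = [forall o, hl e o \in U].
Proof.
rewrite inE; apply/andP/forallP => [[s t] []//|H].
by split; [exact: (H false)|exact: (H true)].
Qed.

Lemma Ein_hl (U : {set V}) e o : e \in Ein U -> hl e o \in U.
Proof. by rewrite in_Ein => /forallP. Qed.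

Hypothesis forest : forall U : {set V}, U != set0 -> #|Ein U| < #|U|.
Hypothesis inj : injective llab.

Lemma ctight1 v : ctight [set v].
Proof.
have n0 : [set v] != set0 by apply/set0Pn; exists v; rewrite inE.
have := forest n0; rewrite cards1 ltnS leqn0 cards_eq0 => /eqP E0.
rewrite /ctight n0 E0 cards0 cards1 /=; by apply/forallP => e; rewrite in_set0.
Qed.

Section Blk.
Variables (W : {set V}) (blk : V -> V).
Hypothesis ctW : ctight W.

Definition fib (S : {set V}) := [set v in W | blk v \in S].
(** Mixed edges are the edges that survive when every block is collapsed to a point; [mixin S]
    consists of those among the blocks of [S]. *)
Definition mixed e := blk (lsrc e) != blk (ltgt e).
Definition mixin (S : {set V}) := [set e in Ein (fib S) | mixed e].
Definition blks := blk @: W.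

Hypothesis ctblk : forall q, q \in blks -> ctight (fib [set q]).

Lemma ctight_lab (U : {set V}) e : ctight U -> e \in Ein U -> llab e \in U.
Proof. by case/and3P=> _ _ /forallP/(_ e)/implyP. Qed.

Lemma fib_sub S : fib S \subset W.
Proof. by apply/subsetP => v; rewrite inE => /andP[]. Qed.

Lemma in_fib S v : (v \in fib S) = (v \in W) && (blk v \in S).
Proof. by rewrite inE. Qed.

Lemma Ein_sub (U U' : {set V}) : U \subset U' -> Ein U \subset Ein U'.
Proof.
by move=> /subsetP s; apply/subsetP => e; rewrite !inE => /andP[/s -> /s ->].
Qed.

Lemma fibE : W = fib blks.
Proof.
by apply/setP => v; rewrite inE; case: (boolP (v \in W)) => //= vW; rewrite imset_f.
Qed.

(** An edge of [fib S] that is not mixed lies in a single block, and every block has one vertex more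
    than edges; these defects add up to [#|S|]. *)
Lemma Ein_fib (S : {set V}) : S \subset blks ->
  #|Ein (fib S)| + #|S| = #|fib S| + #|mixin S|.
Proof.
move=> SB.
have cU : #|fib S| = \sum_(q in S) #|fib [set q]|.
  rewrite -sum1_card (partition_big blk (mem S)) /=; last by move=> v; rewrite inE => /andP[].
  apply: eq_bigr => q qS; rewrite -sum1_card; apply: eq_bigl => v.
  by rewrite !inE; case: (v \in W) => //=; case: (eqVneq (blk v) q) => [->|]; rewrite ?qS ?andbF.
have cE : #|Ein (fib S) :\: mixin S| = \sum_(q in S) #|Ein (fib [set q])|.
  rewrite -sum1_card (partition_big (blk \o lsrc) (mem S)) /=; last first.
    by move=> e; rewrite inE => /andP[_]; rewrite !inE => /andP[/andP[]].
  apply: eq_bigr => q qS; rewrite -sum1_card; apply: eq_bigl => e.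
  rewrite !inE /mixed; case: (lsrc e \in W) => //=.
  case: (ltgt e \in W) => //=; rewrite ?andbF //.
  have [->|ne] := eqVneq (blk (lsrc e)) q; rewrite ?andbF //= qS /= andbT eq_sym.
  by have [->|ne] := eqVneq (blk (ltgt e)) q; rewrite ?qS ?andbF ?andbT //; case: (_ \in S).
have mS : mixin S \subset Ein (fib S) by apply/subsetP => e; rewrite inE => /andP[].
have := cardsID (mixin S) (Ein (fib S)); rewrite (setIidPr mS) cE => <-.
rewrite cU -(sum1_card (mem S)) -addnA -big_split /= addnC; congr (_ + _).
apply: eq_bigr => q qS; have /ctblk/and3P[_ /eqP <- _] := subsetP SB q qS.
by rewrite addn1.
Qed.

Lemma mixin_lt (S : {set V}) : S \subset blks -> S != set0 -> #|mixin S| < #|S|.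
Proof.
clear ctW; move=> SB S0; have := Ein_fib SB.
have /forest : fib S != set0.
  have [q qS] := set0Pn _ S0; have := subsetP SB q qS => /imsetP[v vW qE].
  by apply/set0Pn; exists v; rewrite inE vW -qE.
lia.
Qed.

Lemma mixin_lab (S : {set V}) e : e \in mixin S -> llab e \in W.
Proof.
rewrite inE => /andP[eE _]; apply: ctight_lab ctW _.
exact: (subsetP (Ein_sub (fib_sub S))).
Qed.

(** A block with n vertices has n - 1 inner edges, all labelled in it. As labels are injective, at
    most one vertex of the block is left to label a mixed edge. *)
Lemma lab_block_inj e e' : e \in mixin blks -> e' \in mixin blks ->
  blk (llab e) = blk (llab e') -> e = e'.
Proof.
move=> em em' bE; apply/eqP; apply/negP => /negP nee'.
pose q := blk (llab e); have qB : q \in blks by apply: imset_f; apply: mixin_lab em.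
have cq := ctblk qB; have := cq => /and3P[_ /eqP cE _].
have nin e1 : e1 \in mixin blks -> e1 \notin Ein (fib [set q]).
  rewrite !inE => /andP[_ mx]; apply/negP => /andP[/andP[_ /eqP h1] /andP[_ /eqP h2]].
  by move: mx; rewrite /mixed h1 h2 eqxx.
pose D := e |: (e' |: Ein (fib [set q])).
have cD : #|D| = #|Ein (fib [set q])|.+2.
  rewrite cardsU1 cardsU1 (nin e') // [_ \in _ |: _]inE (negbTE (nin e em)) orbF inE (negbTE nee').
  by [].
have : #|llab @: D| <= #|fib [set q]|.
  apply: subset_leq_card; apply/subsetP => v /imsetP[e1 e1D ->].
  move: e1D; rewrite !in_setU !in_set1 => /or3P[/eqP->|/eqP->|e1E].
  - by rewrite in_fib (mixin_lab em) in_set1 eqxx.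
  - by rewrite in_fib (mixin_lab em') in_set1 -bE eqxx.
  - exact: ctight_lab cq _.
by rewrite card_imset // cD -cE; lia.
Qed.

End Blk.

(* Sending the block q to the block of the end [t (+) c q] of the mixed edge
   labelled in q has no cycles, for both t. *)
Definition acyclic_blocks (W : {set V}) (blk : V -> V) (c : V -> bool) :=
  forall (t : bool) (S : {set V}), S != set0 ->
  exists2 q, q \in S & forall e, e \in Ein W -> mixed blk e -> blk (llab e) = q ->
                    blk (hl e (t (+) c q)) \notin S.

(** The partition has the fewest blocks among those with at least two closed tight blocks and [J0]
    inside one of them. By minimality, a union of several but not all blocks is never closed tight.
    If a mixed edge is labelled in a block next to it, the union of its two end blocks is closed
    tight, hence everything. Otherwise the cut condition for two arborescences holds. *)
Lemma block_structure (W J0 : {set V}) :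
  ctight W -> 1 < #|W| -> J0 \proper W -> (J0 = set0 \/ ctight J0) ->
  exists blk : V -> V,
  [/\ forall q, q \in blk @: W -> ctight (fib W blk [set q]) /\ #|fib W blk [set q]| < #|W|,
      {in J0 &, forall u v, blk u = blk v},
      {in Ein W &, forall e e', mixed blk e -> mixed blk e' ->
         blk (llab e) = blk (llab e') -> e = e'} &
      (exists e0 j, [/\ e0 \in Ein W, forall e, e \in Ein W -> mixed blk e -> e = e0,
          blk (llab e0) = blk (hl e0 (~~ j)) & mixed blk e0])
   \/ ((forall e j, e \in Ein W -> mixed blk e -> blk (llab e) != blk (hl e j)) /\
       exists c, acyclic_blocks W blk c)].
Proof.
move=> ctW W1 J0W J0c.
pose adm (b : {ffun V -> V}) :=
  [&& 1 < #|blks W b|, [forall q in blks W b, ctight (fib W b [set q])] &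
      [forall u in J0, forall v in J0, b u == b v]].
have [b0 ab0] : exists b0, adm b0.
  have [J00|[j0 j0J]] := set_0Vmem J0.
    exists [ffun v => v]; apply/and3P; split.
    - by rewrite (_ : blks _ _ = W) //; apply/setP => v; apply/imsetP/idP => [[w wW ->]|vW]; [rewrite ffunE|exists v; rewrite ?ffunE].
    - apply/forallP => q; apply/implyP => /imsetP[v vW ->]; rewrite ffunE.
      rewrite (_ : fib _ _ _ = [set v]) ?ctight1 //; apply/setP => w; rewrite !inE ffunE.
      by case: (eqVneq w v) => [->|]; rewrite ?vW ?andbF.
    - by apply/forallP => u; apply/implyP; rewrite J00 inE.
  have ctJ : ctight J0 by case: J0c => // J00; rewrite J00 inE in j0J.
  have JW := proper_sub J0W.
  exists [ffun v => if v \in J0 then j0 else v]; set b := finfun _.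
  have bE v : b v = if v \in J0 then j0 else v by rewrite ffunE.
  apply/and3P; split.
  - have [w wW wJ] : exists2 w, w \in W & w \notin J0 by apply/subsetPn; case/andP: J0W.
    have j0W := subsetP JW _ j0J.
    have -> : 1 = #|[set j0; w]|.-1 by rewrite cards2; case: eqP wJ => // <-; rewrite j0J.
    rewrite cards2; case: eqP => [jw|_]; first by rewrite -jw j0J in wJ.
    rewrite (_ : _ < _ = (#|[set j0; w]| <= #|blks W b|)); last by rewrite cards2; case: eqP wJ => // <-; rewrite j0J.
    apply: subset_leq_card; apply/subsetP => v; rewrite !inE => /orP[]/eqP->.
    + by apply/imsetP; exists j0; rewrite // bE j0J.
    + by apply/imsetP; exists w; rewrite // bE (negbTE wJ).
  - apply/forallP => q; apply/implyP => /imsetP[v vW ->]; rewrite bE; case: ifP => vJ.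
      rewrite (_ : fib _ _ _ = J0) //; apply/setP => u; rewrite !inE bE.
      case: ifP => uJ; first by rewrite (subsetP JW) // eqxx.
      by case: eqP => [uj|_]; rewrite ?andbF //; rewrite uj j0J in uJ.
    rewrite (_ : fib _ _ _ = [set v]) ?ctight1 //; apply/setP => u; rewrite !inE bE.
    case: ifP => uJ; last by case: eqP => [->|]; rewrite ?vW ?andbF.
    apply/andP/eqP => [[_ /eqP jv]|uv]; first by rewrite -jv j0J in vJ.
    by rewrite uv vJ in uJ.
  - apply/forallP => u; apply/implyP => uJ; apply/forallP => v; apply/implyP => vJ.
    by rewrite !bE uJ vJ.
have [b /and3P[b1 /forallP bct /forallP bJ] bmin] := arg_minnP (fun b : {ffun V -> V} => #|blks W b|) ab0.
have ctq q : q \in blks W b -> ctight (fib W b [set q]) by move/(implyP (bct q)).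
have Jb : {in J0 &, forall u v, b u = b v}.
  by move=> u v uJ vJ; apply/eqP; have /implyP/(_ uJ)/forallP/(_ v)/implyP/(_ vJ) := bJ u.
(* Merging the blocks of [S] would leave fewer blocks, but still at least two because [S] is not
   everything. *)
have prime (S : {set V}) : S \subset blks W b -> 1 < #|S| -> S != blks W b ->
    ~~ ctight (fib W b S).
  move=> SB S1 SneB; apply/negP => ctS.
  have [q0 q0S] : exists q0, q0 \in S by apply/set0Pn; rewrite -card_gt0; lia.
  have Sp : S \proper blks W b by rewrite properEneq SneB.
  pose b' := [ffun v => if b v \in S then q0 else b v].
  have b'E v : b' v = if b v \in S then q0 else b v by rewrite ffunE.
  have bl' : blks W b' = q0 |: (blks W b :\: S).
    apply/setP => q; apply/imsetP/idP => [[v vW ->]|].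
      rewrite b'E; case: ifP => bS; rewrite !inE ?eqxx // bS /=.
      by rewrite imset_f ?orbT.
    rewrite !inE => /orP[/eqP->|/andP[qS /imsetP[v vW qv]]].
      have /imsetP[v vW qv] := subsetP SB _ q0S; exists v => //; by rewrite b'E -qv q0S.
    by exists v; rewrite // b'E -qv (negbTE qS).
  have cbl' : #|blks W b'| = (#|blks W b| - #|S|).+1.
    by rewrite bl' cardsU1 !inE q0S /= add1n cardsD (setIidPr SB).
  have ltS := proper_card Sp.
  have : adm b'.
    apply/and3P; split.
    - by rewrite cbl'; lia.
    - apply/forallP => q; apply/implyP; rewrite bl' !inE => /orP[/eqP->|/andP[qS qB]].
        rewrite (_ : fib W b' _ = fib W b S) //; apply/setP => v; rewrite !inE b'E.
        case: ifP => bS; rewrite ?eqxx //.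
        by case: eqP => [bq|_]; rewrite ?andbF //; rewrite bq q0S in bS.
      rewrite (_ : fib W b' _ = fib W b [set q]) ?ctq //; apply/setP => v; rewrite !inE b'E.
      case: ifP => bS //; case: (eqVneq q0 q) => [qq|_].
        by rewrite -qq q0S in qS.
      by case: eqP => [bq|_]; rewrite ?andbF //; rewrite -bq bS in qS.
    - apply/forallP => u; apply/implyP => uJ; apply/forallP => v; apply/implyP => vJ.
      by rewrite !b'E (Jb u v uJ vJ).
  by move/bmin; rewrite cbl'; lia.
have cq_lt q : q \in blks W b -> #|fib W b [set q]| < #|W|.
  move=> qB; apply: proper_card; rewrite properEneq fib_sub andbT.
  apply/eqP => fW; have := b1; rewrite ltnNge => /negP[].
  rewrite -(cards1 q); apply: subset_leq_card; apply/subsetP => p /imsetP[v vW ->].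
  by move: vW; rewrite -fW !inE => /andP[].
have EinW : Ein (fib W b (blks W b)) = Ein W by rewrite -fibE.
have mixE e : e \in mixin W b (blks W b) = (e \in Ein W) && mixed b e.
  by rewrite inE EinW.
have labi : {in Ein W &, forall e e', mixed b e -> mixed b e' ->
         b (llab e) = b (llab e') -> e = e'}.
  move=> e e' eW eW' m m'; apply: (lab_block_inj ctW ctq); by rewrite mixE ?eW ?eW'.
have pair e j : e \in Ein W -> mixed b e -> b (llab e) = b (hl e (~~ j)) ->
    blks W b = [set b (hl e false); b (hl e true)].
  move=> eW me lE; apply/eqP; rewrite eq_sym; apply/negP => /negP ne.
  set S := [set _; _] in ne.
  have SB : S \subset blks W b.
    by apply/subsetP => q; rewrite !inE => /orP[]/eqP->; apply/imset_f/Ein_hl.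
  have cS : #|S| = 2 by rewrite cards2; move: me; rewrite /mixed /= => ->.
  have SS : 1 < #|S| by rewrite cS.
  have /negP[] := prime S SB SS ne.
  have inS o : hl e o \in fib W b S.
    rewrite in_fib Ein_hl //= !inE; case: o; by rewrite eqxx ?orbT.
  have emS : e \in mixin W b S by rewrite inE me andbT in_Ein; apply/forallP.
  have mS : #|mixin W b S| = 1.
    have := mixin_lt ctq SB; rewrite -card_gt0 cS => /(_ isT).
    have : 0 < #|mixin W b S| by apply/card_gt0P; exists e.
    lia.
  have F0 : fib W b S != set0 by apply/set0Pn; exists (hl e true).
  apply/and3P; split=> //.
    have := Ein_fib ctq SB; rewrite mS cS => h; apply/eqP; move: h; lia.
  apply/forallP => e1; apply/implyP => e1E.
  have e1W := subsetP (Ein_sub (fib_sub W b S)) _ e1E.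
  rewrite in_fib (ctight_lab ctW e1W) /=.
  case: (boolP (mixed b e1)) => m1.
    have : e1 \in mixin W b S by rewrite inE e1E.
    have /cards1P[e2 ->] : #|mixin W b S| == 1 by rewrite mS.
    rewrite inE => /eqP e12; move: emS; have /cards1P[e3 e3E] : #|mixin W b S| == 1 by rewrite mS.
    have : e1 \in mixin W b S by rewrite inE e1E.
    rewrite e3E !inE => /eqP-> /eqP<-; rewrite lE; case: (j) => /=; by rewrite eqxx ?orbT.
  pose q := b (lsrc e1); have qS : q \in S by have := Ein_hl false e1E; rewrite in_fib => /andP[].
  have := ctight_lab (ctq q (subsetP SB _ qS)) (e := e1).
  rewrite in_Ein in_fib in_set1 => H.
  have /H/andP[_ /eqP->] // : [forall o, hl e1 o \in fib W b [set q]].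
  apply/forallP => o; rewrite in_fib Ein_hl // in_set1 /q; case: o => //=.
  by move: m1; rewrite /mixed negbK eq_sym.
exists b; split=> //; first by move=> q qB; split; [exact: ctq|exact: cq_lt].
case: (boolP [exists e in Ein W, mixed b e && [exists j, b (llab e) == b (hl e (~~ j))]]).
  move=> /existsP[e0 /and3P[e0W m0 /existsP[j /eqP lE]]]; left; exists e0, j; split=> //.
  move=> e eW me; have := pair e0 j e0W m0 lE => B2.
  have : #|mixin W b (blks W b)| <= 1.
    have := mixin_lt ctq (subxx (blks W b)); rewrite -card_gt0 => /(_ (ltnW b1)).
    by rewrite {2}B2 cards2; case: (_ != _); lia.
  by move/card_le1_eqP => /(_ e e0)-> //; rewrite mixE ?eW ?e0W.
move=> /existsPn nope; right.
have nolab e j : e \in Ein W -> mixed b e -> b (llab e) != b (hl e j).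
  move=> eW me; have := nope e; rewrite eW me /= => /existsPn/(_ (~~ j)).
  by rewrite negbK.
split=> //.
pose eb (q : V) := [pick e in Ein W | mixed b e && (b (llab e) == q)].
(* Inner vertices of the digraph are the blocks that label a mixed edge, which is then unique by
   [labi]; the two arcs lead to the blocks of its two ends. *)
pose N : {set V} := [set q | isSome (eb q)].
pose h q o := if eb q is Some e then b (hl e o) else q.
have ebP q : q \in N -> exists e, [/\ eb q = Some e, e \in Ein W, mixed b e & b (llab e) = q].
  rewrite inE /eb; case: pickP => // e /and3P[eW me /eqP lq] _; by exists e.
have ebE e : e \in Ein W -> mixed b e -> eb (b (llab e)) = Some e.
  move=> eW me; rewrite /eb; case: pickP => [e' /and3P[eW' me' /eqP lq]|/(_ e)].
    by congr Some; apply: labi.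
  by rewrite eW me eqxx.
have [|c cP] := @two_arborescences V N h; last first.
  exists c => t S S0.
  case: (boolP (S \subset N)) => [SN|/subsetPn[q qS qN]]; last first.
    exists q => // e eW me lq; move: qN; rewrite inE -lq ebE //.
  have [q qS hq] := cP t S SN S0; exists q => // e eW me lq.
  by move: hq; rewrite /h -lq ebE.
move=> S SN S0.
have NB : N \subset blks W b.
  by apply/subsetP => q /ebP[e [_ eW me <-]]; apply/imset_f/(ctight_lab ctW).
have SB := subset_trans SN NB.
(* With at most one leaving arc, all members of [S] but one send both arcs into [S]. Their mixed
   edges lie among the blocks of [S], where a forest has room for only [#|S| - 1]. Equality makes
   [fib S] tight with all its mixed labels inside, against [prime]. *)
have mixS : exists2 D : {set V}, D \subset S & leaving h (fun _ _ => true) S <= 1 -> #|S| <= #|D|.+1 /\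
   forall q, q \in D -> forall o, h q o \in S.
  exists [set q in S | [forall o, h q o \in S]].
    by apply/subsetP => q; rewrite inE => /andP[].
  rewrite /leaving => le1; split; last by move=> q; rewrite inE => /andP[_ /forallP].
  set D := [set q in S | _]; rewrite -(cardsID D S) (setIidPr _); last first.
    by apply/subsetP => q; rewrite inE => /andP[].
  rewrite -addn1 leq_add2l; apply: leq_trans le1.
  rewrite -(pair_bigA _ (fun q o => ([&& q \in S, true & h q o \notin S] : nat))) /=.
  rewrite -sum1_card [leqLHS]big_mkcond; apply: leq_sum => q _.
  rewrite big_bool /= !inE; case: (boolP (q \in S)) => //= qS; rewrite ?andbF // andbT.
  case: ifP => // /forallPn[[] ->]; lia.
rewrite ltnNge; apply/negP => le1.
have [D DS /(_ le1)[cD Dh]] := mixS.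
have S1 : 1 < #|S|.
  rewrite ltnNge; apply/negP => S1; move: le1; rewrite leqNgt => /negP[].
  have /cards1P[q Sq] : #|S| == 1 by rewrite eqn_leq S1 card_gt0.
  have /ebP[e [eq1 eW me lq]] : q \in N by apply: (subsetP SN); rewrite Sq inE.
  rewrite /leaving (bigD1 (q, false)) //= (bigD1 (q, true)) /=; last by rewrite xpair_eqE andbF.
  rewrite Sq !inE eqxx /=.
  by rewrite /h eq1 -lq !(eq_sym (b (hl _ _))) !nolab.
pose f e := b (llab e).
have DF : D \subset f @: mixin W b S.
  apply/subsetP => q qD; have := subsetP SN q (subsetP DS q qD) => /ebP[e [eq1 eW me lq]].
  apply/imsetP; exists e; rewrite // inE me andbT in_Ein; apply/forallP => o.
  by rewrite in_fib Ein_hl //=; have := Dh q qD o; rewrite /h eq1.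
have cF := leq_imset_card f (mixin W b S).
have mlt := mixin_lt ctq SB S0.
have leDF := subset_leq_card DF.
have DE : D = f @: mixin W b S by apply/eqP; rewrite eqEcard DF; lia.
have SneB : S != blks W b.
  apply/eqP => SE; have : #|N| <= #|mixin W b (blks W b)|.
    apply: leq_trans (leq_imset_card f _); apply: subset_leq_card.
    by apply/subsetP => q /ebP[e [_ eW me <-]]; apply/imset_f; rewrite mixE eW.
  have := subset_leq_card SN; rewrite SE.
  have := mixin_lt ctq (subxx (blks W b)); rewrite -card_gt0 => /(_ (ltnW b1)); lia.
have /negP[] := prime S SB S1 SneB.
apply/and3P; split.
- have [q qS] := set0Pn _ S0; have := subsetP SB q qS => /imsetP[v vW qE].
  by apply/set0Pn; exists v; rewrite inE vW -qE.
- by have := Ein_fib ctq SB => h1; apply/eqP; move: h1; lia.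
apply/forallP => e1; apply/implyP => e1E.
have e1W := subsetP (Ein_sub (fib_sub W b S)) _ e1E.
rewrite in_fib (ctight_lab ctW e1W) /=.
case: (boolP (mixed b e1)) => m1.
  by apply: (subsetP DS); rewrite DE; apply/imsetP; exists e1; rewrite // inE e1E.
pose q := b (lsrc e1); have qS : q \in S by have := Ein_hl false e1E; rewrite in_fib => /andP[].
have := ctight_lab (ctq q (subsetP SB _ qS)) (e := e1).
rewrite in_Ein in_fib in_set1 => H.
have /H/andP[_ /eqP->] // : [forall o, hl e1 o \in fib W b [set q]].
apply/forallP => o; rewrite in_fib Ein_hl // in_set1 /q; case: o => //=.
by move: m1; rewrite /mixed negbK eq_sym.
Qed.

End Blocks.

(** * Square complexes over a labeled oriented graph *)

Section Complexes.
Variables (V E : finType) (lsrc llab ltgt : E -> V).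
Local Notation hl := (hl lsrc ltgt).
Local Notation Ein := (Ein lsrc ltgt).
Local Notation ctight := (ctight lsrc llab ltgt).

(* A finite square complex over the LOG: [vt a o] is the origin (o = false) or
   the end (o = true) of the edge a, and the face b has the horizontal sides
   [hs b false] (bottom), [hs b true] (top) and the vertical sides [vs b false]
   (left), [vs b true] (right). *)
Record cplx := Cplx {
  cX : finType; cA : finType; cB : finType;
  vt : cA -> bool -> cX; al : cA -> V; bl : cB -> E;
  hs : cB -> bool -> cA; vs : cB -> bool -> cA;
  hsP : forall b j, al (hs b j) = hl (bl b) j;
  vsP : forall b i, al (vs b i) = llab (bl b);
  crP : forall b i j, vt (hs b j) i = vt (vs b i) j }.

(** Invariant functions replace paths, since connectedness of a split complex then follows by
    pulling functions back and forth. *)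
Definition conn (L : cplx) := forall h : cX L -> bool,
  (forall a, h (vt a false) = h (vt a true)) -> forall x y, h x = h y.

Definition immersed (L : cplx) :=
  (forall (a a' : cA L) o, vt a o = vt a' o -> al a = al a' -> a = a') /\
  (forall b b' : cB L, bl b = bl b' -> hs b false = hs b' false -> b = b').

(** Heights serve to pick lowest and highest vertices of finite sets, for which a strict increase
    along edges suffices. *)
Definition graded (L : cplx) :=
  exists u : cX L -> nat, forall a, u (vt a false) < u (vt a true).

Definition over (L : cplx) (W : {set V}) := forall a : cA L, al a \in W.

(** At a common corner immersion identifies the horizontal sides, then at their ends the vertical
    ones, and finally the bottom sides, which determine the face. *)
Lemma corner_inj L (b b' : cB L) i j : immersed L -> bl b = bl b' ->
  vt (hs b j) i = vt (hs b' j) i -> b = b'.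
Proof.
move=> [ia ib] e v.
have hj : hs b j = hs b' j by apply: ia v _; rewrite !hsP e.
have vE o : vs b o = vs b' o by apply: (ia _ _ j); rewrite ?vsP ?e // -!crP hj.
apply: (ib _ _ e); apply: (ia _ _ false); first by rewrite !crP vE.
by rewrite !hsP e.
Qed.

(** * Splitting a vertex, and subcomplexes *)

Section Split.
Variables (L : cplx) (S : cA L -> bool -> bool) (D : pred (cB L)).
Hypothesis SD : forall b, D b -> forall i j, S (hs b j) i = S (vs b i) j.

(** Ends in [S] are attached to the new vertex [None]. A face of [D] survives because, by [SD], none
    of its corners joins an end in [S] to an end outside. *)
Definition svt (a : cA L) o : option (cX L) := if S a o then None else Some (vt a o).

Definition split_cplx : cplx.
refine (@Cplx (option (cX L)) (cA L) {b : cB L | D b} svt (@al L)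
  (fun b => bl (val b)) (fun b => hs (val b)) (fun b => vs (val b)) _ _ _).
- by move=> b j; exact: hsP.
- by move=> b j; exact: vsP.
- by move=> b i j; rewrite /svt (SD (valP b)) crP.
Defined.

Definition unsplit (p : cX L) (x : option (cX L)) := if x is Some y then y else p.

Lemma svtK p a o : (forall a o, S a o -> vt a o = p) -> unsplit p (svt a o) = vt a o.
Proof. by move=> Sp; rewrite /svt; case: ifP => // /Sp. Qed.

Lemma split_imm p : (forall a o, S a o -> vt a o = p) -> immersed L -> immersed split_cplx.
Proof.
move=> Sp [ia ib]; split.
  move=> a a' o /= h; apply: (ia _ _ o); by rewrite -(svtK a o Sp) h svtK.
by move=> b b' /= e h; apply: val_inj; apply: ib.
Qed.

Lemma split_graded p : (forall a o, S a o -> vt a o = p) -> graded L -> graded split_cplx.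
Proof.
move=> Sp [u uP]; exists (fun x => u (unsplit p x)) => a /=.
by rewrite !svtK.
Qed.

Lemma card_splitX : #|cX split_cplx| = #|cX L|.+1.
Proof. exact: card_option. Qed.

Lemma card_splitB : #|cB split_cplx| = #|D|.
Proof. exact: card_sig. Qed.

End Split.

Section Sub.
Variables (L : cplx) (h : pred (cX L)) (H : pred V).
Hypothesis hH : forall a, H (al a) -> h (vt a false) = h (vt a true).

(** Testing the origin is enough: [hH] makes [h] agree at both ends of an edge labelled in [H]. *)
Definition subA (a : cA L) := h (vt a false) && H (al a).
Definition subB (b : cB L) := [&& subA (hs b false), subA (hs b true), subA (vs b false) & subA (vs b true)].

Lemma subA_vt a o : subA a -> h (vt a o).
Proof. by case/andP=> h1 h2; case: o; rewrite // -hH. Qed.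

Definition sub_vt (a : {a | subA a}) o : {x | h x} := exist _ (vt (val a) o) (subA_vt o (valP a)).

Lemma subB_hs b j : subB b -> subA (hs b j).
Proof. by case/and4P; case: j. Qed.

Lemma subB_vs b j : subB b -> subA (vs b j).
Proof. by case/and4P; case: j. Qed.

Definition sub : cplx.
refine (@Cplx {x | h x} {a | subA a} {b | subB b} sub_vt (fun a => al (val a))
  (fun b => bl (val b))
  (fun b j => exist _ (hs (val b) j) (subB_hs j (valP b)))
  (fun b j => exist _ (vs (val b) j) (subB_vs j (valP b))) _ _ _).
- by move=> b j /=; exact: hsP.
- by move=> b j /=; exact: vsP.
- by move=> b i j /=; apply: val_inj; exact: crP.
Defined.

Lemma sub_imm : immersed L -> immersed sub.
Proof.
move=> [ia ib]; split.
  move=> a a' o /= [v] e; apply: val_inj; exact: ia v e.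
move=> b b' /= e [v]; apply: val_inj; exact: ib.
Qed.

Lemma sub_graded : graded L -> graded sub.
Proof. by move=> [u uP]; exists (fun x => u (val x)) => a /=. Qed.

Lemma card_subX : #|cX sub| = #|h|.
Proof. exact: card_sig. Qed.
Lemma card_subA : #|cA sub| = #|subA|.
Proof. exact: card_sig. Qed.
Lemma card_subB : #|cB sub| = #|subB|.
Proof. exact: card_sig. Qed.

Lemma subB_A b : (subA (hs b false) || subA (hs b true)) && H (llab (bl b)) &&
   H (hl (bl b) false) && H (hl (bl b) true) -> subB b.
Proof.
move=> /andP[/andP[/andP[hh h0] h1] h2].
have Hh j : H (al (hs b j)) by rewrite hsP; case: j.
have Hv j : H (al (vs b j)) by rewrite vsP.
have e1 : h (vt (hs b true) false) = h (vt (hs b false) false).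
  by rewrite !crP -hH.
have : h (vt (hs b false) false).
  by move: hh; rewrite /subA e1 => /orP[]/andP[].
move=> hb; rewrite /subB /subA !Hh !Hv e1 hb !andbT /=.
by rewrite -!crP hb /= -hH.
Qed.

End Sub.

Lemma conn_vertex L (a0 : cA L) (x : cX L) : conn L -> exists (a : cA L) o, vt a o = x.
Proof.
move=> cL; case: (pickP (fun p : cA L * bool => vt p.1 p.2 == x)) => [[a o] /eqP|no]; first by exists a, o.
have no' a o : (vt a o == x) = false := no (a, o).
have := cL (fun y => y == x) _ x (vt a0 false); rewrite eqxx no' => H.
suff: true = false by [].
by apply: H => a; rewrite !no'.
Qed.

(** Choosing an end at each vertex injects vertices into ends. The truncated difference
    [2 * #|cA L| - #|cX L|], later an induction measure, is therefore exact. *)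
Lemma conn_card L : conn L -> 0 < #|cA L| -> #|cX L| <= 2 * #|cA L|.
Proof.
move=> cL /card_gt0P[a0 _].
have -> : 2 * #|cA L| = #|{: cA L * bool}| by rewrite card_prod card_bool mulnC.
have f x : {p : cA L * bool | vt p.1 p.2 == x}.
  by apply: sigW; have [a [o ao]] := conn_vertex a0 x cL; exists (a, o); apply/eqP.
apply: (@leq_card _ _ (fun x => sval (f x))) => x y xy.
by rewrite -(eqP (svalP (f x))) -(eqP (svalP (f y))) xy.
Qed.

Lemma conn_crossing L : conn L -> crossing (@vt L) setT setT.
Proof.
move=> cL U _ /set0Pn[x xU] /eqP UT.
case: (pickP (fun p : cA L * bool => (vt p.1 p.2 \in U) && (vt p.1 (~~ p.2) \notin U))) => [[a o] /andP[h1 h2]|no].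
  by exists a, o; rewrite !inE h2.
case: UT; apply/setP => y; rewrite inE -xU; symmetry.
apply: (cL (mem U)) => a /=; have := no (a, false); have := no (a, true) => /=.
by case: (vt a false \in U); case: (vt a true \in U).
Qed.

Lemma conn_card1 L : conn L -> #|cX L| <= #|cA L|.+1.
Proof.
move=> cL; case: (posnP #|cX L|) => [-> //|/card_gt0P[x _]].
have := growth (conn_crossing cL) (subsetT [set x]).
have n0 : [set x] != set0 by apply/set0Pn; exists x; rewrite inE.
move=> /(_ n0); have := cardsD1 x [set: cX L]; rewrite inE cardsT => ->.
have : #|[set a in [set: cA L] | ~~ [forall o, vt a o \in [set x]]]| <= #|cA L|.
  by rewrite -cardsT; apply/subset_leq_card/subsetT.
lia.
Qed.

End Complexes.

(** * Bridges of vertex links *)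

Section Bridges.
Variables (V E : finType) (lsrc llab ltgt : E -> V).
Local Notation hl := (hl lsrc ltgt).
Local Notation Ein := (Ein lsrc ltgt).
Local Notation ctight := (ctight lsrc llab ltgt).
Local Notation cplx := (cplx lsrc llab ltgt).
Implicit Types L : cplx.

Definition ends_at L (p : cX L) (S : cA L -> bool -> bool) := forall a o, S a o -> vt a o = p.

Definition sep L (S : cA L -> bool -> bool) (b : cB L) i j := S (hs b j) i != S (vs b i) j.

(* [S] is a set of ends at the vertex [p] such that the corner (i, j) of [b] is
   the only corner joining an end in [S] to an end outside [S]: a bridge of the
   link of [p]. Only bridges that do not tear the J-labelled ends apart count,
   unless the face belongs to J. *)
Definition is_bridge (J : {set V}) L (p : cX L) S (b : cB L) i j :=
  [/\ ends_at p S,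
      forall b' i' j', sep S b' i' j' = ((b', i', j') == (b, i, j)) &
      bl b \in Ein J \/
      forall a o a' o', vt a o = p -> vt a' o' = p -> al a \in J -> al a' \in J ->
        S a o = S a' o'].

Definition has_bridge (J : {set V}) L := exists (p : cX L) S b i j, is_bridge J p S b i j.

Lemma bridge_keep J L (p : cX L) S b i j : is_bridge J p S b i j ->
  forall b', predC1 b b' -> forall i' j', S (hs b' j') i' = S (vs b' i') j'.
Proof.
move=> [_ sP _] b' /= nb i' j'; apply/eqP; rewrite -[_ == _]negbK.
have := sP b' i' j'; rewrite /sep => ->.
by apply/negP => /eqP[bb]; rewrite bb eqxx in nb.
Qed.

Lemma sep_hl L (p : cX L) S b i j : ends_at p S -> sep S b i j -> vt (hs b j) i = p.
Proof.
move=> Sp; rewrite /sep; case: (boolP (S (hs b j) i)) => [/Sp //|_].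
by case: (boolP (S (vs b i) j)) => // /Sp; rewrite crP.
Qed.

(* both copies of p lie on the boundary path of the removed face *)
Lemma bridge_around J L (p : cX L) S b i j (h : option (cX L) -> bool) :
  is_bridge J p S b i j ->
  (forall j', h (svt S (hs b j') false) = h (svt S (hs b j') true)) ->
  (forall i', h (svt S (vs b i') false) = h (svt S (vs b i') true)) ->
  h None = h (Some p).
Proof.
move=> [Sp sP _] hh hv.
have nsep i' j' : (i', j') != (i, j) -> S (hs b j') i' = S (vs b i') j'.
  move=> ne; apply/eqP; rewrite -[_ == _]negbK.
  have := sP b i' j'; rewrite /sep => ->; apply: contra ne => /eqP[-> ->].
  exact: eqxx.
have sepb : S (hs b j) i != S (vs b i) j by have := sP b i j; rewrite /sep eqxx.
have vE : vt (hs b j) i = p by apply: sep_hl Sp _.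
have he j' o o' : h (svt S (hs b j') o) = h (svt S (hs b j') o') by case: o o' => -[]//; rewrite hh.
have ve j' o o' : h (svt S (vs b j') o) = h (svt S (vs b j') o') by case: o o' => -[]//; rewrite hv.
have around : h (svt S (hs b j) i) = h (svt S (vs b i) j).
  rewrite (he _ i (~~ i)).
  have -> : svt S (hs b j) (~~ i) = svt S (vs b (~~ i)) j.
    by rewrite /svt nsep ?crP //; rewrite xpair_eqE; case: (i).
  rewrite (ve _ j (~~ j)).
  have -> : svt S (vs b (~~ i)) (~~ j) = svt S (hs b (~~ j)) (~~ i).
    by rewrite /svt nsep ?crP //; rewrite xpair_eqE; case: (i).
  rewrite (he _ (~~ i) i).
  have -> : svt S (hs b (~~ j)) i = svt S (vs b i) (~~ j).
    by rewrite /svt nsep ?crP //; rewrite xpair_eqE; case: (j); rewrite andbF.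
  exact: ve.
move: around; rewrite /svt -crP vE; move: sepb.
by case: (S _ _); case: (S _ _).
Qed.

Lemma split_conn J L (p : cX L) S b i j (br : is_bridge J p S b i j) :
  conn L -> conn (split_cplx (bridge_keep br)).
Proof.
move=> cL h hh; have [Sp sP _] := br.
have hp : h None = h (Some p).
  by apply: (bridge_around br) => ?; exact: hh.
pose k x := h (Some x).
have kE a o : h (svt S a o) = k (vt a o).
  by rewrite /svt; case: ifP => // /Sp ->; rewrite hp.
have kk := cL k _; have {}kk x y : k x = k y by apply: kk => a; rewrite -!kE hh.
move=> [x|] [y|]; rewrite ?hp; exact: kk.
Qed.

Section Lift.
Variables (J : {set V}) (L : cplx) (p : cX L) (S : cA L -> bool -> bool).
Hypothesis Sp : ends_at p S.
Hypothesis nosep : forall b, predT b -> forall i j, S (hs b j) i = S (vs b i) j.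
Let L' := split_cplx nosep.
Variable h : pred (cX L').
Hypothesis hh : forall a : cA L', predT (al a) -> h (vt a false) = h (vt a true).

(** Tearing a link apart along its components creates no bridges. The delicate point is the
    condition on [J], since ends labelled in [J] may sit at both copies of the split vertex. *)
Lemma bridge_lift : has_bridge J (sub hh) -> has_bridge J L.
Proof.
move=> [[p' hp'] [S' [[b hb] [i [j [/= Sp' sP' J']]]]]].
pose ext (a : cA L) : option (cA (sub hh)) := insub a.
pose S1 (a : cA L) o := if ext a is Some a' then S' a' o else false.
have S1E (a : cA L) (ha : subA h predT (a : cA L')) o : S1 a o = S' (exist _ a ha) o.
  by rewrite /S1 /ext insubT; congr S'; apply: val_inj.
have S1p a o : S1 a o -> svt S a o = p'.
  rewrite /S1 /ext; case: insubP => // a' ha <- /Sp' /= /(congr1 val) /=.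
  by [].
pose pL := unsplit p p'.
have pLE a o : svt S a o = p' -> vt a o = pL by rewrite /pL => e; rewrite -e svtK.
have he (a : cA L) o o' : h (svt S a o) = h (svt S a o').
  by case: o o' => -[] //; have := hh (a := a) isT => /= ->.
have cr (b' : cB L) i' j' : svt S (hs b' j') i' = svt S (vs b' i') j'.
  by rewrite /svt nosep // crP.
have hA (a : cA L) o : subA h predT (a : cA L') = h (svt S a o).
  by rewrite /subA andbT (he a o false).
have hc (b' : cB L) i' j' : h (svt S (hs b' j') i') = h (svt S (hs b' false) false).
  rewrite (he _ i' false); case: j' => //; rewrite cr (he _ true false) -cr.
  by [].
have Hh (b' : cB L) j' : subA h predT (hs b' j' : cA L') = h (svt S (hs b' false) false).
  by rewrite (hA _ false) hc.
have Hv (b' : cB L) j' : subA h predT (vs b' j' : cA L') = h (svt S (hs b' false) false).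
  by rewrite (hA _ false) -cr hc.
have sep1 (b' : cB L) i' j' : sep S1 b' i' j' = ((b', i', j') == (val b, i, j)).
  case: (boolP (h (svt S (hs b' false) false))) => hb'.
    have hB : subB h predT (exist _ b' isT : cB L') by rewrite /subB /= !Hh !Hv hb'.
    have := sP' (exist _ (exist _ b' isT : cB L') hB) i' j'.
    rewrite /sep /= !xpair_eqE -!val_eqE /= => <-.
    by rewrite -!S1E.
  have S10 (a : cA L) o : ~~ subA h predT (a : cA L') -> S1 a o = false.
    by move=> na; rewrite /S1 /ext insubN.
  rewrite /sep !S10 ?Hh ?Hv //=; symmetry; apply/negP => /eqP[bE _ _].
  have /negP[] := hb'; rewrite -(Hh b' false) bE; exact: (subB_hs false hb).
(* [S2] also takes all ends at the other copy of the vertex, exactly when the [J]-labelled ends at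
   [p'] lie in [S1]. No corner joins the two copies, so the separating corners stay the same. *)
pose ex := [exists a, exists o, S1 a o && (al a \in J)].
pose S2 a o := S1 a o || [&& ex, svt S a o != p' & vt a o == pL].
exists pL, S2, (val b), i, j; split.
- by move=> a o /orP[/S1p/pLE //|/and3P[_ _ /eqP]].
- move=> b' i' j'; rewrite -sep1 /sep /S2 -cr -crP.
  case: (boolP [&& ex, _ & _]) => [/and3P[_ ne _]|_]; last by rewrite !orbF.
  have -> : S1 (hs b' j') i' = false by apply/negP => /S1p /eqP; apply/negP.
  have -> : S1 (vs b' i') j' = false by apply/negP => /S1p /eqP; rewrite -cr; apply/negP.
  by [].
case: J' => [J'|J']; [by left|right].
have atp (a : cA L) o (e : svt S a o = p') : subA h predT (a : cA L').
  by rewrite (hA _ o) e.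
have J1 (a : cA L) o (a' : cA L) o' : svt S a o = p' -> svt S a' o' = p' -> al a \in J -> al a' \in J ->
    S1 a o = S1 a' o'.
  move=> e e' aJ aJ'; rewrite (S1E _ (atp _ _ e)) (S1E _ (atp _ _ e')); apply: J' => //; exact: val_inj.
suff S2E a o : vt a o = pL -> al a \in J -> S2 a o = ex by move=> a o a' o' e e' aJ aJ'; rewrite !S2E.
move=> e aJ; rewrite /S2 e eqxx andbT; case: (eqVneq (svt S a o) p') => [e'|ne] /=.
  rewrite andbF orbF; apply/idP/existsP => [S1a|[a' /existsP[o' /andP[S1a' aJ']]]].
    by exists a; apply/existsP; exists o; rewrite S1a.
  by rewrite (J1 a o a' o') // (S1p a').
rewrite andbT; have -> // : S1 a o = false.
by apply/negP => /S1p /eqP; apply/negP.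
Qed.
End Lift.

(** A function on the side [h] is extended to the other side by its value at the copy of [p] lying
    in [h]. The extension agrees at both copies, hence descends to [L] and is constant. *)
Lemma cut_conn L (p : cX L) S (Sp : ends_at p S)
  (nosep : forall b, predT b -> forall i j, S (hs b j) i = S (vs b i) j)
  (h : pred (cX (split_cplx nosep)))
  (hh : forall a : cA (split_cplx nosep), predT (al a) -> h (vt a false) = h (vt a true)) :
  conn L -> h None != h (Some p) -> conn (sub hh).
Proof.
move=> cL hne k kk.
have [x0 hx0 x0E] : exists2 x0 : option (cX L), h x0 & x0 = if h None then None else Some p.
  case: (boolP (h None)) => hN; first by exists None.
  by exists (Some p) => //; move: hne; rewrite (negbTE hN); case: (h _).
pose G (y : cX (split_cplx nosep)) := if insub y is Some z then k (z : cX (sub hh)) else k (exist _ x0 hx0).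
have GE y (hy : h y) : G y = k (exist _ y hy).
  by rewrite /G insubT.
have Gn y : ~~ h y -> G y = k (exist _ x0 hx0) by move=> hy; rewrite /G insubN.
have Ginv a : G (svt S a false) = G (svt S a true).
  have := hh a isT => /= e; case: (boolP (h (svt S a true))) => ha.
    have hA : subA h predT (a : cA (split_cplx nosep)) by rewrite /subA andbT /= e.
    by have := kk (exist _ a hA); rewrite /= /sub_vt /= -!GE.
  by rewrite !Gn // e.
have GN : G None = G (Some p).
  case: (boolP (h None)) => hN.
    have hp : ~~ h (Some p) by move: hne; rewrite hN; case: (h _).
    rewrite (Gn _ hp) (GE _ hN); congr k; apply: val_inj; by rewrite /= x0E hN.
  have hp : h (Some p) by move: hne; rewrite (negbTE hN); case: (h _).
  rewrite (Gn _ hN) (GE _ hp); congr k; apply: val_inj; by rewrite /= x0E (negbTE hN).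
have gE a o : G (svt S a o) = G (Some (vt a o)).
  by rewrite /svt; case: ifP => // /Sp ->.
have gc x y : G (Some x) = G (Some y).
  by apply: (cL (fun x => G (Some x))) => a; rewrite -!gE Ginv.
suff H z : k z = G (Some p) by move=> x y; rewrite !H.
case: z => -[x|] hx; rewrite -GE //.
Qed.

End Bridges.

(** * Euler characteristic *)

Section Core.
Variables (V E : finType) (lsrc llab ltgt : E -> V).
Local Notation hl := (hl lsrc ltgt).
Local Notation Ein := (Ein lsrc ltgt).
Local Notation ctight := (ctight lsrc llab ltgt).
Local Notation cplx := (cplx lsrc llab ltgt).
Local Notation mixed := (mixed lsrc ltgt).
Implicit Types L : cplx.
Hypothesis forest : forall U : {set V}, U != set0 -> #|Ein U| < #|U|.
Hypothesis inj : injective llab.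

Definition compat_sets (J W : {set V}) := [\/ J \subset W, [disjoint J & W] | W \subset J].

(** Written additively to stay in nat, [core_at] bounds the Euler characteristic by 0 and [main_at]
    by 1. The second form is what the components labelled in a smaller block contribute to the
    induction. *)
Definition core_at (W : {set V}) := forall (J : {set V}) L, ctight J -> compat_sets J W ->
  conn L -> immersed L -> graded L -> over L W -> 0 < #|cB L| -> ~ has_bridge J L ->
  #|cX L| + #|cB L| <= #|cA L|.

Definition main_at (W : {set V}) := forall L,
  conn L -> immersed L -> graded L -> over L W -> #|cX L| + #|cB L| <= #|cA L|.+1.

(** Splitting at a bridge trades a face for a vertex and keeps the Euler characteristic, until
    either no bridge or no face is left. *)
Lemma core_main W : ctight W -> core_at W -> main_at W.
Proof.
move=> ctW core L; have [n] := ubnP #|cB L|; elim: n L => // n IH L Bn cL iL gL oL.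
case: (posnP #|cB L|) => [->|B0]; first by rewrite addn0 conn_card1.
case: (pselect (has_bridge W L)) => [[p [S [b [i [j br]]]]]|nb]; last first.
  by apply: leqW; apply: core nb; rewrite // ; constructor 1.
have [Sp _ _] := br.
have := IH (split_cplx (bridge_keep br)); rewrite card_splitX card_splitB cardC1 => H.
have : #|cX L|.+1 + #|cB L|.-1 <= #|cA L|.+1.
  apply: H; [by lia|exact: split_conn| exact: split_imm Sp _|exact: split_graded Sp _|].
  by move=> a; exact: (oL a).
lia.
Qed.

(** Connectedness of all vertex links, in terms of unions of link components. *)
Definition nocut L := forall (p : cX L) S, ends_at p S ->
  (forall (b : cB L) i j, S (hs b j) i = S (vs b i) j) ->
  forall (a a' : cA L) o o', S a o -> vt a' o' = p -> S a' o'.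

Section Reduced.
Variables (W J : {set V}) (L : cplx).
Hypotheses (ctW : ctight W) (W1 : 1 < #|W|) (ctJ : ctight J) (JW : compat_sets J W).
Hypotheses (cL : conn L) (iL : immersed L) (gL : graded L) (oL : over L W) (B0 : 0 < #|cB L|).
Hypotheses (nobr : ~ has_bridge J L) (ncL : nocut L).
Hypothesis IHW : forall W', ctight W' -> #|W'| < #|W| -> core_at W' /\ main_at W'.
Variable blk : V -> V.
Hypothesis blkW : forall q, q \in blk @: W ->
  ctight (fib W blk [set q]) /\ #|fib W blk [set q]| < #|W|.
Hypothesis blkJ : J \proper W -> {in J &, forall u v, blk u = blk v}.
Hypothesis blki : {in Ein W &, forall e e', mixed blk e -> mixed blk e' ->
         blk (llab e) = blk (llab e') -> e = e'}.

Let blE (b : cB L) : bl b \in Ein W.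
Proof. by rewrite inE -[lsrc _]/(hl (bl b) false) -[ltgt _]/(hl (bl b) true) -!hsP !oL. Qed.

Lemma nonmixed_lab (b : cB L) j : ~~ mixed blk (bl b) -> blk (llab (bl b)) = blk (hl (bl b) j).
Proof.
move=> nm; set q := blk (lsrc (bl b)).
have hq o : blk (hl (bl b) o) = q.
  by case: o => //=; apply/esym/eqP; move: nm; rewrite /mixed negbK.
have qW : q \in blk @: W by apply: imset_f; rewrite -[lsrc _]/(hl (bl b) false) -hsP oL.
have [ctq _] := blkW qW.
have /(ctight_lab ctq) : bl b \in Ein (fib W blk [set q]).
  by rewrite in_Ein; apply/forallP => o; rewrite in_fib in_set1 hq eqxx -hsP oL.
by rewrite in_fib in_set1 => /andP[_ /eqP->].
Qed.

(** In the link of [cv k] with the ends grouped by blocks, these corners are the edges that are not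
    loops. *)
Definition mc (k : cB L * bool * bool) := blk (hl (bl k.1.1) k.2) != blk (llab (bl k.1.1)).
Definition cv (k : cB L * bool * bool) := vt (hs k.1.1 k.2) k.1.2.
Definition touch (k : cB L * bool * bool) q := (blk (hl (bl k.1.1) k.2) == q) || (blk (llab (bl k.1.1)) == q).

Lemma mc_mixed k : mc k -> mixed blk (bl k.1.1).
Proof. by apply: contraTT => /nonmixed_lab h; rewrite /mc -(h k.2) eqxx. Qed.

(** The ends at [p] labelled in block [q] are separated from the other ends by the mixed corners
    touching [q] only, so a single such corner is a bridge. It respects [J], which lies in one
    block, misses [W] or contains it. *)
Lemma no_single (p : cX L) q k0 :
  mc k0 -> cv k0 = p -> touch k0 q ->
  (forall k, mc k -> cv k = p -> touch k q -> k = k0) -> False.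
Proof.
case: k0 => [[b i] j]; rewrite /cv /touch /= => m0 c0 t0 uniq; case: nobr.
exists p, (fun a o => (vt a o == p) && (blk (al a) == q)), b, i, j; split.
- by move=> a o /andP[/eqP].
- move=> b' i' j'; rewrite /sep -crP hsP vsP; case: (eqVneq (vt (hs b' j') i') p) => [e|ne] /=.
    apply/idP/eqP => [tt|[-> _ ->]].
      have t' : touch (b', i', j') q by rewrite /touch /=; move: tt; case: (_ == q) => //=; case: (_ == q).
      apply: uniq => //; rewrite /mc /=; apply: contraNneq tt => ->.
      exact: eqxx.
    move: m0 t0; rewrite /mc /=; case: (eqVneq (blk (hl _ _)) q) => [->|_] /=.
      by rewrite eq_sym => /negbTE->.
    by move=> _ ->.
  by apply/esym/negP => /eqP[bE iE jE]; move: ne; rewrite bE iE jE c0 eqxx.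
- case: JW => [JsubW|dis|WJ].
  + case: (eqVneq J W) => [JeW|JneW]; first by left; rewrite JeW.
    right=> a o a' o' -> -> aJ aJ'; rewrite (blkJ _ aJ aJ') //.
    by rewrite properEneq JneW.
  + by right=> a o a' o' _ _ aJ; have := disjointFr dis aJ; rewrite oL.
  + by left; apply: (subsetP (Ein_sub _ _ WJ)).
Qed.

Definition bare (p : cX L) := [forall k, mc k ==> (cv k != p)].

Lemma bareP p k : bare p -> mc k -> cv k != p.
Proof. by move=> /forallP/(_ k)/implyP. Qed.

Lemma bare_same p (a a' : cA L) o o' : bare p -> vt a o = p -> vt a' o' = p ->
  blk (al a) = blk (al a').
Proof.
move=> bp e e'; apply/esym/eqP.
have := @ncL p (fun a'' o => (vt a'' o == p) && (blk (al a'') == blk (al a))).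
move=> H; have // : (vt a' o' == p) && (blk (al a') == blk (al a)); last by case/andP.
apply: (H _ _ a a' o o') => //; last by rewrite e !eqxx.
  by move=> ? ? /andP[/eqP].
move=> b i j; rewrite -crP hsP vsP; case: (eqVneq (vt _ _) p) => [eb|] //=.
case: (boolP (mc (b, i, j))) => [m|]; last by rewrite /mc negbK => /eqP /= ->.
by have := bareP bp m; rewrite /cv /= eb eqxx.
Qed.

(** By [bare_same] the block of the labels is constant along the connected complex, so the induction
    hypothesis for that smaller block applies. *)
Lemma all_bare : (forall p, bare p) -> #|cX L| + #|cB L| <= #|cA L|.
Proof.
move=> ab; have [b _] : exists b : cB L, true by case/card_gt0P: B0 => b; exists b.
pose a0 := hs b false; pose q := blk (al a0).
have qW : q \in blk @: W by apply: imset_f; exact: oL.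
have [ctq ltq] := blkW qW.
have all_q (a : cA L) : blk (al a) = q.
  have hx x : exists (a : cA L) o, vt a o = x := conn_vertex a0 x cL.
  pose g x := `[< exists (a : cA L) o, vt a o = x /\ blk (al a) = q >].
  have gE (a1 : cA L) o : g (vt a1 o) = (blk (al a1) == q).
    apply/asboolP/eqP => [[a2 [o2 [e2 <-]]]|e]; last by exists a1, o.
    by apply: (bare_same (ab (vt a1 o)) _ e2).
  have := cL (h := g) (fun a1 => _) (vt a false) (vt a0 false).
  by rewrite !gE eqxx => H; apply/eqP; apply: H => a1; rewrite !gE.
have [coreq _] := IHW ctq ltq.
apply: (coreq J) => //.
  case: JW => [JsubW|dis|WJ].
  - case: (eqVneq J W) => [JeW|JneW]; first by constructor 3; rewrite JeW fib_sub.
    have pJ : J \proper W by rewrite properEneq JneW.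
    have [v vJ] : exists v, v \in J by apply/set0Pn; case/and3P: ctJ.
    case: (eqVneq (blk v) q) => [vq|vq].
      constructor 1; apply/subsetP => u uJ; rewrite in_fib in_set1 (subsetP JsubW) //=.
      by rewrite (blkJ pJ uJ vJ) vq.
    constructor 2; rewrite disjoint_subset; apply/subsetP => u uJ; rewrite !inE (blkJ pJ uJ vJ).
    by rewrite (negbTE vq) andbF.
  - by constructor 2; apply: disjointWr dis; exact: fib_sub.
  - by constructor 3; apply: subset_trans WJ; exact: fib_sub.
by move=> a; rewrite in_fib oL in_set1 all_q eqxx.
Qed.

(** The label of [e0] shares its block with the end [~~ j0], so all mixed corners lie on the sides
    [j0] of faces labelled [e0]. At the lowest origin of such a side only one of them can sit,
    against [no_single]. *)
Lemma two_blocks e0 j0 : (forall e, e \in Ein W -> mixed blk e -> e = e0) ->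
  blk (llab e0) = blk (hl e0 (~~ j0)) -> mixed blk e0 ->
  #|cX L| + #|cB L| <= #|cA L|.
Proof.
move=> uni lab m0; have [u uP] := gL.
case: (pickP (fun b : cB L => bl b == e0)) => [b1 /eqP b1E|no]; last first.
  apply: all_bare => p; apply/forallP => k; apply/implyP => /mc_mixed /(uni _ (blE _)) kE.
  by have := no k.1.1; rewrite kE eqxx.
pose st b := vt (hs (b : cB L) j0) false.
have [b /eqP bE bmin] := arg_minnP (fun b => u (st b)) (introT eqP b1E : (fun b => bl b == e0) b1).
have hne : blk (hl e0 (~~ j0)) != blk (hl e0 j0).
  by move: m0; rewrite /mixed; case: (j0); rewrite //= eq_sym.
have mcb i b' : bl b' = e0 -> mc (b', i, j0) by rewrite /mc /= => ->; rewrite lab eq_sym.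
exfalso; apply: (@no_single (st b) (blk (hl e0 j0)) (b, false, j0)) => //; first exact: mcb.
  by rewrite /touch /= bE eqxx.
move=> [[b' i] j] m c t; have b'E := uni _ (blE _) (mc_mixed m); rewrite /= in b'E.
have jE : j = j0.
  move: m; rewrite /mc /= b'E lab; case: (eqVneq j j0) => // jj.
  have jn : j = ~~ j0 by move: jj; case: (j); case: (j0).
  by rewrite jn eqxx.
rewrite jE /cv /= in c *; case: i c {m t} => c.
  (* A corner at the far end would belong to a face whose side [j0] starts lower than the
     minimum. *)
  have := uP (hs b' j0); rewrite c ltnNge => /negP[]; apply: bmin; exact/eqP.
by congr (_, _, _); apply: (corner_inj iL _ c); rewrite b'E bE.
Qed.

Section Acyclic.
Variable c : V -> bool.
Hypothesis nolab : forall e j, e \in Ein W -> mixed blk e -> blk (llab e) != blk (hl e j).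
Hypothesis acy : acyclic_blocks lsrc llab ltgt W blk c.

Lemma mcE k : mc k = mixed blk (bl k.1.1).
Proof.
apply/idP/idP => [|m]; first exact: mc_mixed.
by rewrite /mc eq_sym; apply: nolab.
Qed.

(** Types of the horizontal and the vertical end of a corner, the type of an end being its
    orientation plus the bit [c] of the block of its label. *)
Definition t1 (k : cB L * bool * bool) := k.1.2 (+) c (blk (hl (bl k.1.1) k.2)).
Definition t2 (k : cB L * bool * bool) := k.2 (+) c (blk (llab (bl k.1.1))).

Definition mend (a : cA L) o := [exists k : cB L * bool * bool,
  mc k && (((hs k.1.1 k.2, k.1.2) == (a, o)) || ((vs k.1.1 k.1.2, k.2) == (a, o)))].

Definition node t p q := [exists a : cA L, exists o, [&& mend a o, vt a o == p, blk (al a) == q & o (+) c q == t]].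

Lemma mend_other a o : mend a o -> mend a (~~ o).
Proof.
move=> /existsP[[[b i] j]] /= /andP[m /orP[]/eqP[aE oE]]; apply/existsP.
  exists (b, ~~ i, j); rewrite mcE /=; have := m; rewrite mcE /= => ->.
  by rewrite aE oE !eqxx.
exists (b, i, ~~ j); rewrite mcE /=; have := m; rewrite mcE /= => ->.
by rewrite aE oE !eqxx orbT.
Qed.

Lemma node_h k : mc k -> node (t1 k) (cv k) (blk (hl (bl k.1.1) k.2)).
Proof.
move=> m; apply/existsP; exists (hs k.1.1 k.2); apply/existsP; exists k.1.2.
rewrite hsP !eqxx !andbT; apply/existsP; exists k; by rewrite m eqxx.
Qed.

Lemma node_v k : mc k -> node (t2 k) (cv k) (blk (llab (bl k.1.1))).
Proof.
move=> m; apply/existsP; exists (vs k.1.1 k.1.2); apply/existsP; exists k.2.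
rewrite vsP /cv crP !eqxx !andbT; apply/existsP; exists k; by rewrite m eqxx orbT.
Qed.

Lemma nodeP t p q : node t p q -> exists k, [/\ mc k, cv k = p &
  (blk (hl (bl k.1.1) k.2) = q /\ t1 k = t) \/ (blk (llab (bl k.1.1)) = q /\ t2 k = t)].
Proof.
move=> /existsP[a /existsP[o /and4P[/existsP[k /andP[m kk]] /eqP ap /eqP aq /eqP ot]]].
exists k; move: kk => /orP[]/eqP[aE oE]; split=> //.
- by rewrite /cv aE oE.
- by left; rewrite /t1 -hsP aE aq oE.
- by rewrite /cv crP aE oE.
- by right; rewrite /t2 -(vsP _ k.1.2) aE aq oE.
Qed.

Definition nodes t p := [set q | node t p q].
(** These are the marked corners, where both ends have the same type. *)
Definition zeros t p := [set k | [&& mc k, cv k == p, t1 k == t & t2 k == t]].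

(** A marked corner is determined by the block of its label: the block gives the mixed edge by
    [blki], the types give the position in the square, and immersion gives the face. The other end
    of the corner lies in the block of [hl e (t (+) c q)]. So a block [q] that this map sends out of
    [nodes t p], as [acy] provides, labels no marked corner. *)
Lemma zeros_lt t p : nodes t p != set0 -> #|zeros t p| < #|nodes t p|.
Proof.
move=> n0; have [q qn qP] := acy t n0.
have inj2 : {in zeros t p &, injective (fun k => blk (llab (bl k.1.1)))}.
  move=> [[b i] j] [[b' i'] j']; rewrite !inE /= => /and4P[m /eqP e1 /eqP t1E /eqP t2E].
  move=> /and4P[m' /eqP e1' /eqP t1E' /eqP t2E'] qE.
  have bE : bl b = bl b' by apply: blki => //; [exact: mc_mixed m|exact: mc_mixed m'].
  have jE : j = j'.
    by move: t2E t2E'; rewrite /t2 /= qE => <-; case: (j); case: (j'); case: (c _).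
  have iE : i = i'.
    by move: t1E t1E'; rewrite /t1 /= bE jE => <-; case: (i); case: (i'); case: (c _).
  congr (_, _, _) => //; apply: (corner_inj iL bE (i := i) (j := j)).
  by move: e1 e1'; rewrite /cv /= jE iE => ->.
rewrite -(card_in_imset inj2) (cardsD1 q (nodes t p)) qn; apply: subset_leq_card.
apply/subsetP => q' /imsetP[k]; rewrite inE => /and4P[m /eqP e /eqP t1E /eqP t2E] ->.
rewrite !inE; have := node_v m; rewrite t2E e => ->; rewrite andbT.
apply/negP => /eqP qE.
have := qP (bl k.1.1) (blE _) (mc_mixed m) qE.
have -> : t (+) c q = k.2 by rewrite -t2E /t2 qE addbK.
by rewrite inE; have := node_h m; rewrite t1E e => ->.
Qed.

(** Each type that occurs contributes 1 by [zeros_lt]. If only one type occurred, every mixed corner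
    at [p] would be marked; by [no_single] each block would be touched twice, while a corner touches
    two blocks, so there would be as many marked corners as blocks. *)
Lemma nonbare_count p : ~~ bare p ->
  2 + #|zeros false p| + #|zeros true p| <= #|nodes false p| + #|nodes true p|.
Proof.
move=> nb.
have zl t : #|zeros t p| + (nodes t p != set0) <= #|nodes t p|.
  case: (boolP (nodes t p != set0)) => [/zeros_lt|n0]; first by rewrite addn1.
  rewrite addn0 (_ : zeros t p = set0) ?cards0 //; apply/setP => k; rewrite !inE.
  apply/negP => /and4P[m /eqP e /eqP t1E _]; move: n0; rewrite negbK => /eqP/setP.
  by move=> /(_ (blk (hl (bl k.1.1) k.2))); rewrite !inE -t1E -e node_h.
case: (boolP ((nodes false p != set0) && (nodes true p != set0))) => [/andP[n1 n2]|no].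
  by have := zl false; have := zl true; rewrite n1 n2; lia.
(* all the mixed ends at p have the same type t, so all mixed corners are zero corners *)
have [t nt] : exists t, nodes (~~ t) p = set0.
  by move: no; rewrite negb_and !negbK => /orP[]/eqP e; [exists true|exists false].
have t12 k : mc k -> cv k = p -> t1 k = t /\ t2 k = t.
  have hE x q : node x (cv k) q -> cv k = p -> x = t.
    move=> n e; case: (eqVneq x t) => // ne.
    have : q \in nodes (~~ t) p by rewrite inE -e (_ : ~~ t = x) //; move: ne; case: (x); case: (t).
    by rewrite nt inE.
  by move=> m e; split; [exact: hE (node_h m) e|exact: hE (node_v m) e].
have zE : zeros t p = [set k | mc k & cv k == p].
  apply/setP => k; rewrite !inE; case: (boolP (mc k)) => //= m; case: eqP => //= e.
  by have [-> ->] := t12 k m e; rewrite eqxx.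
have nt0 : nodes t p != set0.
  have /forallPn[k] := nb; rewrite negb_imply negbK => /andP[m /eqP e].
  apply/set0Pn; exists (blk (hl (bl k.1.1) k.2)); rewrite inE -e.
  by have [<- _] := t12 k m e; exact: node_h.
exfalso; have := zeros_lt nt0; rewrite ltnNge => /negP[].
rewrite -(leq_pmul2l (isT : 0 < 2)) mulnC.
have two q : q \in nodes t p -> 2 <= #|[set k in zeros t p | touch k q]|.
  rewrite inE => /nodeP[k [m e tk]].
  have tq : touch k q by rewrite /touch; case: tk => -[-> _]; rewrite eqxx ?orbT.
  rewrite ltnNge; apply/negP => /card_le1_eqP le1.
  apply: (no_single m e tq) => k' m' e' t'; apply: le1; by rewrite inE zE inE ?m ?m' ?e ?e' eqxx.
have -> : #|nodes t p| * 2 = \sum_(q in nodes t p) 2 by rewrite sum_nat_const.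
apply: (@leq_trans (\sum_(q in nodes t p) #|[set k in zeros t p | touch k q]|)); first exact: leq_sum.
have -> : \sum_(q in nodes t p) #|[set k in zeros t p | touch k q]| =
          \sum_(q in nodes t p) \sum_(k in zeros t p) touch k q.
  apply: eq_bigr => q _; rewrite -sum1_card big_mkcond /= [RHS]big_mkcond /=.
  by apply: eq_bigr => k _; rewrite inE; case: (k \in _); case: (touch k q).
rewrite exchange_big /= mul2n -addnn -sum1_card -big_split /=; apply: leq_sum => k _.
apply: leq_trans (_ : \sum_(q : V) ((blk (hl (bl k.1.1) k.2) == q) + (blk (llab (bl k.1.1)) == q)) <= _).
  rewrite big_mkcond /=; apply: leq_sum => q _; case: ifP => // _; rewrite /touch.
  by case: (_ == q); case: (_ == q).
rewrite big_split /=.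
have s1 x : \sum_(q : V) (x == q : nat) = 1.
  by rewrite (bigD1 x) //= eqxx big1 // => q /negbTE; rewrite eq_sym => ->.
by rewrite !s1.
Qed.

Definition bends p q := [exists a : cA L, exists o, [&& bare p, vt a o == p & blk (al a) == q]].

Lemma node_nbare t p q : node t p q -> ~~ bare p.
Proof. by move=> /nodeP[k [m e _]]; apply/negP => /bareP /(_ m); rewrite e eqxx. Qed.

(* the components of the subcomplex spanned by the edges labelled in block q *)
Section Comp.
Variable q : V.
Hypothesis qW : q \in blk @: W.
Hypothesis nab : ~ forall p, bare p.

Let Aq (a : cA L) := blk (al a) == q.
Let inv (h : {ffun cX L -> bool}) := [forall a, Aq a ==> (h (vt a false) == h (vt a true))].
Let same x y := [forall h, inv h ==> (h x == h y)].

Let same_edge a : Aq a -> same (vt a false) (vt a true).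
Proof. by move=> Aa; apply/forallP => h; apply/implyP => /forallP/(_ a)/implyP/(_ Aa). Qed.

Let sameP x y : reflect (forall h, inv h -> h x = h y) (same x y).
Proof.
apply: (iffP forallP) => [H h ih|H h]; first exact/eqP/(implyP (H h)).
by apply/implyP => /H ->.
Qed.

(** [pick] depends only on the extension of its predicate, so this is a canonical representative of
    a component. *)
Definition rep (x : cX L) : cX L := odflt x [pick y | same x y].

Lemma rep_same x y : same x y -> rep x = rep y.
Proof.
move=> /sameP xy; have e : same x =1 same y.
  by move=> z; apply/sameP/sameP => H h ih; [rewrite -(xy h ih)|rewrite (xy h ih)]; apply: H.
rewrite /rep; rewrite -(eq_pick e); case: pickP => // no.
by have /negP[] := negbT (no x); apply/sameP.
Qed.

Lemma same_rep x : same x (rep x).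
Proof. by rewrite /rep; case: pickP => //= _; apply/sameP. Qed.

Let qset := fib W blk [set q].
Let Hq v := v \in qset.

Lemma in_qset (a : cA L) : (al a \in qset) = Aq a.
Proof. by rewrite in_fib oL in_set1. Qed.

Section OneComp.
Variable y : cX L.
Let C x := rep x == y.

Lemma C_edge a : Hq (al a) -> C (vt a false) = C (vt a true).
Proof. by rewrite /Hq in_qset => /same_edge/rep_same e; rewrite /C /= e. Qed.

Let LC := sub C_edge.

Lemma LC_conn : conn LC.
Proof.
move=> k kk.
pose h : {ffun cX L -> bool} := [ffun x => if insub x is Some z then k (z : cX LC) else false].
have hE x (hx : C x) : h x = k (exist _ x hx) by rewrite ffunE insubT.
have ih : inv h.
  apply/forallP => a; apply/implyP => Aa; have aq : al a \in qset by rewrite in_qset.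
  have := C_edge aq; case: (boolP (C (vt a true))) => ca e.
    have sa : subA C Hq a by rewrite /subA /Hq e /= aq.
    apply/eqP; have := kk (exist _ a sa); rewrite /= /sub_vt /= -!hE; exact.
  by rewrite !ffunE !insubN // e.
move=> [x hx] [x' hx']; rewrite -!hE.
have /sameP xy : same x x'.
  have /eqP e1 := hx; have /eqP e2 := hx'; have := same_rep x; have := same_rep x'.
  by rewrite e1 e2 => /sameP s2 /sameP s1; apply/sameP => g ig; rewrite (s1 g ig) (s2 g ig).
exact: xy.
Qed.

Lemma comp_main : #|C| + #|subB C Hq| <= #|subA C Hq|.+1.
Proof.
have [ctq ltq] := blkW qW; have [_ mainq] := IHW ctq ltq.
have := mainq LC LC_conn; rewrite card_subX card_subA card_subB; apply.
- exact: sub_imm.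
- exact: sub_graded.
- by move=> [a sa] /=; case/andP: (sa).
Qed.

Lemma subA_end (a : cA L) o : Aq a -> C (vt a o) -> subA C Hq a.
Proof.
move=> Aa; have aq : al a \in qset by rewrite in_qset.
by rewrite /subA /Hq aq andbT; case: o; rewrite // (C_edge aq).
Qed.

(** The component has Euler characteristic at most 1 by induction, which is too weak by 2 after
    doubling. If mixed ends occur, each of the two types is missing at some vertex of [cov]. If none
    occur, some vertex is not counted in [bends]; otherwise the component would be all of [L] and
    every vertex bare. *)
Lemma comp_count : #|[set x | C x & node false x q]| + #|[set x | C x & node true x q]|
  + 2 * #|[set x | C x & bends x q]| + 2 * #|subB C Hq| <= 2 * #|subA C Hq|.
Proof.
have [u uP] := gL.
case: (posnP #|subA C Hq|) => [A0|Apos].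
  have nA a : ~~ subA C Hq a.
    apply/negP => sa; have : 0 < #|subA C Hq| by apply/card_gt0P; exists a.
    by rewrite A0.
  have nE a o : Aq a -> ~~ C (vt a o) by move=> Aa; apply: contra (nA a); exact: subA_end.
  have n0 t : [set x | C x & node t x q] = set0.
    apply/setP => x; rewrite !inE; apply/negP => /andP[Cx /existsP[a /existsP[o /and4P[_ /eqP e aq _]]]].
    by have := nE a o aq; rewrite e Cx.
  have b0 : [set x | C x & bends x q] = set0.
    apply/setP => x; rewrite !inE; apply/negP => /andP[Cx /existsP[a /existsP[o /and3P[_ /eqP e aq]]]].
    by have := nE a o aq; rewrite e Cx.
  rewrite !n0 b0 !cards0 /= (_ : #|subB C Hq| = 0) ?A0 //.
  by apply: eq_card0 => b; apply/negP => /and4P[sa _ _ _]; have := nA (hs b false); rewrite sa.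
have cm := comp_main.
pose cov := [set x | C x & node false x q || node true x q].
pose bs := [set x | C x & bends x q].
have dis : #|cov| + #|bs| <= #|C|.
  have d0 : cov :&: bs = set0.
    apply/setP => x; rewrite !inE; apply/negP => /andP[/andP[_ nn] /andP[_ /existsP[a /existsP[o /and3P[bx _ _]]]]].
    by case/orP: nn => /node_nbare; rewrite bx.
  rewrite -cardsUI d0 cards0 addn0; apply: subset_leq_card; apply/subsetP => x.
  by rewrite !inE => /orP[]/andP[].
case: (set_0Vmem cov) => [cov0|[x0 x0c]].
  have n0 t : [set x | C x & node t x q] = set0.
    apply/setP => x; rewrite !inE; apply/negP => /andP[Cx nt]; have : x \in cov.
      by rewrite inE Cx /=; case: t nt => ->; rewrite ?orbT.
    by rewrite cov0 inE.
  rewrite !n0 cards0 -/bs.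
  suff : #|bs| < #|C| by lia.
  apply: proper_card; rewrite properE; apply/andP; split; first by apply/subsetP => x; rewrite !inE => /andP[].
  apply/negP => Cbs.
  have Cq x (a : cA L) o : C x -> vt a o = x -> Aq a /\ bare x.
    move=> Cx e; have := subsetP Cbs x Cx; rewrite inE => /andP[_ /existsP[a' /existsP[o' /and3P[bx /eqP e' aq']]]].
    by split=> //; rewrite /Aq (bare_same bx e e').
  have Cinv a : C (vt a false) = C (vt a true).
    apply/idP/idP => Cx.
      by have [Aa _] := Cq _ a false Cx erefl; rewrite -(C_edge (a := a)) // /Hq in_qset.
    by have [Aa _] := Cq _ a true Cx erefl; rewrite (C_edge (a := a)) // /Hq in_qset.
  have [x Cx] : exists x, C x.
    have /card_gt0P[a /andP[Ca _]] := Apos; by exists (vt a false).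
  apply: nab => p; have Cp : C p by rewrite (cL Cinv p x).
  have /card_gt0P[a _] := Apos; have [a' [o' e']] := conn_vertex a p cL.
  by have [] := Cq p a' o' Cp e'.
have cn t : #|[set x | C x & node t x q]| < #|cov|.
  suff [x xc nx] : exists2 x, x \in cov & ~~ node t x q.
    apply: proper_card; rewrite properE; apply/andP; split.
      by apply/subsetP => z; rewrite !inE => /andP[-> h]; case: t h nx => ->; rewrite ?orbT.
    by apply/subsetPn; exists x; rewrite // inE negb_and nx orbT.
  have step x a o : vt a o = x -> x \in cov -> mend a o -> Aq a -> vt a (~~ o) \in cov.
    move=> e xc ma Aa; rewrite inE; apply/andP; split.
      have Cx : C (vt a o) by move: xc; rewrite inE e => /andP[].
      by have := C_edge (a := a); rewrite /Hq in_qset => /(_ Aa); case: o e Cx {ma xc} => /= e Cx; rewrite ?Cx // => ->.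
    suff : node (~~ o (+) c q) (vt a (~~ o)) q by case: (_ (+) _) => ->; rewrite ?orbT.
    by apply/existsP; exists a; apply/existsP; exists (~~ o); rewrite mend_other // !eqxx [_ == q]Aa.
  (* Ends of type [t] in block [q] have orientation [t (+) c q]. A terminal end cannot occur at the
     lowest vertex of [cov] and an origin cannot occur at the highest, since the other end of the
     edge is again in [cov]. *)
  case tE : (t (+) c q).
    have [x xc xmin] := arg_minnP u x0c; exists x => //; apply/negP.
    move=> /existsP[a /existsP[o /and4P[ma /eqP e aq /eqP ot]]].
    have oE : o = true by rewrite -tE -ot addbK.
    rewrite oE in e ma; have := xmin _ (step x a true e xc ma aq).
    by rewrite -e leqNgt uP.
  have [x xc xmax] := arg_maxnP u x0c; exists x => //; apply/negP.
  move=> /existsP[a /existsP[o /and4P[ma /eqP e aq /eqP ot]]].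
  have oE : o = false by rewrite -tE -ot addbK.
  rewrite oE in e ma; have := xmax _ (step x a false e xc ma aq).
  by rewrite -e /= leqNgt uP.
have := cn false; have := cn true; rewrite -/bs; lia.
Qed.

End OneComp.

Lemma block_count :
  #|[set x | node false x q]| + #|[set x | node true x q]| + 2 * #|[set x | bends x q]|
  + 2 * #|[set b : cB L | ~~ mixed blk (bl b) & blk (lsrc (bl b)) == q]|
  <= 2 * #|[set a | Aq a]|.
Proof.
have part (T : finType) (P : pred T) (f : T -> cX L) :
    #|[set t | P t]| = \sum_y #|[set t | (rep (f t) == y) && P t]|.
  rewrite -sum1_card (partition_big (fun t => rep (f t)) xpredT) //=.
  by apply: eq_bigr => z _; rewrite -sum1_card; apply: eq_bigl => t; rewrite !inE andbC.
rewrite !(part (cX L) _ id) (part _ _ (fun a => vt a false)) (part _ _ (fun b => vt (hs b false) false)).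
rewrite !big_distrr /= -!big_split /=; apply: leq_sum => y _.
apply: leq_trans (leq_trans (comp_count y) _); last first.
  by rewrite leq_mul2l /=; apply/eq_leq/eq_card => a; rewrite inE unfold_in /subA /Hq in_qset.
rewrite leq_add2l leq_mul2l /=; apply/eq_leq/eq_card => b; rewrite inE [RHS]unfold_in.
apply/idP/idP => [/and3P[Cb nm bq]|/and4P[sa sb sc sd]].
  have hq j : hl (bl b) j \in qset.
    by rewrite -hsP in_qset /Aq hsP -(nonmixed_lab j nm) (nonmixed_lab false nm).
  apply: subB_A; first exact: C_edge.
  have lq : llab (bl b) \in qset by rewrite -(vsP b false) in_qset /Aq vsP (nonmixed_lab false nm).
  by rewrite /subA /Hq !hsP !hq lq /= Cb.
move: sa sb; rewrite /subA /Hq !in_qset /Aq !hsP => /andP[h1 /eqP e1] /andP[_ /eqP e2].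
by rewrite h1 /mixed -[lsrc _]/(hl (bl b) false) -[ltgt _]/(hl (bl b) true) e1 e2 !eqxx.
Qed.

End Comp.

(** Summed over the blocks, [block_count] has twice the number of edges on the right. On the left a
    bare vertex pays 2 through [bends]; any other vertex pays 2 plus its marked corners by
    [nonbare_count]. The marked corners pay 2 for each mixed face, and the other faces are counted
    directly. *)
Lemma acyclic_count : ~ (forall p, bare p) -> #|cX L| + #|cB L| <= #|cA L|.
Proof.
move=> nab.
have [b0 _] : exists b : cB L, true by case/card_gt0P: B0 => b; exists b.
have sumq : \sum_(q in blk @: W)
  (#|[set x | node false x q]| + #|[set x | node true x q]| + 2 * #|[set x | bends x q]|
  + 2 * #|[set b : cB L | ~~ mixed blk (bl b) & blk (lsrc (bl b)) == q]|) <=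
  \sum_(q in blk @: W) 2 * #|[set a : cA L | blk (al a) == q]|.
  by apply: leq_sum => q qW; exact: block_count.
have dist (F : V -> nat) : \sum_(q in blk @: W) 2 * F q = 2 * \sum_(q in blk @: W) F q by rewrite big_distrr.
rewrite 3!big_split /= (dist (fun q => #|[set x | bends x q]|)) in sumq.
rewrite (dist (fun q => #|[set b : cB L | ~~ mixed blk (bl b) & blk (lsrc (bl b)) == q]|)) in sumq.
rewrite (dist (fun q => #|[set a : cA L | blk (al a) == q]|)) in sumq.
have sA : \sum_(q in blk @: W) #|[set a : cA L | blk (al a) == q]| = #|cA L|.
  rewrite -[RHS]cardsT -[RHS]sum1_card (partition_big (fun a => blk (al a)) (mem (blk @: W))) /=.
    by apply: eq_bigr => q _; rewrite -sum1_card; apply: eq_bigl => a; rewrite !inE.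
  by move=> a _; apply: imset_f; exact: oL.
have sB : \sum_(q in blk @: W) #|[set b : cB L | ~~ mixed blk (bl b) & blk (lsrc (bl b)) == q]|
        = #|[set b : cB L | ~~ mixed blk (bl b)]|.
  rewrite -[RHS]sum1_card (partition_big (fun b => blk (lsrc (bl b))) (mem (blk @: W))) /=.
    by apply: eq_bigr => q _; rewrite -sum1_card; apply: eq_bigl => a; rewrite !inE.
  by move=> b _; apply: imset_f; rewrite -[lsrc _]/(hl (bl b) false) -hsP oL.
have nodeW t p q : node t p q -> q \in blk @: W.
  by move=> /existsP[a /existsP[o /and4P[_ _ /eqP <- _]]]; apply: imset_f; exact: oL.
have sN t : \sum_(q in blk @: W) #|[set x | node t x q]| = \sum_x #|nodes t x|.
  transitivity (\sum_(q in blk @: W) \sum_x (node t x q : nat)).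
    by apply: eq_bigr => q _; rewrite -sum1_card big_mkcond; apply: eq_bigr => x _; rewrite inE; case: (node _ _ _).
  rewrite exchange_big; apply: eq_bigr => x _; rewrite -sum1_card big_mkcond [RHS]big_mkcond.
  apply: eq_bigr => q _; rewrite inE; case: (boolP (node t x q)) => [/nodeW ->//|_].
  by case: (_ \in _).
have sb : #|[set p | bare p]| <= \sum_(q in blk @: W) #|[set x | bends x q]|.
  have -> : \sum_(q in blk @: W) #|[set x | bends x q]| = \sum_x \sum_(q in blk @: W) bends x q.
    rewrite exchange_big; apply: eq_bigr => q _; rewrite -sum1_card big_mkcond /=.
    by apply: eq_bigr => x _; rewrite inE; case: (bends _ _).
  rewrite -sum1_card big_mkcond /=; apply: leq_sum => x _; rewrite inE; case: ifP => // bx.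
  have [a [o e]] := conn_vertex (hs b0 false) x cL.
  rewrite (bigD1 (blk (al a))) /=; last by apply: imset_f; exact: oL.
  rewrite (_ : bends x (blk (al a))) //; apply/existsP; exists a; apply/existsP; exists o.
  by rewrite bx e !eqxx.
have sZ : 2 * #|[set b : cB L | mixed blk (bl b)]| <= \sum_x (#|zeros false x| + #|zeros true x|).
  (* For each side [j] of a mixed face exactly one [i] makes both types equal, which gives two
     marked corners per face. *)
  pose f (z : cB L * bool) := let: (b, j) := z in
    (b, (j (+) c (blk (llab (bl b)))) (+) c (blk (hl (bl b) j)), j).
  pose Z := [set k | mc k & t1 k == t2 k].
  have -> : \sum_x (#|zeros false x| + #|zeros true x|) = #|Z|.
    rewrite -[RHS]sum1_card (partition_big cv xpredT) //=; apply: eq_bigr => x _.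
    have -> : #|zeros false x| + #|zeros true x| = #|zeros false x :|: zeros true x|.
      rewrite cardsU (_ : _ :&: _ = set0) ?cards0 ?subn0 //; apply/setP => k; rewrite !inE.
      by apply/negP => /andP[/and4P[_ _ /eqP-> _] /and4P[]].
    rewrite -sum1_card; apply: eq_bigl => k; rewrite !inE.
    by case: (mc k); case: (cv k == x); case: (t1 k); case: (t2 k).
  have -> : 2 * #|[set b : cB L | mixed blk (bl b)]| = #|setX [set b : cB L | mixed blk (bl b)] [set: bool]|.
    by rewrite cardsX cardsT card_bool mulnC.
  rewrite -(card_imset _ (_ : injective f)); last by move=> [b j] [b' j'] [-> _ ->].
  apply: subset_leq_card; apply/subsetP => k /imsetP[[b j]]; rewrite !inE andbT => m ->.
  by rewrite mcE /f /= m /t1 /t2 /= addbK eqxx.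
have nonb : \sum_(x | ~~ bare x) (2 + #|zeros false x| + #|zeros true x|) <=
            \sum_x (#|nodes false x| + #|nodes true x|).
  rewrite big_mkcond; apply: leq_sum => x _; case: ifP => // nb.
  by rewrite /= nonbare_count.
have zb : \sum_x (#|zeros false x| + #|zeros true x|) = \sum_(x | ~~ bare x) (#|zeros false x| + #|zeros true x|).
  rewrite [RHS]big_mkcond; apply: eq_bigr => x _; case: ifP => // /negbFE bx.
  have z0 t : zeros t x = set0.
    by apply/setP => k; rewrite !inE; apply/negP => /and4P[m e _ _]; have := bareP bx m; rewrite e.
  by rewrite !z0 cards0.
have cb : #|[set p | bare p]| + #|[set p | ~~ bare p]| = #|cX L|.
  rewrite -(cardsC [set p | bare p]); congr (_ + _); apply/eq_card => x; by rewrite !inE.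
have cB2 : #|[set b : cB L | mixed blk (bl b)]| + #|[set b : cB L | ~~ mixed blk (bl b)]| = #|cB L|.
  rewrite -(cardsC [set b : cB L | mixed blk (bl b)]); congr (_ + _); apply/eq_card => x; by rewrite !inE.
have nb2 : \sum_(x | ~~ bare x) (2 + #|zeros false x| + #|zeros true x|) =
    2 * #|[set p | ~~ bare p]| + \sum_(x | ~~ bare x) (#|zeros false x| + #|zeros true x|).
  have -> : #|[set p | ~~ bare p]| = \sum_(x | ~~ bare x) 1.
    by rewrite -sum1_card; apply: eq_bigl => x; rewrite inE.
  by rewrite big_distrr -big_split /=; apply: eq_bigr => x _; rewrite muln1 addnA.
move: sumq; rewrite sA sB !sN => sumq.
have sp : \sum_x (#|nodes false x| + #|nodes true x|) = \sum_x #|nodes false x| + \sum_x #|nodes true x| by rewrite big_split.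
lia.
Qed.
End Acyclic.
End Reduced.

Lemma reduced_core (W J : {set V}) L :
  ctight W -> (forall W', ctight W' -> #|W'| < #|W| -> core_at W' /\ main_at W') ->
  ctight J -> compat_sets J W ->
  conn L -> immersed L -> graded L -> over L W -> 0 < #|cB L| -> ~ has_bridge J L ->
  nocut L -> #|cX L| + #|cB L| <= #|cA L|.
Proof.
move=> ctW IHW ctJ JW cL iL gL oL B0 nb nc.
have blE (b : cB L) : bl b \in Ein W.
  by rewrite inE -[lsrc _]/(hl (bl b) false) -[ltgt _]/(hl (bl b) true) -!hsP !oL.
have W1 : 1 < #|W|.
  have [b _] : exists b : cB L, true by case/card_gt0P: B0 => b; exists b.
  have /and3P[_ /eqP <- _] := ctW; rewrite ltnS; apply/card_gt0P; by exists (bl b).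
(* If [J] is not a proper part of [W], then every block is disjoint from [J] or contained in it,
   whatever the partition. *)
pose J0 := if J \proper W then J else set0.
have J0W : J0 \proper W.
  rewrite /J0; case: ifP => // _; rewrite properE sub0set /=; apply/negP.
  by rewrite subset0 => /eqP W0; rewrite W0 cards0 in W1.
have J0c : J0 = set0 \/ ctight J0 by rewrite /J0; case: ifP; [right|left].
have [blk [blkW blkJ blki str]] := block_structure forest inj ctW W1 J0W J0c.
have blkJ' : J \proper W -> {in J &, forall u v, blk u = blk v}.
  by move=> JpW; move: blkJ; rewrite /J0 JpW.
case: str => [[e0 [j0 [_ uni lab m0]]]|[nolab [c acy]]].
  exact: (two_blocks ctJ JW cL iL gL oL B0 nb nc IHW blkW blkJ' uni lab m0).
case: (pselect (forall p, bare (L := L) blk p)) => [ab|nab].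
  exact: (all_bare ctJ JW cL iL gL oL B0 nb nc IHW blkW blkJ' ab).
exact: (acyclic_count ctW W1 ctJ JW cL iL gL oL B0 nb nc IHW blkW blkJ' blki nolab acy nab).
Qed.

(** A piece without faces may have Euler characteristic 1. At most one piece lacks faces, and the
    vertex gained by the split pays for it. *)
Lemma cut_arith x1 x2 a1 a2 b1 b2 x a b n : x1 + x2 = x.+1 -> a1 + a2 = a -> b1 + b2 = b ->
  x1 <= 2 * a1 -> x2 <= 2 * a2 -> 2 * a - x < n.+1 -> 0 < b ->
  (2 * a1 - x1 < n -> x1 + b1 <= a1 + (b1 == 0)) ->
  (2 * a2 - x2 < n -> x2 + b2 <= a2 + (b2 == 0)) -> x + b <= a.
Proof.
move=> hx ha hb l1 l2 mu b0 r1 r2.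
have {}r1 : x1 + b1 <= a1 + (b1 == 0) by apply: r1; lia.
have {}r2 : x2 + b2 <= a2 + (b2 == 0) by apply: r2; lia.
move: r1 r2; case: eqP => e1; case: eqP => e2 /=; lia.
Qed.

(** A disconnected link is split with all faces kept. Either the complex stays connected with one
    more vertex, or it falls into two connected pieces; by [bridge_lift] no bridge appears, and
    [2 * #|cA L| - #|cX L|] drops in both cases. *)
Lemma cut_core (W J : {set V}) n :
  (forall L, conn L -> immersed L -> graded L -> over L W -> 0 < #|cB L| -> ~ has_bridge J L ->
    2 * #|cA L| - #|cX L| < n -> #|cX L| + #|cB L| <= #|cA L|) ->
  forall L, conn L -> immersed L -> graded L -> over L W -> 0 < #|cB L| -> ~ has_bridge J L ->
    2 * #|cA L| - #|cX L| < n.+1 -> ~ nocut L -> #|cX L| + #|cB L| <= #|cA L|.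
Proof.
move=> IH L cL iL gL oL B0 nb mu cut.
have [p [S [Sp [nosep [a [a' [o [o' [Sa a'p nSa']]]]]]]]] : exists (p : cX L) S, ends_at p S /\
  (forall (b : cB L) i j, S (hs b j) i = S (vs b i) j) /\
  exists a a' o o', [/\ S a o, vt a' o' = p & ~~ S a' o'].
  apply: contrapT => H; apply: cut => p S Sp ns a a' o o' Sa a'p; apply: contrapT => nS; apply: H.
  by exists p, S; split=> //; split=> //; exists a, a', o, o'; split=> //; apply/negP.
have nosep' : forall b, predT b -> forall i j, S (hs b j) i = S (vs b i) j by move=> b _; exact: nosep.
pose L' := split_cplx nosep'.
have cXL : #|cX L'| = #|cX L|.+1 := card_splitX _.
have cBL : #|cB L'| = #|cB L| by rewrite card_splitB; apply: eq_card.
have iL' : immersed L' := split_imm _ Sp iL.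
have gL' : graded L' := split_graded _ Sp gL.
have A0 : 0 < #|cA L| by apply/card_gt0P; exists a.
have lX := conn_card cL A0.
pose hT : pred (cX L') := predT.
have hhT : forall a : cA L', predT (al a) -> hT (vt a false) = hT (vt a true) by [].
case: (pselect (conn L')) => [cL'|ncL'].
  have cs : conn (sub hhT).
    move=> k kk [x hx] [y hy]; have := cL' (fun x => k (exist _ x isT)) _ x y.
    have -> : hx = isT by apply: bool_irrelevance.
    have -> : hy = isT by apply: bool_irrelevance.
    by apply=> a1; have := kk (exist _ a1 isT) => /=; congr (k _ = k _); apply: val_inj.
  have := IH (sub hhT) cs (sub_imm _ iL') (sub_graded _ gL').
  rewrite card_subX card_subA card_subB.
  have -> : #|hT| = #|cX L|.+1 by rewrite -cXL; apply: eq_card.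
  have -> : #|subA hT predT| = #|cA L| by apply: eq_card.
  have -> : #|subB hT predT| = #|cB L| by rewrite -cBL; apply: eq_card.
  move=> /(_ (fun a => oL (val a)) B0 (fun br => nb (bridge_lift Sp br))).
  have : 2 * #|cA L| - #|cX L|.+1 < n.
    have lX' : #|cX L|.+1 <= 2 * #|cA L| by rewrite -cXL; exact: (conn_card cL' A0).
    move: mu; lia.
  lia.
have [h hh [x [y hxy]]] : exists2 h : cX L' -> bool, (forall a, h (vt a false) = h (vt a true)) &
    exists x y, h x != h y.
  apply: contrapT => H; apply: ncL' => h hh x y; apply: contrapT => hxy; apply: H.
  by exists h => //; exists x, y; apply/eqP.
have hne : h None != h (Some p).
  apply: contra_neq hxy => hp.
  have kE a1 o1 : h (svt S a1 o1) = h (Some (vt a1 o1)).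
    by rewrite /svt; case: ifP => // /Sp ->.
  have kk u v : h (Some u) = h (Some v).
    by apply: (cL (fun u => h (Some u))) => a1; rewrite -!kE; exact: hh.
  by case: (x) (y) => [u|] [v|]; rewrite ?hp; exact: kk.
have hh1 : forall a : cA L', predT (al a) -> h (vt a false) = h (vt a true) by move=> a1 _; exact: hh.
pose h2 : pred (cX L') := fun x => ~~ h x.
have hh2 : forall a : cA L', predT (al a) -> h2 (vt a false) = h2 (vt a true) by move=> a1 _; rewrite /h2 hh.
have c1 : conn (sub hh1) by apply: (cut_conn Sp).
have c2 : conn (sub hh2) by apply: (cut_conn Sp) => //; rewrite /h2; move: hne; case: (h None); case: (h _).
have one (h' : pred (cX L')) (hh' : forall a : cA L', predT (al a) -> h' (vt a false) = h' (vt a true)) :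
    conn (sub hh') -> 0 < #|subA h' predT| ->
    #|subA h' predT| <= #|cA L| /\
    (2 * #|subA h' predT| - #|h'| < n -> #|h'| + #|subB h' predT| <= #|subA h' predT| + (#|subB h' predT| == 0)).
  move=> ch A1; split; first exact: max_card.
  move=> mu'; case: (posnP #|subB h' predT|) => [B00|Bp].
    by rewrite B00 addn0 addn1; have := conn_card1 ch; rewrite card_subX card_subA.
  rewrite addn0; have := IH (sub hh') ch (sub_imm _ iL') (sub_graded _ gL').
  rewrite card_subX card_subA card_subB => /(_ (fun a => oL (val a)) Bp (fun br => nb (bridge_lift Sp br))).
  exact.
have cX2 : #|h| + #|h2| = #|cX L|.+1 by rewrite -cXL -(cardC h).
have cA2 : #|subA h predT| + #|subA h2 predT| = #|cA L|.
  rewrite -(cardC (subA h predT)); congr (_ + _); apply: eq_card => a1.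
  by rewrite !unfold_in /= /subA /h2 /= !andbT.
have cB2 : #|subB h predT| + #|subB h2 predT| = #|cB L|.
  rewrite -cBL -(cardC (subB h predT)); congr (_ + _); apply: eq_card => b1.
  rewrite !unfold_in /= /subB /subA /h2 /= !andbT.
  have e1 : svt S (hs (val b1) true) false = svt S (vs (val b1) false) true by rewrite /svt nosep crP.
  have e2 : svt S (hs (val b1) false) false = svt S (vs (val b1) false) false by rewrite /svt nosep crP.
  have e3 : svt S (hs (val b1) false) true = svt S (vs (val b1) true) false by rewrite /svt nosep crP.
  have := hh (hs (val b1) false); have := hh (vs (val b1) false); rewrite /= e1 e2 e3 => -> ->.
  by case: (h _).
have Sa1 : svt S a o = None by rewrite /svt Sa.
have Sa2 : svt S a' o' = Some p by rewrite /svt (negbTE nSa') a'p.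
have inA (h' : pred (cX L')) (a1 : cA L) o1 : (forall a : cA L', h' (vt a false) = h' (vt a true)) ->
    h' (svt S a1 o1) -> 0 < #|subA h' predT|.
  move=> hh' ha; apply/card_gt0P; exists a1; rewrite unfold_in /subA andbT.
  by case: o1 ha => ha //; have /= -> := hh' a1.
have hh2' : forall a : cA L', h2 (vt a false) = h2 (vt a true) by move=> a1; rewrite /h2 hh.
have [A1 A2] : 0 < #|subA h predT| /\ 0 < #|subA h2 predT|.
  case hN: (h None); move: hne; rewrite hN => hp.
    split; [apply: (inA h a o hh)|apply: (inA h2 a' o' hh2')]; rewrite ?Sa1 ?Sa2 ?hN //.
  split; [apply: (inA h a' o' hh)|apply: (inA h2 a o hh2')]; rewrite ?Sa1 ?Sa2 /h2 ?hN //.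
  by move: hp; case: (h _).
have [_ r1] := one h hh1 c1 A1; have [_ r2] := one h2 hh2 c2 A2.
have := conn_card c1; rewrite card_subX card_subA => /(_ A1) l1.
have := conn_card c2; rewrite card_subX card_subA => /(_ A2) l2.
apply: (cut_arith cX2 cA2 cB2 l1 l2 mu B0 r1 r2).
Qed.

Theorem core W : ctight W -> core_at W /\ main_at W.
Proof.
have [m] := ubnP #|W|; elim: m W => // m IHm W Wm ctW.
suff cW : core_at W by split=> //; exact: core_main.
have IHW W' : ctight W' -> #|W'| < #|W| -> core_at W' /\ main_at W'.
  by move=> ct lt; apply: IHm => //; apply: leq_trans lt _.
move=> J L ctJ JW; have [n] := ubnP (2 * #|cA L| - #|cX L|); elim: n L => // n IHn L mu cL iL gL oL B0 nb.
case: (pselect (nocut L)) => nc; first exact: (reduced_core ctW IHW ctJ JW).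
apply: (cut_core (W := W) (J := J) (n := n) _ cL) => // L' cL' iL' gL' oL' B0' nb' mu'.
exact: IHn.
Qed.

End Core.

(** * Components labelled in a closed tight set *)

Section JLemma.
Variables (V E : finType) (lsrc llab ltgt : E -> V).
Local Notation hl := (hl lsrc ltgt).
Local Notation Ein := (Ein lsrc ltgt).
Local Notation ctight := (ctight lsrc llab ltgt).
Local Notation cplx := (cplx lsrc llab ltgt).
Implicit Types L : cplx.
Hypothesis forest : forall U : {set V}, U != set0 -> #|Ein U| < #|U|.
Hypothesis inj : injective llab.
Hypothesis ctT : ctight [set: V].
Variable J : {set V}.
Hypothesis ctJ : ctight J.
Let HJ v := v \in J.

Definition jclosed L (h : pred (cX L)) := forall a : cA L, HJ (al a) -> h (vt a false) = h (vt a true).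

Lemma subB_Ein L (h : pred (cX L)) b : subB h HJ b -> bl b \in Ein J.
Proof.
by move=> /and4P[/andP[_ h1] /andP[_ h2] _ _]; rewrite inE; move: h1 h2; rewrite /HJ !hsP => -> ->.
Qed.

(** Bridges of [L] are removed while the [J]-part is watched. A bridge in a face of [J] costs the
    [J]-part one face and gives it one vertex. Any other bridge keeps the [J]-labelled ends
    together, so the [J]-part changes only by a vertex that no [J]-labelled edge meets. *)
Lemma sub_chi L : conn L -> immersed L -> graded L -> #|cA L| < #|cX L| + #|cB L| ->
  forall h : pred (cX L), jclosed h -> (exists x, h x) ->
  exists h1 : pred (cX L), [/\ jclosed h1, (exists x, h1 x), (forall x, h1 x -> h x) &
    #|subA h1 HJ| < #|h1| + #|subB h1 HJ|].
Proof.
have [n] := ubnP #|cB L|; elim: n L => // n IH L Bn cL iL gL chi h hh [x0 hx0].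
have oL : over L [set: V] by move=> a; rewrite inE.
case: (posnP #|cB L|) => [B0|Bp].
  (* Without faces [L] is a tree. By [growth] each vertex outside [h] needs an edge that is not
     inside [h], which leaves too few edges for [h] to have Euler characteristic below 1. *)
  exists h; split=> //; first by exists x0.
  have n0 : [set x | h x] != set0 by apply/set0Pn; exists x0; rewrite inE.
  have := growth (conn_crossing cL) (subsetT [set x | h x]) n0.
  set N := [set a in _ | _].
  have : #|subA h HJ| + #|N| <= #|cA L|.
    rewrite -(cardC (mem N)) addnC leq_add2l; apply: subset_leq_card; apply/subsetP => a sa.
    rewrite !inE /= negbK; apply/forallP => o; rewrite inE; exact: (subA_vt hh).
  have := cardsC [set x | h x]; rewrite setTD cardsE; lia.
case: (pselect (has_bridge J L)) => [[p [S [b [i [j br]]]]]|nb]; last first.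
  have JT : compat_sets J [set: V] by constructor 1; exact: subsetT.
  by have [/(_ J L ctJ JT cL iL gL oL Bp nb)] := core forest inj ctT; lia.
have [Sp sP Jb] := br.
have {IH} := IH (split_cplx (bridge_keep br)); rewrite card_splitX card_splitB cardC1 => IH.
have Bn1 : #|cB L|.-1 < n by lia.
have chi' : #|cA L| < #|cX L|.+1 + #|cB L|.-1 by lia.
have cs : conn (split_cplx (bridge_keep br)) by exact: split_conn.
have {}IH := IH Bn1 cs (split_imm _ Sp iL) (split_graded _ Sp gL) chi'.
case: (boolP (bl b \in Ein J)) => [bJ|bJ].
  have eJ j' : HJ (al (hs b j')) by rewrite /HJ hsP Ein_hl.
  have vJ j' : HJ (al (vs b j')) by rewrite /HJ vsP; apply: ctight_lab bJ.
  have [||h1' [h1c [x1 hx1] h1h h1chi]] := IH (fun x => h (unsplit p x)).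
  - by move=> a aJ /=; rewrite !svtK // hh.
  - by exists (Some x0).
  have hp : h1' None = h1' (Some p).
    by apply: (bridge_around br) => j'; apply: h1c; rewrite ?eJ ?vJ.
  pose h1 x := h1' (Some x).
  have h1E a o : h1' (svt S a o) = h1 (vt a o) by rewrite /svt; case: ifP => // /Sp ->.
  exists h1; split.
  - by move=> a aJ; rewrite -!h1E; exact: h1c.
  - by case: x1 hx1 => [x1|]; rewrite ?hp; [exists x1|exists p].
  - by move=> x; exact: h1h.
  have cA' : #|subA h1' HJ| = #|subA h1 HJ|.
    by apply: eq_card => a; rewrite !unfold_in /subA /= h1E.
  have sBE b' (nb' : predC1 b b') : subB h1' HJ (exist _ b' nb' : cB (split_cplx (bridge_keep br))) = subB h1 HJ b'.
    by rewrite /subB /subA /= !h1E.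
  have cX' : #|h1'| = #|h1| + h1 p.
    have Si : injective (@Some (cX L)) by move=> ? ? [].
    rewrite (cardD1 None) [_ \in _]unfold_in hp addnC -(card_image Si h1).
    congr (_ + _); apply: eq_card => -[x|]; rewrite inE /=.
      by apply/idP/imageP => [hx|[y hy [->]]//]; exists x.
    by apply/esym/imageP => -[].
  have bB : subB h1 HJ b = h1 p.
    have [i1 [j1 vE]] : exists i1 j1, vt (hs b j1) i1 = p.
      by exists i, j; apply: sep_hl Sp _; have := sP b i j; rewrite eqxx => ->.
    rewrite /subB /subA !eJ !vJ !andbT -!crP.
    have e1 : h1 (vt (hs b false) false) = h1 (vt (hs b false) true) by rewrite -!h1E; apply: h1c; exact: eJ.
    have e2 : h1 (vt (hs b true) false) = h1 (vt (hs b true) true) by rewrite -!h1E; apply: h1c; exact: eJ.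
    have e3 : h1 (vt (hs b false) false) = h1 (vt (hs b true) false).
      by rewrite !crP -!h1E; apply: h1c; exact: vJ.
    rewrite -vE -e1 -e3; case: i1 {vE}; case: j1; rewrite -?e2 -?e1 -?e3; by case: (h1 _).
  have cB' : #|subB h1' HJ| + h1 p = #|subB h1 HJ|.
    rewrite -bB (cardD1 b (subB h1 HJ)) addnC; congr (_ + _).
    rewrite -(card_image val_inj (subB h1' HJ)); apply: eq_card => b'; rewrite inE /=.
    apply/imageP/andP => [[[b1 nb1] s1 ->]|[nb' s1]].
      by split=> //; change (is_true (subB h1 HJ b1)); rewrite -(sBE b1 nb1).
    by exists (exist _ b' nb') => //; change (is_true (subB h1' HJ (exist _ b' nb'))); rewrite sBE.
  have : #|subA h1' HJ| < #|h1'| + #|subB h1' HJ| := h1chi.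
  by rewrite cA' cX' -cB' -addnA (addnC (h1 p : nat)).
have {}Jb : forall a o a' o', vt a o = p -> vt a' o' = p -> al a \in J -> al a' \in J ->
        S a o = S a' o' by case: Jb => // bJ'; rewrite bJ' in bJ.
have [s sE] : exists s, forall (a : cA L) o, vt a o = p -> al a \in J -> S a o = s.
  case: (pselect (exists (a : cA L) o, vt a o = p /\ al a \in J)) => [[a [o [e aJ]]]|no].
    by exists (S a o) => a' o' e' aJ'; apply: Jb.
  by exists true => a o e aJ; case: no; exists a, o.
(* [pJ] is the copy of [p] that carries all [J]-labelled ends, [po] the other copy; [inJ] embeds the
   old vertices accordingly. *)
pose pJ : option (cX L) := if s then None else Some p.
pose po : option (cX L) := if s then Some p else None.
have Jsvt (a : cA L) o : al a \in J -> svt S a o != po.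
  move=> aJ; rewrite /svt /po; case: (eqVneq (vt a o) p) => [e|ne].
    by rewrite (sE a o e aJ) e; case: (s).
  by case: ifP => [/Sp e|_]; [rewrite e eqxx in ne|case: (s) => //; apply: contra_neq ne => -[]].
pose inJ x : option (cX L) := if x == p then pJ else Some x.
have inJE (a : cA L) o : al a \in J -> svt S a o = inJ (vt a o).
  move=> aJ; rewrite /inJ /svt /pJ; case: eqP => [e|ne]; first by rewrite (sE a o e aJ) e.
  by case: ifP => // /Sp.
have inJK x : unsplit p (inJ x) = x by rewrite /inJ /pJ; case: eqP => [->|]; case: (s).
have inJpo x : inJ x != po.
  rewrite /inJ /pJ /po; case: (eqVneq x p) => [_|ne]; first by case: (s).
  by case: (s) => //; apply: contra_neq ne => -[].
have inJ_onto x : x != po -> x = inJ (unsplit p x).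
  rewrite /inJ /po /pJ; case: x => [x|] /=; last by rewrite eqxx; case: (s).
  by case: (eqVneq x p) => // ->; case: (s); rewrite ?eqxx.
have [||h1' [h1c [x1 hx1] h1h h1chi]] := IH (fun x => (x != po) && h (unsplit p x)).
- by move=> a aJ /=; rewrite !Jsvt //= !svtK // hh.
- by exists (inJ x0); rewrite inJpo inJK.
pose h1 x := h1' (inJ x).
have h1E (a : cA L) o : al a \in J -> h1' (svt S a o) = h1 (vt a o) by move=> aJ; rewrite inJE.
exists h1; split.
- by move=> a aJ; rewrite -!h1E //; exact: h1c.
- have /andP[x1o _] := h1h _ hx1; exists (unsplit p x1); by rewrite /h1 -inJ_onto.
- by move=> x /h1h /andP[_]; rewrite inJK.
have cA' : #|subA h1' HJ| = #|subA h1 HJ|.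
  by apply: eq_card => a; rewrite !unfold_in /subA /=; case: (boolP (HJ _)); rewrite ?andbF // => aJ; rewrite h1E.
have cX' : #|h1'| = #|h1|.
  rewrite -(card_image (f := inJ) (can_inj inJK)); apply: eq_card => x; rewrite unfold_in.
  apply/idP/imageP => [hx|[y hy ->]//]; exists (unsplit p x).
    by rewrite unfold_in /h1 -inJ_onto //; case/andP: (h1h _ hx).
  by rewrite -inJ_onto //; case/andP: (h1h _ hx).
have cB' : #|subB h1' HJ| = #|subB h1 HJ|.
  have sAE (a : cA L) : h1' (svt S a false) && HJ (al a) = h1 (vt a false) && HJ (al a).
    by case: (boolP (HJ _)); rewrite ?andbF // => aJ; rewrite h1E.
  have sBE b' (nb' : predC1 b b') : subB h1' HJ (exist _ b' nb' : cB (split_cplx (bridge_keep br))) = subB h1 HJ b'.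
    by rewrite /subB /subA /= !sAE.
  rewrite -(card_image val_inj (subB h1' HJ)); apply: eq_card => b'.
  apply/imageP/idP => [[[b1 nb1] s1 ->]|s1].
    by change (is_true (subB h1 HJ b1)); rewrite -(sBE b1 nb1).
  have nb' : predC1 b b' by apply/eqP => bE; move: s1; rewrite bE => /subB_Ein; apply/negP.
  by exists (exist _ b' nb') => //; change (is_true (subB h1' HJ (exist _ b' nb'))); rewrite sBE.
have : #|subA h1' HJ| < #|h1'| + #|subB h1' HJ| := h1chi.
by rewrite cA' cX' cB'.
Qed.

(** A closed non-empty subset of a connected part is the whole part, so the set found by [sub_chi]
    is [h] itself. *)
Lemma comp_chi L (h : pred (cX L)) (hh : jclosed h) :
  conn L -> immersed L -> graded L -> #|cA L| < #|cX L| + #|cB L| ->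
  (exists x, h x) -> conn (sub hh) ->
  #|cA (sub hh)| < #|cX (sub hh)| + #|cB (sub hh)|.
Proof.
move=> cL iL gL chi hx ch; rewrite card_subX card_subA card_subB.
have [h1 [h1c [x1 hx1] h1h h1chi]] := sub_chi cL iL gL chi hh hx.
have hE x : h1 x = h x.
  apply/idP/idP => [/h1h//|hxx].
  have := ch (fun z => h1 (val z)) _ (exist _ x hxx) (exist _ x1 (h1h _ hx1)) => /= ->//.
  by move=> [a /andP[ha aJ]] /=; exact: h1c.
have sA a : subA h1 HJ a = subA h HJ a by rewrite /subA hE.
have -> : #|h| = #|h1| by apply: eq_card => x; rewrite !unfold_in hE.
have -> : #|subA h HJ| = #|subA h1 HJ| by apply: eq_card => a; exact: esym (sA a).
suff -> : #|subB h HJ| = #|subB h1 HJ| by [].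
apply: eq_card => b; rewrite [LHS]unfold_in [RHS]unfold_in /subB !sA.
by [].
Qed.

End JLemma.

(** * First cohomology and the Euler characteristic *)

Section Cohomology.
Variables (V E : finType) (lsrc llab ltgt : E -> V) (F : fieldType).
Local Notation cplx := (cplx lsrc llab ltgt).
Local Open Scope ring_scope.

Definition cocycle (L : cplx) (al : cA L -> F) :=
  forall b, al (hs b false) + al (vs b true) = al (vs b false) + al (hs b true).
Definition coboundary (L : cplx) (al : cA L -> F) :=
  exists u : cX L -> F, forall a, al a = u (vt a true) - u (vt a false).

(** Cochains are row vectors. The cocycles [kermx D1] lie in the row space of [D0], whose rank is at
    most [#|cX L| - 1] because [D0] kills the constants. *)
Lemma cohom_chi (L : cplx) : (0 < #|cX L|)%N ->
  (forall al : cA L -> F, cocycle al -> coboundary al) ->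
  (#|cA L| < #|cX L| + #|cB L|)%N.
Proof.
move=> X0 H1.
pose D0 : 'M[F]_(#|cX L|, #|cA L|) := \matrix_(i, j)
  (((vt (enum_val j) true == enum_val i) : nat)%:R - ((vt (enum_val j) false == enum_val i) : nat)%:R).
pose D1 : 'M[F]_(#|cA L|, #|cB L|) := \matrix_(i, j)
  (((hs (enum_val j) false == enum_val i) : nat)%:R + ((vs (enum_val j) true == enum_val i) : nat)%:R
   - ((vs (enum_val j) false == enum_val i) : nat)%:R - ((hs (enum_val j) true == enum_val i) : nat)%:R).
have sumd (T : finType) (g : 'I_#|T| -> F) (t : T) :
    \sum_i g i * ((t == enum_val i) : nat)%:R = g (enum_rank t).
  rewrite (bigD1 (enum_rank t)) //= enum_rankK eqxx mulr1 big1 ?addr0 // => i ne.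
  case: eqP => [te|]; last by rewrite mulr0.
  by rewrite te enum_valK eqxx in ne.
have K : (kermx D1 <= D0)%MS.
  apply/row_subP => i; have : row i (kermx D1) *m D1 = 0 by rewrite -row_mul mulmx_ker row0.
  move: (row i _) => {i} r r0.
  have [|u uP] := H1 (fun a => r 0 (enum_rank a)).
    move=> b; have /matrixP/(_ 0 (enum_rank b)) := r0; rewrite !mxE => h.
    move: h; under eq_bigr => k _ do rewrite !mxE enum_rankK !(mulrDr, mulrN).
    rewrite !sumrB big_split /= !(sumd (cA L) (fun k => r 0 k)) => h.
    by apply/eqP; rewrite -subr_eq0 opprD addrA h.
  apply/submxP; exists (\row_k u (enum_val k)); apply/rowP => k; rewrite !mxE.
  have := uP (enum_val k); rewrite enum_valK => ->.
  under eq_bigr => l _ do rewrite !mxE mulrBr.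
  rewrite sumrB !(sumd (cX L) (fun k => u (enum_val k))) !enum_rankK.
  by [].
have rk1 := mxrankS K; rewrite mxrank_ker in rk1.
have rk2 : (0 < \rank (kermx D0))%N.
  rewrite lt0n mxrank_eq0; apply/negP => /eqP k0.
  have : (const_mx 1 : 'rV[F]_#|cX L|) *m D0 = 0.
    apply/rowP => k; rewrite !mxE; under eq_bigr => l _ do rewrite !mxE mulrBr.
    by rewrite sumrB !(sumd (cX L) (fun _ => 1)) subrr.
  move/sub_kermxP; rewrite k0 submx0 => /eqP/rowP.
  have /card_gt0P[x _] := X0; move=> /(_ (enum_rank x)); rewrite !mxE => /eqP.
  by rewrite oner_eq0.
rewrite mxrank_ker in rk2; have := rank_leq_col D1; lia.
Qed.
End Cohomology.

(** * Trees and sub-LOTs as vertex sets *)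

Section LOT.
Variables (V E : finType) (lsrc llab ltgt : E -> V).
Hypothesis lot : is_LOT lsrc llab ltgt.

Lemma lot_crossing (HV : {set V}) (HE : {set E}) :
  (forall u v, u \in HV -> v \in HV ->
         connect [rel a b | [&& a \in HV, b \in HV & log_adj lsrc ltgt HE a b]] u v) ->
  crossing (hl lsrc ltgt) HV HE.
Proof.
move=> co U UW /set0Pn[u uU] UneW.
have [v vW vU] : exists2 v, v \in HV & v \notin U.
  by apply/subsetPn; apply: contra UneW => WU; rewrite eqEsubset UW.
have /connectP[s ps vE] := co u v (subsetP UW u uU) vW.
elim: s u uU ps vE => [|w s IH] u uU /=; first by move=> _ vu; rewrite vu uU in vU.
move=> /andP[/and3P[uW wW /existsP[e /andP[eE uw]]] ps] vE.
case: (boolP (w \in U)) => wU; first exact: (IH w).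
case/orP: uw => /andP[/eqP e1 /eqP e2].
  by exists e, false; rewrite /= e1 e2 inE wU wW.
by exists e, true; rewrite /= e1 e2 inE wU wW.
Qed.

Lemma notEin (HE : {set E}) (U : {set V}) :
  #|[set a in HE | ~~ [forall o, hl lsrc ltgt a o \in U]]| = #|HE :\: Ein lsrc ltgt U|.
Proof. by apply: eq_card => e; rewrite [LHS]inE [RHS]inE in_Ein andbC. Qed.

(** Growing [U] to the whole tree takes an edge outside [Ein U] for each new vertex, and the tree
    has one edge less than vertices. *)
Lemma lot_forest (U : {set V}) : U != set0 -> #|Ein lsrc ltgt U| < #|U|.
Proof.
move=> U0; have [co cE] := lot.
have cr : crossing (hl lsrc ltgt) [set: V] [set: E].
  apply: lot_crossing => u v _ _; rewrite (eq_connect (e' := log_adj lsrc ltgt [set: E])) //.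
  by move=> a b /=; rewrite !inE.
have := growth cr (subsetT U) U0; rewrite notEin.
have := cardsC U; have := cardsC (Ein lsrc ltgt U); rewrite !setTD -cE; lia.
Qed.

Lemma lot_ctight : ctight lsrc llab ltgt [set: V].
Proof.
have [_ cE] := lot; apply/and3P; split.
- by rewrite -card_gt0 cardsT -cE.
- rewrite cardsT -cE eqSS -[X in _ == X]cardsT; apply/eqP; apply: eq_card => e.
  by rewrite !inE.
- by apply/forallP => e; rewrite !inE implybT.
Qed.

(** Being connected, [HE] has at least [#|HV| - 1] edges, which is all that a forest admits inside
    [HV]. Hence a sub-LOT is a full subgraph. *)
Lemma sublot_ctight HV HE : is_subLOT lsrc llab ltgt HV HE ->
  ctight lsrc llab ltgt HV /\ HE = Ein lsrc ltgt HV.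
Proof.
move=> [HE0 eP co]; have /card_gt0P[e0 e0E] := HE0.
have [x0 _ _] := eP e0 e0E.
have HV0 : HV != set0 by apply/set0Pn; exists (lsrc e0).
have EV : HE \subset Ein lsrc ltgt HV.
  by apply/subsetP => e /eP[s _ t]; rewrite inE s t.
have n0 : [set lsrc e0] != set0 by apply/set0Pn; exists (lsrc e0); rewrite inE.
have xV : [set lsrc e0] \subset HV by rewrite sub1set.
have := growth (lot_crossing co) xV n0; rewrite notEin => g1.
have f1 := lot_forest n0; have f2 := lot_forest HV0.
have s1 := subset_leq_card EV.
have := cardsD1 (lsrc e0) HV; rewrite x0 => c1.
have c2 : #|HE :\: Ein lsrc ltgt [set lsrc e0]| <= #|HE| by apply/subset_leq_card/subsetDl.
have EE : HE = Ein lsrc ltgt HV by apply/eqP; rewrite eqEcard EV; lia.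
split=> //; apply/and3P; split=> //; first by rewrite -EE; apply/eqP; rewrite EE; lia.
by apply/forallP => e; apply/implyP; rewrite -EE => /eP[].
Qed.

End LOT.

(** * Removing a leaf of a tree *)

Section Leaf.
Context (V E : finType) (lsrc llab ltgt : E -> V).
Local Notation cplx := (cplx lsrc llab ltgt).

Definition leaf (L : cplx) (l : cX L) (a0 : cA L) (o0 : bool) :=
  forall a o, (vt a o == l) = ((a, o) == (a0, o0)).

(** Degrees add up to twice the number of edges, which is too small for degree at least 2 at all
    vertices other than [p0]. *)
Lemma leaf_exists (L : cplx) (p0 : cX L) : conn L -> #|cA L| < #|cX L| -> 1 < #|cX L| ->
  exists l a0 o0, l != p0 /\ leaf l a0 o0.
Proof.
move=> cL AX X1.
pose D x := #|[set q : cA L * bool | vt q.1 q.2 == x]|.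
have D1 x : 0 < D x.
  rewrite card_gt0; apply/set0Pn.
  case: (pickP (fun q : cA L * bool => vt q.1 q.2 == x)) => [q qx|no]; first by exists q; rewrite inE.
  have /card_gt0P[y] : 0 < #|predC1 x| by rewrite cardC1; lia.
  rewrite inE => /negP[]; have no' a o : (vt a o == x) = false := no (a, o).
  have := cL (pred1 x) _ y x; rewrite /= eqxx => -> // a.
  by rewrite /= !no'.
have DS : \sum_x D x = 2 * #|cA L|.
  have -> : 2 * #|cA L| = #|{: cA L * bool}| by rewrite card_prod card_bool mulnC.
  rewrite -sum1_card (partition_big (fun q : cA L * bool => vt q.1 q.2) predT) //=.
  by apply: eq_bigr => x _; rewrite /D -sum1_card; apply: eq_bigl => q; rewrite inE.
case: (pickP (fun x => (x != p0) && (D x == 1))) => [l /andP[lp /cards1P[[a0 o0] Dl]]|no].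
  exists l, a0, o0; split=> // a o.
  by move/setP/(_ (a, o)): Dl; rewrite !inE.
exfalso; move: DS; rewrite (bigD1 p0) //=.
have : \sum_(x | x != p0) 2 <= \sum_(x | x != p0) D x.
  by apply: leq_sum => x xp; have := no x; rewrite xp /= => /negbT; have := D1 x; lia.
rewrite sum_nat_const cardC1; have := D1 p0.
move: (D p0) (\sum_(x | x != p0) D x) AX X1 => d T.
by move: #|cA L| #|cX L| => a x; clear; lia.
Qed.

Section Del.
Variables (L : cplx) (l : cX L) (a0 : cA L) (o0 : bool).
Hypothesis lf : leaf l a0 o0.

Lemma del_vtP (a : {a | a != a0}) o : vt (val a) o != l.
Proof. by rewrite lf xpair_eqE negb_and (valP a). Qed.

Definition del : cplx.
refine (@Cplx V E lsrc llab ltgt {x | x != l} {a | a != a0} void (fun a o => exist _ (vt (val a) o) (del_vtP a o))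
  (fun a => al (val a)) (fun b => match b with end) (fun b => match b with end) (fun b => match b with end) _ _ _); by case.
Defined.

Lemma del_otherP : vt a0 (~~ o0) != l.
Proof. by rewrite lf xpair_eqE eqxx /= eqb_negLR; case: o0. Qed.

Definition other : cX del := exist _ (vt a0 (~~ o0)) del_otherP.

Definition retr (x : cX L) : cX del := if insub x is Some x' then x' else other.

Lemma retr_val (x : cX del) : retr (val x) = x.
Proof. by rewrite /retr valK. Qed.

Lemma retr_l : retr l = other.
Proof. by rewrite /retr insubF // eqxx. Qed.

Lemma retr_vt0 o : retr (vt a0 o) = other.
Proof.
case: (eqVneq o o0) => [->|ne].
  by rewrite (_ : vt a0 o0 = l) ?retr_l //; apply/eqP; rewrite lf eqxx.
by rewrite (_ : o = ~~ o0) ?(retr_val other) //; move: ne; case: (o); case: o0.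
Qed.

Lemma retr_vt (a : cA del) o : retr (vt (val a) o) = vt a o.
Proof. exact: (retr_val (vt a o)). Qed.

Lemma del_conn : conn L -> conn del.
Proof.
move=> cL h hh x y; rewrite -(retr_val x) -(retr_val y).
apply: (cL (fun x => h (retr x))) => a.
case: (eqVneq a a0) => [->|na]; first by rewrite !retr_vt0.
by have := hh (exist _ a na); rewrite -!retr_vt.
Qed.

Lemma card_delX : #|cX del| = #|cX L|.-1.
Proof. by rewrite card_sig cardC1. Qed.

Lemma card_delA : #|cA del| = #|cA L|.-1.
Proof. by rewrite card_sig cardC1. Qed.

End Del.
End Leaf.

(** * Folding glued cells to an immersed complex *)

Section Fold.
Context (V E : finType) (lsrc llab ltgt : E -> V).
Local Notation cplx := (cplx lsrc llab ltgt).
Local Notation hl := (hl lsrc ltgt).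
Variables (T : finType) (ty : T -> option (V + E)).
Local Notation S := (T * (bool * bool))%type.
Variable glue : S -> S -> Prop.

(** Each square of the grid carries a closed cell of type [ty]: a vertex, an edge or a face. Its
    four corners name the corners of that cell, with repetitions recorded by [degen]; for an edge
    only the first coordinate matters. *)
Definition stp (v : V) (s s' : S) : bool := (s.1 == s'.1) &&
  match ty s.1 with
  | None => false
  | Some (inl w) => [&& w == v, ~~ s.2.1 & s'.2.1]
  | Some (inr e) => [&& ~~ s.2.1, s'.2.1, s.2.2 == s'.2.2 & hl e s.2.2 == v]
                 || [&& ~~ s.2.2, s'.2.2, s.2.1 == s'.2.1 & llab e == v]
  end.

Definition degen (s s' : S) : bool := (s.1 == s'.1) &&
  match ty s.1 with None => true | Some (inl w) => s.2.1 == s'.2.1 | Some (inr e) => s.2 == s'.2 end.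

(** Stallings folding as a closure condition: edges with the same label at identified corners have
    their other ends identified. Intersecting all such relations in [eqv] avoids building a sequence
    of folds. *)
Record folded (r : rel S) : Prop := Folded {
  fo_refl : forall s, r s s; fo_sym : forall s t, r s t -> r t s;
  fo_trans : forall s t u, r s t -> r t u -> r s u;
  fo_degen : forall s t, degen s t -> r s t;
  fo_glue : forall s t, glue s t -> r s t;
  fo_fwd : forall v s t s' t', r s t -> stp v s s' -> stp v t t' -> r s' t';
  fo_bwd : forall v s t s' t', r s' t' -> stp v s s' -> stp v t t' -> r s t }.

Definition eqv (s t : S) : bool := `[< forall r, folded r -> r s t >].

Lemma eqv_min r s t : folded r -> eqv s t -> r s t.
Proof. by move=> fr /asboolP; apply. Qed.

Lemma eqv_folded : folded eqv.
Proof.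
split.
- by move=> s; apply/asboolP => r fr; exact: fo_refl.
- by move=> s t /asboolP h; apply/asboolP => r fr; apply: fo_sym => //; exact: h.
- by move=> s t u /asboolP h /asboolP h'; apply/asboolP => r fr; apply: (fo_trans fr (h r fr)); exact: h'.
- by move=> s t h; apply/asboolP => r fr; exact: fo_degen.
- by move=> s t h; apply/asboolP => r fr; exact: fo_glue.
- by move=> v s t s' t' /asboolP h h1 h2; apply/asboolP => r fr; apply: (fo_fwd fr (h r fr) h1 h2).
- by move=> v s t s' t' /asboolP h h1 h2; apply/asboolP => r fr; apply: (fo_bwd fr (h r fr) h1 h2).
Qed.

Definition cls s : {set S} := [set t | eqv s t].

Definition fX := {x : {set S} | [exists s, x == cls s]}.
Lemma pi_subproof s : [exists t, cls s == cls t]. Proof. by apply/existsP; exists s. Qed.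
Definition fpi s : fX := exist _ (cls s) (pi_subproof s).

Lemma fpiE s t : (fpi s = fpi t) <-> eqv s t.
Proof.
have eq := eqv_folded; split=> [/(congr1 val) /= /setP/(_ t)|h].
  by rewrite !inE (fo_refl eq) => ->.
apply: val_inj; apply/setP => u; rewrite !inE; apply/idP/idP => h'.
  by apply: (fo_trans eq _ h'); exact: fo_sym.
exact: (fo_trans eq h h').
Qed.

Lemma fpi_surj (x : fX) : exists s, fpi s = x.
Proof. by have /existsP[s /eqP xs] := valP x; exists s; apply: val_inj. Qed.

(** Edges are pairs of origin and label, faces pairs of lower left corner and label, so the
    uniqueness half of immersion at these points is built in. *)
Definition isA (q : fX * V) := [exists s, exists s', stp q.2 s s' && (fpi s == q.1)].
Definition isB (q : fX * E) := [exists Q, (ty Q == Some (inr q.2)) && (fpi (Q, (false, false)) == q.1)].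

Lemma A_witness (q : {q | isA q}) : {ss : S * S | stp (val q).2 ss.1 ss.2 /\ fpi ss.1 = (val q).1}.
Proof.
apply: cid; have /existsP[s /existsP[s' /andP[h /eqP h']]] := valP q.
by exists (s, s').
Qed.

Lemma B_witness (q : {q | isB q}) : {Q | ty Q = Some (inr (val q).2) /\ fpi (Q, (false, false)) = (val q).1}.
Proof.
by apply: cid; have /existsP[Q /andP[/eqP h /eqP h']] := valP q; exists Q.
Qed.

Definition fvt (a : {q | isA q}) (o : bool) : fX := fpi (if o then (sval (A_witness a)).2 else (sval (A_witness a)).1).

Lemma fvt_step a s s' : stp (val a).2 s s' -> fpi s = (val a).1 -> fpi s' = fvt a true.
Proof.
rewrite /fvt; case: (A_witness a) => -[t t'] /= [h1 h2] h e.
by apply/fpiE; apply: (fo_fwd eqv_folded _ h h1); apply/fpiE; rewrite e h2.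
Qed.

Lemma fvt0 a : fvt a false = (val a).1.
Proof. by rewrite /fvt; case: (A_witness a) => -[t t'] /= [h1 h2]. Qed.

Lemma isA_step v s s' : stp v s s' -> isA (fpi s, v).
Proof. by move=> h; apply/existsP; exists s; apply/existsP; exists s'; rewrite h eqxx. Qed.

Definition edge_of v s s' (h : stp v s s') : {q | isA q} := exist _ (fpi s, v) (isA_step h).

Lemma edge_of_vt v s s' (h : stp v s s') o : fvt (edge_of h) o = fpi (if o then s' else s).
Proof. by case: o; [symmetry; apply: (@fvt_step (edge_of h) s)|rewrite fvt0]. Qed.

Lemma stp_h Q e j : ty Q = Some (inr e) -> stp (hl e j) (Q, (false, j)) (Q, (true, j)).
Proof. by move=> h; rewrite /stp eqxx /= h !eqxx. Qed.
Lemma stp_v Q e i : ty Q = Some (inr e) -> stp (llab e) (Q, (i, false)) (Q, (i, true)).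
Proof. by move=> h; rewrite /stp eqxx /= h !eqxx orbT. Qed.
Lemma stp_e Q v j j' : ty Q = Some (inl v) -> stp v (Q, (false, j)) (Q, (true, j')).
Proof. by move=> h; rewrite /stp eqxx /= h !eqxx. Qed.

Definition fQ (b : {q | isB q}) := sval (B_witness b).
Lemma fQ_ty b : ty (fQ b) = Some (inr (val b).2). Proof. by case: (svalP (B_witness b)). Qed.
Lemma fQ_pi b : fpi (fQ b, (false, false)) = (val b).1. Proof. by case: (svalP (B_witness b)). Qed.

Definition fhs b j := edge_of (stp_h j (fQ_ty b)).
Definition fvs b i := edge_of (stp_v i (fQ_ty b)).

Definition foldc : cplx.
refine (@Cplx V E lsrc llab ltgt fX {q | isA q} {q | isB q} fvt (fun a => (val a).2) (fun b => (val b).2) fhs fvs _ _ _).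
- by [].
- by [].
- by move=> b i j; rewrite /fhs /fvs !edge_of_vt; case: i; case: j.
Defined.

Lemma face_corners Q Q' e c : ty Q = Some (inr e) -> ty Q' = Some (inr e) ->
  fpi (Q, (false, false)) = fpi (Q', (false, false)) -> fpi (Q, c) = fpi (Q', c).
Proof.
move=> h h' e0; have eq := eqv_folded; case: c => i j.
have e1 i' : fpi (Q, (i', false)) = fpi (Q', (i', false)).
  case: i' => //; apply/fpiE; apply: (fo_fwd eq _ (stp_h false h) (stp_h false h')); exact/fpiE.
case: j => //; apply/fpiE; apply: (fo_fwd eq _ (stp_v i h) (stp_v i h')); exact/fpiE.
Qed.

Lemma foldc_imm : immersed foldc.
Proof.
have eq := eqv_folded; split.
  move=> a a' o va aa; apply: val_inj; rewrite [RHS]surjective_pairing [LHS]surjective_pairing; congr pair; last exact: aa.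
  case: o va; last by rewrite /= !fvt0.
  rewrite /= /fvt; case: (A_witness a) => -[t t'] /= [h1 h2]; case: (A_witness a') => -[u u'] /= [h3 h4] /fpiE tu.
  rewrite -h2 -h4; apply/fpiE; apply: (fo_bwd eq tu h1).
  by have -> : (sval a).2 = (sval a').2 by exact: aa.
move=> b b' bb hh; apply: val_inj; rewrite [RHS]surjective_pairing [LHS]surjective_pairing; congr pair; last exact: bb.
by have := congr1 (fun a => fvt a false) hh; rewrite /= !edge_of_vt !fQ_pi.
Qed.

Lemma fold_face Q e : ty Q = Some (inr e) ->
  exists2 b : cB foldc, bl b = e & forall i j, vt (hs b j) i = fpi (Q, (i, j)).
Proof.
move=> h; have hB : isB (fpi (Q, (false, false)), e) by apply/existsP; exists Q; rewrite h !eqxx.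
pose b : cB foldc := exist isB _ hB; exists b => // i j.
have tb : ty (fQ b) = Some (inr e) := fQ_ty b.
by rewrite /= edge_of_vt; case: i; apply: (face_corners _ tb h); rewrite fQ_pi.
Qed.

Lemma fold_edge Q v : ty Q = Some (inl v) ->
  exists2 a : cA foldc, al a = v & forall o j, vt a o = fpi (Q, (o, j)).
Proof.
move=> h; exists (edge_of (stp_e false false h)) => // o j; rewrite /= edge_of_vt; apply/fpiE.
by case: o; apply: (fo_degen eqv_folded); rewrite /degen eqxx /= h !eqxx.
Qed.

Lemma fold_vertex Q c c' : ty Q = None -> fpi (Q, c) = fpi (Q, c').
Proof. by move=> h; apply/fpiE; apply: (fo_degen eqv_folded); rewrite /degen eqxx /= h. Qed.

Lemma fold_glue s t : glue s t -> fpi s = fpi t.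
Proof. by move=> h; apply/fpiE; exact: (fo_glue eqv_folded). Qed.

Lemma stp_ind (P : S -> S -> V -> Prop) :
  (forall Q v j j', ty Q = Some (inl v) -> P (Q, (false, j)) (Q, (true, j')) v) ->
  (forall Q e j, ty Q = Some (inr e) -> P (Q, (false, j)) (Q, (true, j)) (hl e j)) ->
  (forall Q e i, ty Q = Some (inr e) -> P (Q, (i, false)) (Q, (i, true)) (llab e)) ->
  forall v s s', stp v s s' -> P s s' v.
Proof.
move=> h1 h2 h3 v [Q [i j]] [Q' [i' j']]; rewrite /stp /= => /andP[/eqP <-].
case tQ: (ty Q) => [[w|e]|] //.
  by case/and3P=> /eqP <-; case: i; case: i' => // _ _; apply: h1.
case/orP=> /and4P[h4 h5 /eqP <- /eqP <-].
  by move: h4 h5; case: i; case: i' => // _ _; apply: h2.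
by move: h4 h5; case: j; case: j' => // _ _; apply: h3.
Qed.

(** A potential on the corners descends to the vertices because being equivalent with equal
    potential is itself a folded relation. *)
Lemma fold_coboundary (F : fieldType) (f : cA foldc -> F) (U : S -> F) :
  (forall s t, degen s t -> U s = U t) -> (forall s t, glue s t -> U s = U t) ->
  (forall (a : cA foldc) s s', stp (al a) s s' -> fpi s = vt a false -> U s' = (U s + f a)%R) -> coboundary f.
Proof.
move=> Ud Ug Us; have eq := eqv_folded.
pose r (s t : S) := eqv s t && (U s == U t).
have Us' v s s' t t' (ss : stp v s s') (tt : stp v t t') : eqv t s -> U t' = (U t + f (edge_of ss))%R.
  by move=> ts; apply: Us => //; rewrite [vt _ _]edge_of_vt; exact/fpiE.
have rf : folded r.
  split.
  - by move=> s; rewrite /r (fo_refl eq) eqxx.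
  - by move=> s t /andP[/(fo_sym eq) h /eqP e]; rewrite /r h e /=.
  - by move=> s t u /andP[h1 /eqP e1] /andP[h2 /eqP e2]; rewrite /r (fo_trans eq h1 h2) e1 e2 /=.
  - by move=> s t h; rewrite /r (fo_degen eq h) (Ud _ _ h) eqxx.
  - by move=> s t h; rewrite /r (fo_glue eq h) (Ug _ _ h) eqxx.
  - move=> v s t s' t' /andP[h1 /eqP h2] ss tt; rewrite /r (fo_fwd eq h1 ss tt) /=.
    by rewrite (Us' _ _ _ _ _ ss ss (fo_refl eq s)) (Us' _ _ _ _ _ ss tt (fo_sym eq h1)) h2.
  - move=> v s t s' t' /andP[h1 /eqP h2] ss tt.
    have h := fo_bwd eq h1 ss tt; rewrite /r h /=; move: h2.
    by rewrite (Us' _ _ _ _ _ ss ss (fo_refl eq s)) (Us' _ _ _ _ _ ss tt (fo_sym eq h)) => /addIr ->.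
have Ue s t : eqv s t -> U s = U t by move=> /(eqv_min rf) /andP[_ /eqP].
have rep (x : fX) : {s | fpi s = x} by apply: cid; exact: fpi_surj.
exists (fun x => U (sval (rep x))) => a.
have [[s s'] [h1 h2]] := A_witness a; rewrite /= in h1 h2.
have e0 : U (sval (rep (vt a false))) = U s.
  by apply: Ue; apply/fpiE; rewrite (svalP (rep _)) /= fvt0 h2.
have e1 : U (sval (rep (vt a true))) = U s'.
  by apply: Ue; apply/fpiE; rewrite (svalP (rep _)) /= -(fvt_step h1 h2).
by rewrite e0 e1 (Us a s s') // ?[(U s + _)%R]addrC ?addrK //= fvt0.
Qed.

End Fold.

From mathcomp Require Import classical_sets functions reals topology subtype_topology normedtype.
From mathcomp Require interval_inference.
From mathcomp Require Import lra ring.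

Import Order.TTheory GRing.Theory Num.Theory.
Import numFieldTopology.Exports.
Local Open Scope classical_set_scope.
Local Open Scope ring_scope.
Local Open Scope quotient_scope.

(** * The topology of the standard complex *)

Section Continuity.
Variables (T S Z : topologicalType) (R : realType).

Lemma ct_comp (f : T -> S) (g : S -> Z) : continuous f -> continuous g -> continuous (fun x => g (f x)).
Proof. by move=> cf cg x; apply: (continuous_comp (cf x) (cg (f x))). Qed.

Lemma ct_pair (f : T -> S) (g : T -> Z) : continuous f -> continuous g -> continuous (fun x => (f x, g x)).
Proof. by move=> cf cg x; exact: (@cvg_pair _ _ _ (nbhs x) (nbhs (f x)) (nbhs (g x)) _ _ _ f g (cf x) (cg x)). Qed.

Lemma ct_fst : continuous (fst : T * S -> T).
Proof. by move=> [x y]; exact: cvg_fst. Qed.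

Lemma ct_snd : continuous (snd : T * S -> S).
Proof. by move=> [x y]; exact: cvg_snd. Qed.

Lemma ct_fst1 (f : T -> S * Z) : continuous f -> continuous (fun x => (f x).1).
Proof. by move=> cf x; apply: (continuous_comp (g := fst) (cf x)); case: (f x) => a b; exact: cvg_fst. Qed.

Lemma ct_snd1 (f : T -> S * Z) : continuous f -> continuous (fun x => (f x).2).
Proof. by move=> cf x; apply: (continuous_comp (g := snd) (cf x)); case: (f x) => a b; exact: cvg_snd. Qed.

Lemma ct_cst (z : Z) : continuous (fun _ : T => z).
Proof. exact: cst_continuous. Qed.

Lemma ct_id : continuous (fun x : T => x).
Proof. by move=> x; exact. Qed.

Lemma ct_add (f g : T -> R) : continuous f -> continuous g -> continuous (fun x => f x + g x).
Proof. by move=> cf cg x; apply: (@cvgD R R^o _ _ _ f g); [exact: cf|exact: cg]. Qed.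

Lemma ct_opp (f : T -> R) : continuous f -> continuous (fun x => - f x).
Proof. by move=> cf x; apply: (@cvgN R R^o _ _ _ f); exact: cf. Qed.

Lemma ct_mul (f g : T -> R) : continuous f -> continuous g -> continuous (fun x => f x * g x).
Proof. by move=> cf cg x; apply: (@cvgM _ _ _ _ f g); [exact: cf|exact: cg]. Qed.

Lemma ct_max (f g : T -> R) : continuous f -> continuous g -> continuous (fun x => Num.max (f x) (g x)).
Proof. by move=> cf cg x; apply: (@continuous_max R T f g x); [exact: cf|exact: cg]. Qed.

Lemma ct_min (f g : T -> R) : continuous f -> continuous g -> continuous (fun x => Num.min (f x) (g x)).
Proof. by move=> cf cg x; apply: (@continuous_min R T f g x); [exact: cf|exact: cg]. Qed.

Lemma ct_norm (f : T -> R) : continuous f -> continuous (fun x => `|f x|).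
Proof. by move=> cf x; apply: (@cvg_norm _ R^o _ _ _ f); exact: cf. Qed.

Lemma closed_le (f g : T -> R) : continuous f -> continuous g -> closed [set x | f x <= g x].
Proof.
move=> cf cg; rewrite (_ : [set x | _] = (fun x => g x - f x) @^-1` [set y | 0 <= y]).
  apply: closed_comp; last exact: closed_ge.
  by move=> x _; apply: (@ct_add g (fun x => - f x)); [|apply: ct_opp].
by apply/seteqP; split => x /=; rewrite subr_ge0.
Qed.

Lemma closed_pasting (I : finType) (C : I -> set T) (g : I -> T -> Z) (f : T -> Z) :
  (forall i, closed (C i)) -> (forall x, exists i, C i x) ->
  (forall i, continuous (g i)) -> (forall i x, C i x -> f x = g i x) -> continuous f.
Proof.
move=> cC cov cg fg; apply/continuous_closedP => D cD.
rewrite (_ : f @^-1` D = \bigcup_(i in [set: I]) (C i `&` (g i) @^-1` D)).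
  apply: closed_bigcup => [|i _]; first exact: cardinality.finite_finset.
  apply: closedI => //; move/continuous_closedP: (cg i); exact.
apply/seteqP; split => [x Dx|x [i _ [Ci Di]]] /=; last by rewrite (fg i).
by have [i Ci] := cov x; exists i => //; split=> //=; rewrite -(fg i).
Qed.

Lemma closed_pasting2 (c : T -> R) (d : T -> R) (g1 g2 f : T -> Z) :
  continuous c -> continuous d -> continuous g1 -> continuous g2 ->
  (forall x, c x <= d x -> f x = g1 x) -> (forall x, d x <= c x -> f x = g2 x) -> continuous f.
Proof.
move=> cc cd cg1 cg2 f1 f2.
apply: (@closed_pasting bool (fun b => if b then [set x | c x <= d x] else [set x | d x <= c x])
  (fun b => if b then g1 else g2)).
- by case; apply: closed_le.
- by move=> x; case: (leP (c x) (d x)) => h; [exists true|exists false => /=; exact: ltW].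
- by case.
- by case=> x /=; [exact: f1|exact: f2].
Qed.

End Continuity.

Lemma ct_opp_id (R : realType) : continuous (@GRing.opp R).
Proof. by apply: (@ct_opp R R (fun x => x)); exact: ct_id. Qed.

Lemma ct_norm_id (R : realType) : continuous (fun x : R => `|x|).
Proof. by apply: (@ct_norm R R (fun x => x)); exact: ct_id. Qed.

Lemma ct_addc (R : realType) (c : R) : continuous (+%R c).
Proof. by apply: (@ct_add R R (fun=> c) (fun x => x)); [exact: ct_cst|exact: ct_id]. Qed.

Lemma ct_mulc (R : realType) (c : R) : continuous ( *%R c).
Proof. by apply: (@ct_mul R R (fun=> c) (fun x => x)); [exact: ct_cst|exact: ct_id]. Qed.

Lemma ct_maxc (R : realType) (c : R) : continuous (Num.max c).
Proof. by apply: (@ct_max R R (fun=> c) (fun x => x)); [exact: ct_cst|exact: ct_id]. Qed.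

Lemma ct_minc (R : realType) (c : R) : continuous (Num.min c).
Proof. by apply: (@ct_min R R (fun=> c) (fun x => x)); [exact: ct_cst|exact: ct_id]. Qed.

Ltac ctn := match goal with
  | |- continuous (fun _ => ?z) => apply: ct_cst
  | |- continuous (fun x => x) => apply: ct_id
  | |- continuous fst => apply: ct_fst
  | |- continuous snd => apply: ct_snd
  | |- continuous (fun x => (_, _)) => apply: ct_pair; ctn
  | |- continuous (fun x => fst (@?f x)) => apply: ct_fst1; ctn
  | |- continuous (fun x => snd (@?f x)) => apply: ct_snd1; ctn
  | |- continuous (fun x => _ + _) => apply: ct_add; ctn
  | |- continuous (fun x => - _) => apply: ct_opp; ctn
  | |- continuous (fun x => _ * _) => apply: ct_mul; ctn
  | |- continuous (fun x => Num.max _ _) => apply: ct_max; ctn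
  | |- continuous (fun x => Num.min _ _) => apply: ct_min; ctn
  | |- continuous (fun x => `|_|) => apply: ct_norm; ctn
  | |- continuous (@Algebra.opp _) => apply: ct_opp_id
  | |- continuous (@Num.norm _ _) => apply: ct_norm_id
  | |- continuous (+%R _) => apply: ct_addc
  | |- continuous ( *%R _) => apply: ct_mulc
  | |- continuous (Num.max _) => apply: ct_maxc
  | |- continuous (Num.min _) => apply: ct_minc
  | |- continuous id => apply: ct_id
  | |- _ => try assumption
  end.

Section Clip.
Variable R : realType.
Definition clip (x : R) : R := Num.max 0 (Num.min x 1).

Lemma clip_in x : 0 <= clip x <= 1.
Proof. by rewrite /clip le_max lexx ge_max ler01 ge_min lexx orbT. Qed.

Lemma clip_id x : 0 <= x <= 1 -> clip x = x.
Proof. by move=> /andP[x0 x1]; rewrite /clip min_l // max_r. Qed.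

Lemma clipK x : clip (clip x) = clip x.
Proof. exact: clip_id (clip_in x). Qed.

Lemma clip_continuous : continuous clip.
Proof.
by rewrite /clip; ctn.
Qed.

Lemma clip_itv x : clip x \in (`[0, 1]%classic : set R).
Proof. by apply/mem_set; rewrite /= in_itv /= clip_in. Qed.

Definition toI (x : R) : unit_interval R := exist _ (clip x) (clip_itv x).

Lemma toI_continuous : continuous toI.
Proof.
apply/continuousP => A [B oB <-].
rewrite -comp_preimage (_ : set_val \o toI = clip) //.
by move/continuousP: clip_continuous; apply.
Qed.

Lemma clip2_itv (p : R * R) : (clip p.1, clip p.2) \in (`[0, 1] `*` `[0, 1] : set (R * R)).
Proof. by apply/mem_set; split; rewrite /= in_itv /= clip_in. Qed.

Definition toS (p : R * R) : unit_square R := exist _ (clip p.1, clip p.2) (clip2_itv p).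

Lemma toS_continuous : continuous toS.
Proof.
apply/continuousP => A [B oB <-].
rewrite -comp_preimage (_ : set_val \o toS = fun p => (clip p.1, clip p.2)) //.
suff: continuous (fun p : R * R => (clip p.1, clip p.2)) by move/continuousP; apply.
by rewrite /clip; ctn.
Qed.

Lemma toIK (p : unit_interval R) : toI (set_val p) = p.
Proof.
apply: val_inj => /=; apply: clip_id.
by have := set_mem (valP p); rewrite /= in_itv.
Qed.

Lemma toSK (p : unit_square R) : toS (set_val p) = p.
Proof.
apply: val_inj => /=; have [/= h1 h2] := set_mem (valP p).
rewrite !in_itv /= in h1 h2.
have -> : \val p = set_val p by [].
rewrite !clip_id //; by case: (set_val p) h1 h2.
Qed.

Lemma set_val_continuous (T : topologicalType) (A : set T) : continuous (set_val : set_type A -> T).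
Proof. exact: initial_continuous. Qed.

End Clip.

Section Cells.
Context (R : realType) (V E : finType) (lsrc llab ltgt : E -> V).
Local Notation K := (LOGcomplex R lsrc llab ltgt).
Local Notation hl := (hl lsrc ltgt).

(** Composing with [clip] parametrises cells by all of [R] or [R * R], which keeps subtypes out of
    later formulas. *)
Definition cell_edge (v : V) (t : R) : K := \pi_K (existT (cell R (V:=V) (E:=E)) (inl v) (toI t)).
Definition cell_face (e : E) (p : R * R) : K := \pi_K (existT (cell R (V:=V) (E:=E)) (inr e) (toS p)).

Local Notation kedge := cell_edge.
Local Notation kface := cell_face.

Lemma kedge_continuous v : continuous (kedge v).
Proof.
apply: (ct_comp (f := @toI R) (g := fun t => \pi_K (existT (cell R (V:=V) (E:=E)) (inl v) t))).
  exact: toI_continuous.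
apply: (ct_comp (f := existT (cell R (V:=V) (E:=E)) (inl v)) (g := \pi_K)).
  exact: existT_continuous.
exact: pi_continuous.
Qed.

Lemma kface_continuous e : continuous (kface e).
Proof.
apply: (ct_comp (f := @toS R) (g := fun t => \pi_K (existT (cell R (V:=V) (E:=E)) (inr e) t))).
  exact: toS_continuous.
apply: (ct_comp (f := existT (cell R (V:=V) (E:=E)) (inr e)) (g := \pi_K)).
  exact: existT_continuous.
exact: pi_continuous.
Qed.

Lemma K_continuous (Z : topologicalType) (f : K -> Z) :
  (forall v, continuous (f \o kedge v)) -> (forall e, continuous (f \o kface e)) -> continuous f.
Proof.
move=> fv fe; apply/quotient_continuous.
have := @sigT_continuous _ (cell R (V:=V) (E:=E)) Z (fun i p => f (\pi_K (existT (cell R (V:=V) (E:=E)) i p))).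
have -> : unstable.sigT_fun (fun (i : V + E) p => f (\pi_K (existT (cell R (V:=V) (E:=E)) i p))) = f \o \pi_K.
  by apply/funext => -[i p].
apply; case=> [v|e].
  rewrite (_ : (fun p => _) = (f \o kedge v) \o set_val); last first.
    by apply/funext => p /=; rewrite /cell_edge toIK.
  by move=> p; apply: continuous_comp; [exact: set_val_continuous|exact: fv].
rewrite (_ : (fun p => _) = (f \o kface e) \o set_val); last first.
  by apply/funext => p /=; rewrite /cell_face toSK.
by move=> p; apply: continuous_comp; [exact: set_val_continuous|exact: fe].
Qed.

Definition is_basep (k : K) := @is_basepoint R V E lsrc llab ltgt k.

Definition cpt (k : K) : canon_point R V E := Defs.canon lsrc llab ltgt (repr k).

Lemma piE (x y : precomplex R V E) : (\pi_K x = \pi_K y) <-> (Defs.canon lsrc llab ltgt x = Defs.canon lsrc llab ltgt y).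
Proof.
split => [|h]; first by move/eqquotP/asboolP.
by apply/eqquotP/asboolP.
Qed.

Lemma cpt_pi x : cpt (\pi_K x) = Defs.canon lsrc llab ltgt x.
Proof. by apply/piE; rewrite reprK. Qed.

Lemma cpt_inj : injective cpt.
Proof. by move=> k k' /piE; rewrite !reprK. Qed.

Lemma cpt_edge v t : cpt (kedge v t) = canon_edge E v (clip t).
Proof. by rewrite cpt_pi. Qed.

Lemma cpt_face e p : cpt (kface e p) = canon_square lsrc llab ltgt e (clip p.1, clip p.2).
Proof. by rewrite cpt_pi. Qed.

Lemma clip0 : clip (0 : R) = 0. Proof. by rewrite clip_id // lexx ler01. Qed.
Lemma clip1 : clip (1 : R) = 1. Proof. by rewrite clip_id // lexx ler01. Qed.

Lemma cpt_base k : is_basep k <-> cpt k = None.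
Proof.
split => [[x [xN <-]]|kN]; first by rewrite cpt_pi.
by exists (repr k); rewrite reprK.
Qed.

Lemma base_uniq k k' : is_basep k -> is_basep k' -> k = k'.
Proof. by move=> /cpt_base h /cpt_base h'; apply: cpt_inj; rewrite h h'. Qed.

Lemma kedge_base v t : clip t = 0 \/ clip t = 1 -> is_basep (kedge v t).
Proof. by move=> h; apply/cpt_base; rewrite cpt_edge /canon_edge; case: h => ->; rewrite eqxx ?orbT. Qed.

Lemma kedge_clip v t : kedge v (clip t) = kedge v t.
Proof. by apply: cpt_inj; rewrite !cpt_edge clipK. Qed.

Lemma kface_clip e s t : kface e (clip s, clip t) = kface e (s, t).
Proof. by apply: cpt_inj; rewrite !cpt_face /= !clipK. Qed.

Definition end_pt (o : bool) : R := o%:R.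
Local Notation o2r := end_pt.

Lemma clip_o2r o : clip (o2r o) = o2r o.
Proof. by case: o; rewrite /end_pt ?clip0 ?clip1. Qed.

Lemma kface_h e j s : kface e (s, o2r j) = kedge (hl e j) s.
Proof.
apply: cpt_inj; rewrite cpt_face cpt_edge /= clip_o2r /canon_square.
by case: j; rewrite /end_pt /= ?oner_eq0 ?eqxx.
Qed.

Lemma kface_v e i t : kface e (o2r i, t) = kedge (llab e) t.
Proof.
apply: cpt_inj; rewrite cpt_face cpt_edge /= clip_o2r /canon_square /canon_edge.
have -> : (o2r i == 0) || (o2r i == 1) by case: i; rewrite /end_pt /= eqxx ?orbT.
by case: (clip t == 0) => //; case: (clip t == 1).
Qed.

Variant kpoint_spec (k : K) : Prop :=
| KBase of is_basep k
| KEdge v t of 0 < t < 1 & k = kedge v t & cpt k = Some (inl (v, t))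
| KFace e s t of 0 < s < 1 & 0 < t < 1 & k = kface e (s, t) & cpt k = Some (inr (e, (s, t))).

Lemma kedgeP v t : kpoint_spec (kedge v t).
Proof.
have := clip_in t; rewrite -kedge_clip; move: (clip t) => {}t /andP[t0 t1].
case: (eqVneq t 0) => [->|n0]; first by apply/KBase/kedge_base; left; exact: clip0.
case: (eqVneq t 1) => [->|n1]; first by apply/KBase/kedge_base; right; exact: clip1.
apply: (@KEdge _ v t); rewrite ?lt_neqAle 1?eq_sym ?n0 ?n1 ?t0 ?t1 //.
by rewrite cpt_edge /canon_edge clip_id ?t0 // (negbTE n0) (negbTE n1).
Qed.

Lemma kfaceP e p : kpoint_spec (kface e p).
Proof.
case: p => s t; have := clip_in t; have := clip_in s; rewrite -kface_clip.
move: (clip t) (clip s) => {}t {}s /andP[s0 s1] /andP[t0 t1].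
case: (eqVneq t 0) => [->|n0].
  by rewrite -[0]/(o2r false) kface_h; exact: kedgeP.
case: (eqVneq t 1) => [->|n1].
  by rewrite -[1]/(o2r true) kface_h; exact: kedgeP.
case: (eqVneq s 0) => [->|m0].
  by rewrite -[0]/(o2r false) kface_v; exact: kedgeP.
case: (eqVneq s 1) => [->|m1].
  by rewrite -[1]/(o2r true) kface_v; exact: kedgeP.
have tI : 0 < t < 1 by rewrite !lt_neqAle t0 t1 eq_sym n0 n1.
have sI : 0 < s < 1 by rewrite !lt_neqAle s0 s1 eq_sym m0 m1.
apply: (@KFace _ e s t sI tI) => //.
by rewrite cpt_face /canon_square /= !clip_id ?t0 ?s0 // (negbTE n0) (negbTE n1) (negbTE m0) (negbTE m1).
Qed.

Lemma kpointP k : kpoint_spec k.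
Proof.
rewrite -(reprK k); case: (repr k) => -[v|e] p.
  by rewrite (_ : \pi_K _ = kedge v (set_val p)); [exact: kedgeP|rewrite /cell_edge toIK].
by rewrite (_ : \pi_K _ = kface e (set_val p)); [exact: kfaceP|rewrite /cell_face toSK].
Qed.

Section Glue.
Variables (Z : Type) (z0 : Z) (fv : V -> R -> Z) (fe : E -> R * R -> Z).

(** A map out of K prescribed on open cells; under the compatibility hypotheses the same formulas
    hold on closed cells. *)
Definition kglue (k : K) : Z :=
  match cpt k with
  | None => z0
  | Some (inl (v, t)) => fv v t
  | Some (inr (e, p)) => fe e p
  end.

Hypothesis fv0 : forall v o, fv v (o2r o) = z0.
Hypothesis feh : forall e j s, 0 <= s <= 1 -> fe e (s, o2r j) = fv (hl e j) s.
Hypothesis fev : forall e i t, 0 <= t <= 1 -> fe e (o2r i, t) = fv (llab e) t.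

Lemma kglue_base k : is_basep k -> kglue k = z0.
Proof. by move=> /cpt_base h; rewrite /kglue h. Qed.

Lemma kglue_edge v t : kglue (kedge v t) = fv v (clip t).
Proof.
rewrite /kglue cpt_edge /canon_edge; case: (eqVneq (clip t) 0) => [->|_] /=.
  by rewrite -(fv0 v false).
by case: (eqVneq (clip t) 1) => [->|] //=; rewrite -(fv0 v true).
Qed.

Lemma kglue_face e p : kglue (kface e p) = fe e (clip p.1, clip p.2).
Proof.
case: p => s t /=; rewrite -kface_clip.
have := clip_in t; have := clip_in s; move: (clip t) (clip s) => {}t {}s s01 t01.
case: (eqVneq t 0) => [->|n0].
  by rewrite -[0]/(o2r false) kface_h kglue_edge clip_id // feh.
case: (eqVneq t 1) => [->|n1].
  by rewrite -[1]/(o2r true) kface_h kglue_edge clip_id // feh.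
case: (eqVneq s 0) => [->|m0].
  by rewrite -[0]/(o2r false) kface_v kglue_edge clip_id // fev.
case: (eqVneq s 1) => [->|m1].
  by rewrite -[1]/(o2r true) kface_v kglue_edge clip_id // fev.
by rewrite /kglue cpt_face /canon_square /= !clip_id // (negbTE n0) (negbTE n1) (negbTE m0) (negbTE m1).
Qed.

End Glue.

Lemma kglue_continuous (Z : topologicalType) (z0 : Z) (fv : V -> R -> Z) (fe : E -> R * R -> Z) :
  (forall v o, fv v (o2r o) = z0) ->
  (forall e j s, 0 <= s <= 1 -> fe e (s, o2r j) = fv (hl e j) s) ->
  (forall e i t, 0 <= t <= 1 -> fe e (o2r i, t) = fv (llab e) t) ->
  (forall v, continuous (fv v)) -> (forall e, continuous (fe e)) ->
  continuous (kglue z0 fv fe).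
Proof.
move=> h0 hh hv cv ce; apply: K_continuous => [v|e].
  rewrite (_ : _ \o _ = fv v \o @clip R); last by apply/funext => t /=; rewrite kglue_edge.
  by move=> t; apply: continuous_comp; [exact: clip_continuous|exact: cv].
rewrite (_ : _ \o _ = fe e \o (fun p => (clip p.1, clip p.2))); last first.
  by apply/funext => p /=; rewrite (kglue_face h0 hh hv).
apply: (ct_comp (f := fun p : R * R => (clip p.1, clip p.2)) (g := fe e)); last exact: ce.
by rewrite /clip; ctn.
Qed.

End Cells.

(** * Hausdorff property and products with the interval *)

Section Separation.
Variable R : realType.

Lemma sep_hausdorff (T : topologicalType) :
  (forall x y : T, x <> y -> exists2 f : T -> R, continuous f & f x <> f y) -> hausdorff_space T.
Proof.
move=> H p q cl; apply: contrapT => pq; have [f cf] := H p q pq; apply.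
apply: (@Rhausdorff R) => A B fA fB.
have [x [/= Ax Bx]] := cl (f @^-1` A) (f @^-1` B) (cf p A fA) (cf q B fB).
by exists (f x).
Qed.

(** Images of compact sets in a Hausdorff space are closed, so finitely many compact pieces covering
    [W] detect continuity. This yields continuity of homotopies on K and on the sphere, which are
    glued from cells times an interval. *)
Lemma compact_quot (I : finType) (S W Z : topologicalType) (C : set S) (q : I -> S -> W) (h : W -> Z) :
  compact C -> hausdorff_space W -> (forall i, continuous (q i)) ->
  (forall w, exists i s, C s /\ q i s = w) ->
  (forall i, continuous (fun s => h (q i s))) -> continuous h.
Proof.
move=> cC hW cq onto ch; apply/continuous_closedP => D cD.
rewrite (_ : h @^-1` D = \bigcup_(i in [set: I]) (q i @` (C `&` (fun s => h (q i s)) @^-1` D))).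
  apply: closed_bigcup => [|i _]; first exact: cardinality.finite_finset.
  apply: compact_closed => //; apply: continuous_compact.
    exact: continuous_subspaceT.
  by apply: compact_closedI => //; move/continuous_closedP: (ch i); exact.
apply/seteqP; split => [w Dw|w [i _ [s [Cs Ds] <-]]] //.
by have [i [s [Cs sw]]] := onto w; exists i => //; exists s => //; split=> //=; rewrite sw.
Qed.

Definition Icube : set (R * R * R) := (`[0, 1] `*` `[0, 1]) `*` `[0, 1].

Lemma Icube_compact : compact Icube.
Proof.
apply: compact_setX; last exact: segment_compact.
by apply: compact_setX; exact: segment_compact.
Qed.

End Separation.

Section KHausdorff.
Context (R : realType) (V E : finType) (lsrc llab ltgt : E -> V).
Local Notation K := (LOGcomplex R lsrc llab ltgt).
Local Notation hl := (hl lsrc ltgt).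
Local Notation kedge := (@cell_edge R V E lsrc llab ltgt).
Local Notation kface := (@cell_face R V E lsrc llab ltgt).
Local Notation kglue := (@kglue R V E lsrc llab ltgt).

Definition bump (s : R) := s * (1 - s).

(** The factor [bump] vanishes at both ends, so the function is 0 at the base point; on a face it
    interpolates the values on the sides. Separation of points takes for [c] the constant 1 or the
    coordinate. *)
Definition edge_fun (v : V) (c : R -> R) : K -> R :=
  let fv v' t := if v' == v then bump t * c t else 0 in
  kglue 0 fv (fun e p => fv (lsrc e) p.1 * (1 - p.2) + fv (ltgt e) p.1 * p.2 + fv (llab e) p.2).

Definition face_fun (e : E) (c : R * R -> R) : K -> R :=
  kglue 0 (fun _ _ => 0) (fun e' p => if e' == e then bump p.1 * bump p.2 * c p else 0).

Lemma bump_o2r o : bump (end_pt R o) = 0.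
Proof. by rewrite /bump /end_pt; case: o; rewrite ?subrr ?mulr0 ?mul0r. Qed.

Lemma edge_fun_continuous v c : continuous c -> continuous (edge_fun v c).
Proof.
move=> cc.
have cf v' : continuous (fun t : R => if v' == v then bump t * c t else 0).
  by case: (v' == v) => /=; rewrite /bump; ctn.
have f0 v' o : (if v' == v then bump (end_pt R o) * c (end_pt R o) else 0) = 0.
  by rewrite bump_o2r mul0r; case: ifP.
apply: kglue_continuous => // [e j s _|e i t _|e] /=.
- by rewrite f0 addr0 /end_pt; case: j => /=; rewrite ?subrr ?subr0 ?mulr0 ?mulr1 ?add0r ?addr0.
- by rewrite !f0 !mul0r !add0r.
apply: ct_add; first apply: ct_add.
- apply: ct_mul; last by ctn.
  by apply: (ct_comp (f := fst) (g := fun t => if lsrc e == v then bump t * c t else 0)); [ctn|exact: cf].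
- apply: ct_mul; last by ctn.
  by apply: (ct_comp (f := fst) (g := fun t => if ltgt e == v then bump t * c t else 0)); [ctn|exact: cf].
- by apply: (ct_comp (f := snd) (g := fun t => if llab e == v then bump t * c t else 0)); [ctn|exact: cf].
Qed.

Lemma face_fun_continuous e c : continuous c -> continuous (face_fun e c).
Proof.
move=> cc; apply: kglue_continuous => // [e' j s _|e' i t _|v|e'] /=.
- by rewrite bump_o2r mulr0 mul0r; case: ifP.
- by rewrite bump_o2r !mul0r; case: ifP.
- by ctn.
- by case: (e' == e) => /=; rewrite /bump; ctn.
Qed.

Lemma bump_gt0 s : 0 < s < 1 -> 0 < bump s.
Proof. by move=> /andP[s0 s1]; rewrite /bump mulr_gt0 // subr_gt0. Qed.

(** The functions with [c = 1] detect the open cell of a point, those with a coordinate for [c] then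
    detect the coordinate. Faces come first, because [edge_fun] need not vanish on them. *)
Lemma K_separated (k k' : K) : k <> k' -> exists2 f : K -> R, continuous f & f k <> f k'.
Proof.
move=> kk; apply: contrapT => H; apply: kk.
have Hf (f : K -> R) : continuous f -> f k = f k'.
  by move=> cf; apply: contrapT => ne; apply: H; exists f.
have cst1 : continuous (fun _ : R * R => 1 : R) by ctn.
have cst1' : continuous (fun _ : R => 1 : R) by ctn.
have Hface e (k1 k2 : K) s t : 0 < s < 1 -> 0 < t < 1 -> k1 = kface e (s, t) -> cpt k1 = Some (inr (e, (s, t))) ->
   (forall f : K -> R, continuous f -> f k1 = f k2) -> k1 = k2.
  move=> s01 t01 k1E c1 H12.
  have := H12 _ (face_fun_continuous (e:=e) cst1).
  rewrite /face_fun /kglue c1 eqxx mulr1 => b12.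
  have bp : 0 < bump s * bump t by rewrite mulr_gt0 ?bump_gt0.
  case: (kpointP k2) => [/cpt_base c2|v u _ _ c2|e' s' t' s01' t01' k2E c2]; move: b12; rewrite c2.
  - by move=> b0; move: bp; rewrite b0 ltxx.
  - by move=> b0; move: bp; rewrite b0 ltxx.
  case: eqP => [ee|_ b0]; last by move: bp; rewrite b0 ltxx.
  rewrite mulr1 => /= bb.
  have := H12 _ (face_fun_continuous (e:=e) (@ct_fst R R)); have := H12 _ (face_fun_continuous (e:=e) (@ct_snd R R)).
  rewrite /face_fun /kglue c1 c2 ee eqxx /= -bb.
  have b0 : bump s * bump t != 0 by rewrite gt_eqF.
  move=> /(mulfI b0) tt /(mulfI b0) ss; by rewrite k1E k2E tt ss ee.
have Hedge v (k1 k2 : K) t : 0 < t < 1 -> k1 = kedge v t -> cpt k1 = Some (inl (v, t)) ->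
   (forall f : K -> R, continuous f -> f k1 = f k2) -> k1 = k2.
  move=> t01 k1E c1 H12.
  have := H12 _ (edge_fun_continuous (v:=v) cst1').
  rewrite /edge_fun /kglue c1 eqxx mulr1 => b12.
  have bp : 0 < bump t by rewrite bump_gt0.
  case: (kpointP k2) => [/cpt_base c2|v' u u01 k2E c2|e' s' t' s01' t01' k2E c2].
  - by move: b12; rewrite c2 => b0; move: bp; rewrite b0 ltxx.
  - move: b12; rewrite c2; case: eqP => [vv|_ b0]; last by move: bp; rewrite b0 ltxx.
    rewrite mulr1 => bb; have := H12 _ (edge_fun_continuous (v:=v) (@ct_id R)).
    rewrite /edge_fun /kglue c1 c2 vv eqxx -bb.
    by move=> /(mulfI (lt0r_neq0 bp)) tt; rewrite k1E k2E tt vv.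
  - by symmetry; apply: Hface s01' t01' k2E c2 _ => f cf; rewrite H12.
case: (kpointP k) => [bk|v u u01 kE c|e s t s01 t01 kE c].
- case: (kpointP k') => [bk'|v u u01 kE c|e s t s01 t01 kE c].
  + exact: base_uniq.
  + by symmetry; apply: Hedge u01 kE c _ => f cf; rewrite Hf.
  + by symmetry; apply: Hface s01 t01 kE c _ => f cf; rewrite Hf.
- exact: Hedge u01 kE c Hf.
- exact: Hface s01 t01 kE c Hf.
Qed.

Lemma KI_hausdorff : hausdorff_space (K * unit_interval R)%type.
Proof.
apply: (@sep_hausdorff R) => -[k i] [k' i'] ne.
case: (pselect (k = k')) => [kk|/K_separated[f cf fk]].
  exists (fun p => set_val p.2).
    by apply: (ct_comp (f := snd) (g := set_val)); [ctn|exact: set_val_continuous].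
  by move=> /= /val_inj ii; apply: ne; rewrite kk ii.
by exists (fun p => f p.1) => //; apply: (ct_comp (f := fst) (g := f)); [ctn|].
Qed.

Lemma K_continuous2 (Z : topologicalType) (F : K -> R -> Z) :
  (forall v, continuous (fun p : R * R => F (kedge v p.1) (clip p.2))) ->
  (forall e, continuous (fun p : R * R * R => F (kface e p.1) (clip p.2))) ->
  continuous (fun q : K * R => F q.1 (clip q.2)).
Proof.
move=> cv ce.
pose h (w : K * unit_interval R) := F w.1 (set_val w.2).
have hE : (fun q : K * R => F q.1 (clip q.2)) = (fun q => h (q.1, toI q.2)) by [].
rewrite hE; apply: (ct_comp (f := fun q : K * R => (q.1, toI q.2)) (g := h)).
  by apply: ct_pair; [ctn|apply: (ct_comp (f := snd) (g := @toI R)); [ctn|exact: toI_continuous]].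
pose q (i : V + E) (p : R * R * R) : K * unit_interval R :=
  (match i with inl v => kedge v p.1.1 | inr e => kface e p.1 end, toI p.2).
apply: (@compact_quot (V + E)%type _ _ _ (@Icube R) q h (@Icube_compact R) KI_hausdorff).
- case=> [v|e]; apply: ct_pair.
  + by apply: (ct_comp (f := fun p : R * R * R => p.1.1) (g := kedge v)); [ctn|exact: kedge_continuous].
  + by apply: (ct_comp (f := snd) (g := @toI R)); [ctn|exact: toI_continuous].
  + by apply: (ct_comp (f := fst) (g := kface e)); [ctn|exact: kface_continuous].
  + by apply: (ct_comp (f := snd) (g := @toI R)); [ctn|exact: toI_continuous].
- have in01 (x : R) : 0 < x < 1 -> x \in `[0, 1].
    by move=> /andP[h0 h1]; rewrite in_itv /= (ltW h0) (ltW h1).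
  have z01 : (0 : R) \in `[0, 1] by rewrite in_itv /= lexx ler01.
  move=> [k i]; have := set_mem (valP i); rewrite /= => i01.
  case: (kpointP k) => [bk|v t t01 kE _|e s t s01 t01 kE _].
  + move: bk => [[[v|e] p] [cp pk]].
      exists (inl v), (set_val p, 0, set_val i); split.
        by split=> //; split=> //; exact: set_mem (valP p).
      by rewrite /q /= toIK /cell_edge toIK pk.
    exists (inr e), (set_val p, set_val i); split; first by split=> //; exact: set_mem (valP p).
    by rewrite /q /= toIK /cell_face toSK pk.
  + exists (inl v), (t, 0, set_val i); split; first by split=> //; split=> //; exact: in01.
    by rewrite /q /= toIK kE.
  + exists (inr e), (s, t, set_val i); split; first by split=> //; split; exact: in01.
    by rewrite /q /= toIK kE.
- case=> [v|e].
    by apply: (ct_comp (f := fun p : R * R * R => (p.1.1, p.2)) (g := fun p : R * R => F (kedge v p.1) (clip p.2))); [ctn|exact: cv].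
  exact: ce.
Qed.

End KHausdorff.

(** * Contraction of the labelling map *)

Section Maps.
Context (R : realType) (V E : finType) (lsrc llab ltgt : E -> V).
Local Notation cplx := (cplx lsrc llab ltgt).
Local Notation o2r := (end_pt R).

Record fmap (L : cplx) (Z : Type) := FMap {
  mx : cX L -> Z; ma : cA L -> R -> Z; mb : cB L -> R -> R -> Z }.

Definition compat (L : cplx) (Z : Type) (f : fmap L Z) :=
  [/\ forall a o, ma f a (o2r o) = mx f (vt a o),
      forall b j s, mb f b s (o2r j) = ma f (hs b j) s &
      forall b i t, mb f b (o2r i) t = ma f (vs b i) t].

Definition fin_set (L : cplx) (Z : Type) (P : Z -> Prop) (f : fmap L Z) :=
  [/\ forall x, P (mx f x), forall a s, P (ma f a s) & forall b s t, P (mb f b s t)].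

Definition fcont (L : cplx) (Z : topologicalType) (F : R -> fmap L Z) :=
  [/\ forall x, continuous (fun t => mx (F t) x),
      forall a, continuous (fun q : R * R => ma (F q.2) a q.1) &
      forall b, continuous (fun q : R * R * R => mb (F q.2) b q.1.1 q.1.2)].

(** [P] confines the homotopy, for instance to the subcomplex of a sub-LOT, and the vertex [p0]
    stays at [z0]. *)
Definition fhom (L : cplx) (Z : topologicalType) (P : Z -> Prop) (z0 : Z) (p0 : cX L) (f g : fmap L Z) :=
  exists F : R -> fmap L Z, [/\ fcont F, (forall t, compat (F t)), (forall t, fin_set P (F t)),
    (forall t, mx (F t) p0 = z0) & F 0 = f /\ F 1 = g].

Lemma fmap_eq (L : cplx) Z (f g : fmap L Z) : (forall x, mx f x = mx g x) ->
  (forall a s, ma f a s = ma g a s) -> (forall b s t, mb f b s t = mb g b s t) -> f = g.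
Proof.
case: f g => [fx fa fb] [gx ga gb] /= h1 h2 h3.
by congr FMap; [exact/funext|apply/funext => ?; exact/funext|
  apply/funext => ?; apply/funext => ?; exact/funext].
Qed.

Lemma fhom_trans (L : cplx) (Z : topologicalType) (P : Z -> Prop) z0 (p0 : cX L) (f g h : fmap L Z) :
  fhom P z0 p0 f g -> fhom P z0 p0 g h -> fhom P z0 p0 f h.
Proof.
move=> [F [[F1 F2 F3] cF PF pF [F0 Fg]]] [G [[G1 G2 G3] cG PG pG [Gg Gh]]].
pose H t := if t <= 1/2 :> R then F (2 * t) else G (2 * t - 1).
have H1 t : t <= 1/2 -> H t = F (2 * t) by rewrite /H => ->.
have H2 t : 1/2 <= t -> H t = G (2 * t - 1).
  rewrite le_eqVlt => /orP[/eqP <-|lt]; last by rewrite /H leNgt lt.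
  rewrite H1 // (_ : 2 * (1 / 2) = 1); last by lra.
  by rewrite subrr Fg Gg.
exists H; split.
- split=> [x|a|b].
  + apply: (closed_pasting2 (c := fun t => t) (d := fun _ => 1/2)
      (g1 := fun t => mx (F (2 * t)) x) (g2 := fun t => mx (G (2 * t - 1)) x)); try by ctn.
    * by apply: (ct_comp (f := fun t : R => 2 * t) (g := fun t => mx (F t) x)) => //; ctn.
    * by apply: (ct_comp (f := fun t : R => 2 * t - 1) (g := fun t => mx (G t) x)) => //; ctn.
    * by move=> t /H1 ->.
    * by move=> t /H2 ->.
  + apply: (closed_pasting2 (c := fun q : R * R => q.2) (d := fun _ => 1/2)
      (g1 := fun q => ma (F (2 * q.2)) a q.1) (g2 := fun q => ma (G (2 * q.2 - 1)) a q.1)); try by ctn.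
    * by apply: (ct_comp (f := fun q : R * R => (q.1, 2 * q.2)) (g := fun q : R * R => ma (F q.2) a q.1)) => //; ctn.
    * by apply: (ct_comp (f := fun q : R * R => (q.1, 2 * q.2 - 1)) (g := fun q : R * R => ma (G q.2) a q.1)) => //; ctn.
    * by move=> t /H1 ->.
    * by move=> t /H2 ->.
  + apply: (closed_pasting2 (c := fun q : R * R * R => q.2) (d := fun _ => 1/2)
      (g1 := fun q => mb (F (2 * q.2)) b q.1.1 q.1.2) (g2 := fun q => mb (G (2 * q.2 - 1)) b q.1.1 q.1.2)); try by ctn.
    * by apply: (ct_comp (f := fun q : R * R * R => (q.1, 2 * q.2)) (g := fun q : R * R * R => mb (F q.2) b q.1.1 q.1.2)) => //; ctn.
    * by apply: (ct_comp (f := fun q : R * R * R => (q.1, 2 * q.2 - 1)) (g := fun q : R * R * R => mb (G q.2) b q.1.1 q.1.2)) => //; ctn.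
    * by move=> t /H1 ->.
    * by move=> t /H2 ->.
- by move=> t; rewrite /H; case: ifP.
- by move=> t; rewrite /H; case: ifP.
- by move=> t; rewrite /H; case: ifP.
- split; first by rewrite H1 ?mulr0 //; lra.
  rewrite H2; last by lra.
  by rewrite (_ : 2 * 1 - 1 = 1) //; lra.
Qed.

End Maps.

Section Kap.
Variable R : realType.
Implicit Types s t : R.
Local Notation o2r := (end_pt R).

(** The outer quarters of the interval are pushed to the ends. This makes maps constant near corners
    and leaves room to insert a path there. *)
Definition kap s : R := clip ((s - 1/4) * 2).
(** On the unit interval this is the distance from the end [o]; it also serves to reverse a
    coordinate. *)
Definition fl (o : bool) s : R := if o then 1 - s else s.

Lemma kap_cts : continuous kap.
Proof. by rewrite /kap /clip; ctn. Qed.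

Lemma fl_cts o : continuous (fl o).
Proof. by rewrite /fl; case: o => /=; ctn. Qed.

Lemma kap_in s : 0 <= kap s <= 1. Proof. exact: clip_in. Qed.

Variant clip_spec (x : R) : R -> Prop :=
| ClipL of x <= 0 : clip_spec x 0
| ClipM of 0 <= x & x <= 1 : clip_spec x x
| ClipR of 1 <= x : clip_spec x 1.

Lemma clipP x : clip_spec x (clip x).
Proof.
rewrite /clip; case: (leP x 1) => h1; case: (leP 0 _) => h0; constructor; lra.
Qed.

Lemma kap_lo s : s <= 1/4 -> kap s = 0.
Proof. by rewrite /kap => h; case: clipP => *; lra. Qed.
Lemma kap_hi s : 3/4 <= s -> kap s = 1.
Proof. by rewrite /kap => h; case: clipP => *; lra. Qed.

Lemma kap_o2r o : kap (o2r o) = o2r o.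
Proof. by case: o; [rewrite kap_hi|rewrite kap_lo] => //; rewrite /end_pt /=; lra. Qed.

Lemma kap_fl o s : kap (fl o s) = fl o (kap s).
Proof. by case: o => //=; rewrite /kap; case: clipP => *; case: clipP => *; lra. Qed.

Lemma flK o : involutive (fl o).
Proof. by case: o => s /=; lra. Qed.

Lemma fl_in o s : 0 <= s <= 1 -> 0 <= fl o s <= 1.
Proof. by case: o => /=; lra. Qed.

Lemma fl_clip o s : fl o (clip s) = clip (fl o s).
Proof. by case: o => //=; case: clipP => *; case: clipP => *; lra. Qed.

Lemma fl_o2r i j : fl i (o2r j) = o2r (i (+) j).
Proof. by case: i; case: j; rewrite /end_pt /=; lra. Qed.

Lemma fl_fl i j s : fl i (fl j s) = fl (i (+) j) s.
Proof. by case: i; case: j => /=; lra. Qed.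

Lemma fl_near o o' s : fl o s <= 1/4 -> fl o' s <= 1/4 -> o = o'.
Proof. by case: o; case: o' => //=; lra. Qed.

Lemma kap_near o s : fl o s <= 1/4 -> kap s = o2r o.
Proof. by case: o => /= h; [rewrite kap_hi|rewrite kap_lo]; rewrite /end_pt //=; lra. Qed.

(* replacing a map near the corners in [full] by a path *)
Section Paste.
Variables (I : finType) (full : pred I) (Z : Type).

Definition paste (m : I -> R) (g : R -> Z) (base : Z) : Z :=
  if [pick c | full c && (m c <= 1/4)] is Some c then g (4 * m c) else base.

Lemma paste_in m g base c : full c -> m c <= 1/4 -> (forall c', m c' <= 1/4 -> c' = c) ->
  paste m g base = g (4 * m c).
Proof.
move=> fc mc uc; rewrite /paste; case: pickP => [c' /andP[_ /uc -> //]|/(_ c)].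
by rewrite fc mc.
Qed.

Lemma paste_out m g base : (forall c, full c -> 1/4 <= m c) ->
  (forall c, full c -> m c = 1/4 -> base = g 1) -> paste m g base = base.
Proof.
move=> mc bc; rewrite /paste; case: pickP => // c /andP[fc mc'].
have e : m c = 1/4 by apply/eqP; rewrite eq_le mc' mc.
by rewrite e (bc c) //; congr g; lra.
Qed.

Lemma paste_P (P : Z -> Prop) m g base : (forall u, P (g u)) -> P base -> P (paste m g base).
Proof. by rewrite /paste; case: pickP. Qed.

End Paste.

(** Collars of different corners are disjoint, and on the rim [m c x = 1/4] of a full collar the
    base map equals [g 1]. *)
Lemma paste_cts (I : finType) (full : pred I) (Z T : topologicalType) (m : I -> T -> R)
    (g : R -> T -> Z) (base : T -> Z) :
  (forall c, continuous (m c)) -> continuous (fun q : R * T => g q.1 q.2) -> continuous base ->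
  (forall x c c', m c x <= 1/4 -> m c' x <= 1/4 -> c = c') ->
  (forall x c, full c -> m c x = 1/4 -> base x = g 1 x) ->
  continuous (fun x => paste full (m ^~ x) (g ^~ x) (base x)).
Proof.
move=> cm cg cb um bg.
pose C (k : option I) : set T := if k is Some c then (if full c then [set x | m c x <= 1/4] else set0)
  else \bigcap_(c in [set c | full c]) [set x | 1/4 <= m c x].
pose G (k : option I) x := if k is Some c then g (4 * m c x) x else base x.
apply: (@closed_pasting _ _ (option I) C G).
- case=> [c|] /=; first by case: ifP => _; [apply: closed_le; [exact: cm|ctn]|exact: closed0].
  by apply: closed_bigI => c _; apply: closed_le; [ctn|exact: cm].
- move=> x; case: (pickP (fun c => full c && (m c x <= 1/4))) => [c /andP[fc mc]|no].
    by exists (Some c); rewrite /C fc.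
  by exists None => c fc /=; have := no c; rewrite fc /= leNgt => /negbT; rewrite negbK => /ltW.
- case=> [c|] //=.
  apply: (ct_comp (f := fun x => (4 * m c x, x)) (g := fun q : R * T => g q.1 q.2)) => //.
  by ctn; exact: cm.
- case=> [c|] x /=; last first.
    by move=> h; apply: paste_out => c fc; [exact: h|exact: bg].
  case: ifP => // fc /= mc; apply: paste_in => // c' mc'; exact: um mc' mc.
Qed.

End Kap.

Section Around.
Variable R : realType.
Implicit Types x y u : R.

(** Assigns to a point of the square a parameter of [bdpath]. The last argument of [min] is the
    bilinear interpolation, in [kap x] and [kap y], of the parameters 1, 1/4, 1/2, 3/4 at the
    corners (0,0), (0,1), (1,1), (1,0). The maximum with [kap y / 4] gives the left side, and the
    ramp [4 * x] runs through the whole circuit on the first quarter of the bottom. *)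
Definition wind x y : R :=
  Num.max (kap y / 4) (Num.min (4 * x) (1 - kap x / 4 - 3 * kap y / 4 + kap x * kap y / 2)).

Lemma wind_cts : continuous (fun q : R * R => wind q.1 q.2).
Proof.
have c1 : continuous (fun q : R * R => kap q.1).
  by apply: (ct_comp (f := fst) (g := @kap R)); [ctn|exact: kap_cts].
have c2 : continuous (fun q : R * R => kap q.2).
  by apply: (ct_comp (f := snd) (g := @kap R)); [ctn|exact: kap_cts].
by rewrite /wind; ctn.
Qed.

Let mxl (a b : R) : b <= a -> Num.max a b = a. Proof. by move/max_l. Qed.
Let mxr (a b : R) : a <= b -> Num.max a b = b. Proof. by move/max_r. Qed.
Let mnl (a b : R) : a <= b -> Num.min a b = a. Proof. by move/min_l. Qed.
Let mnr (a b : R) : b <= a -> Num.min a b = b. Proof. by move/min_r. Qed.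

Lemma wind_top x y : 0 <= x <= 1 -> kap y = 1 -> wind x y = 1/4 + kap x / 4.
Proof.
move=> x01 yE; rewrite /wind yE; have := kap_in x => /andP[k0 k1].
case: (leP x (1/4)) => h.
  rewrite (kap_lo h) mxl; first by lra.
  by rewrite ge_min; apply/orP; right; lra.
by rewrite mnr ?mxr; lra.
Qed.

Lemma wind_bot x y : 0 <= x <= 1 -> kap y = 0 -> 1/4 <= x -> wind x y = 1 - kap x / 4.
Proof.
move=> x01 yE h; rewrite /wind yE; have := kap_in x => /andP[k0 k1].
by rewrite mnr ?mxr; lra.
Qed.

Lemma wind_bot0 x y : 0 <= x <= 1 -> kap y = 0 -> x <= 1/4 -> wind x y = 4 * x.
Proof.
move=> x01 yE h; rewrite /wind yE (kap_lo h).
by rewrite mnl ?mxr; lra.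
Qed.

Lemma wind_left y : wind 0 y = kap y / 4.
Proof.
rewrite /wind (kap_lo (s:=0)); last by lra.
have := kap_in y => /andP[k0 k1]; rewrite mxl //.
by rewrite ge_min; apply/orP; left; lra.
Qed.

Lemma wind_right x y : 3/4 <= x -> wind x y = 3/4 - kap y / 4.
Proof.
move=> h; rewrite /wind (kap_hi h); have := kap_in y => /andP[k0 k1].
by rewrite mnr ?mxr; lra.
Qed.

(* the boundary of the square, counterclockwise from the origin along the left side *)
Definition bdpath u : R * R :=
  (clip (Num.min (4 * u - 1) (4 - 4 * u)), clip (Num.min (4 * u) (3 - 4 * u))).

Lemma bdpath_cts : continuous bdpath.
Proof. by rewrite /bdpath /clip; ctn. Qed.

Let c0 x : x <= 0 -> clip x = 0. Proof. by case: clipP => *; lra. Qed.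
Let c1 x : 1 <= x -> clip x = 1. Proof. by case: clipP => *; lra. Qed.

Lemma bdpath_left x : 0 <= x <= 1 -> bdpath (x / 4) = (0, x).
Proof.
move=> h; rewrite /bdpath [Num.min (4 * _) _]mnl; last by lra.
rewrite c0; last by rewrite ge_min; apply/orP; left; lra.
by rewrite clip_id; [congr pair|]; lra.
Qed.

Lemma bdpath_top x : 0 <= x <= 1 -> bdpath (1/4 + x / 4) = (x, 1).
Proof.
move=> h; rewrite /bdpath [Num.min (4 * _ - 1) _]mnl; last by lra.
rewrite [clip (Num.min _ _)]c1; last by rewrite le_min; apply/andP; split; lra.
by rewrite clip_id; [congr pair|]; lra.
Qed.

Lemma bdpath_right x : 0 <= x <= 1 -> bdpath (3/4 - x / 4) = (1, x).
Proof.
move=> h; rewrite /bdpath c1; last by rewrite le_min; apply/andP; split; lra.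
rewrite mnr; last by lra.
by rewrite clip_id; [congr pair|]; lra.
Qed.

Lemma bdpath_bot x : 0 <= x <= 1 -> bdpath (1 - x / 4) = (x, 0).
Proof.
move=> h; rewrite /bdpath [Num.min (4 * _ - 1) _]mnr; last by lra.
rewrite [clip (Num.min _ _)]c0; last by rewrite ge_min; apply/orP; right; lra.
by rewrite clip_id; [congr pair|]; lra.
Qed.

Section Cat4.
Variables (Z T : topologicalType) (e n : bool -> R -> T -> Z).
Hypothesis ce : forall y : bool, continuous (fun q : R * T => e y q.1 q.2).
Hypothesis cn : forall y : bool, continuous (fun q : R * T => n y q.1 q.2).
Hypothesis j1 : forall t, n false 1 t = e true 0 t.
Hypothesis j2 : forall t, e true 1 t = n true 1 t.
Hypothesis j3 : forall t, n true 0 t = e false 1 t.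

(** Four side maps concatenated with the parametrisation of [bdpath]; the right and bottom sides are
    run backwards. *)
Definition cat4 u t : Z :=
  if u <= 1/4 then n false (4 * u) t else if u <= 1/2 then e true (4 * u - 1) t
  else if u <= 3/4 then n true (3 - 4 * u) t else e false (4 - 4 * u) t.

Lemma cat4_left x t : x <= 1 -> cat4 (x / 4) t = n false x t.
Proof. by move=> h; rewrite /cat4 ifT; [congr n|]; lra. Qed.

Lemma cat4_top x t : 0 <= x <= 1 -> cat4 (1/4 + x / 4) t = e true x t.
Proof.
move=> h; rewrite /cat4; case: ifP => h1.
  have -> : x = 0 by lra.
  by rewrite -j1; congr n; lra.
by rewrite ifT; [congr e|]; lra.
Qed.

Lemma cat4_right x t : 0 <= x <= 1 -> cat4 (3/4 - x / 4) t = n true x t.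
Proof.
move=> h; rewrite /cat4 ifF; last by apply/negbTE; rewrite -ltNge; lra.
case: ifP => h1.
  have -> : x = 1 by lra.
  by rewrite -j2; congr e; lra.
by rewrite ifT; [congr n|]; lra.
Qed.

Lemma cat4_bot x t : 0 <= x <= 1 -> cat4 (1 - x / 4) t = e false x t.
Proof.
move=> h; rewrite /cat4 ifF; last by apply/negbTE; rewrite -ltNge; lra.
rewrite ifF; last by apply/negbTE; rewrite -ltNge; lra.
case: ifP => h1.
  have -> : x = 1 by lra.
  by rewrite -j3; congr n; lra.
by congr e; lra.
Qed.

Lemma cat4_cts : continuous (fun q : R * T => cat4 q.1 q.2).
Proof.
have cc (k : bool -> R -> T -> Z) (y : bool) (f : R -> R) : continuous f -> (forall y : bool, continuous (fun q : R * T => k y q.1 q.2)) ->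
   continuous (fun q : R * T => k y (f q.1) q.2).
  move=> cf ck; apply: (ct_comp (f := fun q : R * T => (f q.1, q.2)) (g := fun q : R * T => k y q.1 q.2)); last exact: ck.
  by apply: ct_pair; [apply: (ct_comp (f := fst) (g := f)); ctn|ctn].
pose k1 (q : R * T) := if q.1 <= 3/4 then n true (3 - 4 * q.1) q.2 else e false (4 - 4 * q.1) q.2.
have ck1 : continuous k1.
  apply: (closed_pasting2 (c := fst) (d := fun=> 3/4)
    (g1 := fun q => n true (3 - 4 * q.1) q.2) (g2 := fun q => e false (4 - 4 * q.1) q.2)); try by ctn.
  - by apply: (cc n true (fun u => 3 - 4 * u)) => //; ctn.
  - by apply: (cc e false (fun u => 4 - 4 * u)) => //; ctn.
  - by move=> q; rewrite /k1 => ->.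
  - move=> q; rewrite /k1; case: ifP => // h1 h2; have -> : q.1 = 3/4 by lra.
    have -> : 3 - 4 * (3/4) = 0 :> R by lra.
    have -> : 4 - 4 * (3/4) = 1 :> R by lra.
    exact: j3.
pose k2 (q : R * T) := if q.1 <= 1/2 then e true (4 * q.1 - 1) q.2 else k1 q.
have ck2 : continuous k2.
  apply: (closed_pasting2 (c := fst) (d := fun=> 1/2)
    (g1 := fun q => e true (4 * q.1 - 1) q.2) (g2 := k1)); try by ctn.
  - by apply: (cc e true (fun u => 4 * u - 1)) => //; ctn.
  - by move=> q; rewrite /k2 => ->.
  - move=> q; rewrite /k2; case: ifP => // h1 h2; rewrite /k1 ifT; last by lra.
    have -> : q.1 = 1/2 by lra.
    have -> : 3 - 4 * (1/2) = 1 :> R by lra.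
    have -> : 4 * (1/2) - 1 = 1 :> R by lra.
    exact: j2.
apply: (closed_pasting2 (c := fst) (d := fun=> 1/4)
    (g1 := fun q => n false (4 * q.1) q.2) (g2 := k2)); try by ctn.
- by apply: (cc n false (fun u => 4 * u)) => //; ctn.
- by move=> q; rewrite /cat4 => ->.
- move=> q; rewrite /cat4; case: ifP => // h1 h2; rewrite /k2 ifT; last by lra.
  have -> : q.1 = 1/4 by lra.
  have -> : 4 * (1/4) = 1 :> R by lra.
  rewrite subrr; exact: j1.
Qed.

End Cat4.
End Around.

(** * Transferring a map from the split complex back *)

Section Stretch.
Context (R : realType) (V E : finType) (lsrc llab ltgt : E -> V).
Local Notation cplx := (cplx lsrc llab ltgt).
Local Notation o2r := (end_pt R).
Variables (J : {set V}) (L : cplx) (p : cX L) (S : cA L -> bool -> bool) (f : cB L) (i j : bool).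
Variable br : is_bridge J p S f i j.
Local Notation L' := (split_cplx (bridge_keep br)).

(** Away from the bridge corner, a corner has both ends in [S], and is then full, or none. *)
Definition full b (c : bool * bool) := S (hs b c.2) c.1 && S (vs b c.1) c.2.

Lemma full_nsep b o k : (b, o, k) != (f, i, j) -> S (hs b k) o = full b (o, k) /\ S (vs b o) k = full b (o, k).
Proof.
move=> ne; have [_ sP _] := br; have := sP b o k; rewrite (negbTE ne) /sep /full /=.
by case: (S (hs b k) o); case: (S (vs b o) k).
Qed.

Lemma full_neq b o k : full b (o, k) -> (b, o, k) != (f, i, j).
Proof.
have [_ sP _] := br; have := sP b o k; rewrite /sep /full /= => <-.
by case: (S (hs b k) o); case: (S (vs b o) k).
Qed.

(* the axis of the side of f that ends in S at the bridge corner *)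
Definition swapped := S (vs f i) j.
Local Notation sw := swapped.

Lemma swN : S (hs f j) i = ~~ sw.
Proof.
have [_ sP _] := br; have := sP f i j; rewrite eqxx /sep /swapped.
by case: (S (hs f j) i); case: (S (vs f i) j).
Qed.

Definition loc (s t : R) : R * R := if sw then (fl j t, fl i s) else (fl i s, fl j t).
(** In the coordinates of [loc], [eside y] is parallel to the first axis at height [y], and
    [nside y] is parallel to the second one. *)
Definition eside y := if sw then vs f (i (+) y) else hs f (j (+) y).
Definition nside y := if sw then hs f (j (+) y) else vs f (i (+) y).
Definition eflip := if sw then j else i.
Definition nflip := if sw then i else j.

Lemma loc_cts : continuous (fun q : R * R => loc q.1 q.2).
Proof.
have c1 : continuous (fun q : R * R => fl i q.1).
  by apply: (ct_comp (f := fst) (g := @fl R i)); [ctn|exact: fl_cts].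
have c2 : continuous (fun q : R * R => fl j q.2).
  by apply: (ct_comp (f := snd) (g := @fl R j)); [ctn|exact: fl_cts].
by rewrite /loc; case: sw => /=; ctn.
Qed.

Definition cm (c : bool * bool) (s t : R) : R := Num.max (fl c.1 s) (fl c.2 t).

Lemma cm_le c s t : (cm c s t <= 1/4) = (fl c.1 s <= 1/4) && (fl c.2 t <= 1/4).
Proof. by rewrite /cm ge_max. Qed.

Lemma cm_near c c' s t : cm c s t <= 1/4 -> cm c' s t <= 1/4 -> c = c'.
Proof.
case: c c' => [o k] [o' k']; rewrite !cm_le /= => /andP[h1 h2] /andP[h3 h4].
by rewrite (fl_near h1 h3) (fl_near h2 h4).
Qed.

Section Def.
Variables (Z : Type) (Psi : fmap R L' Z) (g : R -> Z) (be : R -> R -> Z).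

Definition ep y x := ma Psi (eside y) (fl eflip x).
Definition np y x := ma Psi (nside y) (fl nflip x).

Definition sbase b s t := if insub b : option {b : cB L | predC1 f b} is Some b'
  then mb Psi b' (kap s) (kap t) else be (loc s t).1 (loc s t).2.

(** An end in [S] gets a collar of length 1/4 on which [g] leads from the copy [Some p] to [None];
    full corners of faces get the same collar. Beyond the collars the map of the split complex is
    used, rescaled by [kap]. *)
Definition stretch : fmap R L Z := FMap (fun x => mx Psi (Some x))
  (fun a s => paste (S a) (fun o => fl o (clip s)) g (ma Psi a (kap (clip s))))
  (fun b s t => paste (full b) (fun c => cm c (clip s) (clip t)) g (sbase b (clip s) (clip t))).

(* [be] fills the square f, with the stretched maps on its sides; the bridge
   corner is put at the origin and the side ending in S on the first axis *)
Record fills : Prop := Fills {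
  fcompat : compat Psi;
  fg0 : g 0 = mx Psi (Some p); fg1 : g 1 = mx Psi None;
  fb1 : forall x, 0 <= x <= 1 -> be x 1 = ep true (kap x);
  fb2 : forall x, 0 <= x <= 1/4 -> be x 0 = g (4 * x);
  fb2' : forall x, 1/4 <= x <= 1 -> be x 0 = ep false (kap x);
  fb3 : forall y, 0 <= y <= 1 -> be 0 y = np false (kap y);
  fb4 : forall y, 0 <= y <= 1 -> be 1 y = np true (kap y);
  fb5 : forall o y x t, o || y -> 0 <= x <= 1 -> 0 <= t <= 1 -> fl o x <= 1/4 -> fl y t <= 1/4 ->
    be x t = ep y (o2r o) }.

Hypothesis fi : fills.

Lemma edge_end a o : S a o -> ma Psi a (o2r o) = g 1.
Proof.
have [h _ _] := fcompat fi; move=> Sa; rewrite h (fg1 fi) /=.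
by rewrite /svt Sa.
Qed.

Lemma edge_out a s : (forall o, S a o -> 1/4 <= fl o s) ->
  paste (S a) (fun o => fl o s) g (ma Psi a (kap s)) = ma Psi a (kap s).
Proof.
move=> h; apply: paste_out => // o So /eqP; rewrite eq_le => /andP[/kap_near -> _].
exact: edge_end.
Qed.

Lemma edge_in a o s z : S a o -> fl o s <= 1/4 -> paste (S a) (fun o => fl o s) g z = g (4 * fl o s).
Proof. by move=> Sa h; apply: paste_in => // o' h'; exact: fl_near h' h. Qed.

Let ff (o k : bool) : o (+) (o (+) k) = k. Proof. by case: o; case: k. Qed.
Let xb (o k : bool) : o (+) k = k (+) o. Proof. by case: o; case: k. Qed.

(** Near a full corner the base map is constant: outside [f] because [kap] is, on [f] by [fb5],
    since the bridge corner is not full. Hence a collar fits in continuously. *)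
Lemma sbase_corner b c s t : 0 <= s <= 1 -> 0 <= t <= 1 -> full b c -> cm c s t <= 1/4 -> sbase b s t = g 1.
Proof.
case: c => o k s01 t01 fc; rewrite cm_le /= => /andP[ho hk].
have /andP[/= Sh Sv] := fc.
rewrite /sbase; case: insubP => [b' _ bE|].
  rewrite (kap_near ho) (kap_near hk); have [_ hb _] := fcompat fi.
  by rewrite hb /= bE edge_end.
rewrite negbK => /eqP bf; subst b.
have ne : (o (+) i) || (k (+) j).
  by have := full_neq fc; rewrite !xpair_eqE eqxx /=; case: (o) (i) (k) (j) => -[] [] [].
rewrite /loc; case swE: sw => /=.
  rewrite (fb5 fi (o := k (+) j) (y := o (+) i)); last 5 first.
  - by rewrite orbC.
  - exact: fl_in.
  - exact: fl_in.
  - by rewrite fl_fl addbK.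
  - by rewrite fl_fl addbK.
  by rewrite /ep /eside /eflip swE fl_o2r [o (+) i]xb [k (+) j]xb !ff edge_end.
rewrite (fb5 fi (o := o (+) i) (y := k (+) j)); last 5 first.
- by [].
- exact: fl_in.
- exact: fl_in.
- by rewrite fl_fl addbK.
- by rewrite fl_fl addbK.
by rewrite /ep /eside /eflip swE fl_o2r [o (+) i]xb [k (+) j]xb !ff edge_end.
Qed.

Let fl0 k : fl k (o2r k) = 0. Proof. by rewrite fl_o2r addbb. Qed.

Lemma stretch_hs b k s : mb stretch b s (o2r k) = ma stretch (hs b k) s.
Proof.
rewrite /= clip_o2r; have := clip_in s; move: (clip s) => {}s s01.
case: (boolP [exists o, full b (o, k) && (fl o s <= 1/4)]) => [/existsP[o /andP[fo ho]]|no].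
  have mE : cm (o, k) s (o2r k) = fl o s.
    by rewrite /cm /= fl0 max_l //; case/andP: (fl_in o s01).
  rewrite (@paste_in _ _ _ _ (fun c => cm c s (o2r k)) _ _ (o, k)) ?mE //; last first.
    by move=> c' h'; apply: cm_near h' _; rewrite mE.
  by rewrite (edge_in (o := o)) //; case/andP: fo.
have {}no o : full b (o, k) -> 1/4 < fl o s.
  move=> fo; rewrite ltNge; apply/negP => h; case/negP: no; apply/existsP; exists o.
  by rewrite fo h.
rewrite paste_out; last 2 first.
- case=> o k' fo; rewrite leNgt; apply/negP => /ltW; rewrite cm_le /= => /andP[h1 h2].
  have kk : k' = k by apply: (fl_near h2); rewrite fl0; lra.
  by subst k'; have := no o fo; lra.
- move=> c fc mE; apply: (sbase_corner (c := c)) => //; last by rewrite mE.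
  by rewrite /end_pt; case: (k) => /=; lra.
rewrite /sbase; case: insubP => [b' nb bE|].
  have [_ hb _] := fcompat fi; rewrite kap_o2r hb /= bE edge_out // => o So.
  by apply/ltW/no; rewrite -(proj1 (full_nsep _)) // !xpair_eqE (negbTE nb).
rewrite negbK => /eqP bf; subst b.
have nE o : (o, k) != (i, j) -> S (hs f k) o -> 1/4 <= fl o s.
  move=> ne So; apply/ltW/no; rewrite -(proj1 (full_nsep _)) //.
  by apply: contra ne => /eqP[-> ->].
rewrite /loc; case swE: sw => /=; rewrite fl_o2r.
  have out o : S (hs f k) o -> 1/4 <= fl o s.
    move=> So; apply: nE => //; apply/negP => /eqP[oi kj]; move: So.
    by rewrite oi kj swN swE.
  have e2 : ma Psi (hs f k) (kap s) = np (j (+) k) (kap (fl i s)).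
    by rewrite /np /nside /nflip swE ff kap_fl flK.
  rewrite edge_out // e2; case: (j (+) k).
    by apply: (fb4 fi); exact: fl_in.
  by apply: (fb3 fi); exact: fl_in.
have e2 : ma Psi (hs f k) (kap s) = ep (j (+) k) (kap (fl i s)).
  by rewrite /ep /eside /eflip swE ff kap_fl flK.
(* For [k = j] this side ends in [S] at the bridge corner, and [g] runs along its first quarter. *)
case: (eqVneq k j) => [kj|nkj].
  have Si : S (hs f k) i by rewrite kj swN swE.
  case: (leP (fl i s) (1/4)) => h.
    rewrite kj addbb (fb2 fi); last by case/andP: (fl_in i s01) => ->.
    by rewrite (edge_in (o := i)) -?kj.
  rewrite edge_out; last first.
    move=> o So; case: (eqVneq o i) => [->|ne]; first exact: ltW.
    by apply: nE => //; rewrite xpair_eqE (negbTE ne).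
  rewrite e2 kj addbb (fb2' fi) // ltW //=; by case/andP: (fl_in i s01).
have jk : j (+) k = true by move: nkj; case: (j); case: (k).
rewrite edge_out; first by rewrite e2 jk (fb1 fi) //; exact: fl_in.
by move=> o So; apply: nE => //; rewrite xpair_eqE (negbTE nkj) andbF.
Qed.

Lemma stretch_vs b k s : mb stretch b (o2r k) s = ma stretch (vs b k) s.
Proof.
rewrite /= clip_o2r; have := clip_in s; move: (clip s) => {}s s01.
case: (boolP [exists o, full b (k, o) && (fl o s <= 1/4)]) => [/existsP[o /andP[fo ho]]|no].
  have mE : cm (k, o) (o2r k) s = fl o s.
    by rewrite /cm /= fl0 max_r //; case/andP: (fl_in o s01).
  rewrite (@paste_in _ _ _ _ (fun c => cm c (o2r k) s) _ _ (k, o)) ?mE //; last first.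
    by move=> c' h'; apply: cm_near h' _; rewrite mE.
  by rewrite (edge_in (o := o)) //; case/andP: fo.
have {}no o : full b (k, o) -> 1/4 < fl o s.
  move=> fo; rewrite ltNge; apply/negP => h; case/negP: no; apply/existsP; exists o.
  by rewrite fo h.
rewrite paste_out; last 2 first.
- case=> k' o fo; rewrite leNgt; apply/negP => /ltW; rewrite cm_le /= => /andP[h1 h2].
  have kk : k' = k by apply: (fl_near h1); rewrite fl0; lra.
  by subst k'; have := no o fo; lra.
- move=> c fc mE; apply: (sbase_corner (c := c)) => //; last by rewrite mE.
  by rewrite /end_pt; case: (k) => /=; lra.
rewrite /sbase; case: insubP => [b' nb bE|].
  have [_ _ hb] := fcompat fi; rewrite kap_o2r hb /= bE edge_out // => o So.
  by apply/ltW/no; rewrite -(proj2 (full_nsep _)) // !xpair_eqE (negbTE nb).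
rewrite negbK => /eqP bf; subst b.
have nE o : (k, o) != (i, j) -> S (vs f k) o -> 1/4 <= fl o s.
  move=> ne So; apply/ltW/no; rewrite -(proj2 (full_nsep _)) //.
  by apply: contra ne => /eqP[-> ->].
rewrite /loc; case swE: sw => /=; rewrite fl_o2r; last first.
  have out o : S (vs f k) o -> 1/4 <= fl o s.
    move=> So; apply: nE => //; apply/negP => /eqP[oi kj]; move: So.
    by rewrite oi kj -/swapped swE.
  have e2 : ma Psi (vs f k) (kap s) = np (i (+) k) (kap (fl j s)).
    by rewrite /np /nside /nflip swE ff kap_fl flK.
  rewrite edge_out // e2; case: (i (+) k).
    by apply: (fb4 fi); exact: fl_in.
  by apply: (fb3 fi); exact: fl_in.
have e2 : ma Psi (vs f k) (kap s) = ep (i (+) k) (kap (fl j s)).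
  by rewrite /ep /eside /eflip swE ff kap_fl flK.
case: (eqVneq k i) => [kj|nkj].
  have Si : S (vs f k) j by rewrite kj -/swapped swE.
  case: (leP (fl j s) (1/4)) => h.
    rewrite kj addbb (fb2 fi); last by case/andP: (fl_in j s01) => ->.
    by rewrite (edge_in (o := j)) -?kj.
  rewrite edge_out; last first.
    move=> o So; case: (eqVneq o j) => [->|ne]; first exact: ltW.
    by apply: nE => //; rewrite xpair_eqE (negbTE ne) andbF.
  rewrite e2 kj addbb (fb2' fi) // ltW //=; by case/andP: (fl_in j s01).
have jk : i (+) k = true by move: nkj; case: (i); case: (k).
rewrite edge_out; first by rewrite e2 jk (fb1 fi) //; exact: fl_in.
by move=> o So; apply: nE => //; rewrite xpair_eqE (negbTE nkj).
Qed.

Lemma stretch_compat : compat stretch.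
Proof.
split; [|exact: stretch_hs|exact: stretch_vs] => a o.
rewrite /= clip_o2r; case: (boolP (S a o)) => So.
  rewrite (edge_in (o := o)) // fl0; last by lra.
  by rewrite mulr0 (fg0 fi); have [Sp _ _] := br; rewrite (Sp _ _ So).
rewrite edge_out; last first.
  move=> o' So'; have : o' != o by apply: contra So => /eqP <-.
  by rewrite fl_o2r /end_pt; case: (o'); case: (o) => //= _; lra.
by have [h _ _] := fcompat fi; rewrite kap_o2r h /= /svt (negbTE So).
Qed.

End Def.

Lemma stretch_fin (Z : Type) (P : Z -> Prop) (Psi : fmap R L' Z) g be :
  fin_set P Psi -> (forall u, P (g u)) -> (forall x y, P (be x y)) -> fin_set P (stretch Psi g be).
Proof.
move=> [h1 h2 h3] hg hb; split=> [x|a s|b s t] /=; first exact: h1.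
  exact: paste_P.
by apply: paste_P => //; rewrite /sbase; case: insubP.
Qed.

Lemma stretch_fcont (Z : topologicalType) (F : R -> fmap R L' Z) (g : R -> R -> Z) (be : R -> R -> R -> Z) :
  fcont F -> continuous (fun q : R * R => g q.1 q.2) -> continuous (fun q : R * R * R => be q.1.1 q.1.2 q.2) ->
  (forall t, fills (F t) (g ^~ t) (fun x y => be x y t)) ->
  fcont (fun t => stretch (F t) (g ^~ t) (fun x y => be x y t)).
Proof.
move=> [F1 F2 F3] cg cb fi; split.
- by move=> x; exact: F1.
- move=> a /=.
  apply: (paste_cts (full := S a) (m := fun o (q : R * R) => fl o (clip q.1)) (g := fun u (q : R * R) => g u q.2)
    (base := fun q : R * R => ma (F q.2) a (kap (clip q.1)))).
  + move=> o; apply: (ct_comp (f := fun q : R * R => clip q.1) (g := @fl R o)); last exact: fl_cts.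
    by apply: (ct_comp (f := fst) (g := @clip R)); [ctn|exact: clip_continuous].
  + by apply: (ct_comp (f := fun q : R * (R * R) => (q.1, q.2.2)) (g := fun q : R * R => g q.1 q.2)) => //; ctn.
  + apply: (ct_comp (f := fun q : R * R => (kap (clip q.1), q.2)) (g := fun q : R * R => ma (F q.2) a q.1)); last exact: F2.
    apply: ct_pair; last by ctn.
    apply: (ct_comp (f := fun q : R * R => clip q.1) (g := @kap R)); last exact: kap_cts.
    by apply: (ct_comp (f := fst) (g := @clip R)); [ctn|exact: clip_continuous].
  + by move=> q o o'; exact: fl_near.
  + move=> q o So /eqP; rewrite eq_le => /andP[/kap_near -> _]; exact: (edge_end (fi q.2) So).
- move=> b /=.
  have cc1 : continuous (fun q : R * R * R => clip q.1.1).
    by apply: (ct_comp (f := fun q : R * R * R => q.1.1) (g := @clip R)); [ctn|exact: clip_continuous].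
  have cc2 : continuous (fun q : R * R * R => clip q.1.2).
    by apply: (ct_comp (f := fun q : R * R * R => q.1.2) (g := @clip R)); [ctn|exact: clip_continuous].
  apply: (paste_cts (full := full b) (m := fun c (q : R * R * R) => cm c (clip q.1.1) (clip q.1.2))
    (g := fun u (q : R * R * R) => g u q.2)
    (base := fun q : R * R * R => sbase (F q.2) (fun x y => be x y q.2) b (clip q.1.1) (clip q.1.2))).
  + move=> c; apply: ct_max.
      by apply: (ct_comp (f := fun q : R * R * R => clip q.1.1) (g := @fl R c.1)) => //; exact: fl_cts.
    by apply: (ct_comp (f := fun q : R * R * R => clip q.1.2) (g := @fl R c.2)) => //; exact: fl_cts.
  + by apply: (ct_comp (f := fun q : R * (R * R * R) => (q.1, q.2.2)) (g := fun q : R * R => g q.1 q.2)) => //; ctn.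
  + rewrite /sbase; case: insubP => [b' _ _|_].
      apply: (ct_comp (f := fun q : R * R * R => (kap (clip q.1.1), kap (clip q.1.2), q.2))
        (g := fun q : R * R * R => mb (F q.2) b' q.1.1 q.1.2)); last exact: F3.
      apply: ct_pair; last by ctn.
      by apply: ct_pair; [apply: (ct_comp (f := fun q : R * R * R => clip q.1.1) (g := @kap R))|
        apply: (ct_comp (f := fun q : R * R * R => clip q.1.2) (g := @kap R))] => //; exact: kap_cts.
    apply: (ct_comp (f := fun q : R * R * R => (loc (clip q.1.1) (clip q.1.2), q.2))
        (g := fun q : R * R * R => be q.1.1 q.1.2 q.2)) => //.
    apply: ct_pair; last by ctn.
    apply: (ct_comp (f := fun q : R * R * R => (clip q.1.1, clip q.1.2)) (g := fun q : R * R => loc q.1 q.2)).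
      by ctn.
    exact: loc_cts.
  + by move=> q c c'; exact: cm_near.
  + move=> q c fc mE; apply: (sbase_corner (fi q.2) (c := c)) => //; try exact: clip_in.
    by rewrite mE.
Qed.

End Stretch.

(** * Contracting across one bridge *)

Section Contract.
Context (R : realType) (V E : finType) (lsrc llab ltgt : E -> V).
Local Notation cplx := (cplx lsrc llab ltgt).
Local Notation o2r := (end_pt R).
Local Notation K := (LOGcomplex R lsrc llab ltgt).
Local Notation kedge := (@cell_edge R V E lsrc llab ltgt).
Local Notation kface := (@cell_face R V E lsrc llab ltgt).
Variables (k0 : K) (k0P : is_basep k0).
Variables (W : {set V}) (P : K -> Prop).
Hypothesis Pk0 : P k0.
Hypothesis Pe : forall v s, v \in W -> P (kedge v s).
Hypothesis Pf : forall e q, e \in Ein lsrc ltgt W -> P (kface e q).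

Definition phi (L : cplx) : fmap R L K :=
  FMap (fun=> k0) (fun a s => kedge (al a) s) (fun b s t => kface (bl b) (s, t)).
Definition fcst (L : cplx) : fmap R L K := FMap (fun=> k0) (fun _ _ => k0) (fun _ _ _ => k0).

Lemma kedge_o2r v o : kedge v (o2r o) = k0.
Proof.
apply: base_uniq k0P; apply: kedge_base; rewrite clip_o2r.
by case: o; [right|left].
Qed.

Lemma phi_compat L : compat (phi L).
Proof.
split=> [a o|b j s|b i t] /=; first exact: kedge_o2r.
  by rewrite kface_h hsP.
by rewrite kface_v vsP.
Qed.

Lemma over_bl (L : cplx) (b : cB L) : over L W -> bl b \in Ein lsrc ltgt W.
Proof.
move=> oL; have := oL (hs b false); have := oL (hs b true); rewrite !hsP.
by move=> h1 h2; rewrite in_Ein; apply/forallP => -[].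
Qed.

Lemma phi_fin L : over L W -> fin_set P (phi L).
Proof. by move=> oL; split=> [x|a s|b s t] //=; [exact: Pe|exact/Pf/over_bl]. Qed.

Lemma kap_clip s : kap (clip s) = kap (s : R).
Proof.
case: (clipP s) => [h|//|h]; first by rewrite !kap_lo //; lra.
by rewrite !kap_hi //; lra.
Qed.

Definition kt (t s : R) : R := (1 - t) * clip s + t * kap s.

Lemma kt_cts : continuous (fun q : R * R => kt q.2 q.1).
Proof. by rewrite /kt /kap /clip; ctn. Qed.

Definition phik (L : cplx) : fmap R L K :=
  FMap (fun=> k0) (fun a s => kedge (al a) (kap s)) (fun b s t => kface (bl b) (kap s, kap t)).

Lemma phi_kap L p0 : over L W -> fhom P k0 p0 (phi L) (phik L).
Proof.
move=> oL; exists (fun t => FMap (fun=> k0) (fun a s => kedge (al a) (kt t s))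
   (fun b s t' => kface (bl b) (kt t s, kt t t'))).
have ktE t o : kt t (o2r o) = o2r o by rewrite /kt clip_o2r kap_o2r -mulrDl subrK mul1r.
split=> //.
- split=> [x|a|b] /=; first by ctn.
    by apply: (ct_comp (f := fun q : R * R => kt q.2 q.1) (g := kedge (al a))); [exact: kt_cts|exact: kedge_continuous].
  apply: (ct_comp (f := fun q : R * R * R => (kt q.2 q.1.1, kt q.2 q.1.2)) (g := kface (bl b))); last exact: kface_continuous.
  apply: ct_pair.
    by apply: (ct_comp (f := fun q : R * R * R => (q.1.1, q.2)) (g := fun q : R * R => kt q.2 q.1)); [ctn|exact: kt_cts].
  by apply: (ct_comp (f := fun q : R * R * R => (q.1.2, q.2)) (g := fun q : R * R => kt q.2 q.1)); [ctn|exact: kt_cts].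
- move=> t; split=> [a o|b j s|b i s] /=; rewrite ktE ?kedge_o2r //.
    by rewrite kface_h hsP.
  by rewrite kface_v vsP.
- by move=> t; split=> [x|a s|b s t'] //=; [exact: Pe|exact/Pf/over_bl].
- split; apply: fmap_eq => //= *; rewrite /kt.
  + by rewrite subr0 mul1r mul0r addr0 kedge_clip.
  + by rewrite subr0 !mul1r !mul0r !addr0 kface_clip.
  + by rewrite subrr mul0r mul1r add0r.
  + by rewrite subrr !mul0r !mul1r !add0r.
Qed.

Section Step.
Variables (J : {set V}) (L : cplx) (p : cX L) (S : cA L -> bool -> bool) (f : cB L) (i j : bool).
Variable br : is_bridge J p S f i j.
Local Notation L' := (split_cplx (bridge_keep br)).
Local Notation sw := (swapped S f i j).
Hypothesis oL : over L W.

Definition glob (q : R * R) : R * R := if sw then (fl i q.2, fl j q.1) else (fl i q.1, fl j q.2).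
Local Notation eside := (eside S f i j).
Local Notation nside := (nside S f i j).
Local Notation eflip := (eflip S f i j).
Local Notation nflip := (nflip S f i j).

Lemma glob_cts : continuous glob.
Proof.
have c1 : continuous (fun q : R * R => fl i q.1) by apply: (ct_comp (f := fst) (g := @fl R i)); [ctn|exact: fl_cts].
have c2 : continuous (fun q : R * R => fl i q.2) by apply: (ct_comp (f := snd) (g := @fl R i)); [ctn|exact: fl_cts].
have c3 : continuous (fun q : R * R => fl j q.1) by apply: (ct_comp (f := fst) (g := @fl R j)); [ctn|exact: fl_cts].
have c4 : continuous (fun q : R * R => fl j q.2) by apply: (ct_comp (f := snd) (g := @fl R j)); [ctn|exact: fl_cts].
by rewrite /glob; case: sw; apply: ct_pair.
Qed.

Lemma corner_f o k : (o, k) != (i, j) -> svt S (hs f k) o = svt S (vs f o) k.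
Proof.
move=> ne; have ne' : (f, o, k) != (f, i, j) by apply: contra ne => /eqP[-> ->].
by have [h1 h2] := full_nsep br ne'; rewrite /svt h1 h2 crP.
Qed.

Lemma np_ep (Z : Type) (Psi : fmap R L' Z) o y : compat Psi -> o || y -> np Psi o (o2r y) = ep Psi y (o2r o).
Proof.
move=> [h _ _] oy; rewrite /np /ep /nside /eside /nflip /eflip.
case: sw; rewrite !fl_o2r !h /=; congr mx.
  by rewrite corner_f //; move: oy; case: o; case: y => //; case: (i); case: (j).
by rewrite corner_f //; move: oy; case: o; case: y => //; case: (i); case: (j).
Qed.

Lemma bridge_vt : vt (hs f j) i = p.
Proof. by have [Sp sP _] := br; apply: sep_hl Sp _; rewrite sP eqxx. Qed.

Lemma np0 (Z : Type) (Psi : fmap R L' Z) : compat Psi -> np Psi false 0 = mx Psi (Some p).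
Proof.
move=> [h _ _]; rewrite /np /nside /nflip -[0]/(o2r false) fl_o2r !addbF; have := swN br.
case swE: sw; rewrite h /= /svt => hn; first by rewrite hn bridge_vt.
by move: swE; rewrite /swapped => ->; rewrite -crP bridge_vt.
Qed.

Lemma ep0 (Z : Type) (Psi : fmap R L' Z) : compat Psi -> ep Psi false 0 = mx Psi None.
Proof.
move=> [h _ _]; rewrite /ep /eside /eflip -[0]/(o2r false) fl_o2r !addbF; have := swN br.
case swE: sw; rewrite h /= /svt => hn; last by rewrite hn.
by move: swE; rewrite /swapped => ->.
Qed.

Lemma wind_corner o y (x t : R) : o || y -> 0 <= x <= 1 -> fl o x <= 1/4 -> fl y t <= 1/4 ->
  wind x t = if o then 3/4 - o2r y / 4 else 1/4 + o2r false / 4.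
Proof.
case: o => [_ x01 h1 h2|/= yt x01 h1 h2].
  by rewrite wind_right; [rewrite (kap_near h2)|move: h1 => /=; lra].
by rewrite yt in h2; rewrite wind_top // ?(kap_near h2) // (kap_near (o := false) h1).
Qed.

Lemma kface_ep x y : kface (bl f) (glob (x, o2r y)) = ep (phi L') y x.
Proof.
rewrite /ep /eside /eflip /glob; case: sw => /=; rewrite fl_o2r.
  by rewrite kface_v vsP.
by rewrite kface_h hsP.
Qed.

Lemma kface_np x y : kface (bl f) (glob (o2r y, x)) = np (phi L') y x.
Proof.
rewrite /np /nside /nflip /glob; case: sw => /=; rewrite fl_o2r.
  by rewrite kface_h hsP.
by rewrite kface_v vsP.
Qed.

Let lerp (t : R) (a b : R * R) : R * R := ((1 - t) * a.1 + t * b.1, (1 - t) * a.2 + t * b.2).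
Let lerpxx t a : lerp t a a = a.
Proof. by rewrite /lerp -!mulrDl subrK !mul1r; case: a. Qed.

(** At time [t] the inserted path is the boundary circuit of [f] shrunk towards the bridge corner by
    the factor [t]: constant at first, the full circuit at the end. Meanwhile [be2] slides the face
    linearly to its boundary. *)
Definition g2 (u t : R) : K := kface (bl f) (glob (t * (bdpath u).1, t * (bdpath u).2)).
Definition be2 (x y t : R) : K := kface (bl f) (glob (lerp t (kap x, kap y) (bdpath (wind x y)))).

Let in01 o : 0 <= o2r o <= 1. Proof. by rewrite /end_pt; case: o => /=; lra. Qed.

Lemma fills2 t : fills (phi L') (g2 ^~ t) (fun x y => be2 x y t).
Proof.
have k0E : kface (bl f) (glob (0, 0)) = k0.
  by rewrite -[X in (_, X)]/(o2r false) kface_ep ep0 //; exact: phi_compat.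
have z1 : kap (1 : R) = 1 := kap_o2r R true.
have z0 : kap (0 : R) = 0 := kap_o2r R false.
have zz : (0 : R) <= 0 <= 1 := in01 false.
split.
- exact: phi_compat.
- by rewrite /g2 -[X in bdpath X](mul0r 4^-1) bdpath_left // !mulr0.
- by rewrite /g2 -[X in bdpath X](subr0 1) -[X in 1 - X](mul0r 4^-1) bdpath_bot // !mulr0.
- move=> x x01; rewrite /be2 wind_top // bdpath_top; last exact: kap_in.
  by rewrite z1 lerpxx -[1]/(o2r true) kface_ep.
- move=> x /andP[x0 x1]; rewrite /be2 /g2 wind_bot0 //; last by lra.
  by rewrite (kap_lo x1) z0 /lerp /= !mulr0 !add0r.
- move=> x /andP[x0 x1]; rewrite /be2 wind_bot //; last by lra.
  rewrite bdpath_bot; last exact: kap_in.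
  by rewrite z0 lerpxx -[X in (_, X)]/(o2r false) kface_ep.
- move=> y y01; rewrite /be2 wind_left bdpath_left; last exact: kap_in.
  by rewrite z0 lerpxx -[X in (X, _)]/(o2r false) kface_np.
- move=> y y01; rewrite /be2 wind_right; last by lra.
  rewrite bdpath_right; last exact: kap_in.
  by rewrite z1 lerpxx -[X in (X, _)]/(o2r true) kface_np.
- move=> o y x t' oy x01 t01 h1 h2; rewrite /be2 (wind_corner oy) // (kap_near h1) (kap_near h2).
  have -> : bdpath (if o then 3 / 4 - o2r y / 4 else 1 / 4 + o2r false / 4) = (o2r o, o2r y).
    by move: oy; case: (o) => [_|/= ->]; rewrite ?bdpath_right ?bdpath_top.
  by rewrite lerpxx kface_ep.
Qed.

Lemma g2_cts : continuous (fun q : R * R => g2 q.1 q.2).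
Proof.
rewrite /g2; apply: (ct_comp (f := fun q : R * R => glob (q.2 * (bdpath q.1).1, q.2 * (bdpath q.1).2)) (g := kface (bl f))); last exact: kface_continuous.
apply: (ct_comp (f := fun q : R * R => (q.2 * (bdpath q.1).1, q.2 * (bdpath q.1).2)) (g := glob)); last exact: glob_cts.
have cb : continuous (fun q : R * R => bdpath q.1).
  by apply: (ct_comp (f := fst) (g := @bdpath R)); [ctn|exact: bdpath_cts].
by apply: ct_pair; apply: ct_mul; try ctn.
Qed.

Lemma be2_cts : continuous (fun q : R * R * R => be2 q.1.1 q.1.2 q.2).
Proof.
have cb : continuous (fun q : R * R * R => bdpath (wind q.1.1 q.1.2)).
  apply: (ct_comp (f := fun q : R * R * R => wind q.1.1 q.1.2) (g := @bdpath R)); last exact: bdpath_cts.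
  by apply: (ct_comp (f := fst) (g := fun q : R * R => wind q.1 q.2)); [ctn|exact: wind_cts].
rewrite /be2; apply: (ct_comp (f := fun q : R * R * R => glob (lerp q.2 (kap q.1.1, kap q.1.2) (bdpath (wind q.1.1 q.1.2)))) (g := kface (bl f))); last exact: kface_continuous.
apply: (ct_comp (f := fun q : R * R * R => lerp q.2 (kap q.1.1, kap q.1.2) (bdpath (wind q.1.1 q.1.2))) (g := glob)); last exact: glob_cts.
have c1 : continuous (fun q : R * R * R => kap q.1.1).
  by apply: (ct_comp (f := fun q : R * R * R => q.1.1) (g := @kap R)); [ctn|exact: kap_cts].
have c2 : continuous (fun q : R * R * R => kap q.1.2).
  by apply: (ct_comp (f := fun q : R * R * R => q.1.2) (g := @kap R)); [ctn|exact: kap_cts].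
have cl : continuous (fun q : R * ((R * R) * (R * R)) => lerp q.1 q.2.1 q.2.2) by rewrite /lerp; ctn.
by apply: (ct_comp (f := fun q : R * R * R => (q.2, ((kap q.1.1, kap q.1.2), bdpath (wind q.1.1 q.1.2)))) (g := fun q : R * ((R * R) * (R * R)) => lerp q.1 q.2.1 q.2.2)); ctn.
Qed.

Definition stage2 t : fmap R L K := stretch (phi L') (g2 ^~ t) (fun x y => be2 x y t).

Lemma paste_same (I : finType) (full : pred I) Z (m : I -> R) (g : R -> Z) base :
  (forall c, full c -> m c <= 1/4 -> base = g (4 * m c)) -> paste full m g base = base.
Proof. by move=> h; rewrite /paste; case: pickP => // c /andP[fc mc]; rewrite (h c). Qed.

Lemma stage2_0 : stage2 0 = phik L.
Proof.
have g0 u u' : g2 u 0 = g2 u' 0 by rewrite /g2 !mul0r.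
apply: fmap_eq => //= [a s|b s t].
  rewrite paste_same ?kap_clip // => o So ho; rewrite (g0 _ 1) -kap_clip (kap_near ho).
  exact: (edge_end (fills2 0)).
rewrite paste_same.
  rewrite /sbase; case: insubP => [b' _ <-|]; first by rewrite !kap_clip.
  rewrite negbK => /eqP ->; rewrite /be2 /lerp subr0 !mul1r !mul0r !addr0 /loc /glob.
  by case: sw => /=; rewrite !kap_fl !flK !kap_clip.
move=> c fc mc; rewrite (g0 _ 1).
by apply: (sbase_corner (fills2 0) _ _ fc mc); exact: clip_in.
Qed.

Section Stage3.
Variable F : R -> fmap R L' K.
Hypotheses (cF : fcont F) (coF : forall t, compat (F t)) (PF : forall t, fin_set P (F t)).
Hypotheses (F0 : F 0 = phi L') (F1 : F 1 = fcst L').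

(** The image of the boundary circuit of [f] under the homotopy of the split complex. It joins the
    images of the two copies of [p] at every time, even while these move apart. *)
Definition g3 (u t : R) : K := cat4 (fun y x t => ep (F t) y x) (fun y x t => np (F t) y x) u t.
Definition stage3 t : fmap R L K := stretch (F t) (g3 ^~ t) (fun x y => g3 (wind x y) t).

Let j1 t : np (F t) false 1 = ep (F t) true 0. Proof. exact: (@np_ep _ (F t) false true). Qed.
Let j2 t : ep (F t) true 1 = np (F t) true 1. Proof. by symmetry; exact: (@np_ep _ (F t) true true). Qed.
Let j3 t : np (F t) true 0 = ep (F t) false 1. Proof. exact: (@np_ep _ (F t) true false). Qed.

Lemma fills3 t : fills (F t) (g3 ^~ t) (fun x y => g3 (wind x y) t).
Proof.
have z1 : kap (1 : R) = 1 := kap_o2r R true.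
have z0 : kap (0 : R) = 0 := kap_o2r R false.
have zz : (0 : R) <= 0 <= 1 := in01 false.
rewrite /g3; split=> //.
- by rewrite -[X in cat4 _ _ X](mul0r 4^-1) cat4_left ?ler01 // np0.
- by rewrite -[X in cat4 _ _ X](subr0 1) -[X in 1 - X](mul0r 4^-1) cat4_bot // ep0.
- by move=> x x01; rewrite wind_top // cat4_top //; exact: kap_in.
- move=> x /andP[x0 x1]; rewrite wind_bot0 //; lra.
- move=> x /andP[x0 x1]; rewrite wind_bot //; last by lra.
  by rewrite cat4_bot //; exact: kap_in.
- by move=> y y01; rewrite wind_left cat4_left //; case/andP: (kap_in y).
- move=> y y01; rewrite wind_right; last by lra.
  by rewrite cat4_right //; exact: kap_in.
- move=> o y x t' oy x01 t01 h1 h2; rewrite (wind_corner oy) //.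
  move: (oy); case: (o) => [_|/= ->]; last by rewrite cat4_top.
  by rewrite cat4_right // (@np_ep _ (F t) true y).
Qed.

Lemma g3_cts : continuous (fun q : R * R => g3 q.1 q.2).
Proof.
have [_ F2 _] := cF.
have cl o : continuous (fun q : R * R => fl o q.1) by apply: (ct_comp (f := fst) (g := @fl R o)); [ctn|exact: fl_cts].
have ca a o : continuous (fun q : R * R => ma (F q.2) a (fl o q.1)).
  apply: (ct_comp (f := fun q : R * R => (fl o q.1, q.2)) (g := fun q : R * R => ma (F q.2) a q.1)); last exact: F2.
  by apply: ct_pair; [exact: cl|ctn].
by apply: cat4_cts => // y; [exact: (ca (eside y) eflip)|exact: (ca (nside y) nflip)].
Qed.

Lemma g3_P u t : P (g3 u t).
Proof.
have [_ h _] := PF t; rewrite /g3 /cat4 /ep /np.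
by case: ifP => // _; case: ifP => // _; case: ifP.
Qed.

Lemma glob_clip x y : kface (bl f) (glob (clip x, clip y)) = kface (bl f) (glob (x, y)).
Proof. by rewrite /glob; case: sw => /=; rewrite !fl_clip kface_clip. Qed.

Lemma g32 u : g3 u 0 = g2 u 1.
Proof.
have q0 (x y : R) : x <= 0 -> kface (bl f) (glob (x, y)) = kface (bl f) (glob (0, y)).
  by move=> h; rewrite -glob_clip -[RHS]glob_clip; congr (kface _ (glob (_, _))); case: clipP => *; case: clipP => *; lra.
have q1 (x y : R) : 1 <= x -> kface (bl f) (glob (x, y)) = kface (bl f) (glob (1, y)).
  by move=> h; rewrite -glob_clip -[RHS]glob_clip; congr (kface _ (glob (_, _))); case: clipP => *; case: clipP => *; lra.
have r0 (x y : R) : y <= 0 -> kface (bl f) (glob (x, y)) = kface (bl f) (glob (x, 0)).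
  by move=> h; rewrite -glob_clip -[RHS]glob_clip; congr (kface _ (glob (_, _))); case: clipP => *; case: clipP => *; lra.
have r1 (x y : R) : 1 <= y -> kface (bl f) (glob (x, y)) = kface (bl f) (glob (x, 1)).
  by move=> h; rewrite -glob_clip -[RHS]glob_clip; congr (kface _ (glob (_, _))); case: clipP => *; case: clipP => *; lra.
rewrite /g2 /bdpath /= !mul1r glob_clip /g3 /cat4 F0.
case: ifP => h1.
  rewrite q0; last by rewrite ge_min; apply/orP; left; lra.
  by rewrite min_l; [rewrite -[X in (X, _)]/(o2r false) kface_np|lra].
case: ifP => h2.
  rewrite r1; last by rewrite le_min; apply/andP; split; lra.
  by rewrite min_l; [rewrite -[X in (_, X)]/(o2r true) kface_ep|lra].
case: ifP => h3.
  rewrite q1; last by rewrite le_min; apply/andP; split; lra.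
  by rewrite min_r; [rewrite -[X in (X, _)]/(o2r true) kface_np|lra].
rewrite r0; last by rewrite ge_min; apply/orP; right; lra.
by rewrite min_r; [rewrite -[X in (_, X)]/(o2r false) kface_ep|lra].
Qed.

Lemma stage3_0 : stage3 0 = stage2 1.
Proof.
have -> : stage3 0 = stretch (F 0) (g2 ^~ 1) (fun x y => be2 x y 1).
  congr stretch; first by apply/funext => u; exact: g32.
  apply/funext => x; apply/funext => y; rewrite g32 /g2 /be2 /lerp.
  by rewrite subrr !mul0r !add0r.
by rewrite F0.
Qed.

Lemma stage3_1 : stage3 1 = fcst L.
Proof.
have g1 u : g3 u 1 = k0.
  by rewrite /g3 /cat4 /ep /np F1 /=; do !case: ifP => // _.
apply: fmap_eq => [x|a s|b s t] /=; rewrite ?F1 //.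
  by apply: paste_same => *; rewrite g1.
rewrite paste_same; rewrite /sbase; case: insubP => *; by rewrite ?g1 ?F1.
Qed.

End Stage3.

(** Three homotopies are composed: the labelling map is made constant near corners, the face [f] is
    pushed to its boundary, and the contraction of the split complex is carried over by
    [stretch]. *)
Lemma contract_step p0 : fhom P k0 (Some p0 : cX L') (phi L') (fcst L') -> fhom P k0 p0 (phi L) (fcst L).
Proof.
move=> [F [cF coF PF pF [F0 F1]]].
apply: (fhom_trans (phi_kap p0 oL)); apply: (fhom_trans (g := stage2 1)).
  exists stage2; split.
  - by apply: stretch_fcont; [|exact: g2_cts|exact: be2_cts|exact: fills2];
      split=> [x|a|b] /=; [ctn|
        apply: (ct_comp (f := fst) (g := kedge (al a))); [ctn|exact: kedge_continuous]|
        apply: (ct_comp (f := fun q : R * R * R => (q.1.1, q.1.2)) (g := kface (bl (val b)))); [ctn|exact: kface_continuous]].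
  - by move=> t; apply: stretch_compat; exact: fills2.
  - move=> t; apply: stretch_fin; first exact: phi_fin.
      by move=> u; exact/Pf/over_bl.
    by move=> x y; exact/Pf/over_bl.
  - by [].
  - by split=> //; exact: stage2_0.
exists (stage3 F); split.
- apply: stretch_fcont => //; first exact: g3_cts.
    apply: (ct_comp (f := fun q : R * R * R => (wind q.1.1 q.1.2, q.2)) (g := fun q : R * R => g3 F q.1 q.2)).
      apply: ct_pair; last by ctn.
      by apply: (ct_comp (f := fst) (g := fun q : R * R => wind q.1 q.2)); [ctn|exact: wind_cts].
    exact: g3_cts.
  exact: fills3.
- by move=> t; apply: stretch_compat; exact: fills3.
- by move=> t; apply: stretch_fin => // *; exact: g3_P.
- by move=> t; exact: pF.
- by split; [exact: stage3_0|exact: stage3_1].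
Qed.

End Step.
End Contract.

(** * Contracting trees and complexes of positive Euler characteristic *)

Section Trees.
Context (R : realType) (V E : finType) (lsrc llab ltgt : E -> V).
Local Notation cplx := (cplx lsrc llab ltgt).
Local Notation o2r := (end_pt R).
Local Notation K := (LOGcomplex R lsrc llab ltgt).
Local Notation kedge := (@cell_edge R V E lsrc llab ltgt).
Local Notation kface := (@cell_face R V E lsrc llab ltgt).
Variables (k0 : K) (k0P : is_basep k0).
Variables (W : {set V}) (P : K -> Prop).
Hypothesis Pk0 : P k0.
Hypothesis Pe : forall v s, v \in W -> P (kedge v s).
Hypothesis Pf : forall e q, e \in Ein lsrc ltgt W -> P (kface e q).
Local Notation phi := (phi k0).
Local Notation fcst := (fcst k0).

(** A leaf other than [p0] is slid along its edge to the inner end; the resulting map factors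
    through the retraction onto the smaller tree. *)
Lemma contract_tree n (L : cplx) p0 : #|cX L| = n -> conn L -> over L W -> (#|cB L| = 0)%N -> (#|cA L| < #|cX L|)%N ->
  fhom P k0 p0 (phi L) (fcst L).
Proof.
elim: n L p0 => [|n IH] L p0 Xn cL oL B0 AX; first by rewrite Xn in AX.
have noB (b : cB L) : False by have /card0_eq/(_ b) := B0.
case: (ltnP 1 #|cX L|) => [X1|X1]; last first.
  have A0 : #|cA L| = 0%N by lia.
  have noA (a : cA L) : False by have /card0_eq/(_ a) := A0.
  exists (fun=> fcst L); split=> //.
  - by split=> [x|a|b]; [ctn|case: (noA a)|case: (noB b)].
  - by split=> //; apply: fmap_eq.
have [l [a0 [o0 [lp lf]]]] := leaf_exists p0 cL AX X1.
have [F [cF coF PF pF [F0 F1]]] : fhom P k0 (retr lf p0) (phi (del lf)) (fcst (del lf)).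
  apply: IH.
  - by rewrite card_delX Xn.
  - exact: del_conn.
  - by move=> a; exact: oL.
  - by apply: eq_card0 => -[].
  - have : (0 < #|cA L|)%N by apply/card_gt0P; exists a0.
    by rewrite card_delX card_delA; lia.
pose mid : fmap R L K := FMap (fun=> k0) (fun a s => if a == a0 then k0 else kedge (al a) s) (fun b s t => k0).
apply: (fhom_trans (g := mid)).
  pose pos t s : R := (1 - t) * clip s + t * o2r (~~ o0).
  exists (fun t => FMap (fun x => if x == l then kedge (al a0) (pos t (o2r o0)) else k0)
     (fun a s => if a == a0 then kedge (al a0) (pos t s) else kedge (al a) s) (fun b s t => k0)).
  have cp : continuous (fun q : R * R => pos q.2 q.1) by rewrite /pos /clip; ctn.
  split.
  - split=> [x|a|b] /=; last by case: (noB b).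
      case: (x == l); last by ctn.
      apply: (ct_comp (f := fun t => pos t (o2r o0)) (g := kedge (al a0))); last exact: kedge_continuous.
      by apply: (ct_comp (f := fun t : R => (o2r o0, t)) (g := fun q : R * R => pos q.2 q.1)) => //; ctn.
    case: (a == a0).
      by apply: (ct_comp (f := fun q : R * R => pos q.2 q.1) (g := kedge (al a0))) => //; exact: kedge_continuous.
    by apply: (ct_comp (f := fst) (g := kedge (al a))); [ctn|exact: kedge_continuous].
  - move=> t; split=> [a o|b|b]; try by case: (noB b).
    rewrite /= lf xpair_eqE; case: (a == a0) => /=; last by rewrite (kedge_o2r k0P).
    case: eqP => [->//|ne]; rewrite /pos clip_o2r (_ : ~~ o0 = o); last by move: ne; case: (o); case: (o0).
    by rewrite -mulrDl subrK mul1r (kedge_o2r k0P).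
  - move=> t; split=> [x|a s|b]; last by case: (noB b).
      by rewrite /=; case: ifP => // _; exact/Pe/oL.
    by rewrite /=; case: ifP => _; exact/Pe/oL.
  - by move=> t; rewrite /= eq_sym (negbTE lp).
  - split; apply: fmap_eq => /= [x|a s|b]; try by case: (noB b).
    + by case: ifP => // _; rewrite /pos subr0 mul1r mul0r addr0 clip_o2r (kedge_o2r k0P).
    + by case: eqP => // ->; rewrite /pos subr0 mul1r mul0r addr0 kedge_clip.
    + by case: ifP => // _; rewrite /pos subrr mul0r mul1r add0r (kedge_o2r k0P).
    + by case: eqP => // _; rewrite /pos subrr mul0r mul1r add0r (kedge_o2r k0P).
pose A' := {a : cA L | a != a0}.
exists (fun t => FMap (fun x => mx (F t) (retr lf x))
  (fun a s => if insub a : option A' is Some a' then ma (F t) a' s else mx (F t) (other lf)) (fun b s t => k0)).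
have [F2 F3 _] := cF.
split.
- split=> [x|a|b] /=; [exact: F2| |by case: (noB b)].
  case: insubP => [a' _ _|_]; first exact: F3.
  by apply: (ct_comp (f := snd) (g := fun t => mx (F t) (other lf))); [ctn|exact: F2].
- move=> t; split=> [a o|b|b]; try by case: (noB b).
  have [h _ _] := coF t; rewrite /=; case: insubP => [a' _ <-|]; first by rewrite h retr_vt.
  by rewrite negbK => /eqP ->; rewrite retr_vt0.
- move=> t; have [h1 h2 _] := PF t; split=> [x|a s|b]; [exact: h1| |by case: (noB b)].
  by rewrite /=; case: insubP.
- by [].
- rewrite F0 F1; split; apply: fmap_eq => /= [x|a s|b] //; try by case: (noB b).
    by case: insubP => [a' na <-|]; [rewrite (negbTE (valP a'))|rewrite negbK => ->].
  by case: insubP.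
Qed.

Hypothesis forest : forall U : {set V}, U != finset.set0 -> (#|Ein lsrc ltgt U| < #|U|)%N.
Hypothesis inj : injective llab.
Hypothesis ctW : ctight lsrc llab ltgt W.

Theorem contractible (L : cplx) p0 : conn L -> immersed L -> graded L -> over L W ->
  (#|cA L| < #|cX L| + #|cB L|)%N -> fhom P k0 p0 (phi L) (fcst L).
Proof.
move: {2}#|cB L| (erefl #|cB L|) => n; elim: n L p0 => [|n IH] L p0 Bn cL iL gL oL chi.
  by apply: (contract_tree p0 (erefl _)) => //; rewrite Bn addn0 in chi.
have : has_bridge W L.
  apply: contrapT => nb; have [cW _] := core forest inj ctW.
  have := cW W L ctW (Or31 _ _ (subxx W)) cL iL gL oL _ nb.
  by rewrite Bn => /(_ isT); rewrite -Bn leqNgt chi.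
move=> [p [S [f [i [j br]]]]].
have [Sp _ _] := br.
apply: (contract_step k0P Pk0 Pe Pf (br := br)) => //.
apply: IH.
- by rewrite card_splitB cardC1 Bn.
- by exact: split_conn.
- exact: split_imm Sp iL.
- exact: split_graded Sp gL.
- by move=> a; exact: oL.
- rewrite card_splitX card_splitB cardC1 Bn /= addSnnS -Bn; exact: chi.
Qed.

End Trees.

Section Specs.
Variable R : realType.
Variant minP (a b : R) : R -> Prop := MinL of a <= b : minP a b a | MinR of b <= a : minP a b b.
Lemma min_spec a b : minP a b (Num.min a b).
Proof. by case: (leP a b) => h; [exact: MinL|exact/MinR/ltW]. Qed.
Variant maxP (a b : R) : R -> Prop := MaxL of b <= a : maxP a b a | MaxR of a <= b : maxP a b b.
Lemma max_spec a b : maxP a b (Num.max a b).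
Proof. by case: (leP a b) => h; [exact/MaxR|exact/MaxL/ltW]. Qed.

End Specs.

Ltac nomm a := lazymatch a with
  | context [Order.min _ _] => fail | context [Order.max _ _] => fail | context [clip _] => fail | _ => idtac end.
Ltac mms := repeat match goal with
  | |- context [Order.min ?a ?b] => nomm a; nomm b; case: (min_spec a b) => ?
  | |- context [Order.max ?a ?b] => nomm a; nomm b; case: (max_spec a b) => ?
  | |- context [clip ?a] => nomm a; case: (clipP a) => [?|? ?|?]
  end.

(** * Lifting maps of the square *)

Section Cutoffs.
Variable R : realType.
Implicit Types s t : R.
Local Notation o2r := (end_pt R).

(** The three cutoffs are positive on the outer quarters, where [kap] is constant, on (3/16, 13/16)
    and on (1/16, 15/16). The overlaps produce an open cover, and equal values at both ends let the
    functions extend over K. *)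
Definition nearend t := Num.max (1/4 - t) (t - 3/4).
Definition middle t := Num.min (Num.min (t - 3/16) (13/16 - t)) (1/8).
Definition inner t := Num.min (t - 1/16) (15/16 - t).

(** [kap] differs at the two ends of an edge, which are one point of K. [tent] agrees with it up to
    13/16 and then returns to 0, outside the region that the chart of an edge uses. *)
Definition tent t := Num.min (kap t) (clip ((7/8 - t) * 16)).
Definition lo t := clip ((1/4 - t) * 8).
Definition om t := Num.min (clip (16 * t)) (clip (16 * (1 - t))).
Lemma nearend_o2r o : nearend (o2r o) = 1/4.
Proof. by rewrite /nearend /end_pt; case: o => /=; mms; lra. Qed.
Lemma nearend_le t : 0 <= t <= 1 -> nearend t <= 1/4.
Proof. by rewrite /nearend => h; mms; lra. Qed.
Lemma middle_o2r o : middle (o2r o) = - (3/16).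
Proof. by rewrite /middle /end_pt; case: o => /=; mms; lra. Qed.
Lemma middle_ge t : 0 <= t <= 1 -> - (3/16) <= middle t <= 1/8.
Proof. by rewrite /middle => h; mms; lra. Qed.
Lemma inner_o2r o : inner (o2r o) = - (1/16).
Proof. by rewrite /inner /end_pt; case: o => /=; mms; lra. Qed.
Lemma inner_ge t : 0 <= t <= 1 -> - (1/16) <= inner t.
Proof. by rewrite /inner => h; mms; lra. Qed.
Lemma tent_o2r o : tent (o2r o) = 0.
Proof.
by rewrite /tent kap_o2r /end_pt; case: o => /=; mms; lra.
Qed.
Lemma lo_o2r o : lo (o2r o) = o2r (~~ o).
Proof. by rewrite /lo /end_pt; case: o => /=; mms; lra. Qed.
Lemma lo_1o2r o : lo (1 - o2r o) = o2r o.
Proof. by rewrite /lo /end_pt; case: o => /=; mms; lra. Qed.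
Lemma om_o2r o : om (o2r o) = 0.
Proof. by rewrite /om /end_pt; case: o => /=; mms; lra. Qed.

Lemma nearend_gt0 t : (0 < nearend t) = (t < 1/4) || (3/4 < t).
Proof. by rewrite /nearend lt_max !subr_gt0. Qed.
Lemma middle_gt0 t : (0 < middle t) = (3/16 < t) && (t < 13/16).
Proof. by rewrite /middle !lt_min !subr_gt0 (_ : 0 < 1/8) ?andbT //; lra. Qed.
Lemma inner_gt0 t : (0 < inner t) = (1/16 < t) && (t < 15/16).
Proof. by rewrite /inner lt_min !subr_gt0. Qed.

Lemma in01_0 : (0 : R) <= (0 : R) <= 1.
Proof. by rewrite lexx ler01. Qed.
Lemma kap_ge0 t : 0 <= kap t. Proof. by case/andP: (kap_in t). Qed.
Lemma kap_le1 t : kap t <= 1. Proof. by case/andP: (kap_in t). Qed.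
Lemma clip_ge1 x : 1 <= x -> clip x = 1 :> R. Proof. by case: clipP => *; lra. Qed.
Lemma clip_le0 x : x <= 0 -> clip x = 0 :> R. Proof. by case: clipP => *; lra. Qed.
Lemma tent_mid t : t <= 13/16 -> tent t = kap t.
Proof. by move=> h; rewrite /tent [clip _]clip_ge1 ?min_l ?kap_le1 //; lra. Qed.
Lemma tent_lo t : t <= 1/4 -> tent t = 0.
Proof. by move=> h; rewrite /tent kap_lo // min_l //; case/andP: (clip_in ((7/8 - t) * 16)). Qed.
Lemma tent_hi t : 7/8 <= t -> tent t = 0.
Proof. by move=> h; rewrite /tent [clip _]clip_le0 ?min_r ?kap_ge0 //; lra. Qed.
Lemma lo_near t : t <= 1/8 -> lo t = 1.
Proof. by move=> h; rewrite /lo clip_ge1 //; lra. Qed.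
Lemma lo_far t : 1/4 <= t -> lo t = 0.
Proof. by move=> h; rewrite /lo clip_le0 //; lra. Qed.
Lemma om_mid t : 1/16 <= t <= 15/16 -> om t = 1.
Proof. by move=> h; rewrite /om !clip_ge1 ?minxx //; lra. Qed.
Lemma tent_cts : continuous tent.
Proof. by rewrite /tent /kap /clip; ctn. Qed.
Lemma lo_cts : continuous lo.
Proof. by rewrite /lo /clip; ctn. Qed.
Lemma om_cts : continuous om.
Proof. by rewrite /om /clip; ctn. Qed.

End Cutoffs.

Section Charts.
Context (R : realType) (V E : finType) (lsrc llab ltgt : E -> V).
Local Notation K := (LOGcomplex R lsrc llab ltgt).
Local Notation hl := (hl lsrc ltgt).
Local Notation kedge := (@cell_edge R V E lsrc llab ltgt).
Local Notation kface := (@cell_face R V E lsrc llab ltgt).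
Local Notation kglue := (@kglue R V E lsrc llab ltgt).
Local Notation o2r := (end_pt R).
Implicit Types s t : R.
Variables (k0 : K) (k0P : is_basep k0).

Lemma kt_o2r u o : kt u (o2r o) = o2r o.
Proof. by rewrite /kt clip_o2r kap_o2r -mulrDl subrK mul1r. Qed.

(** Deforms the identity of K into the map induced by [kap]. At time 1 points near the base point or
    near an edge have moved onto it, so small sets land in one closed cell. *)
Definition kapt (u : R) : K -> K :=
  kglue k0 (fun v s => kedge v (kt u s)) (fun e q => kface e (kt u q.1, kt u q.2)).

Lemma kapt_end u v o : kedge v (kt u (o2r o)) = k0.
Proof. by rewrite kt_o2r (kedge_o2r k0P). Qed.
Lemma kapt_h u e j s : 0 <= s <= 1 -> kface e (kt u s, kt u (o2r j)) = kedge (hl e j) (kt u s).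
Proof. by rewrite kt_o2r kface_h. Qed.
Lemma kapt_v u e i t : 0 <= t <= 1 -> kface e (kt u (o2r i), kt u t) = kedge (llab e) (kt u t).
Proof. by rewrite kt_o2r kface_v. Qed.

Lemma kt_clip u s : kt u (clip s) = kt u s.
Proof. by rewrite /kt clipK kap_clip. Qed.

Lemma kapt_base u k : is_basep k -> kapt u k = k0.
Proof. exact: kglue_base. Qed.

Lemma kapt_edge u v t : kapt u (kedge v t) = kedge v (kt u t).
Proof. by rewrite /kapt kglue_edge ?kt_clip //; exact: kapt_end. Qed.

Lemma kapt_face u e q : kapt u (kface e q) = kface e (kt u q.1, kt u q.2).
Proof. by rewrite /kapt (kglue_face (kapt_end u) (@kapt_h u) (@kapt_v u)) /= !kt_clip. Qed.

Lemma kapt_cts : continuous (fun q : K * R => kapt (clip q.2) q.1).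
Proof.
apply: (K_continuous2 (F := fun k u => kapt u k)) => [v|e].
  rewrite (_ : (fun p => _) = fun p : R * R => kedge v (kt (clip p.2) p.1)); last first.
    by apply/funext => p; rewrite kapt_edge.
  apply: (ct_comp (f := fun p : R * R => kt (clip p.2) p.1) (g := kedge v)); last exact: kedge_continuous.
  by rewrite /kt /kap /clip; ctn.
rewrite (_ : (fun p => _) = fun p : R * R * R => kface e (kt (clip p.2) p.1.1, kt (clip p.2) p.1.2)); last first.
  by apply/funext => p; rewrite kapt_face.
apply: (ct_comp (f := fun p : R * R * R => (kt (clip p.2) p.1.1, kt (clip p.2) p.1.2)) (g := kface e)); last exact: kface_continuous.
by rewrite /kt /kap /clip; ctn.
Qed.

Lemma kapt0 k : kapt 0 k = k.
Proof.
have kt0 s : kt 0 s = clip s by rewrite /kt subr0 mul1r mul0r addr0.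
case: (kpointP k) => [bk|v t _ -> _|e s t _ _ -> _].
- by rewrite kapt_base // (base_uniq bk k0P).
- by rewrite kapt_edge kt0 kedge_clip.
- by rewrite kapt_face !kt0 kface_clip.
Qed.

Lemma kt1 s : kt 1 s = kap s. Proof. by rewrite /kt subrr mul0r add0r mul1r. Qed.

Lemma kapt1_edge v t : kapt 1 (kedge v t) = kedge v (kap t).
Proof. by rewrite kapt_edge kt1. Qed.
Lemma kapt1_face e q : kapt 1 (kface e q) = kface e (kap q.1, kap q.2).
Proof. by rewrite kapt_face !kt1. Qed.

(* the cells of the chart i: K is covered by the sets [chart i > 0], on which
   the end of the homotopy kapt has values in the closed cell i, with
   coordinates [coord i] *)
Local Notation cells := (option (V + E)).

(** The default is the value of [middle] at the ends: unrelated edges glue continuously and stay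
    outside the chart. *)
Definition sel (b : bool) (x : R) : R := if b then x else - (3/16).

Definition chart (i : cells) : K -> R :=
  match i with
  | None => kglue (1/4) (fun _ t => nearend t) (fun _ q => Num.min (nearend q.1) (nearend q.2))
  | Some (inl v) => kglue (- (3/16)) (fun v' t => sel (v' == v) (middle t))
     (fun e q => Num.max (Num.max (sel (lsrc e == v) (Num.min (middle q.1) (1/8 - q.2)))
                                  (sel (ltgt e == v) (Num.min (middle q.1) (q.2 - 7/8))))
                         (sel (llab e == v) (Num.min (middle q.2) (Num.max (1/8 - q.1) (q.1 - 7/8)))))
  | Some (inr e) => kglue (- (1/16)) (fun _ _ => - (1/16))
     (fun e' q => if e' == e then Num.min (inner q.1) (inner q.2) else - (1/16))
  end.

Definition sel0 (b : bool) (x : R) : R := if b then x else 0.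

Definition coord (i : cells) (k : K) : R * R :=
  match i with
  | None => (0, 0)
  | Some (inl v) => (clip (kglue 0 (fun v' t => sel0 (v' == v) (tent t))
      (fun e q => sel0 (lsrc e == v) (tent q.1 * lo q.2) + sel0 (ltgt e == v) (tent q.1 * lo (1 - q.2))
         + sel0 (llab e == v) (tent q.2 * (lo q.1 + lo (1 - q.1)))) k), 0)
  | Some (inr e) =>
     (clip (kglue 0 (fun _ _ => 0) (fun e' q => if e' == e then kap q.1 * (om q.1 * om q.2) else 0) k),
      clip (kglue 0 (fun _ _ => 0) (fun e' q => if e' == e then kap q.2 * (om q.1 * om q.2) else 0) k))
  end.

Definition realize (i : cells) (q : R * R) : K :=
  match i with None => k0 | Some (inl v) => kedge v q.1 | Some (inr e) => kface e q end.

Lemma sel_o2r b o : sel b (middle (o2r o)) = - (3/16).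
Proof. by rewrite middle_o2r /sel; case: b. Qed.

Lemma sel_le b x : x <= - (3/16) -> sel b x <= - (3/16).
Proof. by rewrite /sel; case: b. Qed.
Lemma sel_ge b x : - (3/16) <= x -> - (3/16) <= sel b x.
Proof. by rewrite /sel; case: b. Qed.

Lemma max3_1 x y z : - (3/16) <= x -> y <= - (3/16) -> z <= - (3/16) -> Num.max (Num.max x y) z = x :> R.
Proof. by move=> h1 h2 h3; rewrite max_l ?max_l //; lra. Qed.
Lemma max3_2 x y z : x <= - (3/16) -> - (3/16) <= y -> z <= - (3/16) -> Num.max (Num.max x y) z = y :> R.
Proof. by move=> h1 h2 h3; rewrite max_l ?max_r //; lra. Qed.
Lemma max3_3 x y z : x <= - (3/16) -> y <= - (3/16) -> - (3/16) <= z -> Num.max (Num.max x y) z = z :> R.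
Proof. by move=> h1 h2 h3; rewrite max_r // ge_max; lra. Qed.

Lemma chart_edge_h v e j s : 0 <= s <= 1 ->
  Num.max (Num.max (sel (lsrc e == v) (Num.min (middle s) (1/8 - o2r j)))
                                  (sel (ltgt e == v) (Num.min (middle s) (o2r j - 7/8))))
                         (sel (llab e == v) (Num.min (middle (o2r j)) (Num.max (1/8 - s) (s - 7/8))))
  = sel (hl e j == v) (middle s).
Proof.
move=> s01; have := middle_ge s01 => /andP[m1 m2].
have h3 : sel (llab e == v) (Num.min (middle (o2r j)) (Num.max (1/8 - s) (s - 7/8))) <= - (3/16).
  by apply: sel_le; rewrite ge_min middle_o2r lexx.
case: j h3; rewrite /end_pt /= => h3.
  rewrite [Num.min _ (1 - _)]min_l; last by lra.
  by rewrite max3_2 //; [apply: sel_le; rewrite ge_min; apply/orP; right; lra|apply: sel_ge].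
rewrite [Num.min _ (_ - 0)]min_l; last by lra.
by rewrite max3_1 //; [apply: sel_ge|apply: sel_le; rewrite ge_min; apply/orP; right; lra].
Qed.

Lemma chart_edge_v v e i t : 0 <= t <= 1 ->
  Num.max (Num.max (sel (lsrc e == v) (Num.min (middle (o2r i)) (1/8 - t)))
                                  (sel (ltgt e == v) (Num.min (middle (o2r i)) (t - 7/8))))
                         (sel (llab e == v) (Num.min (middle t) (Num.max (1/8 - o2r i) (o2r i - 7/8))))
  = sel (llab e == v) (middle t).
Proof.
move=> t01; have := middle_ge t01 => /andP[m1 m2].
have -> : Num.max (1/8 - o2r i) (o2r i - 7/8) = 1/8 :> R.
  by case: i; rewrite /end_pt /=; [rewrite max_r|rewrite max_l]; lra.
rewrite [Num.min (middle t) _]min_l // max3_3 //; last exact: sel_ge.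
  by apply: sel_le; rewrite ge_min middle_o2r lexx.
by apply: sel_le; rewrite ge_min middle_o2r lexx.
Qed.

Lemma chart_edge i v t : chart i (kedge v t) = match i with
  | None => nearend (clip t) | Some (inl w) => sel (v == w) (middle (clip t)) | Some (inr e) => - (1/16) end.
Proof.
case: i => [[w|e]|] /=; rewrite kglue_edge //.
- by move=> *; rewrite sel_o2r.
- by move=> *; rewrite nearend_o2r.
Qed.

Lemma chart_vertex_h j s : 0 <= s <= 1 -> Num.min (nearend s) (nearend (o2r j)) = nearend s.
Proof. by move=> h; rewrite nearend_o2r min_l // nearend_le. Qed.
Lemma chart_vertex_v j s : 0 <= s <= 1 -> Num.min (nearend (o2r j)) (nearend s) = nearend s.
Proof. by move=> h; rewrite nearend_o2r min_r // nearend_le. Qed.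
Lemma chart_face_h (e e' : E) j s : 0 <= s <= 1 -> (if e' == e then Num.min (inner s) (inner (o2r j)) else - (1/16)) = - (1/16).
Proof. by move=> h; rewrite inner_o2r min_r ?inner_ge //; case: ifP. Qed.
Lemma chart_face_v (e e' : E) j s : 0 <= s <= 1 -> (if e' == e then Num.min (inner (o2r j)) (inner s) else - (1/16)) = - (1/16).
Proof. by move=> h; rewrite inner_o2r min_l ?inner_ge //; case: ifP. Qed.

Lemma chart_face i e s t : 0 <= s <= 1 -> 0 <= t <= 1 -> chart i (kface e (s, t)) = match i with
  | None => Num.min (nearend s) (nearend t)
  | Some (inl v) => Num.max (Num.max (sel (lsrc e == v) (Num.min (middle s) (1/8 - t)))
                                  (sel (ltgt e == v) (Num.min (middle s) (t - 7/8))))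
                         (sel (llab e == v) (Num.min (middle t) (Num.max (1/8 - s) (s - 7/8))))
  | Some (inr e') => if e == e' then Num.min (inner s) (inner t) else - (1/16) end.
Proof.
move=> s01 t01; case: i => [[w|e']|] /=; rewrite kglue_face /= ?clip_id //.
- by move=> *; rewrite sel_o2r.
- by move=> *; rewrite chart_edge_h.
- by move=> *; rewrite chart_edge_v.
- by move=> *; rewrite chart_face_h.
- by move=> *; rewrite chart_face_v.
- by move=> *; rewrite nearend_o2r.
- by move=> *; rewrite chart_vertex_h.
- by move=> *; rewrite chart_vertex_v.
Qed.

Lemma chart_cts i : continuous (chart i).
Proof.
case: i => [[w|e']|] /=; apply: kglue_continuous => //.
- by move=> *; rewrite sel_o2r.
- by move=> *; rewrite /= chart_edge_h.
- by move=> *; rewrite /= chart_edge_v.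
- by move=> v; rewrite /sel /middle; case: (v == w); ctn.
- by move=> e; rewrite /sel /middle; do 3!case: (_ == w); ctn.
- by move=> *; rewrite chart_face_h.
- by move=> *; rewrite chart_face_v.
- by move=> v; ctn.
- by move=> e; rewrite /inner; case: (e == e'); ctn.
- by move=> *; rewrite nearend_o2r.
- by move=> *; rewrite chart_vertex_h.
- by move=> *; rewrite chart_vertex_v.
- by move=> _; rewrite /nearend; ctn.
- by move=> _; rewrite /nearend; ctn.
Qed.

Lemma chart_cover k : exists i, 0 < chart i k.
Proof.
case: (kpointP k) => [bk|v t t01 -> _|e s t s01 t01 -> _].
- by exists None; rewrite /= kglue_base //; lra.
- have tc : 0 <= t <= 1 by lra.
  case: (boolP (0 < middle t)) => h; [exists (Some (inl v))|exists None]; rewrite chart_edge clip_id //.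
    by rewrite /sel eqxx.
  by move: h; rewrite middle_gt0 nearend_gt0; lra.
- have tc : 0 <= t <= 1 by lra.
  have sc : 0 <= s <= 1 by lra.
  case: (boolP ((0 < inner s) && (0 < inner t))) => [/andP[h1 h2]|h].
    by exists (Some (inr e)); rewrite chart_face // eqxx lt_min h1.
  case: (boolP (0 < chart None (kface e (s, t)))) => [h0|]; first by exists None.
  rewrite chart_face // lt_min !nearend_gt0 => h0; move: h; rewrite !inner_gt0 => h.
  (* Some coordinate is within 1/16 of a side. Outside the chart of the vertex the other one lies in
     [1/4, 3/4], so the edge on that side provides the chart. *)
  case: (leP t (1/16)) => ht1.
    exists (Some (inl (lsrc e))); rewrite chart_face // !lt_max eqxx; apply/orP; left; apply/orP; left.
    by rewrite /sel lt_min middle_gt0; lra.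
  case: (leP (15/16) t) => ht2.
    exists (Some (inl (ltgt e))); rewrite chart_face // !lt_max eqxx; apply/orP; left; apply/orP; right.
    by rewrite /sel lt_min middle_gt0; lra.
  exists (Some (inl (llab e))); rewrite chart_face // !lt_max eqxx; apply/orP; right.
  by rewrite /sel lt_min lt_max middle_gt0; lra.
Qed.

Lemma sel0_0 b : sel0 b 0 = 0. Proof. by case: b. Qed.

Lemma coord_edge_end (v v' : V) o : sel0 (v' == v) (tent (o2r o)) = 0.
Proof. by rewrite tent_o2r sel0_0. Qed.

Lemma coord_edge_h v e j s : sel0 (lsrc e == v) (tent s * lo (o2r j)) + sel0 (ltgt e == v) (tent s * lo (1 - o2r j))
         + sel0 (llab e == v) (tent (o2r j) * (lo s + lo (1 - s))) = sel0 (hl e j == v) (tent s).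
Proof.
rewrite lo_o2r lo_1o2r tent_o2r mul0r sel0_0 addr0 /end_pt.
by case: j => /=; rewrite mulr0 mulr1 sel0_0 ?add0r ?addr0.
Qed.

Lemma coord_edge_v v e i t : sel0 (lsrc e == v) (tent (o2r i) * lo t) + sel0 (ltgt e == v) (tent (o2r i) * lo (1 - t))
         + sel0 (llab e == v) (tent t * (lo (o2r i) + lo (1 - o2r i))) = sel0 (llab e == v) (tent t).
Proof.
rewrite lo_o2r lo_1o2r tent_o2r !mul0r !sel0_0 !add0r /end_pt.
by case: i => /=; rewrite ?addr0 ?add0r mulr1.
Qed.

Lemma coord_face_bd (e e' : E) x y : x * y = 0 -> (if e' == e then x * y else 0) = 0 :> R.
Proof. by move=> ->; case: ifP. Qed.

Lemma coord_cts i : continuous (coord i).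
Proof.
have cc (g : K -> R) : continuous g -> continuous (fun k => clip (g k)).
  by move=> cg; apply: (ct_comp (f := g) (g := @clip R)) => //; exact: clip_continuous.
have ct1 (g : R -> R) : continuous g -> continuous (fun q : R * R => g q.1).
  by move=> cg; apply: (ct_comp (f := fst) (g := g)) => //; ctn.
have ct2 (g : R -> R) : continuous g -> continuous (fun q : R * R => g q.2).
  by move=> cg; apply: (ct_comp (f := snd) (g := g)) => //; ctn.
have ct3 (g : R -> R) : continuous g -> continuous (fun q : R => g (1 - q)).
  by move=> cg; apply: (ct_comp (f := fun x : R => 1 - x) (g := g)) => //; ctn.
have [t1 t2] := (ct1 _ (@tent_cts R), ct2 _ (@tent_cts R)).
have [l1 l2] := (ct1 _ (@lo_cts R), ct2 _ (@lo_cts R)).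
have [l3 l4] := (ct1 _ (ct3 _ (@lo_cts R)), ct2 _ (ct3 _ (@lo_cts R))).
have [o1 o2] := (ct1 _ (@om_cts R), ct2 _ (@om_cts R)).
have [k1 k2] := (ct1 _ (@kap_cts R), ct2 _ (@kap_cts R)).
case: i => [[v|e]|]; last by rewrite /coord; ctn.
  rewrite /coord; apply: ct_pair; last by ctn.
  apply: cc; apply: kglue_continuous.
  - exact: coord_edge_end.
  - by move=> *; rewrite /= coord_edge_h.
  - by move=> *; rewrite /= coord_edge_v.
  - by move=> v'; rewrite /sel0; case: (v' == v); [exact: tent_cts|ctn].
  - by move=> e; rewrite /sel0; do 3!case: (_ == v); ctn.
rewrite /coord; apply: ct_pair; apply: cc; apply: kglue_continuous => //.
- by move=> *; rewrite coord_face_bd // om_o2r !mulr0.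
- by move=> *; rewrite coord_face_bd // om_o2r mul0r mulr0.
- by move=> v; ctn.
- by move=> e'; case: (e' == e); ctn.
- by move=> *; rewrite coord_face_bd // om_o2r !mulr0.
- by move=> *; rewrite coord_face_bd // om_o2r mul0r mulr0.
- by move=> v; ctn.
- by move=> e'; case: (e' == e); ctn.
Qed.

Lemma coord_in i k : 0 <= (coord i k).1 <= 1 /\ 0 <= (coord i k).2 <= 1.
Proof.
have z := in01_0 R.
by case: i => [[v|e]|] /=; split => //; exact: clip_in.
Qed.

Lemma kap_mul_om t x y : 1/16 <= x <= 15/16 -> 1/16 <= y <= 15/16 -> clip (kap t * (om x * om y)) = kap t.
Proof. by move=> hx hy; rewrite !om_mid // !mulr1 clip_id // kap_in. Qed.

Lemma chart_coord i k : 0 < chart i k -> kapt 1 k = realize i (coord i k).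
Proof.
have ke0 v : kedge v 0 = k0 := kedge_o2r k0P v false.
have ke1 v : kedge v 1 = k0 := kedge_o2r k0P v true.
case: (kpointP k) => [bk|v t t01 -> _|e s t s01 t01 -> _].
- rewrite kapt_base //; case: i => [[v|e]|] //=; rewrite kglue_base // => h; exfalso; lra.
- have tc : 0 <= t <= 1 by lra.
  rewrite chart_edge kapt1_edge clip_id //; case: i => [[w|e]|].
  + rewrite /sel; case: eqP => [->|_]; last by move=> h; exfalso; lra.
    rewrite middle_gt0 => /andP[h1 h2] /=; rewrite kglue_edge; last exact: coord_edge_end.
    by rewrite /sel0 eqxx [clip t]clip_id // tent_mid ?(ltW h2) // clip_id ?kap_in.
  + by move=> h; exfalso; lra.
  + rewrite nearend_gt0 /= => /orP[h|h]; first by rewrite kap_lo ?ltW.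
    by rewrite kap_hi ?ltW.
- have tc : 0 <= t <= 1 by lra.
  have sc : 0 <= s <= 1 by lra.
  rewrite chart_face // kapt1_face /=; case: i => [[w|e']|].
  + rewrite /= kglue_face /=; [|exact: coord_edge_end|by move=> *; rewrite coord_edge_h|by move=> *; rewrite coord_edge_v].
    rewrite [clip s]clip_id // [clip t]clip_id // !lt_max /sel => /orP[/orP[]|].
    * case: eqP => [<-|_]; last by move=> h; exfalso; lra.
      rewrite lt_min middle_gt0 subr_gt0 => /andP[/andP[h1 h2] h3].
      have e1 : lo t = 1 by rewrite lo_near //; lra.
      have e2 : lo (1 - t) = 0 by rewrite lo_far //; lra.
      have e3 : tent t = 0 by rewrite tent_lo //; lra.
      have e4 : tent s = kap s by rewrite tent_mid //; lra.
      rewrite e1 e2 e3 e4.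
      rewrite mulr0 mul0r !sel0_0 !addr0 mulr1 clip_id ?kap_in // (kap_lo (s := t)); last by lra.
      by rewrite -[X in (_, X)]/(o2r false) kface_h.
    * case: eqP => [<-|_]; last by move=> h; exfalso; lra.
      rewrite lt_min middle_gt0 subr_gt0 => /andP[/andP[h1 h2] h3].
      have e1 : lo t = 0 by rewrite lo_far //; lra.
      have e2 : lo (1 - t) = 1 by rewrite lo_near //; lra.
      have e3 : tent t = 0 by rewrite tent_hi //; lra.
      have e4 : tent s = kap s by rewrite tent_mid //; lra.
      rewrite e1 e2 e3 e4.
      rewrite mulr0 mul0r !sel0_0 !addr0 add0r mulr1 clip_id ?kap_in // (kap_hi (s := t)); last by lra.
      by rewrite -[X in (_, X)]/(o2r true) kface_h.
    * case: eqP => [<-|_]; last by move=> h; exfalso; lra.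
      rewrite lt_min middle_gt0 lt_max !subr_gt0 => /andP[/andP[h1 h2] /orP[h3|h3]].
      - have e1 : lo s = 1 by rewrite lo_near //; lra.
        have e2 : lo (1 - s) = 0 by rewrite lo_far //; lra.
        have e3 : tent s = 0 by rewrite tent_lo //; lra.
        have e4 : tent t = kap t by rewrite tent_mid //; lra.
        rewrite e1 e2 e3 e4.
        rewrite !mul0r !sel0_0 !add0r addr0 mulr1 clip_id ?kap_in // (kap_lo (s := s)); last by lra.
        by rewrite -[X in (X, _)]/(o2r false) kface_v.
      - have e1 : lo s = 0 by rewrite lo_far //; lra.
        have e2 : lo (1 - s) = 1 by rewrite lo_near //; lra.
        have e3 : tent s = 0 by rewrite tent_hi //; lra.
        have e4 : tent t = kap t by rewrite tent_mid //; lra.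
        rewrite e1 e2 e3 e4.
        rewrite !mul0r !sel0_0 !add0r mulr1 clip_id ?kap_in // (kap_hi (s := s)); last by lra.
        by rewrite -[X in (X, _)]/(o2r true) kface_v.
  + case: eqP => [<-|_]; last by move=> h; exfalso; lra.
    rewrite lt_min !inner_gt0 => /andP[/andP[h1 h2] /andP[h3 h4]] /=.
    have z (e1 : E) x y : x * y = 0 -> (if e1 == e then x * y else 0) = 0 :> R by move=> ->; case: ifP.
    rewrite !kglue_face //=; try by move=> *; rewrite z // om_o2r ?mul0r ?mulr0.
    rewrite [clip s]clip_id // [clip t]clip_id // eqxx !kap_mul_om //; rewrite ?(ltW h1) ?(ltW h2) ?(ltW h3) ?(ltW h4) //.
  + rewrite lt_min !nearend_gt0 => /andP[h1 h2] /=.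
    have [o ->] : exists o, kap s = o2r o.
      by case/orP: h1 => h; [exists false; rewrite kap_lo ?ltW|exists true; rewrite kap_hi ?ltW].
    have [o' ->] : exists o, kap t = o2r o.
      by case/orP: h2 => h; [exists false; rewrite kap_lo ?ltW|exists true; rewrite kap_hi ?ltW].
    by rewrite kface_h (kedge_o2r k0P).
Qed.

End Charts.

(** * Grids and functions with finitely many values *)

Section Grid.
Variable R : realType.

Definition slab (n a : nat) (x : R) := a%:R / n.+1%:R <= x <= a.+1%:R / n.+1%:R.
Definition square (n a b : nat) (d : R * R) := slab n a d.1 && slab n b d.2.

Lemma slab_exists n (x : R) : 0 <= x <= 1 -> exists2 a, (a < n.+1)%N & slab n a x.
Proof.
move=> /andP[x0 x1].
have n0 : 0 < n.+1%:R :> R by rewrite ltr0n.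
pose P a := (a < n.+1)%N && (a%:R / n.+1%:R <= x).
have P0 : P 0%N by rewrite /P /= mul0r.
have ub a : P a -> (a <= n)%N by case/andP.
have ex : exists a, P a by exists 0%N.
case: (ex_maxnP ex ub) => a /andP[an ax] amax; exists a => //.
rewrite /slab ax /=; case: (leqP n a) => na.
  have -> : a = n by apply/eqP; rewrite eqn_leq na andbT -ltnS.
  by rewrite divff // gt_eqF.
rewrite leNgt; apply/negP => h.
have := amax a.+1; rewrite /P ltnS na (ltW h) => /(_ isT).
by rewrite ltnn.
Qed.

Lemma square_exists n (d : R * R) : 0 <= d.1 <= 1 -> 0 <= d.2 <= 1 ->
  exists a b, [/\ (a < n.+1)%N, (b < n.+1)%N & square n a b d].
Proof.
move=> /(slab_exists n)[a an ha] /(slab_exists n)[b bn hb].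
by exists a, b; split=> //; rewrite /square ha.
Qed.

(** A Lebesgue number of the cover of the unit square, obtained as a mesh size from near-covering
    compactness. *)
Lemma lebesgue_grid (I : finType) (g : I -> R * R -> R) : (forall i, continuous (g i)) ->
  (forall d, exists i, 0 < g i d) ->
  exists n, forall a b, (a < n.+1)%N -> (b < n.+1)%N -> exists i, forall d, square n a b d -> 0 < g i d.
Proof.
move=> cg cov.
pose P (n : nat) (d : R * R) := exists i, forall d', `|d'.1 - d.1| <= n.+1%:R^-1 ->
  `|d'.2 - d.2| <= n.+1%:R^-1 -> 0 < g i d'.
have cI : compact ((`[0, 1] `*` `[0, 1]) : set (R * R)).
  by apply: compact_setX; exact: segment_compact.
have /compact_near_coveringP/(_ nat \oo P _) := cI.
case=> [x _|N _ NP].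
  have [i gi] := cov x.
  have : \forall y \near x, 0 < g i y.
    by apply: (cg i x (fun z => 0 < z)); exact: lt_nbhsr.
  move=> /nbhs_ballP[e /= e0 ball_e].
  exists (ball x (e / 2), [set n | n.+1%:R^-1 < e / 2]) => /=.
    split; first by apply: nbhsx_ballx; lra.
    have e2 : 0 < e / 2 by lra.
    exact: (near_infty_natSinv_lt (interval_inference.PosNum e2)).
  move=> [y n] /= [[by1 by2] hn]; exists i => d' h1 h2; apply: ball_e.
  rewrite /ball /= in by1 by2.
  have tri (p q r z : R) : `|p - q| < e / 2 -> `|r - q| <= z -> z < e / 2 -> `|p - r| < e.
    move=> k1 k2 k3; apply: (le_lt_trans (ler_distD q p r)).
    by rewrite (distrC q r); have := le_lt_trans k2 k3; lra.
  by split; rewrite /ball /=; [exact: tri by1 h1 hn|exact: tri by2 h2 hn].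
exists N => a b aN bN; pose d0 : R * R := (a%:R / N.+1%:R, b%:R / N.+1%:R).
have n0 : 0 < N.+1%:R :> R by rewrite ltr0n.
have slN c x : slab N c x -> `|x - c%:R / N.+1%:R| <= N.+1%:R^-1.
  move=> /andP[h1 h2]; rewrite ger0_norm ?subr_ge0 // lerBlDl (le_trans h2) //.
  by rewrite -natr1 mulrDl mul1r.
have in01 c : (c < N.+1)%N -> [set` `[0, 1]] (c%:R / N.+1%:R : R).
  move=> cN; rewrite /= in_itv /= divr_ge0 ?ler0n //= ler_pdivrMr // mul1r ler_nat.
  exact: ltnW.
have [] := NP N (leqnn N) d0.
  by split; exact: in01.
move=> i gi; exists i => d /andP[h1 h2]; apply: gi; exact: slN.
Qed.

Lemma dense_avoid (s : seq R) (x y : R) : x < y -> exists2 v, x < v < y & v \notin s.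
Proof.
elim: s x y => [|w s IH] x y xy; first by exists ((x + y) / 2) => //; lra.
case: (boolP (x < w < y)) => h.
  have xw : x < w by lra.
  have [v hv vs] := IH x w xw.
  exists v; first by lra.
  by rewrite inE negb_or vs andbT lt_eqF //; lra.
have [v hv vs] := IH x y xy; exists v => //.
rewrite inE negb_or vs andbT; apply/eqP => vw; move: h; rewrite -vw; lra.
Qed.

(** By the intermediate value theorem. Discrete invariants of the lift will be presented as such
    functions in order to be constant. *)
Lemma finite_values_const (D : R -> R) (s : seq R) : continuous D ->
  (forall u, 0 <= u <= 1 -> D u \in s) -> forall u u', 0 <= u <= 1 -> 0 <= u' <= 1 -> D u = D u'.
Proof.
move=> cD Ds.
suff H u u' : 0 <= u <= 1 -> 0 <= u' <= 1 -> u <= u' -> D u = D u'.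
  by move=> u u' h h'; case: (leP u u') => k; [exact: H|symmetry; apply: H => //; exact: ltW].
move=> h h' uu; apply/eqP; apply: contraT => ne.
have mM : Num.min (D u) (D u') < Num.max (D u) (D u').
  by case: (ltgtP (D u) (D u')) ne.
have [v /andP[v1 v2] vs] := dense_avoid s mM.
have cW : {within `[u, u'], continuous D} by exact: continuous_subspaceT.
have [|c c1 cv] := IVT uu cW (v := v); first by rewrite (ltW v1) (ltW v2).
have := Ds c; rewrite cv (negbTE vs) => /(_ _).
move: c1; rewrite in_itv /= => c1; have c01 : 0 <= c <= 1 by lra.
by move=> /(_ c01).
Qed.

End Grid.

Lemma closed_pasting_ex (T Z : topologicalType) (I : finType) (C : I -> set T) (f : T -> Z) :
  (forall i, closed (C i)) -> (forall x, exists i, C i x) ->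
  (forall i, exists2 g : T -> Z, continuous g & forall x, C i x -> f x = g x) -> continuous f.
Proof.
move=> cC cov ex; have g_ i : {g : T -> Z | continuous g & forall x, C i x -> f x = g x}.
  by apply: cid2; exact: ex.
apply: (@closed_pasting T Z I C (fun i => s2val (g_ i)) f cC cov) => i; first by case: (g_ i).
by case: (g_ i) => g cg fg x /=; exact: fg.
Qed.

(** * The lift of a map of the square and evaluation on it *)

Section Eval.
Context (R : realType) (V E : finType) (lsrc llab ltgt : E -> V).
Local Notation cplx := (cplx lsrc llab ltgt).
Local Notation K := (LOGcomplex R lsrc llab ltgt).
Local Notation hl := (hl lsrc ltgt).
Local Notation kedge := (@cell_edge R V E lsrc llab ltgt).
Local Notation kface := (@cell_face R V E lsrc llab ltgt).
Local Notation o2r := (end_pt R).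
Variables (k0 : K) (k0P : is_basep k0).

Definition Kin (J : {set V}) (k : K) : Prop :=
  match cpt k with
  | None => True
  | Some (inl (v, _)) => v \in J
  | Some (inr (e, _)) => e \in Ein lsrc ltgt J
  end.

Lemma Kin_setT k : Kin [set: V]%SET k.
Proof.
rewrite /Kin; case: (cpt k) => [[[v t]|[e q]]|] //.
by rewrite in_Ein; apply/forallP => o; exact: finset.in_setT.
Qed.

Lemma cpt_k0 : cpt k0 = None. Proof. exact/cpt_base. Qed.

Lemma cpt_edge_in v s : 0 < s < 1 -> cpt (kedge v s) = Some (inl (v, s)).
Proof.
move=> h; rewrite cpt_edge /canon_edge clip_id; last by lra.
by rewrite gt_eqF ?lt_eqF //; lra.
Qed.

Lemma cpt_face_in e s t : 0 < s < 1 -> 0 < t < 1 -> cpt (kface e (s, t)) = Some (inr (e, (s, t))).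
Proof.
move=> h h'; have es : clip s = s by apply: clip_id; lra.
have et : clip t = t by apply: clip_id; lra.
case/andP: h => s0 s1; case/andP: h' => t0 t1.
by rewrite cpt_face /canon_square /= es et (gt_eqF t0) (lt_eqF t1) (gt_eqF s0) (lt_eqF s1).
Qed.

Lemma in01P (s : R) : 0 <= s <= 1 -> [\/ s = o2r false, s = o2r true | 0 < s < 1].
Proof.
move=> h; case: (eqVneq s 0) => [->|n0]; first by constructor 1.
case: (eqVneq s 1) => [->|n1]; first by constructor 2.
by constructor 3; rewrite !lt_neqAle eq_sym n0 n1.
Qed.

Lemma o2r_eq1 o : (o2r o == 1) = o.
Proof. by rewrite /end_pt; case: o => /=; rewrite ?eqxx // eq_sym oner_eq0. Qed.

Lemma in_eq1 s : 0 < s < 1 -> (s == 1 :> R) = false.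
Proof. by move=> h; rewrite lt_eqF //; lra. Qed.

Section Nf.
Variables (L : cplx) (iL : immersed L) (J : {set V}) (h : pred (cX L)) (hh : jclosed J h).
Local Notation C := (sub hh).
Variables (Z : Type) (z0 : Z).

(** The value of [m] at the point of [L] over [k] with reference vertex [x]: the origin of its open
    edge, the lower left corner of its open face, or the vertex itself. Immersion makes the cell
    unique; [z0] stands for no cell. *)
Definition nf (m : fmap R C Z) (k : K) (x : cX L) : Z :=
  match cpt k with
  | None => if insub x : option (cX C) is Some x' then mx m x' else z0
  | Some (inl (v, t)) =>
     if [pick a : cA C | (vt (val a) false == x) && (al (val a) == v)] is Some a then ma m a t else z0
  | Some (inr (e, q)) =>
     if [pick b : cB C | (vt (hs (val b) false) false == x) && (bl (val b) == e)] is Some b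
     then mb m b q.1 q.2 else z0
  end.

Lemma nf_vertex m (x : cX C) : nf m k0 (val x) = mx m x.
Proof. by rewrite /nf cpt_k0 valK. Qed.

Lemma nf_edge m (a : cA C) s : compat m -> 0 <= s <= 1 ->
  nf m (kedge (al (val a)) s) (vt (val a) (s == 1)) = ma m a s.
Proof.
move=> [h1 _ _] s01.
have end_ o : nf m (kedge (al (val a)) (o2r o)) (vt (val a) (o2r o == 1)) = ma m a (o2r o).
  by rewrite o2r_eq1 (kedge_o2r k0P) h1 -nf_vertex.
case: (in01P s01) => [->|->|s_in]; [exact: end_|exact: end_|].
rewrite in_eq1 // /nf cpt_edge_in //; case: pickP => [a' /andP[/eqP v' /eqP l']|/(_ a)]; last by rewrite !eqxx.
by congr ma; apply: val_inj; exact: (proj1 iL _ _ false).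
Qed.

Lemma nf_face m (b : cB C) s t : compat m -> 0 <= s <= 1 -> 0 <= t <= 1 ->
  nf m (kface (bl (val b)) (s, t)) (vt (hs (val b) (t == 1)) (s == 1)) = mb m b s t.
Proof.
move=> cm s01 t01; have [_ h2 h3] := cm.
have hside j : nf m (kface (bl (val b)) (s, o2r j)) (vt (hs (val b) (o2r j == 1)) (s == 1)) = mb m b s (o2r j).
  by rewrite o2r_eq1 kface_h h2 -nf_edge //= hsP.
have vside i : nf m (kface (bl (val b)) (o2r i, t)) (vt (hs (val b) (t == 1)) (o2r i == 1)) = mb m b (o2r i) t.
  by rewrite o2r_eq1 kface_v h3 -nf_edge //= vsP crP.
case: (in01P t01) hside => [->|->|t_in] hside //.
case: (in01P s01) vside => [->|->|s_in] vside //.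
rewrite !in_eq1 // /nf cpt_face_in //; case: pickP => [b' /andP[/eqP v' /eqP l']|/(_ b)]; last by rewrite !eqxx.
by congr mb; apply: val_inj; exact: (corner_inj (i := false) (j := false) iL).
Qed.

Lemma face_sub (labJ : forall e, e \in Ein lsrc ltgt J -> llab e \in J) (b : cB L) i j : bl b \in Ein lsrc ltgt J -> h (vt (hs b j) i) -> subB h (fun v => v \in J) b.
Proof.
move=> bJ hb; have lJ := labJ _ bJ; have hJ k : hl (bl b) k \in J by exact: (Ein_hl k bJ).
have eh k : h (vt (hs b k) false) = h (vt (hs b k) true) by apply: hh; rewrite hsP.
have ev k : h (vt (vs b k) false) = h (vt (vs b k) true) by apply: hh; rewrite vsP.
have h0 : h (vt (hs b j) false) by move: hb; case: (i); rewrite // eh.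
have h1 k : h (vt (hs b k) false).
  by case: (eqVneq k j) => [->//|]; move: h0; case: (k); case: (j) => //; rewrite !crP ev.
have h2 k : h (vt (vs b k) false) by rewrite -crP; case: (k); rewrite -?eh.
by rewrite /subB /subA !h1 !h2 !hsP !vsP !hJ !lJ.
Qed.

Lemma edge_sub (a : cA L) o : al a \in J -> h (vt a o) -> subA h (fun v => v \in J) a.
Proof. by move=> aJ ha; rewrite /subA aJ andbT; move: ha; case: o; rewrite // hh. Qed.

End Nf.

Section Lift.
Variable f : R * R -> K.
Hypothesis cf : continuous f.
Variable n : nat.
Local Notation T := ('I_n.+1 * 'I_n.+1)%type.
Variable ty : T -> option (V + E).
Definition sq (Q : T) (d : R * R) := square n Q.1 Q.2 d.
Hypothesis tyP : forall Q d, sq Q d -> 0 < chart (ty Q) (f d).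

Definition fk d := kapt k0 1 (f d).
Definition cq Q d : R * R := coord (ty Q) (f d).
(** The corner serving as reference vertex: lower left for an interior point, moved to the far side
    by each coordinate equal to 1. *)
Definition cc (q : R * R) := (q.1 == 1, q.2 == 1).

Lemma cq_cts Q : continuous (cq Q).
Proof. by apply: (ct_comp (f := f) (g := coord (ty Q))) => //; exact: coord_cts. Qed.

Lemma cq1 Q d : 0 <= (cq Q d).1 <= 1. Proof. by case: (coord_in (ty Q) (f d)). Qed.
Lemma cq2 Q d : 0 <= (cq Q d).2 <= 1. Proof. by case: (coord_in (ty Q) (f d)). Qed.

Lemma fkE Q d : sq Q d -> fk d = realize k0 (ty Q) (cq Q d).
Proof. by move=> /tyP h; rewrite /fk (chart_coord k0P h). Qed.

(** The least identification that makes the reference vertex [xx] of a point independent of the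
    square chosen around it. *)
Definition gluing (s t : T * (bool * bool)) : Prop :=
  exists d, [/\ sq s.1 d, sq t.1 d, s.2 = cc (cq s.1 d) & t.2 = cc (cq t.1 d)].

Definition lift_cplx : cplx := foldc lsrc llab ltgt ty gluing.
Local Notation L := lift_cplx.
Definition lift_corner (s : T * (bool * bool)) : cX L := fpi lsrc llab ltgt ty gluing s.

Local Notation pi := lift_corner.

Definition I2 (d : R * R) : Prop := 0 <= d.1 <= 1 /\ 0 <= d.2 <= 1.

Lemma sq_ex d : {Q : T | I2 d -> sq Q d}.
Proof.
apply: cid; case: (pselect (I2 d)) => [[h1 h2]|h]; last by exists (ord0, ord0).
have [a [b [an bn ab]]] := square_exists n h1 h2.
by exists (Ordinal an, Ordinal bn).
Qed.

Definition xx d : cX L := pi (sval (sq_ex d), cc (cq (sval (sq_ex d)) d)).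

Lemma xxE Q d : I2 d -> sq Q d -> xx d = pi (Q, cc (cq Q d)).
Proof.
move=> h hQ; apply: fold_glue; exists d; split=> //.
exact: (svalP (sq_ex d)).
Qed.

Lemma sq_closed (Y : topologicalType) (g : Y -> R * R) Q : continuous g -> closed [set y | sq Q (g y)].
Proof.
move=> cg; rewrite (_ : [set y | _] =
   ([set y | Q.1%:R / n.+1%:R <= (g y).1] `&` [set y | (g y).1 <= Q.1.+1%:R / n.+1%:R]) `&`
   ([set y | Q.2%:R / n.+1%:R <= (g y).2] `&` [set y | (g y).2 <= Q.2.+1%:R / n.+1%:R])).
  have c1 : continuous (fun y => (g y).1) by apply: ct_fst1.
  have c2 : continuous (fun y => (g y).2) by apply: ct_snd1.
  by apply: closedI; apply: closedI; apply: closed_le => //; ctn.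
apply/seteqP; split=> y; rewrite /sq /square /slab /=.
  by move=> /andP[/andP[-> ->] /andP[-> ->]].
by move=> [[-> ->] [-> ->]].
Qed.

Section Const.
Variables (J : {set V}) (labJ : forall e, e \in Ein lsrc ltgt J -> llab e \in J).
Variables (h : pred (cX L)) (hh : jclosed J h).

Definition corner_val Q c : R := (h (pi (Q, c)))%:R.
(** Jumps of the reference corner are smoothed out: bilinear interpolation is continuous in the
    coordinates. On cells of [J] it equals the value at the reference corner, because [h] agrees at
    the corners of such a cell. *)
Definition interpol Q (q : R * R) : R :=
  (1 - q.2) * ((1 - q.1) * corner_val Q (false, false) + q.1 * corner_val Q (true, false))
  + q.2 * ((1 - q.1) * corner_val Q (false, true) + q.1 * corner_val Q (true, true)).

Lemma H_side Q e j : ty Q = Some (inr e) -> hl e j \in J -> corner_val Q (false, j) = corner_val Q (true, j).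
Proof.
move=> /(fold_face lsrc llab ltgt gluing)[b be bv] hJ; rewrite /corner_val /lift_corner -!bv hh //.
by rewrite hsP be.
Qed.

Lemma V_side Q e i : ty Q = Some (inr e) -> llab e \in J -> corner_val Q (i, false) = corner_val Q (i, true).
Proof.
move=> /(fold_face lsrc llab ltgt gluing)[b be bv] hJ; rewrite /corner_val /lift_corner -!bv !crP hh //.
by rewrite vsP be.
Qed.

Lemma eta_eq Q q : (0 <= q.1 <= 1) -> (0 <= q.2 <= 1) -> Kin J (realize k0 (ty Q) q) ->
  (forall v, ty Q = Some (inl v) -> q.2 = 0) -> (ty Q = None -> q = (0, 0)) ->
  interpol Q q = corner_val Q (cc q).
Proof.
case: q => s t /= s01 t01; case tQ: (ty Q) => [[v|e]|] /= kin c1 c2.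
- rewrite (c1 v) // /interpol /cc /= subr0 mul1r mul0r addr0.
  have -> : ((0 : R) == 1) = false by rewrite eq_sym oner_eq0.
  case: (in01P s01) kin => [->|->|s_in] kin.
  + by rewrite o2r_eq1 /end_pt subr0 mul1r mul0r addr0.
  + by rewrite o2r_eq1 /end_pt subrr mul0r mul1r add0r.
  + rewrite in_eq1 //; move: kin; rewrite /Kin cpt_edge_in // => vJ.
    have [a av aE] := fold_edge lsrc llab ltgt gluing tQ.
    have -> : corner_val Q (true, false) = corner_val Q (false, false).
      by rewrite /corner_val /lift_corner -!(aE _ false) hh // av.
    by rewrite -mulrDl subrK mul1r.
- case: (in01P t01) kin => [->|->|t_in] kin; rewrite /interpol /cc /=.
  + rewrite o2r_eq1 /end_pt subr0 mul1r mul0r addr0.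
    case: (in01P s01) kin => [->|->|s_in] kin.
    * by rewrite o2r_eq1 /end_pt subr0 mul1r mul0r addr0.
    * by rewrite o2r_eq1 /end_pt subrr mul0r mul1r add0r.
    * rewrite in_eq1 //; move: kin; rewrite kface_h /Kin cpt_edge_in // => vJ.
      by rewrite (H_side tQ vJ) -mulrDl subrK mul1r.
  + rewrite o2r_eq1 /end_pt subrr mul0r mul1r add0r.
    case: (in01P s01) kin => [->|->|s_in] kin.
    * by rewrite o2r_eq1 /end_pt subr0 mul1r mul0r addr0.
    * by rewrite o2r_eq1 /end_pt subrr mul0r mul1r add0r.
    * rewrite in_eq1 //; move: kin; rewrite kface_h /Kin cpt_edge_in // => vJ.
      by rewrite (H_side tQ vJ) -mulrDl subrK mul1r.
  + rewrite (in_eq1 t_in); case: (in01P s01) kin => [->|->|s_in].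
    * rewrite kface_v /Kin cpt_edge_in // => vJ; rewrite o2r_eq1 /end_pt subr0 !mul1r !mul0r !addr0.
      by rewrite (V_side false tQ vJ) -mulrDl subrK mul1r.
    * rewrite kface_v /Kin cpt_edge_in // => vJ; rewrite o2r_eq1 /end_pt subrr !mul1r !mul0r !add0r.
      by rewrite (V_side true tQ vJ) -mulrDl subrK mul1r.
    * rewrite /Kin cpt_face_in // => eJ; rewrite in_eq1 //.
      have vJ := labJ eJ; have hJ j : hl e j \in J by exact: (Ein_hl j eJ).
      rewrite -(H_side tQ (hJ false)) -(H_side tQ (hJ true)) -(V_side false tQ vJ).
      by rewrite -!mulrDl !subrK !mul1r.
- by case: (c2 erefl) => -> ->; rewrite /interpol /cc /= eq_sym oner_eq0 subr0 !mul1r !mul0r !addr0.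
Qed.

Lemma h_xx_eta Q d : I2 d -> sq Q d -> Kin J (fk d) -> (h (xx d))%:R = interpol Q (cq Q d).
Proof.
move=> hd hQ; rewrite (fkE hQ) (xxE hd hQ) => kin; rewrite eta_eq //; [exact: cq1|exact: cq2| |].
  by move=> v tQ; rewrite /cq tQ.
by move=> tQ; rewrite /cq tQ.
Qed.

(** On each square [h] at the reference vertex is given by [interpol]. So it is continuous along the
    path, with 0 and 1 as its only values. *)
Lemma h_const (g : R -> R * R) : continuous g ->
  (forall u, 0 <= u <= 1 -> I2 (g u)) -> (forall u, 0 <= u <= 1 -> Kin J (fk (g u))) ->
  h (xx (g 0)) = h (xx (g 1)).
Proof.
move=> cg gI gJ.
pose D u : R := (h (xx (g (clip u))))%:R.
have cgc : continuous (fun u => g (clip u)).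
  by apply: (ct_comp (f := @clip R) (g := g)) => //; exact: clip_continuous.
have cD : continuous D.
  apply: (@closed_pasting _ _ T (fun Q => [set u | sq Q (g (clip u))]) (fun Q u => interpol Q (cq Q (g (clip u))))).
  - by move=> Q; exact: sq_closed.
  - move=> u; exists (sval (sq_ex (g (clip u)))) => /=; apply: (svalP (sq_ex _)); exact/gI/clip_in.
  - move=> Q; apply: (ct_comp (f := fun u => cq Q (g (clip u))) (g := interpol Q)).
      by apply: (ct_comp (f := fun u => g (clip u)) (g := cq Q)) => //; exact: cq_cts.
    by rewrite /interpol; ctn.
  - by move=> Q u /= hQ; apply: h_xx_eta => //; [exact/gI/clip_in|exact/gJ/clip_in].
have : D 0 = D 1.
  apply: (@finite_values_const R D [:: 0; 1]) => //; rewrite ?lexx ?ler01 //.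
  by move=> u _; rewrite /D; case: (h _); rewrite !inE eqxx ?orbT.
rewrite /D clip0 clip1; case: (h (xx (g 0))); case: (h (xx (g 1))) => //= /eqP.
  by rewrite oner_eq0.
by rewrite eq_sym oner_eq0.
Qed.

End Const.

Lemma corners_conn (h : cX L -> bool) : (forall a, h (vt a false) = h (vt a true)) ->
  forall Q c c', h (pi (Q, c)) = h (pi (Q, c')).
Proof.
move=> hh Q [i j] [i' j']; case tQ: (ty Q) => [[v|e]|].
- have [a _ aE] := fold_edge lsrc llab ltgt gluing tQ.
  rewrite /lift_corner -!aE; by case: (i); case: (i').
- have [b _ bE] := fold_face lsrc llab ltgt gluing tQ.
  rewrite /lift_corner -!bE.
  have e1 o k : h (vt (hs b k) o) = h (vt (hs b k) false) by case: o.
  have e2 k : h (vt (hs b k) false) = h (vt (hs b false) false) by case: k => //; rewrite !crP hh.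
  by rewrite e1 e2 [RHS]e1 e2.
- by congr h; exact: fold_vertex.
Qed.

Lemma sq_point Q : exists2 d, I2 d & sq Q d.
Proof.
have n0 : 0 < n.+1%:R :> R by rewrite ltr0n.
have in01 (c : 'I_n.+1) : 0 <= (c%:R / n.+1%:R : R) <= 1.
  by rewrite divr_ge0 ?ler0n //= ler_pdivrMr // mul1r ler_nat ltnW.
exists (Q.1%:R / n.+1%:R, Q.2%:R / n.+1%:R); first by split; exact: in01.
have le (c : nat) : c%:R / n.+1%:R <= c.+1%:R / n.+1%:R :> R.
  by rewrite ler_pM2r ?invr_gt0 // ler_nat.
by rewrite /sq /square /slab /= !lexx !le.
Qed.

(** Points of any two squares are joined by a segment, to which [h_const] applies with all vertices
    as labels. *)
Lemma L_conn : conn L.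
Proof.
move=> h hh x y.
have red z : exists2 d, I2 d & h z = h (xx d).
  have [[Q c] <-] := fpi_surj z; have [d hd hQ] := sq_point Q.
  by exists d => //; rewrite (xxE hd hQ); exact: (corners_conn hh).
have [d hd ->] := red x; have [d' hd' ->] := red y.
pose g u : R * R := (d.1 + u * (d'.1 - d.1), d.2 + u * (d'.2 - d.2)).
have g0 : g 0 = d by rewrite /g !mul0r !addr0; case: (d).
have g1 : g 1 = d' by rewrite /g !mul1r ![_ + (_ - _)]addrC !subrK; case: (d').
have labT e : e \in Ein lsrc ltgt [set: V]%SET -> llab e \in [set: V]%SET by rewrite !inE.
have hT : jclosed [set: V]%SET h by move=> a _; exact: hh.
have := h_const labT hT (g := g); rewrite g0 g1; apply.
- by rewrite /g; ctn.
- move=> u /andP[u0 u1]; case: hd hd' => /andP[? ?] /andP[? ?] [/andP[? ?] /andP[? ?]].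
  by split; rewrite /g /=; apply/andP; split; nra.
- by move=> u _; exact: Kin_setT.
Qed.

Section Family.
Variables (J : {set V}) (labJ : forall e, e \in Ein lsrc ltgt J -> llab e \in J).
Variables (h : pred (cX L)) (hh : jclosed J h).
Local Notation C := (sub hh).
Variables (Z : topologicalType) (z0 : Z) (F : R -> fmap R C Z).
Hypotheses (cF : fcont F) (coF : forall t, compat (F t)).

Variables (Y : topologicalType) (g : Y -> R * R) (tau : Y -> R).
Hypotheses (cg : continuous g) (ctau : continuous tau).
Hypotheses (gI : forall y, I2 (g y)) (gJ : forall y, Kin J (fk (g y))) (gh : forall y, h (xx (g y))).

Definition Ev y := nf z0 (F (tau y)) (fk (g y)) (xx (g y)).

Lemma Ev_face Q e y : ty Q = Some (inr e) -> sq Q (g y) -> fk (g y) = kface e (cq Q (g y)).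
Proof. by move=> tQ hQ; rewrite (fkE hQ) tQ. Qed.

Lemma lift_imm : immersed L. Proof. exact: foldc_imm. Qed.

Lemma eta2 (q : R * R) : q = (q.1, q.2). Proof. by case: q. Qed.

Lemma Ev_whole Q e : ty Q = Some (inr e) -> e \in Ein lsrc ltgt J ->
  exists2 G : Y -> Z, continuous G & forall y, sq Q (g y) -> Ev y = G y.
Proof.
move=> tQ eJ; have [b be bE] := fold_face lsrc llab ltgt gluing tQ.
case: (pselect (exists y, sq Q (g y))) => [[y0 hy0]|no]; last first.
  by exists (fun=> z0); [ctn|move=> y hy; case: no; exists y].
have bS : subB h (fun v => v \in J) b.
  apply: (@face_sub L J h hh labJ b (cc (cq Q (g y0))).1 (cc (cq Q (g y0))).2); first by rewrite be.
  by rewrite bE; have := gh y0; rewrite (xxE (gI y0) hy0).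
pose b' : cB C := exist _ b bS.
exists (fun y => mb (F (tau y)) b' (cq Q (g y)).1 (cq Q (g y)).2).
  apply: (ct_comp (f := fun y => (cq Q (g y), tau y)) (g := fun q : R * R * R => mb (F q.2) b' q.1.1 q.1.2)).
    by apply: ct_pair => //; apply: (ct_comp (f := g) (g := cq Q)) => //; exact: cq_cts.
  by case: cF.
move=> y hy; rewrite /Ev (Ev_face tQ hy) (xxE (gI y) hy) -(@nf_face L lift_imm J h hh _ z0 _ b') //; [|exact: cq1|exact: cq2].
rewrite -eta2 (_ : bl (val b') = e) //; congr nf; symmetry; exact: bE.
Qed.

Lemma Ev_edge Q (a : cA L) (p : R * R -> R) : continuous p -> al a \in J ->
  exists2 G : Y -> Z, continuous G & forall y, sq Q (g y) -> 0 <= p (cq Q (g y)) <= 1 ->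
    fk (g y) = kedge (al a) (p (cq Q (g y))) -> xx (g y) = vt a (p (cq Q (g y)) == 1) -> Ev y = G y.
Proof.
move=> cp aJ.
case: (boolP (subA h (fun v => v \in J) a)) => [aS|no]; last first.
  exists (fun=> z0); first by ctn.
  move=> y _ _ _ xE; case/negP: no; apply: (edge_sub hh (o := p (cq Q (g y)) == 1) aJ).
  by rewrite -xE; exact: gh.
pose a' : cA C := exist _ a aS.
exists (fun y => ma (F (tau y)) a' (p (cq Q (g y)))).
  apply: (ct_comp (f := fun y => (p (cq Q (g y)), tau y)) (g := fun q : R * R => ma (F q.2) a' q.1)).
    apply: ct_pair => //; apply: (ct_comp (f := fun y => cq Q (g y)) (g := p)) => //.
    by apply: (ct_comp (f := g) (g := cq Q)) => //; exact: cq_cts.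
  by case: cF.
by move=> y hy p01 fE xE; rewrite /Ev fE xE -(@nf_edge L lift_imm J h hh _ z0 _ a').
Qed.

Lemma Ev_corner Q c : exists2 G : Y -> Z, continuous G & forall y, sq Q (g y) ->
  fk (g y) = k0 -> xx (g y) = pi (Q, c) -> Ev y = G y.
Proof.
case: (boolP (h (pi (Q, c)))) => [hx|no]; last first.
  by exists (fun=> z0); [ctn|move=> y _ _ xE; case/negP: no; rewrite -xE; exact: gh].
pose x' : cX C := exist (fun x => h x) _ hx.
exists (fun y => mx (F (tau y)) x').
  by apply: (ct_comp (f := tau) (g := fun t => mx (F t) x')) => //; case: cF.
by move=> y hy fE xE; rewrite /Ev fE xE -(@nf_vertex L J h hh _ z0 _ x').
Qed.

(** Codes for closed pieces of a square: everything, a horizontal side, a corner, or by [inr] a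
    vertical side. A point over the [J]-part may lie on the boundary of a face outside [J], so
    continuity is pasted over the pieces that [pvalid] admits. *)
Definition pset (p : option (bool * option bool) + bool) (q : R * R) : Prop :=
  match p with
  | inl None => True
  | inr i => q.1 = o2r i
  | inl (Some (j, None)) => q.2 = o2r j
  | inl (Some (j, Some i)) => q = (o2r i, o2r j)
  end.

Definition pvalid Q (p : option (bool * option bool) + bool) : Prop :=
  match p, ty Q with
  | inl None, Some (inr e) => e \in Ein lsrc ltgt J
  | inl (Some (j, None)), Some (inr e) => hl e j \in J
  | inl (Some (j, None)), Some (inl v) => (v \in J) /\ j = false
  | inr i, Some (inr e) => llab e \in J
  | inl (Some (j, Some i)), _ => True
  | _, _ => False
  end.

Lemma closed_eq (q r : Y -> R) : continuous q -> continuous r -> closed [set y | q y = r y].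
Proof.
move=> cq' cr; rewrite (_ : [set y | _] = [set y | q y <= r y] `&` [set y | r y <= q y]).
  by apply: closedI; apply: closed_le.
apply/seteqP; split=> y /=; first by move=> ->.
by case=> h1 h2; apply/eqP; rewrite eq_le h1 h2.
Qed.

Lemma Ev_cts : continuous Ev.
Proof.
pose I := (T * (option (bool * option bool) + bool))%type.
pose Cs (k : I) : set Y := if `[< pvalid k.1 k.2 >] then [set y | sq k.1 (g y)] `&` [set y | pset k.2 (cq k.1 (g y))] else set0.
have c0 Q : continuous (fun y => cq Q (g y)) by apply: (ct_comp (f := g) (g := cq Q)) => //; exact: cq_cts.
apply: (@closed_pasting_ex _ _ I Cs).
- move=> [Q p]; rewrite /Cs; case: asboolP => _; last exact: closed0.
  apply: closedI; first exact: sq_closed.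
  have c1 : continuous (fun y => (cq Q (g y)).1) by apply: ct_fst1.
  have c2 : continuous (fun y => (cq Q (g y)).2) by apply: ct_snd1.
  case: p => [[[j [i|]]|]|i] /=.
  + rewrite (_ : [set y | _] = [set y | (cq Q (g y)).1 = o2r i] `&` [set y | (cq Q (g y)).2 = o2r j]).
      by apply: closedI; apply: closed_eq => //; ctn.
    by apply/seteqP; split=> y /=; [move=> ->|case: (cq Q (g y)) => a b /= [-> ->]].
  + by apply: closed_eq => //; ctn.
  + exact: closedT.
  + by apply: closed_eq => //; ctn.
- move=> y; have hQ := svalP (sq_ex (g y)) (gI y); set Q := sval _ in hQ.
  suff [p pv ps] : exists2 p, pvalid Q p & pset p (cq Q (g y)).
    by exists (Q, p); rewrite /Cs; case: asboolP.
  have := gJ y; rewrite (fkE hQ); have := cq1 Q (g y); have := cq2 Q (g y).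
  have := erefl (cq Q (g y)); rewrite {1}/cq /pvalid.
  case tQ: (ty Q) => [[v|e]|] /=.
  + case: (cq Q (g y)) => s t [_ <-] /= _ s01; case: (in01P s01) => [->|->|s_in].
    * by exists (inl (Some (false, Some false))).
    * by exists (inl (Some (false, Some true))).
    * by rewrite /Kin cpt_edge_in // => vJ; exists (inl (Some (false, None))).
  + case: (cq Q (g y)) => s t _ /= t01 s01; case: (in01P t01) => [->|->|t_in].
    * case: (in01P s01) => [->|->|s_in].
      - by exists (inl (Some (false, Some false))).
      - by exists (inl (Some (false, Some true))).
      - by rewrite kface_h /Kin cpt_edge_in // => vJ; exists (inl (Some (false, None))).
    * case: (in01P s01) => [->|->|s_in].
      - by exists (inl (Some (true, Some false))).
      - by exists (inl (Some (true, Some true))).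
      - by rewrite kface_h /Kin cpt_edge_in // => vJ; exists (inl (Some (true, None))).
    * case: (in01P s01) => [->|->|s_in].
      - by rewrite kface_v /Kin cpt_edge_in // => vJ; exists (inr false).
      - by rewrite kface_v /Kin cpt_edge_in // => vJ; exists (inr true).
      - by rewrite /Kin cpt_face_in // => eJ; exists (inl None).
  + by case: (cq Q (g y)) => s t [<- <-] *; exists (inl (Some (false, Some false))).
- move=> [Q p]; rewrite /Cs; case: asboolP => [pv|_]; last by exists (fun=> z0); [ctn|].
  have xE y : sq Q (g y) -> xx (g y) = pi (Q, cc (cq Q (g y))) by exact: xxE.
  case: p pv => [[[j [i|]]|]|i]; rewrite /pvalid /=.
  + move=> _; have [G cG GE] := Ev_corner Q (i, j); exists G => // y [/= hy qE]; apply: GE => //.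
      rewrite (fkE hy) qE; case: (ty Q) => [[v|e]|] //=; first by rewrite (kedge_o2r k0P).
      by rewrite kface_h (kedge_o2r k0P).
    by rewrite xE // qE /cc /= !o2r_eq1.
  + case tQ: (ty Q) => [[v|e]|] //.
    * move=> [vJ j0]; have [a av aE] := fold_edge lsrc llab ltgt gluing tQ.
      have [|G cG GE] := @Ev_edge Q a fst (@ct_fst _ _); first by rewrite av.
      exists G => // y [/= hy qE]; apply: GE => //; [exact: cq1|by rewrite (fkE hy) tQ av|].
      by rewrite xE // /cc qE j0 o2r_eq1 (aE _ false).
    * move=> eJ; have [b be bE] := fold_face lsrc llab ltgt gluing tQ.
      have [|G cG GE] := @Ev_edge Q (hs b j) fst (@ct_fst _ _); first by rewrite hsP be.
      exists G => // y [/= hy qE]; apply: GE => //; first exact: cq1.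
        by rewrite (fkE hy) tQ hsP be -kface_h -qE -eta2.
      by rewrite xE // /cc qE o2r_eq1 bE.
  + case tQ: (ty Q) => [[v|e]|] // eJ; have [G cG GE] := Ev_whole tQ eJ.
    by exists G => // y [/= hy _]; exact: GE.
  + case tQ: (ty Q) => [[v|e]|] // eJ; have [b be bE] := fold_face lsrc llab ltgt gluing tQ.
    have [|G cG GE] := @Ev_edge Q (vs b i) snd (@ct_snd _ _); first by rewrite vsP be.
    exists G => // y [/= hy qE]; apply: GE => //; first exact: cq2.
      by rewrite (fkE hy) tQ vsP be -(@kface_v R V E lsrc llab ltgt e i) -qE -eta2.
    by rewrite xE // /cc qE o2r_eq1 -crP bE.
Qed.

End Family.
End Lift.
End Eval.

(** * Matching functions on the squares of a grid *)

Section GridGlue.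
Variables (R : realType) (n : nat) (P : nat -> nat -> R * R -> R).
Local Notation sq := (square (R := R) n).
Hypothesis Pd : forall a b a' b' d d', (a <= n)%N -> (b <= n)%N -> (a' <= n)%N -> (b' <= n)%N ->
  sq a b d -> sq a' b' d -> sq a b d' -> sq a' b' d' -> P a b d - P a' b' d = P a b d' - P a' b' d'.

Let pt a b : R * R := (a%:R / n.+1%:R, b%:R / n.+1%:R).

Let slab0 a : slab n a (a%:R / n.+1%:R : R).
Proof. by rewrite /slab lexx /= ler_pM2r ?invr_gt0 ?ltr0n // ler_nat. Qed.
Let slab1 a : slab n a (a.+1%:R / n.+1%:R : R).
Proof. by rewrite /slab lexx andbT ler_pM2r ?invr_gt0 ?ltr0n // ler_nat. Qed.

Let slab_near a a' (x : R) : slab n a x -> slab n a' x -> [\/ a = a', a' = a.+1 | a = a'.+1].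
Proof.
move=> /andP[h1 h2] /andP[h3 h4].
have : a%:R / n.+1%:R <= a'.+1%:R / n.+1%:R :> R by exact: le_trans h1 h4.
have : a'%:R / n.+1%:R <= a.+1%:R / n.+1%:R :> R by exact: le_trans h3 h2.
rewrite !ler_pM2r ?invr_gt0 ?ltr0n // !ler_nat => k1 k2.
case: (ltngtP a a') => k3.
- by constructor 2; apply/eqP; rewrite eqn_leq k1 k3.
- by constructor 3; apply/eqP; rewrite eqn_leq k2 k3.
- by constructor 1.
Qed.

Fixpoint rowk (a : nat) : R := if a is a'.+1
  then rowk a' + P a' 0 (pt a'.+1 0) - P a'.+1 0 (pt a'.+1 0) else 0.
Fixpoint gridk (a b : nat) : R := if b is b'.+1
  then gridk a b' + P a b' (pt a b'.+1) - P a b'.+1 (pt a b'.+1) else rowk a.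

Let vert a b d : (a <= n)%N -> (b < n)%N -> sq a b d -> sq a b.+1 d ->
  P a b d + gridk a b = P a b.+1 d + gridk a b.+1.
Proof.
move=> an bn h1 h2 /=.
have := @Pd a b a b.+1 d (pt a b.+1) an (ltnW bn) an bn h1 h2.
rewrite /square /= !slab0 slab1 => /(_ isT isT); lra.
Qed.

(** Vertical neighbours match by the construction of [gridk]. Horizontal ones match by induction on
    the row: they are compared at the point common to four squares, where the row below already
    matches. *)
Let horiz a b d : (a < n)%N -> (b <= n)%N -> sq a b d -> sq a.+1 b d ->
  P a b d + gridk a b = P a.+1 b d + gridk a.+1 b.
Proof.
move=> an; elim: b d => [|b IH] d bn h1 h2.
  have := @Pd a 0%N a.+1 0%N d (pt a.+1 0) (ltnW an) bn an bn h1 h2.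
  rewrite /square /= !slab0 slab1 => /(_ isT isT); lra.
have := @Pd a b.+1 a.+1 b.+1 d (pt a.+1 b.+1) (ltnW an) bn an bn h1 h2.
have s1 : sq a b.+1 (pt a.+1 b.+1) by rewrite /square /= slab1 slab0.
have s2 : sq a.+1 b.+1 (pt a.+1 b.+1) by rewrite /square /= !slab0.
have s3 : sq a b (pt a.+1 b.+1) by rewrite /square /= !slab1.
have s4 : sq a.+1 b (pt a.+1 b.+1) by rewrite /square /= slab0 slab1.
move=> /(_ s1 s2).
have := IH _ (ltnW bn) s3 s4.
have := vert (ltnW an) bn s3 s1.
have := vert an bn s4 s2.
lra.
Qed.

Lemma grid_glue : exists k : nat -> nat -> R, forall a b a' b' d,
  (a <= n)%N -> (b <= n)%N -> (a' <= n)%N -> (b' <= n)%N -> sq a b d -> sq a' b' d ->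
  P a b d + k a b = P a' b' d + k a' b'.
Proof.
exists gridk => a b a' b' d an bn a'n b'n /andP[h1 h2] /andP[h3 h4].
have hz c : (c <= n)%N -> slab n c d.2 -> P a c d + gridk a c = P a' c d + gridk a' c.
  move=> cn hc; case: (slab_near h1 h3) => [->//|e|e]; subst.
    by apply: horiz => //; rewrite /square ?h1 ?h3 hc.
  by symmetry; apply: horiz => //; rewrite /square ?h1 ?h3 hc.
rewrite (hz b) //; case: (slab_near h2 h4) => [->//|e|e]; subst.
  by apply: vert => //; rewrite /square h3 ?h2 ?h4.
by symmetry; apply: vert => //; rewrite /square h3 ?h2 ?h4.
Qed.

End GridGlue.

(** * Vanishing of the first cohomology of the lift *)

Section Frac.
Context (R : realType) (V E : finType) (lsrc llab ltgt : E -> V).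
Local Notation cplx := (cplx lsrc llab ltgt).
Local Notation K := (LOGcomplex R lsrc llab ltgt).
Local Notation hl := (hl lsrc ltgt).
Local Notation kedge := (@cell_edge R V E lsrc llab ltgt).
Local Notation kface := (@cell_face R V E lsrc llab ltgt).
Local Notation o2r := (end_pt R).
Variables (k0 : K) (k0P : is_basep k0).
Variables (L : cplx) (iL : immersed L) (al_ : cA L -> R) (coc : cocycle al_).

(** A bilinear potential with increments [al_] along the sides; the right side comes out correctly
    by the cocycle identity. *)
Definition PB (b : cB L) (q : R * R) : R :=
  q.1 * al_ (hs b false) + q.2 * al_ (vs b false) + q.1 * q.2 * (al_ (hs b true) - al_ (hs b false)).

Definition cr (c : bool * bool) : R * R := (o2r c.1, o2r c.2).

Lemma crt1 j : (cr (true, j)).1 = 1. Proof. by []. Qed.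
Lemma crf1 j : (cr (false, j)).1 = 0. Proof. by []. Qed.
Lemma crt2 i : (cr (i, true)).2 = 1. Proof. by []. Qed.
Lemma crf2 i : (cr (i, false)).2 = 0. Proof. by []. Qed.

(** The increase of a potential from the reference vertex to the point. It depends on the point of
    the lift alone and cancels in differences between squares. *)
Definition frac (k : K) (x : cX L) : R :=
  match cpt k with
  | None => 0
  | Some (inl (v, t)) => if [pick a | (vt a false == x) && (al a == v)] is Some a then t * al_ a else 0
  | Some (inr (e, q)) => if [pick b : cB L | (vt (hs b false) false == x) && (bl b == e)] is Some b then PB b q else 0
  end.

Lemma frac_edge a s : 0 <= s <= 1 ->
  s * al_ a = (s == 1)%:R * al_ a + frac (kedge (al a) s) (vt a (s == 1)).
Proof.
move=> s01.
have end_ o : o2r o * al_ a = (o2r o == 1)%:R * al_ a + frac (kedge (al a) (o2r o)) (vt a (o2r o == 1)).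
  by rewrite o2r_eq1 (kedge_o2r k0P) /frac (cpt_k0 k0P) addr0.
case: (in01P s01) => [->|->|s_in]; [exact: end_|exact: end_|].
rewrite in_eq1 // mul0r add0r /frac cpt_edge_in //.
case: pickP => [a' /andP[/eqP v' /eqP l']|/(_ a)]; last by rewrite !eqxx.
by rewrite (proj1 iL _ _ false v' l').
Qed.

Lemma frac_face b s t : 0 <= s <= 1 -> 0 <= t <= 1 ->
  PB b (s, t) = PB b (cr (cc (s, t))) + frac (kface (bl b) (s, t)) (vt (hs b (t == 1)) (s == 1)).
Proof.
move=> s01 t01.
have hside j : PB b (s, o2r j) = PB b (cr (cc (s, o2r j))) + frac (kface (bl b) (s, o2r j)) (vt (hs b (o2r j == 1)) (s == 1)).
  rewrite kface_h -hsP /cr /cc /= o2r_eq1; have := frac_edge (hs b j) s01.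
  rewrite /PB /= /end_pt; case: j => /=; lra.
have vside i : PB b (o2r i, t) = PB b (cr (cc (o2r i, t))) + frac (kface (bl b) (o2r i, t)) (vt (hs b (t == 1)) (o2r i == 1)).
  rewrite kface_v -(vsP b i) /cr /cc /= o2r_eq1 crP; have := frac_edge (vs b i) t01; have := coc b.
  rewrite /PB /= /end_pt; case: i => /= [e1|_]; last by lra.
  have -> : al_ (vs b true) = al_ (vs b false) + al_ (hs b true) - al_ (hs b false) by lra.
  lra.
case: (in01P t01) hside => [->|->|t_in] hside //.
case: (in01P s01) vside => [->|->|s_in] vside //.
rewrite /cc /cr /= !in_eq1 // /frac cpt_face_in //; case: pickP => [b' /andP[/eqP v' /eqP l']|/(_ b)]; last by rewrite !eqxx.
have -> : b' = b by exact: (corner_inj (i := false) (j := false) iL).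
by rewrite /PB /end_pt /=; lra.
Qed.

End Frac.

Section Cohom.
Context (R : realType) (V E : finType) (lsrc llab ltgt : E -> V).
Local Notation cplx := (cplx lsrc llab ltgt).
Local Notation K := (LOGcomplex R lsrc llab ltgt).
Local Notation hl := (hl lsrc ltgt).
Local Notation o2r := (end_pt R).
Variables (k0 : K) (k0P : is_basep k0) (f : R * R -> K) (cf : continuous f).
Variables (n : nat) (ty : 'I_n.+1 * 'I_n.+1 -> option (V + E)).
Hypothesis tyP : forall Q d, sq Q d -> 0 < chart (ty Q) (f d).
Local Notation T := ('I_n.+1 * 'I_n.+1)%type.
Local Notation L := (lift_cplx f ty).
Local Notation pi := (lift_corner f ty).
Local Notation gluing := (gluing f ty).

Variables (al_ : cA L -> R) (coc : cocycle al_).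
Local Notation cr := (cr R).

Definition pot_spec Q (P : R * R -> R) : Prop :=
  match ty Q with
  | None => forall q, P q = 0
  | Some (inl v) => exists a, [/\ al a = v, forall o j, vt a o = pi (Q, (o, j)) & forall q, P q = q.1 * al_ a]
  | Some (inr e) => exists b, [/\ bl b = e, forall i j, vt (hs b j) i = pi (Q, (i, j)) & forall q, P q = PB al_ b q]
  end.

Lemma pot_ex Q : {P | pot_spec Q P}.
Proof.
apply: cid; rewrite /pot_spec; case tQ: (ty Q) => [[v|e]|]; last by exists (fun=> 0).
  by have [a av aE] := fold_edge lsrc llab ltgt gluing tQ; exists (fun q => q.1 * al_ a), a.
by have [b be bE] := fold_face lsrc llab ltgt gluing tQ; exists (PB al_ b), b.
Qed.

Definition pot Q := sval (pot_ex Q).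
Lemma potP Q : pot_spec Q (pot Q). Proof. exact: svalP. Qed.

Lemma pot_cts Q : continuous (pot Q).
Proof.
have := potP Q; rewrite /pot_spec; case: (ty Q) => [[v|e]|].
- move=> [a [_ _ PE]]; rewrite (_ : pot Q = fun q => q.1 * al_ a); last exact/funext.
  by ctn.
- move=> [b [_ _ PE]]; rewrite (_ : pot Q = PB al_ b); last exact/funext.
  by rewrite /PB; ctn.
- by move=> PE; rewrite (_ : pot Q = fun=> 0); [ctn|exact/funext].
Qed.

Lemma pot_frac Q d : sq Q d ->
  pot Q (cq f ty Q d) = pot Q (cr (cc (cq f ty Q d))) + frac al_ (fk k0 f d) (pi (Q, cc (cq f ty Q d))).
Proof.
move=> hQ; rewrite (fkE k0P tyP hQ).
have := potP Q; rewrite /pot_spec; have := cq1 f ty Q d; have := cq2 f ty Q d; case tQ: (ty Q) => [[v|e]|].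
- move=> _ c1 [a [av aE PE]]; rewrite !PE (frac_edge k0P (lift_imm f ty) al_ a c1) av.
  by rewrite (aE _ ((cq f ty Q d).2 == 1)).
- move=> c2 c1 [b [be bE PE]]; rewrite !PE; have := frac_face k0P (lift_imm f ty) coc b c1 c2.
  by rewrite -eta2 be bE.
- by move=> _ _ PE; rewrite !PE /frac (cpt_k0 k0P) addr0.
Qed.

(** On the segment from [d] to [d'], which stays in both squares, the difference equals the one at
    the reference corners. It is continuous with finitely many values. *)
Lemma pot_diff Q Q' d d' : I2 d -> I2 d' -> sq Q d -> sq Q' d -> sq Q d' -> sq Q' d' ->
  pot Q (cq f ty Q d) - pot Q' (cq f ty Q' d) = pot Q (cq f ty Q d') - pot Q' (cq f ty Q' d').
Proof.
move=> i1 i2 h1 h2 h3 h4.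
pose g u : R * R := (d.1 + u * (d'.1 - d.1), d.2 + u * (d'.2 - d.2)).
have g0 : g 0 = d by rewrite /g !mul0r !addr0 -eta2.
have g1 : g 1 = d' by rewrite /g !mul1r ![_ + (_ - _)]addrC !subrK -eta2.
have cg : continuous g by rewrite /g; ctn.
have slu a (x y u : R) : 0 <= u <= 1 -> slab n a x -> slab n a y -> slab n a (x + u * (y - x)).
  rewrite /slab; move: (a%:R / _) (a.+1%:R / _) => l r.
  by move=> /andP[u0 u1] /andP[? ?] /andP[? ?]; apply/andP; split; nra.
have gs (Q0 : T) u : 0 <= u <= 1 -> sq Q0 d -> sq Q0 d' -> sq Q0 (g u).
  by rewrite /sq /square => u01 /andP[? ?] /andP[? ?]; rewrite /g /= !slu.
have gI u : 0 <= u <= 1 -> I2 (g u).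
  move=> /andP[u0 u1]; case: i1 i2 => /andP[? ?] /andP[? ?] [/andP[? ?] /andP[? ?]].
  by split; rewrite /g /=; apply/andP; split; nra.
pose D u := pot Q (cq f ty Q (g u)) - pot Q' (cq f ty Q' (g u)).
have cD : continuous D.
  have cq_ Q0 : continuous (fun u => pot Q0 (cq f ty Q0 (g u))).
    apply: (ct_comp (f := fun u => cq f ty Q0 (g u)) (g := pot Q0)); last exact: pot_cts.
    by apply: (ct_comp (f := g) (g := cq f ty Q0)) => //; exact: cq_cts.
  by rewrite /D; apply: ct_add => //; apply: ct_opp.
pose vals := [seq pot Q (cr c.1) - pot Q' (cr c.2) | c <- enum {: (bool * bool) * (bool * bool)}].
have : D 0 = D 1.
  apply: (@finite_values_const R D vals) => //; rewrite ?lexx ?ler01 // => u u01.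
  apply/mapP; exists (cc (cq f ty Q (g u)), cc (cq f ty Q' (g u))); first by rewrite mem_enum.
  rewrite /D (pot_frac (gs Q u u01 h1 h3)) (pot_frac (gs Q' u u01 h2 h4)) /=.
  rewrite -(xxE f ty (gI u u01) (gs Q u u01 h1 h3)) -(xxE f ty (gI u u01) (gs Q' u u01 h2 h4)).
  by rewrite opprD addrACA subrr addr0.
by rewrite /D g0 g1.
Qed.

Lemma pot_glue : exists k : T -> R, forall Q Q' d, I2 d -> sq Q d -> sq Q' d ->
  pot Q (cq f ty Q d) + k Q = pot Q' (cq f ty Q' d) + k Q'.
Proof.
pose P a b d := pot (inord a, inord b) (cq f ty (inord a, inord b) d).
have sqE a b d : (a <= n)%N -> (b <= n)%N -> square n a b d -> sq (inord a : 'I_n.+1, inord b : 'I_n.+1) d.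
  by move=> an bn; rewrite /sq /= !inordK.
have sqI a b d : (a <= n)%N -> (b <= n)%N -> square n a b d -> I2 (d : R * R).
  have n0 : 0 < n.+1%:R :> R by rewrite ltr0n.
  have sl c (x : R) : (c <= n)%N -> slab n c x -> 0 <= x <= 1.
    move=> cn /andP[l1 l2]; rewrite (le_trans _ l1) /=; last by rewrite divr_ge0 ?ler0n.
    by apply: (le_trans l2); rewrite ler_pdivrMr // mul1r ler_nat.
  by move=> an bn /andP[/(sl _ _ an) ? /(sl _ _ bn) ?].
have [] := @grid_glue R n P.
  move=> a b a' b' d d' an bn a'n b'n h1 h2 h3 h4; apply: pot_diff; try exact: sqE.
    exact: sqI h1.
  exact: sqI h3.
move=> k kP; exists (fun Q : T => k Q.1 Q.2) => -[a b] [a' b'] d hd h1 h2.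
have := kP a b a' b' d; rewrite /P !inord_val; apply => //; by rewrite -ltnS.
Qed.

Lemma lift_coboundary : coboundary al_.
Proof.
have [k kP] := pot_glue; have iL_ := lift_imm f ty.
apply: (@fold_coboundary _ _ _ _ _ _ ty gluing _ al_ (fun s => pot s.1 (cr s.2) + k s.1)).
- move=> [Q c] [Q' c'] /andP[/= /eqP <-]; have := potP Q; rewrite /pot_spec; case: (ty Q) => [[v|e]|].
  + by move=> [a [_ _ PE]] /eqP cc'; rewrite !PE /cr /= cc'.
  + by move=> _ /eqP ->.
  + by move=> PE _; rewrite !PE.
- move=> [Q c] [Q' c'] [d [/= h1 h2 -> ->]].
  have hd : I2 d.
    have n0 : 0 < n.+1%:R :> R by rewrite ltr0n.
    have sl (c0 : 'I_n.+1) (x : R) : slab n c0 x -> 0 <= x <= 1.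
      move=> /andP[l1 l2]; rewrite (le_trans _ l1) /=; last by rewrite divr_ge0 ?ler0n.
      by apply: (le_trans l2); rewrite ler_pdivrMr // mul1r ler_nat.
    by case/andP: h1 => /sl ? /sl ?.
  have := kP Q Q' d hd h1 h2; rewrite (pot_frac h1) (pot_frac h2).
  rewrite -(xxE f ty hd h1) -(xxE f ty hd h2); lra.
- move=> a s s'; move: {1 3}(al a) (erefl (al a)) => v av st; move: av.
  elim/(@stp_ind V E lsrc llab ltgt _ ty): st => [Q w j j' tQ|Q e j tQ|Q e i tQ] aw pa.
  + have := potP Q; rewrite /pot_spec tQ => -[a' [a'w a'E PE]].
    have <- : a' = a by apply: (proj1 iL_ _ _ false); [exact: etrans (a'E false j) pa|rewrite a'w aw].
    by rewrite /= !PE /cr /= /end_pt /=; lra.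
  + have := potP Q; rewrite /pot_spec tQ => -[b [be bE PE]].
    have <- : hs b j = a by apply: (proj1 iL_ _ _ false); [exact: etrans (bE false j) pa|rewrite hsP be aw].
    change (pot Q (cr (true, j)) + k Q = pot Q (cr (false, j)) + k Q + al_ (hs b j)).
    by rewrite !PE /PB; case: (j); rewrite ?crt1 ?crf1 ?crt2 ?crf2; lra.
  + have := potP Q; rewrite /pot_spec tQ => -[b [be bE PE]].
    have <- : vs b i = a.
      by apply: (proj1 iL_ _ _ false); [rewrite -crP; exact: etrans (bE i false) pa|rewrite vsP be aw].
    change (pot Q (cr (i, true)) + k Q = pot Q (cr (i, false)) + k Q + al_ (vs b i)).
    by have := coc b; rewrite !PE /PB; case: (i); rewrite ?crt1 ?crf1 ?crt2 ?crf2; lra.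
Qed.

End Cohom.

(** * Components and cells of the lift *)

Section Components.
Context (V E : finType) (lsrc llab ltgt : E -> V).
Variables (L : cplx lsrc llab ltgt) (J : {set V}) (x0 : cX L).

Definition reach : pred (cX L) := fun x => `[< forall h : pred (cX L), jclosed J h -> h x0 -> h x >].

Lemma reach0 : reach x0. Proof. by apply/asboolP. Qed.

Lemma reach_closed : jclosed J reach.
Proof.
move=> a aJ; apply/asboolP/asboolP => H h hh hx.
  by rewrite -hh //; exact: H.
by rewrite hh //; exact: H.
Qed.

Lemma reach_conn : conn (sub reach_closed).
Proof.
move=> k kk.
pose h' (x : cX L) := if insub x : option (cX (sub reach_closed)) is Some x' then k x' == k (exist (fun x => reach x) x0 reach0) else false.
have h'J : jclosed J h'.
  move=> a aJ; rewrite /h'.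
  case: (boolP (reach (vt a false))) => ra.
    have rt : reach (vt a true) by rewrite -reach_closed.
    have aS : subA reach (fun v => v \in J) a by rewrite /subA ra.
    rewrite !insubT; have := kk (exist _ a aS); rewrite /=.
    by move=> kka; congr (_ == _); apply: etrans (etrans _ kka) _; congr k; exact: val_inj.
  have rt : ~~ reach (vt a true) by rewrite -reach_closed.
  by rewrite !insubN.
have all_ x : k x = k (exist (fun x => reach x) x0 reach0).
  have /asboolP/(_ h' h'J) := valP x; rewrite /h' (insubT reach reach0) eqxx => /(_ isT).
  by rewrite valK => /eqP.
by move=> x y; rewrite (all_ x) (all_ y).
Qed.

End Components.

Section Positions.
Context (R : realType) (V E : finType) (lsrc llab ltgt : E -> V).
Local Notation K := (LOGcomplex R lsrc llab ltgt).
Variables (k0 : K) (k0P : is_basep k0) (f : R * R -> K).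
Variables (n : nat) (ty : 'I_n.+1 * 'I_n.+1 -> option (V + E)).
Hypothesis tyP : forall Q d, sq Q d -> 0 < chart (ty Q) (f d).
Local Notation L := (lift_cplx f ty).

Definition cell_at (x : cX L) (c : canon_point R V E) : Prop :=
  match c with
  | None => True
  | Some (inl (v, _)) => exists2 a : cA L, al a = v & vt a false = x
  | Some (inr (e, _)) => exists2 b : cB L, bl b = e & vt (hs b false) false = x
  end.

(** The lift does contain the cell that [nf] searches for at [fk d] and [xx d]. *)
Lemma pos_cells d : I2 d -> cell_at (xx f ty d) (cpt (fk k0 f d)).
Proof.
move=> hd; have hQ := svalP (sq_ex n d) hd; set Q := sval _ in hQ.
rewrite (xxE f ty hd hQ) (fkE k0P tyP hQ); have := cq1 f ty Q d; have := cq2 f ty Q d.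
have end_ v o : cpt (cell_edge lsrc llab ltgt v (end_pt R o)) = None by rewrite (kedge_o2r k0P) (cpt_k0 k0P).
case tQ: (ty Q) => [[v|e]|]; rewrite /realize; last by rewrite (cpt_k0 k0P).
  have [a av aE] := fold_edge lsrc llab ltgt (gluing f ty) tQ.
  move=> _ s01; case: (in01P s01) => [e|e|s_in]; rewrite ?e ?end_ // cpt_edge_in //.
  by exists a => //; rewrite /cc in_eq1 //; exact: aE.
have [b be bE] := fold_face lsrc llab ltgt (gluing f ty) tQ.
move=> t01 s01; rewrite [cq f ty Q d]eta2; move: (cq f ty Q d).1 (cq f ty Q d).2 s01 t01 => s t s01 t01.
rewrite -[cc (s, t)]/(s == 1, t == 1).
have hside j : cell_at (lift_corner f ty (Q, (s == 1, end_pt R j == 1))) (cpt (cell_face lsrc llab ltgt e (s, end_pt R j))).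
  rewrite kface_h; case: (in01P s01) => [->|->|s_in]; rewrite ?end_ // cpt_edge_in // o2r_eq1 in_eq1 //.
  by exists (hs b j); [rewrite hsP be|exact: bE].
case: (in01P t01) => [->|->|t_in]; [exact: hside|exact: hside|].
have vside i : cell_at (lift_corner f ty (Q, (end_pt R i == 1, t == 1))) (cpt (cell_face lsrc llab ltgt e (end_pt R i, t))).
  rewrite kface_v cpt_edge_in // o2r_eq1 in_eq1 //.
  by exists (vs b i); [rewrite vsP be|rewrite -crP; exact: bE].
case: (in01P s01) => [->|->|s_in]; [exact: vside|exact: vside|].
by rewrite cpt_face_in // !in_eq1 //; exists b => //; exact: bE.
Qed.

End Positions.

(** * The contraction seen from the square *)

Section Package.
Context (R : realType) (V E : finType) (lsrc llab ltgt : E -> V).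
Local Notation K := (LOGcomplex R lsrc llab ltgt).
Local Notation kedge := (@cell_edge R V E lsrc llab ltgt).
Local Notation kface := (@cell_face R V E lsrc llab ltgt).
Variables (k0 : K) (k0P : is_basep k0).
Hypothesis forest : forall U : {set V}, U != finset.set0 -> (#|Ein lsrc ltgt U| < #|U|)%N.
Hypothesis inj : injective llab.
Hypothesis ctT : ctight lsrc llab ltgt [set: V]%SET.
Variables (J : {set V}) (ctJ : ctight lsrc llab ltgt J) (P : K -> Prop).
Hypothesis Pk0 : P k0.
Hypothesis Pe : forall v s, v \in J -> P (kedge v s).
Hypothesis Pf : forall e q, e \in Ein lsrc ltgt J -> P (kface e q).
Variables (f : R * R -> K) (cf : continuous f) (d0 : R * R).
Local Notation fk := (fk k0 f).

Definition in_path (J' : {set V}) (g : R -> R * R) := [/\ continuous g,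
  forall u, 0 <= u <= 1 -> I2 (g u) & forall u, 0 <= u <= 1 -> Kin J' (fk (g u))].

(** The constant cochain 1 is a cocycle. A potential for it grows along edges, and ranking its
    finitely many values gives a height in nat. *)
Lemma coboundary_graded (L : cplx lsrc llab ltgt) :
  (forall al_ : cA L -> R, cocycle al_ -> coboundary al_) -> graded L.
Proof.
move=> H; have [|u uE] := H (fun=> 1); first by move=> b.
exists (fun x => #|[set y | u y < u x]%SET|) => a.
have lt : u (vt a false) < u (vt a true) by have := uE a; lra.
apply: proper_card; apply/properP; split.
  by apply/fintype.subsetP => y; rewrite !inE => h; exact: lt_trans h lt.
by exists (vt a false); rewrite !inE ?lt ?ltxx.
Qed.

(** [Phi d t] is the contraction of the [J]-component of the lift of [d0], evaluated at the lift of
    [d]; [Rch d] says that this lift lies in the component. [Phi] is constant along paths over the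
    base point because the reference vertex cannot change there. *)
Theorem lift_family : exists (Phi : R * R -> R -> K) (Rch : R * R -> Prop),
  [/\ forall (Y : topologicalType) (g : Y -> R * R) (tau : Y -> R), continuous g -> continuous tau ->
        (forall y, [/\ I2 (g y), Kin J (fk (g y)) & Rch (g y)]) -> continuous (fun y => Phi (g y) (tau y)),
      Rch d0 /\ (forall g, in_path J g -> Rch (g 0) -> Rch (g 1)),
      forall g, in_path finset.set0 g -> forall t, Phi (g 0) t = Phi (g 1) t,
      forall d t, P (Phi d t) &
      (forall d, I2 d -> Kin J (fk d) -> Rch d -> Phi d 0 = fk d /\ Phi d 1 = k0) /\
      (fk d0 = k0 -> forall t, Phi d0 t = k0)].
Proof.
have [n nP] := lebesgue_grid (fun i => ct_comp cf (@chart_cts R V E lsrc llab ltgt i))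
   (fun d => chart_cover (f d)).
have ty_ (Q : 'I_n.+1 * 'I_n.+1) : {i | forall d, sq Q d -> 0 < @chart R V E lsrc llab ltgt i (f d)}.
  by apply: cid; exact: nP.
pose ty Q := sval (ty_ Q); have tyP Q d : sq Q d -> 0 < chart (ty Q) (f d) by exact: (svalP (ty_ Q)).
pose LL := lift_cplx f ty; have iLL : immersed LL by exact: lift_imm.
have cLL : conn LL by exact: (L_conn k0P cf tyP).
have cob (al_ : cA LL -> R) : cocycle al_ -> coboundary al_ by move=> h; exact: (lift_coboundary k0P cf tyP h).
have gLL : graded LL by exact: coboundary_graded.
pose x0 := xx f ty d0.
have X0 : (0 < #|cX LL|)%N by apply/card_gt0P; exists x0.
have chi := cohom_chi X0 cob.
pose h : pred (cX LL) := @reach _ _ _ _ _ LL J x0; pose hh : jclosed J h := @reach_closed _ _ _ _ _ LL J x0.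
have cS : conn (sub hh) by exact: reach_conn.
have chiS := comp_chi forest inj ctT ctJ cLL iLL gLL chi (ex_intro (fun x => h x) x0 (@reach0 _ _ _ _ _ LL J x0)) cS.
pose a0 : cX (sub hh) := exist (fun x => h x) x0 (@reach0 _ _ _ _ _ LL J x0).
have oS : over (sub hh) J by move=> a; case/andP: (valP a).
have [F [cF coF PF pF [F0 F1]]] := contractible k0P Pk0 Pe Pf forest inj ctJ a0 cS (sub_imm hh iLL) (sub_graded hh gLL) oS chiS.
have labJ e : e \in Ein lsrc ltgt J -> llab e \in J by exact: ctight_lab.
exists (fun d t => nf k0 (F t) (fk d) (xx f ty d)), (fun d => h (xx f ty d)).
split.
- move=> Y g tau cg ctau H; apply: (Ev_cts k0P cf tyP labJ (z0 := k0) cF coF cg ctau).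
  + by move=> y; case: (H y).
  + by move=> y; case: (H y).
  + by move=> y; case: (H y).
- split; first exact: reach0.
  by move=> g [cg gI gJ]; rewrite (h_const k0P cf tyP labJ hh cg gI gJ).
- move=> g [cg gI gJ] t.
  have lab0 e : e \in Ein lsrc ltgt finset.set0 -> llab e \in (finset.set0 : {set V}).
    by rewrite in_Ein => /forallP/(_ false); rewrite finset.in_set0.
  (* For the empty label set every predicate is closed, so [h_const] may test equality with the
     initial vertex. *)
  have h0 : jclosed (finset.set0 : {set V}) (pred1 (xx f ty (g 0))) by move=> a; rewrite finset.in_set0.
  have := h_const k0P cf tyP lab0 h0 cg gI gJ; rewrite /= eqxx => /esym/eqP ->.
  have gk u : 0 <= u <= 1 -> fk (g u) = k0.
    move=> /gJ; rewrite /Kin; case: (kpointP (fk (g u))) => [bk|v s _ _ ->|e s s' _ _ _ ->].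
    - by move=> _; exact: base_uniq.
    - by rewrite finset.in_set0.
    - by rewrite in_Ein => /forallP/(_ false); rewrite finset.in_set0.
  by rewrite !gk // ?lexx ?ler01.
- move=> d t; have [p1 p2 p3] := PF t; rewrite /nf.
  by case: (cpt _) => [[[v s]|[e q]]|]; [case: pickP|case: pickP|case: insubP].
- split.
    move=> d hd kin hx; rewrite F0 F1; split; last first.
      by rewrite /nf; case: (cpt _) => [[[v s]|[e q]]|]; [case: pickP|case: pickP|case: insubP].
    have := pos_cells k0P tyP hd; move: kin; rewrite /Kin /nf /cell_at.
    case: (kpointP (fk d)) => [bk|v s s01 kE cE|e s s' s01 s01' kE cE].
    + have -> : cpt (fk d) = None by exact/cpt_base.
      by move=> _ _; rewrite (base_uniq bk k0P); case: insubP.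
    + rewrite cE => vJ [a av aE].
      have aS : subA h (fun v => v \in J) a by apply: (edge_sub hh (o := false)); rewrite ?av ?aE.
      pose a1 : cA (sub hh) := exist _ a aS; have a1E : val a1 = a by [].
      case: pickP => [a' /andP[_ /eqP a'v]|/(_ a1)]; last by rewrite a1E av aE !eqxx.
      by rewrite kE -a'v.
    + rewrite cE => eJ [b be bE].
      have bS : subB h (fun v => v \in J) b by apply: (face_sub hh labJ (i := false) (j := false)); rewrite ?be ?bE.
      pose b1 : cB (sub hh) := exist _ b bS; have b1E : val b1 = b by [].
      case: pickP => [b' /andP[_ /eqP b'e]|/(_ b1)]; last by rewrite b1E be bE !eqxx.
      by rewrite kE -b'e.
  by move=> e t; rewrite e; have := nf_vertex k0P k0 (F t) a0; rewrite pF.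
Qed.

End Package.

(** * Fundamental groups *)

Section LoopHomotopy.
Variables (R : realType) (X : topologicalType) (A : set X) (x0 : X).
Local Notation I := (unit_interval R).
Local Notation iv := (set_val : I -> R).

Lemma iv_in (p : I) : 0 <= iv p <= 1.
Proof. by have := set_mem (valP p); rewrite /= in_itv. Qed.

Lemma iv_toI0 x : x = 0 -> iv (toI x) = 0. Proof. by move=> ->; exact: clip0. Qed.
Lemma iv_toI1 x : x = 1 -> iv (toI x) = 1. Proof. by move=> ->; exact: clip1. Qed.

Lemma iv1_cts (S : topologicalType) : continuous (fun q : I * S => iv q.1).
Proof. by apply: (ct_comp (f := fst) (g := iv)); [ctn|exact: set_val_continuous]. Qed.

Lemma iv2_cts (S : topologicalType) : continuous (fun q : S * I => iv q.2).
Proof. by apply: (ct_comp (f := snd) (g := iv)); [ctn|exact: set_val_continuous]. Qed.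

Lemma loop_homotopic_sym (g1 g2 : I -> X) :
  loop_homotopic_in A x0 g1 g2 -> loop_homotopic_in A x0 g2 g1.
Proof.
move=> [H [cH HA H0 H1 He]].
exists (fun q => H (toI (1 - iv q.1), q.2)); split.
- apply: (ct_comp (f := fun q : I * I => (toI (1 - iv q.1), q.2)) (g := H)) => //.
  apply: ct_pair; last by ctn.
  apply: (ct_comp (f := fun q : I * I => 1 - iv q.1) (g := @toI R)); last exact: toI_continuous.
  by have := @iv1_cts I => c; ctn.
- by [].
- by move=> q q0; apply: H1; apply: iv_toI1; rewrite q0 subr0.
- by move=> q q1; apply: H0; apply: iv_toI0; rewrite q1 subrr.
- by move=> q qe; apply: He.
Qed.

Lemma loop_homotopic_trans (g1 g2 g3 : I -> X) :
  loop_homotopic_in A x0 g1 g2 -> loop_homotopic_in A x0 g2 g3 -> loop_homotopic_in A x0 g1 g3.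
Proof.
move=> [H [cH HA H0 H1 He]] [G [cG GA G0 G1 Ge]].
have ci := @iv1_cts I.
pose F (q : I * I) := if iv q.1 <= 1/2 then H (toI (2 * iv q.1), q.2) else G (toI (2 * iv q.1 - 1), q.2).
have F1 q : iv q.1 <= 1/2 -> F q = H (toI (2 * iv q.1), q.2) by rewrite /F => ->.
have F2 q : 1/2 <= iv q.1 -> F q = G (toI (2 * iv q.1 - 1), q.2).
  rewrite le_eqVlt => /orP[/eqP e|h]; last by rewrite /F leNgt h.
  rewrite F1 -?e // (_ : 2 * (1 / 2) = 1); last by lra.
  by rewrite H1 ?G0 //; [apply: iv_toI0; rewrite subrr|exact: iv_toI1].
exists F; split.
- apply: (closed_pasting2 (c := fun q : I * I => iv q.1) (d := fun=> 1/2)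
    (g1 := fun q => H (toI (2 * iv q.1), q.2)) (g2 := fun q => G (toI (2 * iv q.1 - 1), q.2))) => //.
  + by ctn.
  + apply: (ct_comp (f := fun q : I * I => (toI (2 * iv q.1), q.2)) (g := H)) => //.
    apply: ct_pair; last by ctn.
    by apply: (ct_comp (f := fun q : I * I => 2 * iv q.1) (g := @toI R)); [ctn|exact: toI_continuous].
  + apply: (ct_comp (f := fun q : I * I => (toI (2 * iv q.1 - 1), q.2)) (g := G)) => //.
    apply: ct_pair; last by ctn.
    by apply: (ct_comp (f := fun q : I * I => 2 * iv q.1 - 1) (g := @toI R)); [ctn|exact: toI_continuous].
- by move=> q; rewrite /F; case: ifP.
- by move=> q q0; rewrite F1 ?q0; [apply: H0; apply: iv_toI0; rewrite mulr0|lra].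
- move=> q q1; rewrite F2 ?q1; last by lra.
  by apply: G1; apply: iv_toI1; lra.
- by move=> q qe; rewrite /F; case: ifP => _; [exact: He|exact: Ge].
Qed.

End LoopHomotopy.

Section Pi1.
Context (R : realType) (V E : finType) (lsrc llab ltgt : E -> V).
Local Notation K := (LOGcomplex R lsrc llab ltgt).
Local Notation kedge := (@cell_edge R V E lsrc llab ltgt).
Local Notation kface := (@cell_face R V E lsrc llab ltgt).
Local Notation o2r := (end_pt R).
Local Notation I := (unit_interval R).
Local Notation iv := (set_val : I -> R).
Hypotheses (lot : is_LOT lsrc llab ltgt) (inj : injective llab).
Variables (HV : {set V}) (HE : {set E}) (slot : is_subLOT lsrc llab ltgt HV HE).
Variables (k0 : K) (k0P : is_basep k0).
Local Notation A := (@subcomplex R V E lsrc llab ltgt HV HE).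

Lemma A_edge v s : v \in HV -> A (kedge v s).
Proof. by move=> vH; exists (existT (cell R (V:=V) (E:=E)) (inl v) (toI s)). Qed.

Lemma A_face e q : e \in HE -> A (kface e q).
Proof. by move=> eH; exists (existT (cell R (V:=V) (E:=E)) (inr e) (toS q)). Qed.

Lemma A_inv k : A k -> (exists2 v, v \in HV & exists s, k = kedge v s) \/
  (exists2 e, e \in HE & exists q, k = kface e q).
Proof.
move=> [[[v|e] p] [/= h <-]].
  by left; exists v => //; exists (set_val p); rewrite /cell_edge toIK.
by right; exists e => //; exists (set_val p); rewrite /cell_face toSK.
Qed.

Lemma A_kapt u k : A k -> A (kapt k0 u k).
Proof.
move=> /A_inv[[v vH [s ->]]|[e eH [q ->]]].
  by rewrite kapt_edge //; exact: A_edge.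
by rewrite kapt_face //; exact: A_face.
Qed.

Lemma A_k0 : A k0.
Proof.
have [/card_gt0P[e eH] lH _] := slot; have [sH _ _] := lH e eH.
by rewrite -(kedge_o2r k0P (lsrc e) false); exact: A_edge.
Qed.

Lemma A_Kin k : A k -> Kin HV k.
Proof.
have [ct HEE] := sublot_ctight lot slot.
have ce v (t : R) : v \in HV -> match canon_edge E v t return Prop with None => True | Some (inl (v, _)) => v \in HV | Some (inr (e, _)) => e \in Ein lsrc ltgt HV end.
  by rewrite /canon_edge; case: ifP.
move=> /A_inv[[v vH [s ->]]|[e eH [q ->]]]; rewrite /Kin.
  by rewrite cpt_edge; exact: ce.
have [_ lH _] := slot; have [h1 h2 h3] := lH e eH.
rewrite cpt_face /canon_square /=; case: ifP => _; first exact: ce.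
case: ifP => _; first exact: ce.
case: ifP => _; first exact: ce.
by rewrite -HEE.
Qed.

(** The contraction may move the far end of a loop. So each loop is squeezed into the middle third,
    and the outer thirds record the tracks of its two ends. The start rests at [k0], and the far
    ends of both loops have the same track, since the side of the homotopy between them is mapped to
    [k0]. Hence both loops deform to the same loop. *)
Lemma pi1_injective : pi1_inclusion_injective R A k0.
Proof.
move=> g1 g2 [cg1 A1 e1] [cg2 A2 e2] [H [cH _ H0 H1 He]].
pose f (d : R * R) := H (toI d.1, toI d.2).
have cf : continuous f.
  apply: (ct_comp (f := fun d : R * R => (toI d.1, toI d.2)) (g := H)) => //; apply: ct_pair.
    by apply: (ct_comp (f := fst) (g := @toI R)); [ctn|exact: toI_continuous].
  by apply: (ct_comp (f := snd) (g := @toI R)); [ctn|exact: toI_continuous].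
pose ge (e : bool) := if e then g2 else g1.
have cge e : continuous (ge e) by case: e.
have Age e t : A (ge e t) by case: e.
have ege e t : iv t = 0 \/ iv t = 1 -> ge e t = k0 by case: e; [exact: e2|exact: e1].
have fe e t : f (o2r e, t) = ge e (toI t).
  by case: e; [apply: H1; exact: iv_toI1|apply: H0; exact: iv_toI0].
have fs s o : f (s, o2r o) = k0.
  by apply: He; case: (o); [right; exact: iv_toI1|left; exact: iv_toI0].
have in01 o : 0 <= o2r o <= 1 by rewrite /end_pt; case: o => /=; rewrite ?lexx ?ler01.
have [ctH HEE] := sublot_ctight lot slot.
have Pf e q : e \in Ein lsrc ltgt HV -> A (kface e q) by rewrite -HEE; exact: A_face.
have [Phi [Rch [PhiC [R0 RP] PhiS PhiP [Phi01 Phid]]]] :=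
  lift_family k0P (lot_forest lot) inj (lot_ctight lot) ctH A_k0 A_edge Pf cf (o2r false, o2r false).
pose pe e (x : R) : R * R := (o2r e, x).
have fks s o : fk k0 f (s, o2r o) = k0 by rewrite /fk fs kapt_base.
have fkA e x : A (fk k0 f (pe e x)) by rewrite /fk /pe fe; exact: A_kapt.
have hpath J' o : in_path k0 f J' (fun u => (u, o2r o)).
  by split=> [|u u01|u _]; [ctn|split => //; exact: in01|rewrite fks /Kin (cpt_k0 k0P)].
have Re e : Rch (pe e 0).
  case: e => //; exact: (RP _ (hpath HV false) R0).
have Rx e x : 0 <= x <= 1 -> Rch (pe e x).
  move=> /andP[x0 x1]; have := RP (fun u => pe e (u * x)); rewrite mul0r mul1r; apply => //.
  split=> [|u /andP[u0 u1]|u _]; first by rewrite /pe; ctn.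
    by split; [exact: in01|rewrite /=; apply/andP; split; nra].
  exact: A_Kin.
have Ix e x : 0 <= x <= 1 -> I2 (pe e x) by move=> h; split => //; exact: in01.
pose re (t : R) := clip (3 * t - 1).
have ci1 := @iv1_cts R I; have ci2 := @iv2_cts R I.
have stageA e : loop_homotopic_in A k0 (ge e) (fun t => fk k0 f (pe e (re (iv t)))).
  pose lp (s t : R) := (1 - s) * t + s * re t.
  exists (fun q => kapt k0 (clip (iv q.1)) (ge e (toI (lp (iv q.1) (iv q.2))))); split.
  - apply: (ct_comp (f := fun q : I * I => (ge e (toI (lp (iv q.1) (iv q.2))), iv q.1)) (g := fun q : K * R => kapt k0 (clip q.2) q.1)); last exact: kapt_cts.
    apply: ct_pair => //; apply: (ct_comp (f := fun q : I * I => toI (lp (iv q.1) (iv q.2))) (g := ge e)) => //.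
    apply: (ct_comp (f := fun q : I * I => lp (iv q.1) (iv q.2)) (g := @toI R)); last exact: toI_continuous.
    by rewrite /lp /re /clip; ctn.
  - by move=> q; exact: A_kapt.
  - move=> q ->; rewrite clip0 kapt0 //; congr ge.
    by rewrite /lp subr0 mul1r mul0r addr0 toIK.
  - by move=> q ->; rewrite clip1 /fk /pe fe /lp subrr mul0r mul1r add0r.
  - move=> q qe; rewrite ege ?kapt_base // /lp /re.
    case: qe => ->; [left; apply: iv_toI0|right; apply: iv_toI1].
      by rewrite (clip_le0 (x := 3 * 0 - 1)) ?mulr0 ?addr0 //; lra.
    by rewrite (clip_ge1 (x := 3 * 1 - 1)) ?mulr1 ?subrK //; lra.
(* Time rises to 1 on the first third, stays at 1 on the middle one, where only [k0] remains, and
   falls back on the last. *)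
pose c e (t : I) := Phi (pe e (re (iv t))) (Num.min 1 (Num.min (3 * iv t) (3 * (1 - iv t)))).
have re01 t : 0 <= re t <= 1 by exact: clip_in.
have stageB e : loop_homotopic_in A k0 (fun t => fk k0 f (pe e (re (iv t)))) (c e).
  exists (fun q => Phi (pe e (re (iv q.2))) (Num.min (iv q.1) (Num.min (3 * iv q.2) (3 * (1 - iv q.2))))); split.
  - apply: (PhiC _ (fun q : I * I => pe e (re (iv q.2))) (fun q : I * I => Num.min (iv q.1) (Num.min (3 * iv q.2) (3 * (1 - iv q.2))))).
    + by rewrite /pe /re /clip; ctn.
    + by ctn.
    + by move=> q; split; [exact: Ix|exact: A_Kin|exact: Rx].
  - by move=> q; exact: PhiP.
  - move=> q ->; have /andP[t0 t1] := iv_in q.2.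
    rewrite min_l; last by rewrite le_min; apply/andP; split; lra.
    by case: (Phi01 (pe e (re (iv q.2)))) => //; [exact: Ix|exact: A_Kin|exact: Rx].
  - by move=> q ->.
  - move=> q qe; have /andP[s0 s1] := iv_in q.1.
    have Phi0 o : Phi (pe e (o2r o)) 0 = k0.
      have [|||-> _] := Phi01 (pe e (o2r o)); [exact/Ix/in01|exact: A_Kin|exact/Rx/in01|exact: fks].
    case: qe => ->; rewrite /re.
      rewrite (clip_le0 (x := 3 * 0 - 1)); last by lra.
      by rewrite mulr0 [Num.min 0 _]min_l ?min_r //; [exact: (Phi0 false)|lra].
    rewrite (clip_ge1 (x := 3 * 1 - 1)); last by lra.
    by rewrite subrr mulr0 [Num.min _ 0]min_r ?min_r //; [exact: (Phi0 true)|lra].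
have cc : c false = c true.
  have Pd e t : Phi (pe e 0) t = k0.
    case: e; last by apply: Phid; exact: fks.
    by have <- := PhiS _ (hpath finset.set0 false) t; apply: Phid; exact: fks.
  have P1 e x : 0 <= x <= 1 -> Phi (pe e x) 1 = k0.
    by move=> h; case: (Phi01 (pe e x)) => //; [exact: Ix|exact: A_Kin|exact: Rx].
  apply/funext => t; rewrite /c; move: (iv t) (iv_in t) => {}t /andP[t0 t1].
  case: (leP t (1/3)) => h1.
    by rewrite /re (clip_le0 (x := 3 * t - 1)) ?Pd //; lra.
  case: (leP t (2/3)) => h2.
    by rewrite [Num.min 1 _]min_l ?P1 // le_min; apply/andP; split; lra.
  rewrite /re (clip_ge1 (x := 3 * t - 1)); last by lra.
  exact: (PhiS _ (hpath finset.set0 true)).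
have G e : loop_homotopic_in A k0 (ge e) (c e) by apply: loop_homotopic_trans (stageA e) (stageB e).
apply: (loop_homotopic_trans (G false)); rewrite cc; exact: loop_homotopic_sym (G true).
Qed.

End Pi1.

Lemma ct_inv (R : realType) (T : topologicalType) (g : T -> R) : continuous g -> (forall x, g x != 0) ->
  continuous (fun x => (g x)^-1).
Proof. by move=> cg g0 x; apply: cvgV => //; exact: cg. Qed.

Lemma ct_sqr (R : realType) (T : topologicalType) (g : T -> R) : continuous g -> continuous (fun x => g x ^+ 2).
Proof.
move=> cg; rewrite (_ : (fun x => g x ^+ 2) = fun x => g x * g x); last by apply/funext => x; rewrite expr2.
exact: ct_mul.
Qed.

(** * The second homotopy group *)

Section Sphere.
Variable R : realType.
Implicit Types a b : R.

Definition de a b := (1 - a ^+ 2) * (1 - b ^+ 2).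
Definition den a b := a ^+ 2 + b ^+ 2 + de a b ^+ 2.

Lemma den_gt0 a b : 0 < den a b.
Proof.
rewrite /den lt_neqAle; apply/andP; split; last by rewrite !addr_ge0 ?sqr_ge0.
rewrite eq_sym paddr_eq0 ?addr_ge0 ?sqr_ge0 // paddr_eq0 ?sqr_ge0 // !sqrf_eq0.
apply/negP => /andP[/andP[/eqP -> /eqP ->]]; rewrite /de expr0n /= subr0 mulr1.
by rewrite oner_eq0.
Qed.

(* inverse stereographic projection of (a, b) / de a b, which blows up at the
   boundary of the square [-1, 1]^2 *)
Definition wrap a b : R * (R * R) :=
  ((a ^+ 2 + b ^+ 2 - de a b ^+ 2) / den a b, (2 * de a b * a / den a b, 2 * de a b * b / den a b)).

Definition cen (x : R) := 2 * clip x - 1.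

Lemma wrap_sphere a b : wrap a b \in [set p : R * (R * R) | p.1 ^+ 2 + p.2.1 ^+ 2 + p.2.2 ^+ 2 = 1].
Proof.
apply/mem_set => /=; have := lt0r_neq0 (den_gt0 a b); rewrite /den => d0.
by field.
Qed.

Definition square_to_sphere (d : R * R) : sphere2 R := exist _ (wrap (cen d.1) (cen d.2)) (wrap_sphere _ _).

Lemma square_to_sphereE d : set_val (square_to_sphere d) = wrap (cen d.1) (cen d.2). Proof. by []. Qed.

Lemma square_to_sphere_continuous : continuous square_to_sphere.
Proof.
apply/continuousP => A [B oB <-].
rewrite -comp_preimage (_ : set_val \o square_to_sphere = fun d => wrap (cen d.1) (cen d.2)) //.
suff: continuous (fun d : R * R => wrap (cen d.1) (cen d.2)) by move/continuousP; apply.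
have c1 : continuous (fun d : R * R => cen d.1) by rewrite /cen /clip; ctn.
have c2 : continuous (fun d : R * R => cen d.2) by rewrite /cen /clip; ctn.
have s1 := ct_sqr c1; have s2 := ct_sqr c2.
have cd : continuous (fun d : R * R => de (cen d.1) (cen d.2)) by rewrite /de; ctn.
have s3 := ct_sqr cd.
have ci : continuous (fun d : R * R => (den (cen d.1) (cen d.2))^-1).
  apply: ct_inv; last by move=> d; exact: lt0r_neq0 (den_gt0 _ _).
  by rewrite /den; ctn.
by rewrite /wrap; ctn.
Qed.

Lemma cen_in x : -1 <= cen x <= 1.
Proof. by rewrite /cen; have := clip_in x; lra. Qed.

Lemma de_ge0 x y : 0 <= de (cen x) (cen y).
Proof.
have /andP[h1 h2] := cen_in x; have /andP[h3 h4] := cen_in y.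
by rewrite /de mulr_ge0 //; nra.
Qed.

Definition on_boundary (d : R * R) := exists o, d.1 = end_pt R o \/ d.2 = end_pt R o.

Lemma de_eq0_boundary (d : R * R) : I2 d -> de (cen d.1) (cen d.2) = 0 -> on_boundary d.
Proof.
case: d => x y [/= hx hy]; rewrite /de /cen !clip_id // => /eqP; rewrite mulf_eq0 => /orP[]/eqP h.
  have : x * (1 - x) = 0 by nra.
  by move/eqP; rewrite mulf_eq0 => /orP[]/eqP e; [exists false|exists true]; left; rewrite /end_pt /=; lra.
have : y * (1 - y) = 0 by nra.
by move/eqP; rewrite mulf_eq0 => /orP[]/eqP e; [exists false|exists true]; right; rewrite /end_pt /=; lra.
Qed.

Lemma boundary_to_base (d : R * R) : on_boundary d -> set_val (square_to_sphere d) = (1, (0, 0)).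
Proof.
move=> bdd; have e0 : de (cen d.1) (cen d.2) = 0.
  by case: bdd => o [] ->; rewrite /de /cen clip_o2r /end_pt; case: (o) => /=; ring.
have := lt0r_neq0 (den_gt0 (cen d.1) (cen d.2)); rewrite square_to_sphereE /wrap /den e0 expr0n /= subr0 addr0 => d0.
by rewrite divff // mulr0 !mul0r.
Qed.

Lemma wrap_x a b : 1 - (wrap a b).1 = 2 * de a b ^+ 2 / den a b.
Proof. by have := lt0r_neq0 (den_gt0 a b); rewrite /wrap /den /= => d0; field. Qed.

(** Points with the same image off the pole have the same stereographic coordinates [w], and each
    point is [de] times [w]. As [de] does not increase along a ray, the factor is determined. *)
Lemma square_to_sphere_inj (d d' : R * R) : I2 d -> I2 d' -> square_to_sphere d = square_to_sphere d' -> d = d' \/ (on_boundary d /\ on_boundary d').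
Proof.
move=> hd hd' /(congr1 set_val); rewrite !square_to_sphereE => qq.
have dn := lt0r_neq0 (den_gt0 (cen d.1) (cen d.2)); have dn' := lt0r_neq0 (den_gt0 (cen d'.1) (cen d'.2)).
have g0 := de_ge0 d.1 d.2; have g0' := de_ge0 d'.1 d'.2.
have := wrap_x (cen d.1) (cen d.2); rewrite qq wrap_x => xx.
case: (eqVneq (de (cen d.1) (cen d.2)) 0) => e0.
  right; split; first exact: de_eq0_boundary.
  apply: de_eq0_boundary => //; move: xx; rewrite e0 expr0n /= mulr0 mul0r => /eqP.
  by rewrite mulf_eq0 invr_eq0 (negbTE dn') orbF mulf_eq0 pnatr_eq0 /= sqrf_eq0 => /eqP.
case: (eqVneq (de (cen d'.1) (cen d'.2)) 0) => e0'.
  exfalso; move/eqP: xx; rewrite e0' expr0n /= mulr0 mul0r eq_sym.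
  by rewrite mulf_eq0 invr_eq0 (negbTE dn) orbF mulf_eq0 pnatr_eq0 /= sqrf_eq0 (negbTE e0).
left.
have key a b : de a b != 0 -> a = (wrap a b).2.1 / (1 - (wrap a b).1) * de a b /\
                              b = (wrap a b).2.2 / (1 - (wrap a b).1) * de a b.
  move=> ne; have n0 := lt0r_neq0 (den_gt0 a b); rewrite wrap_x /=.
  by split; field; rewrite ne n0.
have [k1 k2] := key _ _ e0; have [k1' k2'] := key _ _ e0'.
rewrite qq in k1 k2.
set w1 := (wrap _ _).2.1 / _ in k1 k1'; set w2 := (wrap _ _).2.2 / _ in k2 k2'.
have p1 : 0 < de (cen d.1) (cen d.2) by rewrite lt_neqAle eq_sym e0.
have p2 : 0 < de (cen d'.1) (cen d'.2) by rewrite lt_neqAle eq_sym e0'.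
have mono (c c' : R) : 0 < c -> c <= c' -> (c' * w1) ^+ 2 <= 1 -> (c' * w2) ^+ 2 <= 1 ->
   de (c' * w1) (c' * w2) <= de (c * w1) (c * w2).
  move=> c0 cc h1 h2; rewrite /de.
  have cc2 : c ^+ 2 <= c' ^+ 2 by rewrite ler_sqr ?nnegrE //; lra.
  have l1 : (c * w1) ^+ 2 <= (c' * w1) ^+ 2
    by rewrite [(c * w1) ^+ 2]exprMn [(c' * w1) ^+ 2]exprMn; apply: ler_wpM2r => //; exact: sqr_ge0.
  have l2 : (c * w2) ^+ 2 <= (c' * w2) ^+ 2
    by rewrite [(c * w2) ^+ 2]exprMn [(c' * w2) ^+ 2]exprMn; apply: ler_wpM2r => //; exact: sqr_ge0.
  by apply: ler_pM; lra.
have sq1 x : (cen x) ^+ 2 <= 1 by have := cen_in x; rewrite expr2 => /andP[? ?]; nra.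
have dd : de (cen d.1) (cen d.2) = de (cen d'.1) (cen d'.2).
  have E1 : de (cen d.1) (cen d.2) = de (de (cen d.1) (cen d.2) * w1) (de (cen d.1) (cen d.2) * w2).
    by congr de; rewrite [RHS]mulrC.
  have E2 : de (cen d'.1) (cen d'.2) = de (de (cen d'.1) (cen d'.2) * w1) (de (cen d'.1) (cen d'.2) * w2).
    by congr de; rewrite [RHS]mulrC.
  have s1 : (de (cen d.1) (cen d.2) * w1) ^+ 2 <= 1 by rewrite mulrC -k1.
  have s2 : (de (cen d.1) (cen d.2) * w2) ^+ 2 <= 1 by rewrite mulrC -k2.
  have s1' : (de (cen d'.1) (cen d'.2) * w1) ^+ 2 <= 1 by rewrite mulrC -k1'.
  have s2' : (de (cen d'.1) (cen d'.2) * w2) ^+ 2 <= 1 by rewrite mulrC -k2'.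
  apply/eqP; rewrite eq_le; case: (leP (de (cen d.1) (cen d.2)) (de (cen d'.1) (cen d'.2))) => h /=.
    by have := mono _ _ p1 h s1' s2'; rewrite -E1 -E2.
  by have := mono _ _ p2 (ltW h) s1 s2; rewrite -E1 -E2 leNgt h.
have c1 : cen d.1 = cen d'.1 by rewrite k1 k1' dd.
have c2 : cen d.2 = cen d'.2 by rewrite k2 k2' dd.
move: c1 c2; case: hd hd' => h1 h2 [h3 h4]; rewrite /cen !clip_id // => c1 c2.
by rewrite [LHS]eta2 [RHS]eta2; congr pair; lra.
Qed.

(** The intermediate value theorem on [0, 1/M]: [de] is 1 at [c = 0]. At [c = 1/M] it vanishes if a
    coordinate reaches absolute value 1, and is at most 1, the value of [c], if [M = 1]. *)
Lemma ray_root w1 w2 : exists c : R, [/\ 0 < c, (c * w1) ^+ 2 <= 1, (c * w2) ^+ 2 <= 1 & de (c * w1) (c * w2) = c].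
Proof.
pose M := Num.max 1 (Num.max `|w1| `|w2|).
have M1 : 1 <= M by rewrite /M le_max lexx.
have Mw1 : `|w1| <= M by rewrite /M !le_max lexx !orbT.
have Mw2 : `|w2| <= M by rewrite /M !le_max lexx !orbT.
have M0 : 0 < M by lra.
pose g (c : R) := de (c * w1) (c * w2) - c.
have cg : continuous g.
  have s1 : continuous (fun c : R => (c * w1) ^+ 2) by apply: ct_sqr; ctn.
  have s2 : continuous (fun c : R => (c * w2) ^+ 2) by apply: ct_sqr; ctn.
  by rewrite /g /de; ctn.
have M'0 : 0 <= M^-1 by rewrite invr_ge0 ltW.
have cW : {within `[0, M^-1], continuous g} by exact: continuous_subspaceT.
have sq_le (c w : R) : 0 <= c <= M^-1 -> `|w| <= M -> (c * w) ^+ 2 <= 1.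
  move=> /andP[c0 c1] wM; rewrite -real_normK ?num_real // normrM (ger0_norm c0) expr_le1 ?mulr_ge0 //.
  by rewrite -(mulVf (lt0r_neq0 M0)); apply: ler_pM.
have g0 : g 0 = 1 by rewrite /g /de !mul0r expr0n /= !subr0 mulr1.
have gM : g M^-1 <= 0.
  have Mi : 0 <= M^-1 <= M^-1 by rewrite M'0 lexx.
  have s1 := sq_le _ _ Mi Mw1; have s2 := sq_le _ _ Mi Mw2.
  have sq0 (x : R) : 0 <= x ^+ 2 := sqr_ge0 x.
  have n1 := sq0 (M^-1 * w1); have n2 := sq0 (M^-1 * w2).
  have one (w : R) : `|w| = M -> (M^-1 * w) ^+ 2 = 1.
    move=> wM; rewrite -real_normK ?num_real // normrM (ger0_norm M'0) wM mulVf ?expr1n //.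
    exact: lt0r_neq0.
  rewrite /g /de subr_le0.
  have : [\/ M = 1, `|w1| = M | `|w2| = M].
    rewrite /M; case: (leP 1 (Num.max `|w1| `|w2|)) => h; last by constructor 1.
    by case: (leP `|w1| `|w2|) => k; [constructor 3|constructor 2].
  case=> [e|/one ->|/one ->].
  - by rewrite e invr1 in n1 n2 s1 s2 *; nra.
  - by rewrite subrr mul0r.
  - by rewrite subrr mulr0.
have [|c cI gc] := IVT M'0 cW (v := 0).
  by rewrite g0 ge_min gM orbT le_max ler01.
have c01 : 0 <= c <= M^-1 by move: cI; rewrite in_itv.
exists c; split.
- rewrite lt_neqAle; case/andP: c01 => -> _; rewrite andbT; apply/eqP => e.
  by move: gc; rewrite -e g0 => /eqP; rewrite oner_eq0.
- exact: sq_le.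
- exact: sq_le.
- by move: gc; rewrite /g => /eqP; rewrite subr_eq0 => /eqP.
Qed.

Lemma square_to_sphere_onto (p : sphere2 R) : exists2 d, I2 d & square_to_sphere d = p.
Proof.
have := set_mem (valP p); rewrite /=; set v := sval p => pE.
have pI (d : R * R) : set_val (square_to_sphere d) = v -> square_to_sphere d = p by move=> e; apply: val_inj.
move: pI pE; case: v => x [y z] pI /= pE.
case: (eqVneq x 1) => [x1|x1].
  exists (0, 0); first by split; rewrite /= lexx ler01.
  apply: pI; rewrite boundary_to_base; last by exists false; left.
  have yz : y ^+ 2 + z ^+ 2 = 0 by move: pE; rewrite x1 expr1n; lra.
  have : (y ^+ 2 == 0) && (z ^+ 2 == 0) by rewrite -paddr_eq0 ?sqr_ge0 // yz.
  by rewrite !sqrf_eq0 x1 => /andP[/eqP -> /eqP ->].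
have nx : 1 - x != 0 by rewrite subr_eq0 eq_sym.
have [c [c0 s1 s2 dc]] := ray_root (y / (1 - x)) (z / (1 - x)).
set a := c * _ in s1 dc; set b := c * _ in s2 dc.
have sqI (t : R) : t ^+ 2 <= 1 -> 0 <= (t + 1) / 2 <= 1.
  by rewrite expr2 => h; apply/andP; split; nra.
have cenI (t : R) : t ^+ 2 <= 1 -> cen ((t + 1) / 2) = t.
  by move=> /sqI h; rewrite /cen clip_id //; lra.
exists ((a + 1) / 2, (b + 1) / 2); first by split; exact: sqI.
apply: pI; rewrite square_to_sphereE !cenI // /wrap /den dc /a /b.
have xx : 1 - x ^+ 2 = y ^+ 2 + z ^+ 2 by lra.
have cn := lt0r_neq0 c0.
have key : (c * (y / (1 - x))) ^+ 2 + (c * (z / (1 - x))) ^+ 2 = c ^+ 2 * (1 + x) / (1 - x).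
  by rewrite !exprMn -mulrDr -mulrDl -xx; field.
rewrite key.
have d2 : c ^+ 2 * (1 + x) / (1 - x) + c ^+ 2 = 2 * c ^+ 2 / (1 - x) by field.
have d3 : c ^+ 2 * (1 + x) / (1 - x) - c ^+ 2 = 2 * c ^+ 2 * x / (1 - x) by field.
rewrite d2 d3; by congr (_, (_, _)); field; rewrite cn nx.
Qed.

Lemma interval_sphere_hausdorff : hausdorff_space (unit_interval R * sphere2 R)%type.
Proof.
apply: (@sep_hausdorff R) => -[i p] [i' p'] ne.
case: (pselect (i = i')) => [ii|nii]; last first.
  exists (fun q => set_val q.1); first exact: iv1_cts.
  by move=> /= /val_inj.
have np : set_val p <> set_val p' by move=> /val_inj pp; apply: ne; rewrite ii pp.
have cv : continuous (fun q : unit_interval R * sphere2 R => set_val q.2 : R * (R * R)).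
  by apply: (ct_comp (f := snd) (g := set_val)); [ctn|exact: set_val_continuous].
apply: contrapT => H; apply: np.
have sep (k : R * (R * R) -> R) : continuous k -> k (set_val p) = k (set_val p').
  move=> ck; apply: contrapT => nk; apply: H; exists (fun q => k (set_val q.2)) => //.
  exact: (ct_comp (f := fun q : unit_interval R * sphere2 R => set_val q.2 : R * (R * R)) (g := k)).
have e1 : (set_val p).1 = (set_val p').1 by apply: sep; ctn.
have e2 : (set_val p).2.1 = (set_val p').2.1 by apply: (sep (fun v => v.2.1)); ctn.
have e3 : (set_val p).2.2 = (set_val p').2.2 by apply: (sep (fun v => v.2.2)); ctn.
by move: e1 e2 e3; case: (set_val p) => x [y z]; case: (set_val p') => x' [y' z'] /= -> -> ->.
Qed.

End Sphere.

Section Pi2.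
Context (R : realType) (V E : finType) (lsrc llab ltgt : E -> V).
Local Notation K := (LOGcomplex R lsrc llab ltgt).
Local Notation o2r := (end_pt R).
Local Notation I := (unit_interval R).
Local Notation iv := (set_val : I -> R).
Hypotheses (lot : is_LOT lsrc llab ltgt) (inj : injective llab).
Variables (k0 : K) (k0P : is_basep k0).

(** Boundary points of the square are joined to (0,0) by at most two boundary segments, along which
    [Phi] is constant; so the boundary rests at [k0] and the homotopy descends to the sphere. *)
Lemma lot_pi2_trivial : pi2_trivial R k0.
Proof.
move=> f cf fN; pose fS d := f (square_to_sphere d).
have cfS : continuous fS by apply: (ct_comp (f := @square_to_sphere R) (g := f)) => //; exact: square_to_sphere_continuous.
have [Phi [Rch [PhiC [R0 RP] PhiS _ [Phi01 Phid]]]] :=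
  @lift_family R V E lsrc llab ltgt k0 k0P (lot_forest lot) inj (lot_ctight lot) _ (lot_ctight lot)
    (fun=> True) Logic.I (fun _ _ _ => Logic.I) (fun _ _ _ => Logic.I) fS cfS (0, 0).
have kin d : Kin [set: V]%SET (fk k0 fS d) by exact: Kin_setT.
have scale (u x : R) : 0 <= u <= 1 -> 0 <= x <= 1 -> 0 <= u * x <= 1.
  by move=> /andP[? ?] /andP[? ?]; apply/andP; split; nra.
have Rall d : I2 d -> Rch d.
  move=> [h1 h2]; have := RP (fun u => (u * d.1, u * d.2)); rewrite !mul0r !mul1r -eta2; apply => //.
  by split=> [|u u01|u _]; [ctn|split; exact: scale|exact: kin].
have fbd d : on_boundary d -> fS d = k0 by move=> /boundary_to_base; exact: fN.
have kbd d : on_boundary d -> fk k0 fS d = k0 by move=> /fbd; rewrite /fk => ->; rewrite kapt_base.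
have in01 o : 0 <= o2r o <= 1 by rewrite /end_pt; case: o => /=; rewrite ?lexx ?ler01.
have Pbd d t : I2 d -> on_boundary d -> Phi d t = k0.
  have P0 : Phi (o2r false, o2r false) t = k0 by apply: Phid; apply: kbd; exists false; left.
  have ip (g : R -> R * R) : continuous g -> (forall u, 0 <= u <= 1 -> I2 (g u)) -> (forall u, on_boundary (g u)) ->
     Phi (g 0) t = Phi (g 1) t.
    by move=> cg gI gb; apply: PhiS; split=> // u _; rewrite kbd // /Kin (cpt_k0 k0P).
  case: d => x y [/= + +] [o [] /= ->] => h1 h2.
    have := ip (fun u => (o2r o, u * y)); rewrite mul0r mul1r => <-; first last.
    - by move=> u; exists o; left.
    - by move=> u u01; split; [exact: in01|exact: scale].
    - by ctn.
    have := ip (fun u => (u * o2r o, o2r false)); rewrite mul0r mul1r => <- //; first by ctn.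
    - by move=> u u01; split; [exact: scale|exact: in01].
    - by move=> u; exists false; right.
  have := ip (fun u => (u * x, o2r o)); rewrite mul0r mul1r => <-; first last.
  - by move=> u; exists o; right.
  - by move=> u u01; split; [exact: scale|exact: in01].
  - by ctn.
  have := ip (fun u => (o2r false, u * o2r o)); rewrite mul0r mul1r => <- //; first by ctn.
  - by move=> u u01; split; [exact: in01|exact: scale].
  - by move=> u; exists false; left.
(* [Phi] starts at the stretched map [fk], so the first half of the time performs the stretching. *)
pose hm (d : R * R) (t : R) := if t <= 1/2 then kapt k0 (clip (2 * t)) (fS d) else Phi d (2 * t - 1).
have hm1 d t : t <= 1/2 -> hm d t = kapt k0 (clip (2 * t)) (fS d) by rewrite /hm => ->.
have hm2 d t : I2 d -> 1/2 <= t -> hm d t = Phi d (2 * t - 1).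
  move=> hd; rewrite le_eqVlt => /orP[/eqP e|h]; last by rewrite /hm leNgt h.
  rewrite hm1 -?e // (_ : 2 * (1/2) = 1); last by lra.
  by rewrite subrr clip1; case: (Phi01 d hd (kin d) (Rall d hd)).
have hmbd d t : I2 d -> on_boundary d -> hm d t = k0.
  by move=> hd db; rewrite /hm; case: ifP => _; [rewrite fbd // kapt_base|exact: Pbd].
have hmq d d' t : I2 d -> I2 d' -> square_to_sphere d = square_to_sphere d' -> hm d t = hm d' t.
  by move=> hd hd' /(square_to_sphere_inj hd hd')[->//|[b1 b2]]; rewrite !hmbd.
pose cl (d : R * R) : R * R := (clip d.1, clip d.2).
have clI d : I2 (cl d) by split; exact: clip_in.
have qcl d : square_to_sphere (cl d) = square_to_sphere d by apply: val_inj; rewrite /= /cen !clipK.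
(* An arbitrary section is good enough, because [hmq] makes [H] independent of the choice and
   continuity is tested on the cube. *)
have j_ (p : sphere2 R) : {d | I2 d & square_to_sphere d = p} by apply: cid2; exact: square_to_sphere_onto.
pose j p := s2val (j_ p).
have jI p : I2 (j p) by exact: s2valP.
have jq p : square_to_sphere (j p) = p by exact: (s2valP' (j_ p)).
pose H (q : I * sphere2 R) := hm (j q.2) (iv q.1).
exists H; split.
- pose q' (_ : unit) (s : R * R * R) : I * sphere2 R := (toI s.2, square_to_sphere s.1).
  apply: (@compact_quot unit _ _ _ (@Icube R) q' H (@Icube_compact R) (@interval_sphere_hausdorff R)).
  + move=> i; rewrite /q'; apply: ct_pair.
      by apply: (ct_comp (f := snd) (g := @toI R)); [ctn|exact: toI_continuous].
    by apply: (ct_comp (f := fst) (g := @square_to_sphere R)); [ctn|exact: square_to_sphere_continuous].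
  + move=> [i p]; exists tt, (j p, iv i); split; last by rewrite /q' /= toIK jq.
    by split; [case: (jI p) => h1 h2; split; rewrite /= in_itv|rewrite /= in_itv; exact: iv_in].
  + move=> [].
    have -> : (fun s => H (q' tt s)) = (fun s : R * R * R => hm (cl s.1) (clip s.2)).
      by apply/funext => s; rewrite /H /=; apply: hmq => //; rewrite jq qcl.
    have ccl : continuous (fun s : R * R * R => cl s.1) by rewrite /cl /clip; ctn.
    have cc2 : continuous (fun s : R * R * R => clip s.2) by rewrite /clip; ctn.
    apply: (closed_pasting2 (c := fun s : R * R * R => clip s.2) (d := fun=> 1/2)
      (g1 := fun s => kapt k0 (clip (2 * clip s.2)) (fS (cl s.1))) (g2 := fun s => Phi (cl s.1) (2 * clip s.2 - 1))) => //.
    * by ctn.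
    * apply: (ct_comp (f := fun s : R * R * R => (fS (cl s.1), 2 * clip s.2)) (g := fun q : K * R => kapt k0 (clip q.2) q.1)); last exact: kapt_cts.
      apply: ct_pair; last by ctn.
      by apply: (ct_comp (f := fun s : R * R * R => cl s.1) (g := fS)).
    * apply: (PhiC _ (fun s : R * R * R => cl s.1) (fun s : R * R * R => 2 * clip s.2 - 1)) => //; first by ctn.
      by move=> s; split; [exact: clI|exact: kin|exact: Rall].
    * by move=> s; exact: hm1.
    * by move=> s; exact: hm2.
- move=> q q0; rewrite /H q0 hm1; last by lra.
  by rewrite mulr0 clip0 kapt0 // /fS jq.
- move=> q q1; rewrite /H q1 hm2 //; last by lra.
  rewrite (_ : 2 * 1 - 1 = 1); last by lra.
  by case: (Phi01 (j q.2) (jI _) (kin _) (Rall _ (jI _))).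
- move=> q qN; have b0 : on_boundary (0 : R, 0 : R) by exists false; left.
  have i0 : I2 (0 : R, 0 : R) by split; rewrite /= lexx ler01.
  rewrite /H (hmq _ (0, 0)) ?hmbd // jq; apply: val_inj.
  by rewrite -[LHS]/(set_val q.2) qN -(boundary_to_base b0).
Qed.

End Pi2.

Theorem mainTheorem1 (R : realType) (V E : finType) (lsrc llab ltgt : E -> V) :
  is_LOT lsrc llab ltgt -> log_injective llab ->
  (forall k0 : LOGcomplex R lsrc llab ltgt,
     is_basepoint k0 -> pi2_trivial R k0) /\
  (forall (HV : {set V}) (HE : {set E}), is_subLOT lsrc llab ltgt HV HE ->
     forall k0 : LOGcomplex R lsrc llab ltgt, is_basepoint k0 ->
       pi1_inclusion_injective R (@subcomplex R V E lsrc llab ltgt HV HE) k0).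
Proof.
move=> lot inj; split=> [k0 k0P|HV HE slot k0 k0P]; first exact: lot_pi2_trivial.
exact: (pi1_injective lot inj slot k0P).
Qed.
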